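(* Consider, for $c>0$ and $\epsilon>0$, the planar system $$\dot\theta=\eta,\qquad \dot\eta=c\,\eta-\frac{1}{2\epsilon^2}\,\theta(1-\theta)\,e^{-\epsilon^{-1}(1-\theta)},$$ with equilibria $p_-=(0,0)$ and $p_+=(1,0)$ in the $(\theta,\eta)$-plane. Fix $\kappa>0$ small enough and $\sigma>0$ large enough. Then there exist an $\epsilon_0=\epsilon_0(\sigma)>0$ and a $C^\infty$-smooth function $\overline c:[0,\epsilon_0)\to\mathbb R$ satisfying $$\overline c(0)=1,\qquad \overline c'(0)=\int_{-\infty}^0\bigl(1-h^s(x)\bigr)\,dx-1\approx 0.34405>0,$$ where $h^s(x)=\sqrt{1+(x-1)e^{x}}$ for $x<0$, such that the following assertions hold for each $\epsilon\in(0,\epsilon_0)$: (i) There are no heteroclinic connections between $p_-$ and $p_+$ within $\theta\in[0,1]$ for $0<c<\overline c(\epsilon)$. (ii) There is a strong heteroclinic connection when $c=\overline c(\epsilon)$, whose corresponding orbit converges to $\Gamma(1)$ in Hausdorff distance as $\epsilon\to0$. (iii) There is a weak heteroclinic connection for each $c\in(\overline c(\epsilon),\sigma]$, and for each fixed $c\in(1+\kappa,\sigma]$ the corresponding orbit converges to $\Gamma(c)$ in Hausdorff distance as $\epsilon\to0$.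
   Context: The overdot denotes $d/dz$. The system is the first-order form ($\eta=d\theta/dz$) of the travelling wave equation, with $z=x+ct$, for the Zeldovich-Frank-Kamenetskii equation $\theta_t=\theta_{xx}+\frac{1}{2\epsilon^2}\theta(1-\theta)e^{-\epsilon^{-1}(1-\theta)}$. Only positive wave speeds $c>0$ are considered. A heteroclinic connection between $p_-$ and $p_+$ is an orbit $(\theta(z),\eta(z))$ of the system with $(\theta,\eta)(z)\to p_-$ as $z\to-\infty$ and $(\theta,\eta)(z)\to p_+$ as $z\to+\infty$. For $\epsilon>0$ small (depending on $c$), $p_-$ is a proper unstable node, i.e. the linearization at $p_-$ has two distinct positive eigenvalues $\lambda_w<\lambda_s$, and $p_+$ is a hyperbolic saddle. A heteroclinic connection is called strong if it connects to $p_-$ tangentially to the eigendirection of the larger eigenvalue $\lambda_s$ (i.e. it lies in the strong unstable manifold of $p_-$), and weak if it connects to $p_-$ tangentially to the eigendirection of $\lambda_w$. The singular orbits are the subsets of the $(\theta,\eta)$-plane defined for $c\in[1,\infty)$ by $\Gamma(c)=\Gamma^0(c)\cup\Gamma^1(c)\cup\Gamma^2$, where $$\Gamma^0(c)=\{(\theta,0):\theta\in[0,1-c^{-1}]\},$$ $$\Gamma^1(c)=\{(\theta,c\theta+1-c):\theta\in[1-c^{-1},1)\},$$ $$\Gamma^2=\{(1,\eta):\eta\in[0,1]\}.$$ *)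

(* Defs.v *)
From Stdlib Require Import Reals.
From Coquelicot Require Import Coquelicot.
Open Scope R_scope.

(* The plane carries Coquelicot's product norm on [R * R], which is the
   Euclidean one. *)
Definition plane : Type := R * R.

Definition zfk_field (eps c : R) (p : plane) : plane :=
  (snd p,
   c * snd p
   - 1 / (2 * eps ^ 2) * (fst p * (1 - fst p) * exp (- (/ eps) * (1 - fst p)))).

Definition p_minus : plane := (0, 0).
Definition p_plus : plane := (1, 0).

Definition orbit (g : R -> plane) (p : plane) : Prop := exists z : R, p = g z.

Definition heteroclinic (F : plane -> plane) (p q : plane) (g : R -> plane)
  : Prop :=
  (forall z : R,
     is_derive (K := R_AbsRing)
       (V := prod_NormedModule R_AbsRing R_NormedModule R_NormedModule)
       g z (F (g z))) /\
  filterlim g (Rbar_locally m_infty) (locally (p : R * R)) /\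
  filterlim g (Rbar_locally p_infty) (locally (q : R * R)).

Definition linearization (F : plane -> plane) (p : plane) (L : plane -> plane)
  : Prop :=
  filterdiff (K := R_AbsRing)
    (U := prod_NormedModule R_AbsRing R_NormedModule R_NormedModule)
    (V := prod_NormedModule R_AbsRing R_NormedModule R_NormedModule)
    F (locally (p : R * R)) L.

Definition eigenvector (L : plane -> plane) (lambda : R) (v : plane) : Prop :=
  v <> (0, 0) /\ L v = (lambda * fst v, lambda * snd v).

Definition unit_dir (v : plane) : plane :=
  (fst v / norm (v : R * R), snd v / norm (v : R * R)).

(* The eigendirection is a line, so the limiting unit vector may be either of
   its two orientations: [v] and [- v] are both eigenvectors. *)
Definition leaves_along (L : plane -> plane) (lambda : R) (p : plane)
    (g : R -> plane) : Prop :=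
  exists v : plane,
    eigenvector L lambda v /\
    filterlim (fun z : R => unit_dir (fst (g z) - fst p, snd (g z) - snd p))
      (Rbar_locally m_infty) (locally (unit_dir v : R * R)).

Definition proper_unstable_node (L : plane -> plane) (lw ls : R) : Prop :=
  0 < lw /\ lw < ls /\
  (exists v : plane, eigenvector L lw v) /\
  (exists v : plane, eigenvector L ls v).

Definition strong_heteroclinic (F : plane -> plane) (p q : plane)
    (g : R -> plane) : Prop :=
  heteroclinic F p q g /\
  exists (L : plane -> plane) (lw ls : R),
    linearization F p L /\ proper_unstable_node L lw ls /\
    leaves_along L ls p g.

Definition weak_heteroclinic (F : plane -> plane) (p q : plane)
    (g : R -> plane) : Prop :=
  heteroclinic F p q g /\
  exists (L : plane -> plane) (lw ls : R),
    linearization F p L /\ proper_unstable_node L lw ls /\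
    leaves_along L lw p g.

Definition Gamma0 (c : R) (p : plane) : Prop :=
  0 <= fst p <= 1 - / c /\ snd p = 0.

Definition Gamma1 (c : R) (p : plane) : Prop :=
  1 - / c <= fst p < 1 /\ snd p = c * fst p + 1 - c.

Definition Gamma2 (p : plane) : Prop :=
  fst p = 1 /\ 0 <= snd p <= 1.

Definition Gamma (c : R) (p : plane) : Prop :=
  Gamma0 c p \/ Gamma1 c p \/ Gamma2 p.

Definition within_distance (r : R) (A B : plane -> Prop) : Prop :=
  forall a : plane, A a ->
    exists b : plane, B b /\
      norm ((fst a - fst b, snd a - snd b) : R * R) <= r.

Definition hausdorff_dist (A B : plane -> Prop) : Rbar :=
  Glb_Rbar (fun r : R =>
    0 <= r /\ within_distance r A B /\ within_distance r B A).

(* Convergence of [A eps] to [B] in Hausdorff distance as [eps] tends to [0]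
   from the right. *)
Definition hausdorff_cvg (A : R -> plane -> Prop) (B : plane -> Prop) : Prop :=
  forall delta : R, 0 < delta ->
    at_right 0 (fun eps : R => Rbar_lt (hausdorff_dist (A eps) B) delta).

(* Derivative relative to [D]: one-sided at an endpoint of an interval. *)
Definition is_derive_on (D : R -> Prop) (f : R -> R) (x l : R) : Prop :=
  filterdiff (K := R_AbsRing) (U := R_NormedModule) (V := R_NormedModule)
    f (within D (locally x)) (fun h : R => scal h l).

(* [d n] is the n-th derivative of [f] on [D]; each is continuous on [D] since
   it is itself differentiable there. *)
Definition smooth_on (D : R -> Prop) (f : R -> R) : Prop :=
  exists d : nat -> R -> R,
    (forall x : R, D x -> d 0%nat x = f x) /\
    (forall (n : nat) (x : R), D x -> is_derive_on D (d n) x (d (S n) x)).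

Definition h_s (x : R) : R := sqrt (1 + (x - 1) * exp x).

(* Main.v *)
(* On a heteroclinic orbit eta is a function S of theta with S' = c - f / S, where f is the reaction term, and S(1) = 0. The solution S_c of this scalar problem on (0,1) decreases in c, and its graph reaches the node at the origin exactly when S_c(0) = 0. The threshold speed cb is the supremum of the speeds with S_c(0) > 0. At c = cb the slope S / theta stays above cb / 2 and therefore tends to the larger eigenvalue; for c > cb the graph lies below the threshold graph and its slope is attracted by the smaller eigenvalue. For c < cb an orbit would have to stay above the threshold graph, and the ratio S / eta could not remain in (0,1] backwards in time.

   Smoothness of cb up to eps = 0: write theta = exp(eps y), p = S / theta and X = (theta - 1) / eps, so that p p_y = eps p (cb - p) + X e^X / 2 on y < 0, a problem which is regular at eps = 0. The difference quotients of (cb, p) in eps solve a linear problem with coefficients of the same kind, whose bounded solution on the half-line fixes the speed; feeding expansions of the coefficients back into this problem gains one order per round, hence difference expansions of every order, uniformly in eps. A converse of Taylor's theorem turns these into bounded derivatives of every order on (0, e0), which then extend to eps = 0.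

   Multiplying the front equation by S and integrating gives cb^2 / 2 = 1 / 2 - eps + cb * int_0^1 (cb theta - S) up to O(eps^3), and the integral is eps * int (1 - h_s) to first order, whence cb'(0) = int (1 - h_s) - 1. Its numerical value follows from midpoint and trapezoidal sums for the concave function h_s. *)
Require Import Defs.
From Stdlib Require Import Reals Arith ZArith Lra Lia Psatz ClassicalEpsilon.
From Coquelicot Require Import Coquelicot.
Open Scope R_scope.
Set Bullet Behavior "Strict Subproofs".

(** The scalar problem is singular at both ends. At theta = 1 the quotient f / S degenerates; the
    energy S^2 / 2 removes it and leaves only a Hoelder term c sqrt(2 w), whose monotonicity lets
    comparison arguments replace a Lipschitz bound. At theta = 0 it is S / theta that matters, so
    the estimates on the threshold front carry a factor theta.

    For the smoothness, the obstacle is uniformity: X = (theta - 1) / eps stops at - 1 / eps, so a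
    weight exp (k X) does not vanish as y tends to minus infinity. It is integrable there only up to
    a term of order eps, which has to be integrated against exp (eps y). Hence sources are measured
    by tau (exp (k X) + eps), where tau = 1 - exp X records the zero at theta = 1.

    No derivative of the speed is assumed at any point; difference quotients alone occur. Their
    first bound comes from linearizing about the mean of two profiles, where the difference equation
    is exactly linear. Later rounds linearize about one profile, with a quadratic remainder that
    carries a factor h. *)

Section ContinuousR.
Context {U : UniformSpace}.
Implicit Types (f g : U -> R) (x : U).

Lemma cont_plus f g x : continuous f x -> continuous g x -> continuous (fun y => f y + g y) x.
Proof. apply (continuous_plus (V := R_NormedModule)). Qed.

Lemma cont_minus f g x : continuous f x -> continuous g x -> continuous (fun y => f y - g y) x.
Proof. apply (continuous_minus (V := R_NormedModule)). Qed.

Lemma cont_opp f x : continuous f x -> continuous (fun y => - f y) x.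
Proof. apply (continuous_opp (V := R_NormedModule)). Qed.

Lemma cont_mult f g x : continuous f x -> continuous g x -> continuous (fun y => f y * g y) x.
Proof. apply (continuous_mult (K := R_AbsRing)). Qed.

Lemma cont_const (c : R) x : continuous (fun _ : U => c) x.
Proof. apply continuous_const. Qed.

Lemma cont_inv f x : continuous f x -> f x <> 0 -> continuous (fun y => / f y) x.
Proof.
  intros H H0. apply (continuous_comp f Rinv); [assumption|].
  apply (ex_derive_continuous Rinv). auto_derive. assumption.
Qed.

Lemma cont_div f g x :
  continuous f x -> continuous g x -> g x <> 0 -> continuous (fun y => f y / g y) x.
Proof. intros Hf Hg H0. apply cont_mult; [|apply cont_inv]; assumption. Qed.

Lemma cont_sqrt f x : continuous f x -> continuous (fun y => sqrt (f y)) x.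
Proof. intros H. apply (continuous_comp f sqrt); [assumption|apply continuous_sqrt]. Qed.

Lemma cont_exp f x : continuous f x -> continuous (fun y => exp (f y)) x.
Proof.
  intros H. apply (continuous_comp f exp); [assumption|].
  apply (ex_derive_continuous exp). auto_derive. easy.
Qed.

Lemma cont_abs f x : continuous f x -> continuous (fun y => Rabs (f y)) x.
Proof. intros H. apply (continuous_comp f Rabs); [assumption|apply continuous_Rabs]. Qed.

Lemma cont_pow f x n : continuous f x -> continuous (fun y => f y ^ n) x.
Proof.
  intros H. induction n as [|n IH]; simpl; [apply cont_const|now apply cont_mult].
Qed.

Lemma cont_max f g x : continuous f x -> continuous g x -> continuous (fun y => Rmax (f y) (g y)) x.
Proof.
  intros Hf Hg.
  apply (continuous_ext (fun y => (f y + g y + Rabs (f y - g y)) / 2)).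
  - intros y. unfold Rmax. destruct (Rle_dec (f y) (g y)).
    + rewrite Rabs_left1; lra.
    + rewrite Rabs_right; lra.
  - apply cont_mult; [|apply cont_const].
    apply cont_plus; [now apply cont_plus|]. apply cont_abs. now apply cont_minus.
Qed.

Lemma cont_min f g x : continuous f x -> continuous g x -> continuous (fun y => Rmin (f y) (g y)) x.
Proof.
  intros Hf Hg.
  apply (continuous_ext (fun y => (f y + g y - Rabs (f y - g y)) / 2)).
  - intros y. unfold Rmin. destruct (Rle_dec (f y) (g y)).
    + rewrite Rabs_left1; lra.
    + rewrite Rabs_right; lra.
  - apply cont_mult; [|apply cont_const].
    apply cont_minus; [now apply cont_plus|]. apply cont_abs. now apply cont_minus.
Qed.
End ContinuousR.

Lemma cont_id (x : R) : continuous (fun y : R => y) x.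
Proof. apply continuous_id. Qed.

Ltac cont :=
  repeat first
    [ assumption
    | match goal with
      | |- continuous (fun y => y) _ => apply cont_id
      | |- continuous (fun _ => ?c) _ => apply (cont_const c)
      | |- continuous (Rmult ?a) ?x => change (continuous (fun y : R => a * y) x)
      | |- continuous (Rplus ?a) ?x => change (continuous (fun y : R => a + y) x)
      | |- continuous (Rminus ?a) ?x => change (continuous (fun y : R => a - y) x)
      | |- continuous (Rmax ?a) ?x => change (continuous (fun y : R => Rmax a y) x)
      | |- continuous (Rdiv ?a) ?x => change (continuous (fun y : R => a / y) x)
      | |- continuous Ropp ?x => change (continuous (fun y : R => - y) x)
      | |- continuous exp ?x => change (continuous (fun y : R => exp y) x)
      | |- continuous sqrt ?x => change (continuous (fun y : R => sqrt y) x)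
      | |- continuous (fun _ => _ + _) _ => apply cont_plus
      | |- continuous (fun _ => _ - _) _ => apply cont_minus
      | |- continuous (fun _ => - _) _ => apply cont_opp
      | |- continuous (fun _ => _ / _) _ => apply cont_div; [ | |try lra]
      | |- continuous (fun _ => _ * _) _ => apply cont_mult
      | |- continuous (fun _ => / _) _ => apply cont_inv
      | |- continuous (fun _ => sqrt _) _ => apply cont_sqrt
      | |- continuous (fun _ => exp _) _ => apply cont_exp
      | |- continuous (fun _ => Rabs _) _ => apply cont_abs
      | |- continuous (fun _ => _ ^ _) _ => apply cont_pow
      | |- continuous (fun _ => Rmax _ _) _ => apply cont_max
      | |- continuous (fun _ => Rmin _ _) _ => apply cont_min
      end ].

Lemma cont_pt (f : R -> R) (x : R) : continuous f x -> continuity_pt f x.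
Proof. intros H. apply continuity_pt_filterlim. exact H. Qed.

(** * Comparison principles, integrals and limits on the real line *)

Lemma le_of_sq_le (a b : R) : 0 <= b -> a ^ 2 <= b ^ 2 -> a <= b.
Proof. intros Hb H. nra. Qed.

Lemma mvt_open (f df : R -> R) (a b : R) :
  a < b ->
  (forall t, a <= t <= b -> continuous f t) ->
  (forall t, a < t < b -> is_derive f t (df t)) ->
  exists xi, a < xi < b /\ f b - f a = df xi * (b - a).
Proof.
  intros ab Hc Hd.
  assert (pr1 : forall c, a < c < b -> derivable_pt f c).
  { intros c Hc'. exists (df c). apply is_derive_Reals. now apply Hd. }
  assert (pr2 : forall c, a < c < b -> derivable_pt id c).
  { intros c _. apply derivable_pt_id. }
  destruct (MVT f id a b pr1 pr2 ab) as [xi [P E]].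
  - intros c H. apply continuity_pt_filterlim. now apply Hc.
  - intros c H. apply derivable_continuous_pt, derivable_pt_id.
  - exists xi. split; [exact P|].
    rewrite (pr_nu id xi (pr2 xi P) (derivable_pt_id xi)), derive_pt_id in E.
    assert (E2 : derive_pt f xi (pr1 xi P) = df xi).
    { apply derive_pt_eq_0, is_derive_Reals. now apply Hd. }
    rewrite E2 in E. unfold id in E. lra.
Qed.

Lemma continuous_pos_near (f : R -> R) (x : R) :
  continuous f x -> 0 < f x -> exists d : posreal, forall y, Rabs (y - x) < d -> 0 < f y.
Proof.
  intros Hc Hx.
  assert (H : locally (f x) (fun z => 0 < z)) by (apply (open_gt 0 (f x)); exact Hx).
  destruct (Hc _ H) as [d Hd].
  exists d. intros y Hy. apply Hd. exact Hy.
Qed.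

(** After the last point with [f <= 0] the sign condition makes [f] nonincreasing, so it cannot have
    become positive. The derivative is controlled only where [f > 0], which is what a monotone,
    non-Lipschitz term such as [- c * sqrt w] provides. *)
Lemma comparison (f df : R -> R) (a b : R) :
  a <= b ->
  (forall t, a <= t <= b -> continuous f t) ->
  (forall t, a < t < b -> is_derive f t (df t)) ->
  f a <= 0 ->
  (forall t, a < t < b -> 0 < f t -> df t <= 0) ->
  f b <= 0.
Proof.
  intros ab Hc Hd Ha Hs.
  destruct (Rle_lt_dec (f b) 0) as [|Hb]; [assumption|exfalso].
  set (E := fun s => a <= s <= b /\ f s <= 0).
  destruct (completeness E) as [m [Hub Hlub]].
  { exists b. intros s [? _]. lra. }
  { exists a. split; [lra|assumption]. }
  assert (am : a <= m) by (apply Hub; split; [lra|assumption]).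
  assert (mb : m <= b) by (apply Hlub; intros s [? _]; lra).
  assert (Hm : f m <= 0).
  { destruct (Rle_lt_dec (f m) 0) as [|Hp]; [assumption|exfalso].
    destruct (continuous_pos_near f m (Hc m (conj am mb)) Hp) as [d Hd'].
    assert (m <= m - d).
    { apply Hlub. intros s [Hs1 Hs2].
      destruct (Rle_lt_dec s (m - d)) as [|Hl]; [assumption|exfalso].
      assert (s <= m) by (apply Hub; split; assumption).
      assert (0 < f s) by (apply Hd'; rewrite Rabs_left1; lra). lra. }
    destruct d; simpl in *; lra. }
  assert (mb' : m < b) by (destruct mb; [assumption|subst; lra]).
  destruct (mvt_open f df m b mb') as [xi [Hxi Exi]].
  - intros; apply Hc; lra.
  - intros; apply Hd; lra.
  - assert (0 < f xi).
    { destruct (Rlt_le_dec 0 (f xi)) as [|Hl]; [assumption|exfalso].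
      assert (xi <= m) by (apply Hub; split; lra). lra. }
    assert (df xi <= 0) by (apply Hs; lra). nra.
Qed.

Lemma deriv_comp (f g : R -> R) (x df dg : R) :
  is_derive f (g x) df -> is_derive g x dg -> is_derive (fun t => f (g t)) x (dg * df).
Proof. intros. now apply (is_derive_comp f g). Qed.

Lemma deriv_plus (f g : R -> R) (x df dg : R) :
  is_derive f x df -> is_derive g x dg -> is_derive (fun t => f t + g t) x (df + dg).
Proof. intros. now apply (is_derive_plus (V := R_NormedModule)). Qed.

Lemma deriv_minus (f g : R -> R) (x df dg : R) :
  is_derive f x df -> is_derive g x dg -> is_derive (fun t => f t - g t) x (df - dg).
Proof. intros. now apply (is_derive_minus (V := R_NormedModule)). Qed.

Lemma deriv_mult (f g : R -> R) (x df dg : R) :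
  is_derive f x df -> is_derive g x dg -> is_derive (fun t => f t * g t) x (df * g x + f x * dg).
Proof. intros. apply (is_derive_mult (K := R_AbsRing)); trivial. intros; apply Rmult_comm. Qed.

Lemma deriv_div (f g : R -> R) (x df dg : R) :
  is_derive f x df -> is_derive g x dg -> g x <> 0 ->
  is_derive (fun t => f t / g t) x ((df * g x - f x * dg) / g x ^ 2).
Proof. intros. now apply is_derive_div. Qed.

Lemma deriv_eq (f : R -> R) (x l l' : R) : is_derive f x l -> l = l' -> is_derive f x l'.
Proof. intros H <-. exact H. Qed.

Ltac deriv_as l0 := match goal with |- is_derive ?f ?x ?l => apply (deriv_eq f x l0 l) end.

Lemma deriv_cont (f : R -> R) (x l : R) : is_derive f x l -> continuous f x.
Proof. intros H. apply (ex_derive_continuous f). now exists l. Qed.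

(** Reversal of the variable in [comparison]. Fronts share the value 0 at theta = 1 and are compared
    leftwards from there. *)
Lemma comparison_left (f df : R -> R) (a b : R) :
  a <= b ->
  (forall t, a <= t <= b -> continuous f t) ->
  (forall t, a < t < b -> is_derive f t (df t)) ->
  f b <= 0 ->
  (forall t, a < t < b -> 0 < f t -> 0 <= df t) ->
  f a <= 0.
Proof.
  intros ab Hc Hd Hb Hs.
  replace (f a) with ((fun t => f (- t)) (- a)) by (cbv beta; now rewrite Ropp_involutive).
  apply (comparison (fun t => f (- t)) (fun t => - df (- t)) (- b) (- a)).
  - lra.
  - intros t Ht. apply continuous_comp.
    + apply (continuous_opp (V := R_NormedModule) (fun t : R => t)), continuous_id.
    + apply Hc; lra.
  - intros t Ht.
    replace (- df (- t)) with (scal (-1) (df (- t))) by (unfold scal; simpl; unfold mult; simpl; ring).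
    apply (is_derive_comp f Ropp); [apply Hd; lra|].
    auto_derive; [easy|ring].
  - now rewrite Ropp_involutive.
  - intros t Ht Hf. specialize (Hs (- t)). lra.
Qed.

Lemma nondecreasing_of_derive (f df : R -> R) (a b : R) :
  a <= b ->
  (forall t, a <= t <= b -> continuous f t) ->
  (forall t, a < t < b -> is_derive f t (df t)) ->
  (forall t, a < t < b -> 0 <= df t) ->
  f a <= f b.
Proof.
  intros ab Hc Hd Hs. destruct ab as [ab|<-]; [|lra].
  destruct (mvt_open f df a b ab Hc Hd) as [xi [Hxi E]].
  specialize (Hs xi Hxi). nra.
Qed.

(** Valid for all reals because [sqrt] is 0 on negative numbers, so approximations that dip below 0
    need no separate treatment. *)
Lemma sqrt_Hoelder (x y : R) : Rabs (sqrt x - sqrt y) <= sqrt (Rabs (x - y)).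
Proof.
  assert (G : forall x y, y <= x -> Rabs (sqrt x - sqrt y) <= sqrt (Rabs (x - y))).
  { clear x y. intros x y Hxy.
    assert (sqrt y <= sqrt x).
    { destruct (Rle_lt_dec 0 y); [apply sqrt_le_1; lra|].
      rewrite (sqrt_neg_0 y) by lra. apply sqrt_pos. }
    rewrite !Rabs_right by lra.
    apply Rsqr_incr_0_var; [|apply sqrt_pos].
    rewrite Rsqr_sqrt by lra. unfold Rsqr.
    pose proof (sqrt_pos x); pose proof (sqrt_pos y).
    destruct (Rle_lt_dec 0 y).
    - pose proof (sqrt_sqrt x ltac:(lra)); pose proof (sqrt_sqrt y ltac:(lra)). nra.
    - rewrite (sqrt_neg_0 y) by lra.
      destruct (Rle_lt_dec 0 x).
      + pose proof (sqrt_sqrt x ltac:(lra)). nra.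
      + rewrite (sqrt_neg_0 x) by lra. nra. }
  destruct (Rle_dec y x); [now apply G|].
  rewrite Rabs_minus_sym, (Rabs_minus_sym x). apply G; lra.
Qed.

Lemma sqrt_mono (x y : R) : x <= y -> sqrt x <= sqrt y.
Proof.
  intros H. destruct (Rle_lt_dec 0 x); [apply sqrt_le_1; lra|].
  rewrite (sqrt_neg_0 x) by lra. apply sqrt_pos.
Qed.

Lemma exRI (f : R -> R) (a b : R) : (forall x, continuous f x) -> ex_RInt f a b.
Proof. intros H. apply (ex_RInt_continuous (V := R_CompleteNormedModule)). auto. Qed.

Lemma exRI_on (f : R -> R) (a b : R) :
  (forall x, Rmin a b <= x <= Rmax a b -> continuous f x) -> ex_RInt f a b.
Proof. intros H. now apply (ex_RInt_continuous (V := R_CompleteNormedModule)). Qed.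

Lemma RI_minus (f g : R -> R) (a b : R) : ex_RInt f a b -> ex_RInt g a b ->
  RInt (fun x => f x - g x) a b = RInt f a b - RInt g a b.
Proof. apply (RInt_minus (V := R_CompleteNormedModule)). Qed.

Lemma RI_plus (f g : R -> R) (a b : R) : ex_RInt f a b -> ex_RInt g a b ->
  RInt (fun x => f x + g x) a b = RInt f a b + RInt g a b.
Proof. apply (RInt_plus (V := R_CompleteNormedModule)). Qed.

Lemma RI_scal (f : R -> R) (a b l : R) : ex_RInt f a b ->
  RInt (fun x => l * f x) a b = l * RInt f a b.
Proof. apply (RInt_scal (V := R_CompleteNormedModule)). Qed.

Lemma RI_Chasles (f : R -> R) (a b c : R) : ex_RInt f a b -> ex_RInt f b c ->
  RInt f a b + RInt f b c = RInt f a c.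
Proof. apply (RInt_Chasles (V := R_CompleteNormedModule)). Qed.

Lemma RI_swap (f : R -> R) (a b : R) : ex_RInt f a b -> RInt f a b = - RInt f b a.
Proof.
  intros H. symmetry. apply (opp_RInt_swap (V := R_CompleteNormedModule)).
  now apply (ex_RInt_swap (V := R_NormedModule)).
Qed.

Lemma RI_point (f : R -> R) (a : R) : RInt f a a = 0.
Proof. apply (RInt_point (V := R_CompleteNormedModule)). Qed.

Lemma RI_deriv (f : R -> R) (a b : R) :
  (forall x, Rmin a b <= x <= Rmax a b -> continuous f x) ->
  locally b (fun x => continuous f x) ->
  is_derive (fun x => RInt f a x) b (f b).
Proof.
  intros Hc Hl. apply (is_derive_RInt (V := R_NormedModule) f _ a).
  - destruct Hl as [d Hd]. exists d. intros x Hx. apply (RInt_correct (V := R_CompleteNormedModule)).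
    apply exRI_on. intros z Hz.
    destruct (Rle_dec (Rmin a b) z); [destruct (Rle_dec z (Rmax a b))|].
    + apply Hc; lra.
    + apply Hd. unfold ball in *; simpl in *; unfold AbsRing_ball, abs, minus, plus, opp in *; simpl in *.
      revert Hx n Hz. unfold Rmax, Rmin. repeat destruct Rle_dec; unfold Rabs; repeat destruct Rcase_abs; lra.
    + apply Hd. unfold ball in *; simpl in *; unfold AbsRing_ball, abs, minus, plus, opp in *; simpl in *.
      revert Hx n Hz. unfold Rmax, Rmin. repeat destruct Rle_dec; unfold Rabs; repeat destruct Rcase_abs; lra.
  - apply Hc. unfold Rmin, Rmax; destruct Rle_dec; lra.
Qed.

Lemma RI_abs_const (f : R -> R) (a b M : R) :
  ex_RInt f a b ->
  (forall t, Rmin a b <= t <= Rmax a b -> Rabs (f t) <= M) ->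
  Rabs (RInt f a b) <= Rabs (b - a) * M.
Proof.
  intros He Hb. destruct (Rle_dec a b) as [ab|ab].
  - rewrite Rmin_left, Rmax_right in Hb by lra. rewrite (Rabs_right (b - a)) by lra.
    now apply abs_RInt_le_const.
  - rewrite Rmin_right, Rmax_left in Hb by lra. rewrite RI_swap, Rabs_Ropp by assumption.
    rewrite (Rabs_left (b - a)) by lra. replace (- (b - a)) with (a - b) by ring.
    apply abs_RInt_le_const; [lra| |assumption].
    apply (ex_RInt_swap (V := R_NormedModule)). assumption.
Qed.

Lemma RI_cont (f : R -> R) (a x : R) :
  (forall t, continuous f t) -> continuous (fun x => RInt f a x) x.
Proof.
  intros Hc. apply (ex_derive_continuous (fun x => RInt f a x)). exists (f x).
  apply RI_deriv; [auto|]. exists (mkposreal 1 Rlt_0_1). auto.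
Qed.

(** The majorant enters through its antiderivative [G], so [dG] is never integrated and may be
    singular at the endpoints. *)
Lemma RI_le_increment (g G dG : R -> R) (a b : R) :
  a <= b ->
  (forall x, a <= x <= b -> continuous g x) ->
  (forall x, a <= x <= b -> continuous G x) ->
  (forall x, a < x < b -> is_derive G x (dG x)) ->
  (forall x, a < x < b -> Rabs (g x) <= dG x) ->
  Rabs (RInt g a b) <= G b - G a.
Proof.
  intros ab Hg HG HdG Hb.
  (* [g] is extended by constants so that the endpoints need no care. *)
  set (g' := fun x => g (Rmax a (Rmin x b))).
  assert (Eg : forall x, a <= x <= b -> g' x = g x).
  { intros x Hx. unfold g'. rewrite Rmin_left, Rmax_right; lra. }
  assert (Hg' : forall x, continuous g' x).
  { intros x. unfold g'. apply continuous_comp; [cont|].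
    apply Hg. split; [apply Rmax_l|]. apply Rmax_lub; [lra|apply Rmin_r]. }
  assert (Hd : forall x, is_derive (fun x => RInt g' a x) x (g' x)).
  { intros x. apply RI_deriv; [auto|]. exists (mkposreal 1 Rlt_0_1). auto. }
  assert (HI : forall x, continuous (fun x => RInt g' a x) x).
  { intros x. apply (ex_derive_continuous (fun x => RInt g' a x)). exists (g' x). apply Hd. }
  rewrite (RInt_ext g g' a b).
  2:{ intros x Hx. rewrite Rmin_left, Rmax_right in Hx by lra. symmetry; apply Eg; lra. }
  assert (H1 := nondecreasing_of_derive (fun x => G x - RInt g' a x) (fun x => dG x - g' x) a b ab).
  assert (H2 := nondecreasing_of_derive (fun x => G x + RInt g' a x) (fun x => dG x + g' x) a b ab).
  cbv beta in H1, H2. rewrite RI_point in H1, H2.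
  apply Rabs_le. split.
  - enough (G a + 0 <= G b + RInt g' a b) by lra. apply H2.
    + intros; cont; auto.
    + intros t Ht. apply (is_derive_plus (V := R_NormedModule)); auto.
    + intros t Ht. rewrite Eg by lra. specialize (Hb t Ht). revert Hb. unfold Rabs; destruct Rcase_abs; lra.
  - enough (G a - 0 <= G b - RInt g' a b) by lra. apply H1.
    + intros; cont; auto.
    + intros t Ht. apply (is_derive_minus (V := R_NormedModule)); auto.
    + intros t Ht. rewrite Eg by lra. specialize (Hb t Ht). revert Hb. unfold Rabs; destruct Rcase_abs; lra.
Qed.

Lemma filterlim_R (T : Type) (F : (T -> Prop) -> Prop) {FF : Filter F} (f : T -> R) (l : R) :
  filterlim f F (locally l) <-> (forall e, 0 < e -> F (fun x => Rabs (f x - l) < e)).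
Proof.
  split.
  - intros H e He. apply (proj1 (filterlim_locally f l) H (mkposreal e He)).
  - intros H. apply filterlim_locally. intros [e He]. apply (H e He).
Qed.

Lemma cont_eps (f : R -> R) (x : R) :
  continuous f x <->
  (forall e, 0 < e -> exists d, 0 < d /\ forall y, Rabs (y - x) < d -> Rabs (f y - f x) < e).
Proof.
  unfold continuous. rewrite (filterlim_R R (locally x) (FF := filter_filter)). split.
  - intros H e He. destruct (H e He) as [[d Hd] Hd']. exists d. split; [assumption|].
    intros y Hy. apply Hd'. exact Hy.
  - intros H e He. destruct (H e He) as [d [Hd Hd']]. exists (mkposreal d Hd).
    intros y Hy. apply Hd'. exact Hy.
Qed.

Lemma is_derive_eps (f : R -> R) (x l : R) :
  is_derive f x l <->
  (forall e, 0 < e -> exists d, 0 < d /\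
     forall y, Rabs (y - x) < d -> Rabs (f y - f x - l * (y - x)) <= e * Rabs (y - x)).
Proof.
  split.
  - intros [_ H] e He. destruct (H x (fun P HP => HP) (mkposreal e He)) as [[d Hd] Hd'].
    exists d. split; [assumption|]. intros y Hy. specialize (Hd' y Hy).
    unfold norm, minus, plus, opp, scal in Hd'; simpl in Hd'. unfold abs, mult in Hd'; simpl in Hd'.
    replace (f y - f x - l * (y - x)) with (f y + - f x + - ((y + - x) * l)) by ring. exact Hd'.
  - intros H. split; [apply is_linear_scal_l|].
    intros x' Hx' [e He].
    assert (x' = x) as -> by (symmetry; now apply (is_filter_lim_locally_unique (K := R_AbsRing) (V := R_NormedModule))).
    destruct (H e He) as [d [Hd Hd']]. exists (mkposreal d Hd). intros y Hy.
    specialize (Hd' y Hy).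
    unfold norm, minus, plus, opp, scal; simpl. unfold abs, mult; simpl.
    replace (f y + - f x + - ((y + - x) * l)) with (f y - f x - l * (y - x)) by ring. exact Hd'.
Qed.

Lemma lim0_eps (e : nat -> R) : is_lim_seq e 0 -> forall d, 0 < d -> exists n, e n < d.
Proof.
  intros H d Hd. apply is_lim_seq_spec in H. destruct (H (mkposreal d Hd)) as [n Hn].
  exists n. specialize (Hn n (le_n n)). simpl in Hn. rewrite Rminus_0_r in Hn.
  apply Rle_lt_trans with (2 := Hn). apply Rle_abs.
Qed.

Lemma le_of_lim0 (e : nat -> R) (x : R) : is_lim_seq e 0 -> (forall n, x <= e n) -> x <= 0.
Proof.
  intros H Hx. destruct (Rle_lt_dec x 0) as [|Hp]; [assumption|].
  destruct (lim0_eps e H x Hp) as [n Hn]. specialize (Hx n). lra.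
Qed.

(** Let [m] tend to infinity in the Cauchy estimate: the term [e m] disappears and the limit
    inherits the rate. *)
Lemma cauchy_rate (u e : nat -> R) : is_lim_seq e 0 ->
  (forall n m, Rabs (u n - u m) <= e n + e m) ->
  forall n, Rabs (u n - real (Lim_seq u)) <= e n.
Proof.
  intros He Hu n.
  assert (Hl : is_lim_seq u (real (Lim_seq u))).
  { apply Lim_seq_correct'. apply ex_lim_seq_cauchy_corr. intros [d Hd].
    apply is_lim_seq_spec in He. destruct (He (mkposreal (d / 2) ltac:(lra))) as [N HN].
    exists N. intros p q Hp Hq. simpl in *.
    assert (H1 := HN p Hp). assert (H2 := HN q Hq). specialize (Hu p q).
    rewrite Rminus_0_r in H1, H2.
    pose proof (Rle_abs (e p)). pose proof (Rle_abs (e q)). lra. }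
  assert (H := is_lim_seq_abs _ _ (is_lim_seq_minus' _ _ _ _ (is_lim_seq_const (u n)) Hl)).
  assert (H2 := is_lim_seq_plus' _ _ _ _ (is_lim_seq_const (e n)) He).
  assert (H3 := is_lim_seq_le _ _ _ _ (fun m => Hu n m) H H2). simpl in H3. lra.
Qed.

(** * Existence for w' = g - c sqrt(2 w) by delayed approximations *)

Section SqrtOde.
Variables (g : R -> R) (c G : R).
Hypothesis g_cont : forall t, continuous g t.
Hypothesis c_pos : 0 <= c.
Hypothesis g_bound : forall t, 0 <= t <= 1 -> Rabs (g t) <= G.

(* Tonelli's scheme: the delay [d] makes the equation explicit, so that the iteration becomes stationary on [0,1] after finitely many steps. *)
Fixpoint tonelli (d : R) (n : nat) (t : R) : R :=
  match n with
  | O => 0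
  | S n => RInt (fun s => g s - c * sqrt (2 * tonelli d n (s - d))) 0 (Rmax 0 t)
  end.

Lemma tonelli_cont d n t : continuous (tonelli d n) t.
Proof.
  revert t. induction n as [|n IH]; intros t; simpl; [apply cont_const|].
  apply (continuous_comp (fun t => Rmax 0 t)
    (fun t => RInt (fun s => g s - c * sqrt (2 * tonelli d n (s - d))) 0 t)); [cont|].
  apply (RI_cont _ 0). intros s. cont. apply g_cont.
  apply (continuous_comp (fun s => s - d) (tonelli d n)); [cont|apply IH].
Qed.

Lemma tonelli_integrand_cont d n t :
  continuous (fun s => g s - c * sqrt (2 * tonelli d n (s - d))) t.
Proof.
  cont. apply g_cont.
  apply (continuous_comp (fun s => s - d) (tonelli d n)); [cont|apply tonelli_cont].
Qed.

Lemma tonelli_neg d n t : t <= 0 -> tonelli d n t = 0.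
Proof. intros Ht. destruct n; simpl; [easy|]. rewrite Rmax_left by lra. apply RI_point. Qed.

(** The integrand at [s] sees the previous iterate only at [s - d], so every iteration makes the
    values final on one more interval of length [d]. *)
Lemma tonelli_stationary d n t : 0 < d -> t <= INR n * d -> tonelli d (S n) t = tonelli d n t.
Proof.
  intros Hd. revert t. induction n as [|n IH]; intros t Ht.
  - simpl in Ht. rewrite !tonelli_neg; lra.
  - change (RInt (fun s => g s - c * sqrt (2 * tonelli d (S n) (s - d))) 0 (Rmax 0 t)
      = RInt (fun s => g s - c * sqrt (2 * tonelli d n (s - d))) 0 (Rmax 0 t)).
    apply RInt_ext. intros s Hs. rewrite Rmin_left, Rmax_right in Hs by apply Rmax_l.
    rewrite IH; [easy|]. rewrite S_INR in Ht.
    assert (Rmax 0 t <= INR n * d + d).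
    { apply Rmax_lub; [|lra]. pose proof (pos_INR n). nra. }
    lra.
Qed.

(** Exactly [S n] steps of this length cover [0,1], so [S n] iterations solve the delayed equation
    there. *)
Definition delay (n : nat) : R := / INR (S n).
Definition approx (n : nat) : R -> R := tonelli (delay n) (S n).

Lemma delay_pos n : 0 < delay n.
Proof. apply Rinv_0_lt_compat. apply lt_0_INR. lia. Qed.

Lemma delay_lim : is_lim_seq delay 0.
Proof.
  apply (is_lim_seq_incr_1 (fun n => / INR n)).
  apply (is_lim_seq_inv INR p_infty); [apply is_lim_seq_INR|easy].
Qed.

Lemma approx_eq n t : 0 <= t <= 1 ->
  approx n t = RInt (fun s => g s - c * sqrt (2 * approx n (s - delay n))) 0 t.
Proof.
  intros Ht. unfold approx at 1. rewrite <- tonelli_stationary; [|apply delay_pos|].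
  - change (tonelli (delay n) (S (S n)) t) with
      (RInt (fun s => g s - c * sqrt (2 * tonelli (delay n) (S n) (s - delay n))) 0 (Rmax 0 t)).
    rewrite Rmax_right by lra. easy.
  - unfold delay. rewrite Rinv_r; [lra|]. apply not_0_INR; lia.
Qed.

Lemma approx_derive n t : 0 < t < 1 ->
  is_derive (approx n) t (g t - c * sqrt (2 * approx n (t - delay n))).
Proof.
  intros Ht.
  apply (is_derive_ext_loc (fun t => RInt (fun s => g s - c * sqrt (2 * approx n (s - delay n))) 0 t)).
  - assert (H : locally t (fun x => 0 < x /\ x < 1)).
    { apply (open_and (fun x => 0 < x) (fun x => x < 1)); [apply open_gt|apply open_lt|lra]. }
    revert H. apply filter_imp. intros x Hx. symmetry. apply approx_eq. lra.
  - apply (RI_deriv (fun s => g s - c * sqrt (2 * approx n (s - delay n))) 0 t).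
    + intros; apply tonelli_integrand_cont.
    + exists (mkposreal 1 Rlt_0_1). intros; apply tonelli_integrand_cont.
Qed.

Lemma G_pos : 0 <= G.
Proof. specialize (g_bound 0). pose proof (Rabs_pos (g 0)). lra. Qed.

(** The square root term only lowers the derivative, which is therefore at most [G]. *)
Lemma approx_le n t : t <= 1 -> approx n t <= G.
Proof.
  intros Ht. pose proof G_pos as HG. destruct (Rle_lt_dec t 0) as [H0|H0].
  - unfold approx. rewrite tonelli_neg by assumption. lra.
  - enough (approx n t - G * t <= 0) by nra.
    apply (comparison (fun t => approx n t - G * t)
      (fun t => g t - c * sqrt (2 * approx n (t - delay n)) - G) 0 t).
    + lra.
    + intros s Hs. cont. apply tonelli_cont.
    + intros s Hs. apply (is_derive_minus (V := R_NormedModule) (approx n) (fun t => G * t)).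
      * apply approx_derive. lra.
      * auto_derive; [easy|ring].
    + unfold approx. rewrite tonelli_neg by lra. lra.
    + intros s Hs _. pose proof (g_bound s ltac:(lra)) as Hb.
      pose proof (sqrt_pos (2 * approx n (s - delay n))).
      apply Rabs_le_between in Hb. nra.
Qed.

(** Bound for the right-hand side along every approximation, hence a Lipschitz constant independent
    of the delay. *)
Definition lip : R := G + c * sqrt (2 * G).

Lemma lip_pos : 0 <= lip.
Proof. unfold lip. pose proof G_pos. pose proof (sqrt_pos (2 * G)). nra. Qed.

Lemma approx_lip01 n s t : 0 <= s -> s <= t -> t <= 1 -> Rabs (approx n t - approx n s) <= lip * (t - s).
Proof.
  intros Hs Hst Ht. rewrite !approx_eq by lra.
  rewrite <- (RI_Chasles _ 0 s t); try (apply exRI; intros; apply tonelli_integrand_cont).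
  unfold Rminus at 1. rewrite Rplus_comm, <- Rplus_assoc, Rplus_opp_l, Rplus_0_l.
  rewrite Rmult_comm. rewrite <- (Rabs_right (t - s)) by lra.
  apply RI_abs_const; [apply exRI; intros; apply tonelli_integrand_cont|].
  intros x Hx. rewrite Rmin_left, Rmax_right in Hx by lra.
  pose proof (g_bound x ltac:(lra)) as Hb. apply Rabs_le_between in Hb.
  pose proof (delay_pos n).
  assert (sqrt (2 * approx n (x - delay n)) <= sqrt (2 * G)).
  { apply sqrt_mono. pose proof (approx_le n (x - delay n) ltac:(lra)). lra. }
  pose proof (sqrt_pos (2 * approx n (x - delay n))).
  apply Rabs_le. unfold lip. nra.
Qed.

Lemma approx_lip n s t : s <= t -> t <= 1 -> Rabs (approx n t - approx n s) <= lip * (t - s).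
Proof.
  intros Hst Ht. pose proof lip_pos.
  assert (E : forall x, approx n x = approx n (Rmax 0 x)).
  { intros x. unfold Rmax; destruct Rle_dec; [easy|]. unfold approx. rewrite !tonelli_neg; lra. }
  rewrite (E s), (E t).
  apply Rle_trans with (lip * (Rmax 0 t - Rmax 0 s)).
  - apply approx_lip01; unfold Rmax; repeat destruct Rle_dec; lra.
  - apply Rmult_le_compat_l; [assumption|]. unfold Rmax; repeat destruct Rle_dec; lra.
Qed.

(** Cost of evaluating the square root at the delayed instead of the current time, by Hoelder
    continuity. *)
Definition rate (n : nat) : R := c * sqrt (2 * (lip * delay n)).

Lemma rate_lim : is_lim_seq rate 0.
Proof.
  assert (E : (0:R) = c * sqrt (2 * (lip * 0))) by (rewrite !Rmult_0_r, sqrt_0; ring).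
  rewrite E.
  apply (is_lim_seq_continuous (fun x => c * sqrt (2 * (lip * x))) delay 0); [|apply delay_lim].
  apply cont_pt. cont.
Qed.

Lemma sqrt_delay n t : t <= 1 ->
  c * Rabs (sqrt (2 * approx n (t - delay n)) - sqrt (2 * approx n t)) <= rate n.
Proof.
  intros Ht. apply Rmult_le_compat_l; [assumption|].
  eapply Rle_trans; [apply sqrt_Hoelder|]. apply sqrt_mono.
  rewrite <- Rmult_minus_distr_l, Rabs_mult, (Rabs_right 2) by lra.
  apply Rmult_le_compat_l; [lra|]. rewrite Rabs_minus_sym.
  pose proof (delay_pos n).
  eapply Rle_trans; [apply approx_lip; lra|]. right; ring.
Qed.

(** Monotonicity of the square root stands in for a Lipschitz condition: where approximation [n]
    exceeds approximation [m], the term [- c * sqrt] pushes them together, and only the two delay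
    errors remain. *)
Lemma approx_cauchy1 n m t : 0 <= t <= 1 -> approx n t - approx m t <= rate n + rate m.
Proof.
  intros Ht.
  assert (Hr : forall n, 0 <= rate n) by (intros k; apply Rmult_le_pos; [assumption|apply sqrt_pos]).
  enough (approx n t - approx m t - (rate n + rate m) * t <= 0).
  { pose proof (Hr n); pose proof (Hr m). nra. }
  apply (comparison (fun t => approx n t - approx m t - (rate n + rate m) * t)
    (fun t => (g t - c * sqrt (2 * approx n (t - delay n)))
            - (g t - c * sqrt (2 * approx m (t - delay m))) - (rate n + rate m)) 0 t).
  - lra.
  - intros s Hs. cont; apply tonelli_cont.
  - intros s Hs. apply (is_derive_minus (V := R_NormedModule) (fun t => approx n t - approx m t)).
    + apply (is_derive_minus (V := R_NormedModule)); apply approx_derive; lra.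
    + auto_derive; [easy|ring].
  - unfold approx. rewrite !tonelli_neg; lra.
  - intros s Hs Hp.
    assert (H1 := sqrt_delay n s ltac:(lra)). assert (H2 := sqrt_delay m s ltac:(lra)).
    assert (sqrt (2 * approx m s) <= sqrt (2 * approx n s)).
    { apply sqrt_mono. pose proof (Hr n); pose proof (Hr m). nra. }
    revert H1 H2. unfold Rabs. repeat destruct Rcase_abs; nra.
Qed.

Lemma approx_cauchy n m t : 0 <= t <= 1 -> Rabs (approx n t - approx m t) <= rate n + rate m.
Proof.
  intros Ht. pose proof (approx_cauchy1 n m t Ht). pose proof (approx_cauchy1 m n t Ht).
  apply Rabs_le; lra.
Qed.

(** Clipping the time to [0,1], where convergence is known, makes the limit continuous on the whole
    line. *)
Definition sol (t : R) : R := real (Lim_seq (fun n => approx n (Rmax 0 (Rmin t 1)))).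

Lemma clip01 t : 0 <= Rmax 0 (Rmin t 1) <= 1.
Proof. unfold Rmax, Rmin; repeat destruct Rle_dec; lra. Qed.

Lemma sol_approx n t : 0 <= t <= 1 -> Rabs (approx n t - sol t) <= rate n.
Proof.
  intros Ht. unfold sol. rewrite Rmin_left, Rmax_right by lra.
  apply (cauchy_rate (fun n => approx n t) rate rate_lim).
  intros p q. now apply approx_cauchy.
Qed.

Lemma sol_lip s t : 0 <= s <= 1 -> 0 <= t <= 1 -> Rabs (sol t - sol s) <= lip * Rabs (t - s).
Proof.
  intros Hs Ht.
  enough (Rabs (sol t - sol s) - lip * Rabs (t - s) <= 0) by lra.
  apply (le_of_lim0 (fun n => rate n + rate n)).
  - replace 0 with (0 + 0) by ring. apply is_lim_seq_plus'; apply rate_lim.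
  - intros n. assert (H1 := sol_approx n s Hs). assert (H2 := sol_approx n t Ht).
    assert (H3 : Rabs (approx n t - approx n s) <= lip * Rabs (t - s)).
    { destruct (Rle_dec s t).
      - rewrite (Rabs_right (t - s)) by lra. apply approx_lip; lra.
      - rewrite Rabs_minus_sym, (Rabs_left (t - s)) by lra.
        replace (- (t - s)) with (s - t) by ring. apply approx_lip; lra. }
    revert H1 H2 H3. generalize (lip * Rabs (t - s)). intros r.
    unfold Rabs. repeat destruct Rcase_abs; lra.
Qed.

Lemma sol_cont t : continuous sol t.
Proof.
  apply (continuous_ext (fun t => sol (Rmax 0 (Rmin t 1)))).
  - intros x. unfold sol. rewrite (Rmin_left (Rmax 0 (Rmin x 1))), (Rmax_right 0 (Rmax _ _)); [easy| |]; apply clip01.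
  - apply cont_eps. intros e He. pose proof lip_pos.
    assert (0 < lip + 1) by lra.
    exists (e / (lip + 1)). split; [now apply Rdiv_lt_0_compat|].
    intros y Hy. eapply Rle_lt_trans; [apply sol_lip; apply clip01|].
    assert (Rabs (Rmax 0 (Rmin y 1) - Rmax 0 (Rmin t 1)) <= Rabs (y - t)).
    { unfold Rmax, Rmin, Rabs; repeat destruct Rle_dec; repeat destruct Rcase_abs; lra. }
    apply Rmult_lt_compat_l with (r := lip + 1) in Hy; [|assumption].
    replace ((lip + 1) * (e / (lip + 1))) with e in Hy by (field; lra).
    pose proof (Rabs_pos (y - t)).
    pose proof (Rabs_pos (Rmax 0 (Rmin y 1) - Rmax 0 (Rmin t 1))). nra.
Qed.

Lemma sol_integrand_cont t : continuous (fun s => g s - c * sqrt (2 * sol s)) t.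
Proof. cont; [apply g_cont|apply sol_cont]. Qed.

Lemma sol_eq t : 0 <= t <= 1 -> sol t = RInt (fun s => g s - c * sqrt (2 * sol s)) 0 t.
Proof.
  intros Ht. apply Rminus_diag_uniq.
  enough (Rabs (sol t - RInt (fun s => g s - c * sqrt (2 * sol s)) 0 t) <= 0).
  { revert H. unfold Rabs; destruct Rcase_abs; lra. }
  apply (le_of_lim0 (fun n => rate n + c * sqrt (2 * (lip * delay n + rate n)))).
  - assert (E : (0:R) = 0 + c * sqrt (2 * (lip * 0 + 0))) by (rewrite Rmult_0_r, Rplus_0_r, Rmult_0_r, sqrt_0; ring).
    rewrite E. apply is_lim_seq_plus'; [apply rate_lim|].
    apply (is_lim_seq_continuous (fun x => c * sqrt (2 * x)) (fun n => lip * delay n + rate n)).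
    + apply cont_pt. cont.
    + apply is_lim_seq_plus'; [|apply rate_lim].
      apply (is_lim_seq_scal_l delay lip 0), delay_lim.
  - intros n.
    replace (sol t - RInt (fun s => g s - c * sqrt (2 * sol s)) 0 t)
      with (- (approx n t - sol t)
            + (approx n t - RInt (fun s => g s - c * sqrt (2 * sol s)) 0 t)) by ring.
    eapply Rle_trans; [apply Rabs_triang|]. rewrite Rabs_Ropp.
    apply Rplus_le_compat; [now apply sol_approx|].
    rewrite approx_eq by assumption.
    rewrite <- RI_minus; [|apply exRI; intros; apply tonelli_integrand_cont|apply exRI, sol_integrand_cont].
    assert (0 <= c * sqrt (2 * (lip * delay n + rate n))) by (apply Rmult_le_pos; [assumption|apply sqrt_pos]).
    apply Rle_trans with (Rabs (t - 0) * (c * sqrt (2 * (lip * delay n + rate n)))).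
    2:{ rewrite Rabs_right; nra. }
    apply RI_abs_const.
    + apply exRI. intros x. apply (cont_minus (fun x => g x - c * sqrt (2 * approx n (x - delay n)))).
      apply tonelli_integrand_cont. apply sol_integrand_cont.
    + intros s Hs. rewrite Rmin_left, Rmax_right in Hs by lra.
      replace (g s - c * sqrt (2 * approx n (s - delay n)) - (g s - c * sqrt (2 * sol s)))
        with (c * (sqrt (2 * sol s) - sqrt (2 * approx n (s - delay n)))) by ring.
      rewrite Rabs_mult, (Rabs_right c) by lra.
      apply Rmult_le_compat_l; [assumption|].
      eapply Rle_trans; [apply sqrt_Hoelder|]. apply sqrt_mono.
      rewrite <- Rmult_minus_distr_l, Rabs_mult, (Rabs_right 2) by lra.
      apply Rmult_le_compat_l; [lra|].
      assert (H1 := sol_approx n s ltac:(lra)).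
      pose proof (delay_pos n).
      assert (H2 := approx_lip n (s - delay n) s ltac:(lra) ltac:(lra)).
      replace (s - (s - delay n)) with (delay n) in H2 by ring.
      revert H1 H2. unfold Rabs; repeat destruct Rcase_abs; lra.
Qed.

Lemma sqrt_ode : exists w : R -> R,
  (forall t, continuous w t) /\ w 0 = 0 /\
  (forall t, 0 < t < 1 -> is_derive w t (g t - c * sqrt (2 * w t))).
Proof.
  exists sol. split; [exact sol_cont|]. split.
  - rewrite sol_eq by lra. apply RI_point.
  - intros t Ht.
    apply (is_derive_ext_loc (fun t => RInt (fun s => g s - c * sqrt (2 * sol s)) 0 t)).
    + assert (H : locally t (fun x => 0 < x /\ x < 1)).
      { apply (open_and (fun x => 0 < x) (fun x => x < 1)); [apply open_gt|apply open_lt|lra]. }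
      revert H. apply filter_imp. intros x Hx. symmetry. apply sol_eq. lra.
    + apply (RI_deriv (fun s => g s - c * sqrt (2 * sol s)) 0 t).
      * intros; apply sol_integrand_cont.
      * exists (mkposreal 1 Rlt_0_1). intros; apply sol_integrand_cont.
Qed.
End SqrtOde.

(** Cube of [a / 3 <= exp (a / 3)]. The third power beats the factor [1 / eps ^ 2] of the reaction
    and leaves one factor [eps]. *)
Lemma exp_neg_cube (a : R) : 0 < a -> exp (- a) <= 27 / a ^ 3.
Proof.
  intros Ha. rewrite exp_Ropp.
  assert (H : a / 3 <= exp (a / 3)) by (pose proof (exp_ineq1_le (a / 3)); lra).
  assert (E : exp a = exp (a / 3) ^ 3).
  { simpl. rewrite Rmult_1_r, <- !exp_plus. f_equal. field. }
  assert (H3 : (a / 3) ^ 3 <= exp a) by (rewrite E; apply pow_incr; lra).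
  replace (27 / a ^ 3) with (/ ((a / 3) ^ 3)) by (field; lra).
  apply Rinv_le_contravar; [apply pow_lt; lra|assumption].
Qed.

Lemma exp_le_1 (x : R) : x <= 0 -> exp x <= 1.
Proof. intros Hx. rewrite <- exp_0. destruct Hx as [Hx| ->]; [left; now apply exp_increasing|lra]. Qed.

Lemma exp_mono (x y : R) : x <= y -> exp x <= exp y.
Proof. intros [H| ->]; [left; now apply exp_increasing|lra]. Qed.

(** * Fronts *)

Definition reac (eps th : R) : R :=
  1 / (2 * eps ^ 2) * (th * (1 - th) * exp (- (/ eps) * (1 - th))).

(** The square of [h_s]: the leading-order value of [S ^ 2] in the layer variable [lay]. *)
Definition hs2 (x : R) : R := 1 + (x - 1) * exp x.

Definition lay (eps th : R) : R := (th - 1) / eps.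

(** With theta = 1 + eps x, f d theta equals - (1 + eps x) x e^x / 2 dx. The two summands integrate
    the two powers of eps: the first one produces [hs2], the second is a correction of order eps. *)
Definition reac_prim (eps th : R) : R :=
  ((1 - lay eps th) * exp (lay eps th)
   - eps * ((lay eps th) ^ 2 - 2 * lay eps th + 2) * exp (lay eps th)) / 2.

Lemma reac_prim_derive eps th : 0 < eps -> is_derive (reac_prim eps) th (reac eps th).
Proof.
  intros He. unfold reac_prim, reac, lay. auto_derive; [easy|].
  replace (- / eps * (1 - th)) with ((th + - (1)) * / eps) by (field; lra).
  replace ((th - 1) / eps) with ((th + - (1)) * / eps) by (field; lra).
  field; lra.
Qed.

Lemma reac_cont eps th : 0 < eps -> continuous (reac eps) th.
Proof. intros He. apply (ex_derive_continuous (reac eps)). unfold reac. auto_derive. easy. Qed.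

Lemma reac_pos eps th : 0 < eps -> 0 < th < 1 -> 0 < reac eps th.
Proof.
  intros He Hth. unfold reac. apply Rmult_lt_0_compat.
  - apply Rdiv_lt_0_compat; [lra|]. pose proof (pow_lt eps 2 He). lra.
  - apply Rmult_lt_0_compat; [nra|apply exp_pos].
Qed.

Lemma reac_nonneg eps th : 0 < eps -> 0 <= th <= 1 -> 0 <= reac eps th.
Proof.
  intros He Hth. unfold reac. apply Rmult_le_pos.
  - left. apply Rdiv_lt_0_compat; [lra|]. pose proof (pow_lt eps 2 He). lra.
  - apply Rmult_le_pos; [nra|left; apply exp_pos].
Qed.

Lemma hs2_derive x : is_derive hs2 x (x * exp x).
Proof. unfold hs2. auto_derive; [easy|ring]. Qed.

Lemma hs2_le x : x <= 0 -> hs2 x <= x ^ 2 / 2.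
Proof.
  intros Hx.
  assert (H := nondecreasing_of_derive (fun x => hs2 x - x ^ 2 / 2) (fun x => x * exp x - x) x 0 Hx).
  cbv beta in H. enough (hs2 x - x ^ 2 / 2 <= hs2 0 - 0 ^ 2 / 2) by (unfold hs2 in *; rewrite exp_0 in *; lra).
  apply H.
  - intros. apply (ex_derive_continuous (fun x => hs2 x - x ^ 2 / 2)). unfold hs2. auto_derive. easy.
  - intros. unfold hs2. auto_derive; [easy|]. field.
  - intros t Ht. pose proof (exp_le_1 t ltac:(lra)). pose proof (exp_pos t). nra.
Qed.

Lemma hs2_antitone x y : x <= y <= 0 -> hs2 y <= hs2 x.
Proof.
  intros Hxy. enough (- hs2 x <= - hs2 y) by lra.
  apply (nondecreasing_of_derive (fun x => - hs2 x) (fun x => - (x * exp x)) x y ltac:(lra)).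
  - intros. apply (ex_derive_continuous (fun x => - hs2 x)). unfold hs2. auto_derive. easy.
  - intros. unfold hs2. auto_derive; [easy|]. ring.
  - intros t Ht. pose proof (exp_pos t). nra.
Qed.

Lemma exp_m1_ge : 1 / 3 <= exp (-1).
Proof.
  replace (-1) with (- (1)) by ring. rewrite exp_Ropp.
  replace (1 / 3) with (/ 3) by field. apply Rinv_le_contravar; [apply exp_pos|apply exp_le_3].
Qed.

Lemma exp_m1_le : exp (-1) <= 38 / 100.
Proof.
  replace (-1) with (- (1)) by ring. rewrite exp_Ropp.
  replace (38 / 100) with (/ (100 / 38)) by field. apply Rinv_le_contravar; [lra|].
  assert (E : exp 1 = exp (1 / 16) ^ 16).
  { simpl. rewrite Rmult_1_r, <- !exp_plus. f_equal. field. }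
  (* [(1 + 1 / 16) ^ 16] is about 2.638, just above [100 / 38]. *)
  rewrite E. apply Rle_trans with ((17 / 16) ^ 16); [lra|].
  apply pow_incr. pose proof (exp_ineq1_le (1 / 16)). lra.
Qed.

(** Comparison of derivatives: [1 / 7] works because [2 / 7 < 1 / 3 <= exp (-1) <= exp x]. *)
Lemma hs2_ge_quad x : -1 <= x <= 0 -> x ^ 2 / 7 <= hs2 x.
Proof.
  intros Hx.
  enough (x ^ 2 / 7 - hs2 x <= 0 ^ 2 / 7 - hs2 0) by (unfold hs2 in *; rewrite exp_0 in *; lra).
  apply (nondecreasing_of_derive (fun x => x ^ 2 / 7 - hs2 x) (fun x => x * (2 / 7 - exp x)) x 0 ltac:(lra)).
  - intros. apply (ex_derive_continuous (fun x => x ^ 2 / 7 - hs2 x)). unfold hs2. auto_derive. easy.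
  - intros. unfold hs2. auto_derive; [easy|]. field.
  - intros t Ht. pose proof exp_m1_ge. pose proof (exp_mono (-1) t ltac:(lra)). nra.
Qed.

Lemma hs2_ge_far x : x <= -1 -> 24 / 100 <= hs2 x.
Proof.
  intros Hx. apply Rle_trans with (hs2 (-1)); [|apply hs2_antitone; lra].
  unfold hs2. pose proof exp_m1_le. lra.
Qed.

(* [2 - (x^2 - 2x + 2) e^x] is [int_x^0 s^2 e^s ds]. *)
Lemma quad_exp_bounds x : x <= 0 ->
  0 <= 2 - (x ^ 2 - 2 * x + 2) * exp x <= 2 /\
  2 - (x ^ 2 - 2 * x + 2) * exp x <= - x ^ 3 / 3.
Proof.
  intros Hx.
  assert (H1 := nondecreasing_of_derive (fun x => (x ^ 2 - 2 * x + 2) * exp x) (fun x => x ^ 2 * exp x) x 0 Hx).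
  assert (H2 := nondecreasing_of_derive (fun x => x ^ 3 / 3 - (x ^ 2 - 2 * x + 2) * exp x) (fun x => x ^ 2 * (1 - exp x)) x 0 Hx).
  cbv beta in H1, H2. rewrite exp_0 in H1, H2.
  assert (0 <= (x ^ 2 - 2 * x + 2) * exp x) by (apply Rmult_le_pos; [nra|left; apply exp_pos]).
  assert ((x ^ 2 - 2 * x + 2) * exp x <= (0 ^ 2 - 2 * 0 + 2) * 1).
  { apply H1.
    - intros. apply (ex_derive_continuous (fun x => (x ^ 2 - 2 * x + 2) * exp x)). auto_derive. easy.
    - intros. auto_derive; [easy|]. ring.
    - intros t Ht. apply Rmult_le_pos; [nra|left; apply exp_pos]. }
  assert (x ^ 3 / 3 - (x ^ 2 - 2 * x + 2) * exp x <= 0 ^ 3 / 3 - (0 ^ 2 - 2 * 0 + 2) * 1).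
  { apply H2.
    - intros. apply (ex_derive_continuous (fun x => x ^ 3 / 3 - (x ^ 2 - 2 * x + 2) * exp x)). auto_derive. easy.
    - intros. auto_derive; [easy|]. field.
    - intros t Ht. apply Rmult_le_pos; [nra|]. pose proof (exp_le_1 t). lra. }
  lra.
Qed.

(** Nothing is prescribed at 0: the value [S 0] is an output of the problem started at theta = 1.
    Positivity inside keeps the quotient meaningful. *)
Definition is_front (eps c : R) (S : R -> R) : Prop :=
  (forall th, continuous S th) /\ (forall th, 0 <= S th) /\ S 1 = 0 /\
  (forall th, 0 < th < 1 -> 0 < S th /\ is_derive S th (c - reac eps th / S th)).

(** In the variable t = 1 - theta the energy w = S^2 / 2 solves w' = f - c sqrt(2 w), which is
    continuous at w = 0, so the problem can be started at its degenerate end. A subsolution then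
    keeps [w] positive inside, and [S] is recovered as sqrt(2 w). *)
Lemma front_exists eps c : 0 < eps -> 0 <= c -> exists S, is_front eps c S.
Proof.
  intros He Hc.
  assert (Hg : forall t, continuous (fun t => reac eps (1 - t)) t).
  { intros t. apply (continuous_comp (fun t => 1 - t) (reac eps)); [cont|now apply reac_cont]. }
  assert (He2 := pow_lt eps 2 He).
  assert (Hp : 0 < 1 / (2 * eps ^ 2)) by (apply Rdiv_lt_0_compat; lra).
  destruct (sqrt_ode (fun t => reac eps (1 - t)) c (1 / (2 * eps ^ 2)) Hg Hc) as [w [Hw [Hw0 Hw1]]].
  { intros t Ht. rewrite Rabs_right by (apply Rle_ge, reac_nonneg; lra).
    unfold reac. rewrite <- (Rmult_1_r (1 / (2 * eps ^ 2))) at 2.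
    apply Rmult_le_compat_l; [lra|].
    assert (exp (- / eps * (1 - (1 - t))) <= 1).
    { apply exp_le_1. pose proof (Rinv_0_lt_compat eps He). nra. }
    pose proof (exp_pos (- / eps * (1 - (1 - t)))).
    apply Rle_trans with (1 * 1); [|lra]. apply Rmult_le_compat; nra. }
  (* Lower bound for the quotient of the reaction by [t * (1 - t)]; its exponential factor is
     smallest at [t = 1]. *)
  set (b := 1 / (2 * eps ^ 2) * exp (- / eps)).
  assert (Hb : 0 < b) by (apply Rmult_lt_0_compat; [assumption|apply exp_pos]).
  assert (Hfb : forall t, 0 <= t <= 1 -> b * (t * (1 - t)) <= reac eps (1 - t)).
  { intros t Ht. unfold reac, b.
    replace ((1 - t) * (1 - (1 - t))) with (t * (1 - t)) by ring.
    assert (exp (- / eps) <= exp (- / eps * (1 - (1 - t)))).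
    { apply exp_mono. pose proof (Rinv_0_lt_compat eps He). nra. }
    assert (0 <= t * (1 - t)) by nra.
    rewrite Rmult_assoc, (Rmult_comm (exp (- / eps))).
    apply Rmult_le_compat_l; [lra|]. now apply Rmult_le_compat_l. }
  (* The minimum with 1 turns [a ^ 2] into at most [a], so that [a * (1 + c) <= b] yields
     [a ^ 2 + c * a <= b]. *)
  set (a := Rmin 1 (b / (1 + c))).
  assert (Ha : 0 < a) by (apply Rmin_glb_lt; [lra|apply Rdiv_lt_0_compat; lra]).
  assert (Hab : a ^ 2 + c * a <= b).
  { assert (a <= 1) by apply Rmin_l. assert (a <= b / (1 + c)) by apply Rmin_r.
    assert (a * (1 + c) <= b).
    { apply Rmult_le_reg_r with (/ (1 + c)); [apply Rinv_0_lt_compat; lra|].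
      rewrite Rmult_assoc, Rinv_r by lra. unfold Rdiv in *. lra. }
    nra. }
  (* Where this function exceeds [w], its growth is at most [a ^ 2 * (t * (1 - t))] and the drag
     [c * sqrt (2 * w)] at most [c * a * (t * (1 - t))]; the reaction pays for both. *)
  assert (Hsub : forall t, 0 <= t <= 1 -> a ^ 2 * (t * (1 - t)) ^ 2 / 2 <= w t).
  { intros t Ht. enough (a ^ 2 * (t * (1 - t)) ^ 2 / 2 - w t <= 0) by lra.
    apply (comparison (fun t => a ^ 2 * (t * (1 - t)) ^ 2 / 2 - w t)
      (fun t => a ^ 2 * (t * (1 - t)) * (1 - 2 * t) - (reac eps (1 - t) - c * sqrt (2 * w t))) 0 t); try lra.
    - intros s Hs. cont. apply Hw.
    - intros s Hs. apply (deriv_minus (fun t => a ^ 2 * (t * (1 - t)) ^ 2 / 2)).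
      + auto_derive; [easy|]. field.
      + apply Hw1. lra.
    - intros s Hs Hp'.
      assert (0 <= s * (1 - s)) by nra.
      assert (sqrt (2 * w s) <= a * (s * (1 - s))).
      { rewrite <- (sqrt_pow2 (a * (s * (1 - s)))) by nra. apply sqrt_mono. nra. }
      specialize (Hfb s ltac:(lra)).
      assert (a ^ 2 * (s * (1 - s)) * (1 - 2 * s) <= a ^ 2 * (s * (1 - s))).
      { assert (0 <= a ^ 2 * (s * (1 - s))) by (apply Rmult_le_pos; nra). nra. }
      assert (c * sqrt (2 * w s) <= c * (a * (s * (1 - s)))) by (apply Rmult_le_compat_l; lra).
      nra. }
  exists (fun th => sqrt (2 * w (1 - th))).
  split; [|split; [|split; [|intros th H; split]]].
  - intros th. cont. apply (continuous_comp (fun t => 1 - t) w); [cont|apply Hw].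
  - intros; apply sqrt_pos.
  - rewrite Rminus_diag, Hw0, Rmult_0_r. apply sqrt_0.
  - apply sqrt_lt_R0. specialize (Hsub (1 - th) ltac:(lra)).
    assert (0 < a ^ 2 * ((1 - th) * (1 - (1 - th))) ^ 2) by (apply Rmult_lt_0_compat; apply pow_lt; nra). lra.
  - assert (Hpos : 0 < w (1 - th)).
    { specialize (Hsub (1 - th) ltac:(lra)).
      assert (0 < a ^ 2 * ((1 - th) * (1 - (1 - th))) ^ 2) by (apply Rmult_lt_0_compat; apply pow_lt; nra). lra. }
    specialize (Hw1 (1 - th) ltac:(lra)). cbv beta in Hw1.
    replace (1 - (1 - th)) with th in Hw1 by ring.
    set (d := reac eps th - c * sqrt (2 * w (1 - th))) in *.
    assert (Hs := sqrt_lt_R0 (2 * w (1 - th)) ltac:(lra)).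
    deriv_as (-1 * d * (2 * / (2 * sqrt (2 * w (1 - th))))).
    + apply (deriv_comp (fun u => sqrt (2 * u)) (fun t => w (1 - t))).
      * auto_derive; [lra|]. field. lra.
      * apply (deriv_comp w (fun t => 1 - t)); [assumption|]. auto_derive; [easy|ring].
    + unfold d. field. lra.
Qed.

Section Front.
Variables (eps c : R) (S : R -> R).
Hypothesis He : 0 < eps.
Hypothesis Hc : 0 <= c.
Hypothesis HS : is_front eps c S.

Lemma front_energy_derive th : 0 < th < 1 ->
  is_derive (fun th => S th ^ 2 / 2) th (c * S th - reac eps th).
Proof.
  intros Hth. destruct HS as (_ & _ & _ & H). destruct (H th Hth) as [Hp Hd].
  deriv_as ((c - reac eps th / S th) * S th); [|field; lra].
  apply (deriv_comp (fun u => u ^ 2 / 2) S); [|assumption].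
  auto_derive; [easy|]. field.
Qed.

Lemma front_cont th : continuous S th.
Proof. apply HS. Qed.

Lemma front_1 : S 1 = 0.
Proof. apply HS. Qed.

Lemma front_energy_cont th : continuous (fun th => S th ^ 2 / 2) th.
Proof. pose proof front_cont. cont; auto. Qed.

Lemma reac_prim_cont th : continuous (reac_prim eps) th.
Proof. apply (ex_derive_continuous (reac_prim eps)). exists (reac eps th). now apply reac_prim_derive. Qed.

Lemma lay_1 : lay eps 1 = 0.
Proof. unfold lay. field. lra. Qed.

Lemma lay_neg th : th <= 1 -> lay eps th <= 0.
Proof. intros H. unfold lay. pose proof (Rinv_0_lt_compat eps He). unfold Rdiv. nra. Qed.

Lemma reac_prim_1 : reac_prim eps 1 = 1 / 2 - eps.
Proof. unfold reac_prim. rewrite lay_1, exp_0. field. Qed.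

(** As [c * S >= 0], the sum of energy and [reac_prim] is nondecreasing. The correction of order eps
    in [reac_prim] has the favourable sign and is dropped. *)
Lemma front_energy_upper th : 0 <= th <= 1 -> S th ^ 2 <= hs2 (lay eps th).
Proof.
  intros Hth.
  assert (H : S th ^ 2 / 2 + reac_prim eps th <= S 1 ^ 2 / 2 + reac_prim eps 1).
  { apply (nondecreasing_of_derive (fun th => S th ^ 2 / 2 + reac_prim eps th)
      (fun th => c * S th - reac eps th + reac eps th) th 1 ltac:(lra)).
    - intros t _. apply cont_plus; [apply front_energy_cont|apply reac_prim_cont].
    - intros t Ht. apply (deriv_plus (fun th => S th ^ 2 / 2)).
      + apply front_energy_derive. lra.
      + now apply reac_prim_derive.
    - intros t Ht. destruct HS as (_ & Hp & _). specialize (Hp t). nra. }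
  rewrite front_1, reac_prim_1 in H. unfold reac_prim in H. unfold hs2.
  destruct (quad_exp_bounds (lay eps th) (lay_neg th ltac:(lra))) as [Hq _]. nra.
Qed.

Lemma front_le_1 th : 0 <= th <= 1 -> S th <= 1.
Proof.
  intros Hth. pose proof (front_energy_upper th Hth) as H. destruct HS as (_ & Hp & _). specialize (Hp th).
  assert (hs2 (lay eps th) <= 1).
  { unfold hs2. pose proof (lay_neg th ltac:(lra)). pose proof (exp_pos (lay eps th)). nra. }
  nra.
Qed.

Lemma front_le_lay th : 0 <= th <= 1 -> S th <= - lay eps th.
Proof.
  intros Hth. pose proof (front_energy_upper th Hth) as H. destruct HS as (_ & Hp & _). specialize (Hp th).
  pose proof (lay_neg th ltac:(lra)). pose proof (hs2_le (lay eps th) ltac:(lra)). nra.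
Qed.

(** Since [S <= 1], the drag changes the energy by at most [c * (1 - th)]. The error [2 * eps] does
    not vanish at theta = 1, so this bound serves away from the tip of the layer. *)
Lemma front_energy_lower_far th : 0 <= th <= 1 ->
  hs2 (lay eps th) - 2 * eps - 2 * c * (1 - th) <= S th ^ 2.
Proof.
  intros Hth.
  assert (H : c * th - S th ^ 2 / 2 - reac_prim eps th <= c * 1 - S 1 ^ 2 / 2 - reac_prim eps 1).
  { apply (nondecreasing_of_derive (fun th => c * th - S th ^ 2 / 2 - reac_prim eps th)
      (fun th => c - (c * S th - reac eps th) - reac eps th) th 1 ltac:(lra)).
    - intros t _. apply cont_minus; [apply cont_minus; [cont|apply front_energy_cont]|apply reac_prim_cont].
    - intros t Ht. apply (deriv_minus (fun th => c * th - S th ^ 2 / 2)).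
      + apply (deriv_minus (fun th => c * th)).
        * auto_derive; [easy|ring].
        * apply front_energy_derive. lra.
      + now apply reac_prim_derive.
    - intros t Ht. pose proof (front_le_1 t ltac:(lra)). nra. }
  rewrite front_1, reac_prim_1 in H. unfold reac_prim in H. unfold hs2.
  destruct (quad_exp_bounds (lay eps th) (lay_neg th ltac:(lra))) as [Hq _]. nra.
Qed.

(** The drag is now bounded with [S <= - lay], so the errors are of second and third order in [lay]
    and remain small relative to [hs2] as theta tends to 1. *)
Lemma front_energy_lower_near th : 0 <= th <= 1 ->
  hs2 (lay eps th) - eps * (- lay eps th ^ 3 / 3) - c * eps * lay eps th ^ 2 <= S th ^ 2.
Proof.
  intros Hth.
  assert (H : - (c * eps * lay eps th ^ 2 / 2) - S th ^ 2 / 2 - reac_prim eps th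
     <= - (c * eps * lay eps 1 ^ 2 / 2) - S 1 ^ 2 / 2 - reac_prim eps 1).
  { apply (nondecreasing_of_derive (fun th => - (c * eps * lay eps th ^ 2 / 2) - S th ^ 2 / 2 - reac_prim eps th)
      (fun th => - (c * lay eps th) - (c * S th - reac eps th) - reac eps th) th 1 ltac:(lra)).
    - intros t _. apply cont_minus; [apply cont_minus; [|apply front_energy_cont]|apply reac_prim_cont].
      unfold lay. cont; lra.
    - intros t Ht. apply (deriv_minus (fun th => - (c * eps * lay eps th ^ 2 / 2) - S th ^ 2 / 2)).
      + apply (deriv_minus (fun th => - (c * eps * lay eps th ^ 2 / 2))).
        * unfold lay. auto_derive; [easy|]. field. lra.
        * apply front_energy_derive. lra.
      + now apply reac_prim_derive.
    - intros t Ht. pose proof (front_le_lay t ltac:(lra)). nra. }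
  rewrite front_1, reac_prim_1, lay_1 in H. unfold reac_prim in H. unfold hs2.
  destruct (quad_exp_bounds (lay eps th) (lay_neg th ltac:(lra))) as [_ Hq].
  apply Rmult_le_compat_l with (r := eps) in Hq; lra.
Qed.

(** Above the line of slope [P] the hypothesis gives [reac / S <= c - P], that is, a slope of at
    least [P]. Going left, [S] then falls at least as fast as the line and cannot get above it. *)
Lemma front_trap th1 P : 0 < th1 < 1 -> 0 < P ->
  (forall th, 0 < th < th1 -> reac eps th <= P * (c - P) * th) ->
  S th1 <= P * th1 ->
  forall th, 0 <= th <= th1 -> S th <= P * th.
Proof.
  intros Hth1 HP Hr H1 th Hth. enough (S th - P * th <= 0) by lra.
  apply (comparison_left (fun th => S th - P * th) (fun th => c - reac eps th / S th - P) th th1); try lra.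
  - intros t Ht. pose proof front_cont. cont. auto.
  - intros t Ht. apply (deriv_minus S (fun th => P * th)).
    + apply HS. lra.
    + auto_derive; [easy|ring].
  - intros t Ht Hp. specialize (Hr t ltac:(lra)).
    assert (0 < S t) by (apply HS; lra).
    enough (reac eps t / S t <= c - P) by lra.
    apply Rmult_le_reg_r with (S t); [assumption|].
    unfold Rdiv. rewrite Rmult_assoc, Rinv_l, Rmult_1_r by lra.
    pose proof (reac_nonneg eps t He ltac:(lra)).
    (* Forced by [0 <= reac eps t <= P * (c - P) * t]. *)
    assert (0 <= c - P). { assert (0 < P * t) by nra. nra. }
    nra.
Qed.
End Front.

Lemma front_mono eps c1 c2 S1 S2 : 0 < eps -> 0 <= c1 <= c2 ->
  is_front eps c1 S1 -> is_front eps c2 S2 ->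
  forall th, 0 <= th <= 1 -> S2 th <= S1 th.
Proof.
  intros He Hc H1 H2 th Hth.
  enough (S2 th ^ 2 / 2 - S1 th ^ 2 / 2 <= 0).
  { destruct H1 as (_ & P1 & _). destruct H2 as (_ & P2 & _). specialize (P1 th). specialize (P2 th). nra. }
  apply (comparison_left (fun th => S2 th ^ 2 / 2 - S1 th ^ 2 / 2)
    (fun th => (c2 * S2 th - reac eps th) - (c1 * S1 th - reac eps th)) th 1); try lra.
  - intros t _. apply cont_minus; eapply front_energy_cont; eassumption.
  - intros t Ht. apply (deriv_minus (fun th => S2 th ^ 2 / 2));
      apply front_energy_derive; trivial; lra.
  - rewrite (front_1 eps c1 S1 H1), (front_1 eps c2 S2 H2). lra.
  - intros t Ht Hp. destruct H1 as (_ & P1 & _). destruct H2 as (_ & P2 & _).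
    specialize (P1 t). specialize (P2 t). assert (S1 t <= S2 t) by nra. nra.
Qed.

(** Where [S1 >= S2], the difference of energies has derivative at least [- (c2 - c1) * S2], and
    [S2 <= 1]. The squares of fronts are therefore Lipschitz in the speed, up to both ends. *)
Lemma front_cont_speed eps c1 c2 S1 S2 : 0 < eps -> 0 <= c1 <= c2 ->
  is_front eps c1 S1 -> is_front eps c2 S2 ->
  forall th, 0 <= th <= 1 -> S1 th ^ 2 - S2 th ^ 2 <= 2 * (c2 - c1).
Proof.
  intros He Hc H1 H2 th Hth.
  enough (S1 th ^ 2 / 2 - S2 th ^ 2 / 2 - (c2 - c1) * (1 - th) <= 0) by nra.
  apply (comparison_left (fun th => S1 th ^ 2 / 2 - S2 th ^ 2 / 2 - (c2 - c1) * (1 - th))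
    (fun th => (c1 * S1 th - reac eps th) - (c2 * S2 th - reac eps th) + (c2 - c1)) th 1); try lra.
  - intros t _. apply cont_minus; [apply cont_minus; eapply front_energy_cont; eassumption|cont].
  - intros t Ht. replace (c1 * S1 t - reac eps t - (c2 * S2 t - reac eps t) + (c2 - c1))
      with (c1 * S1 t - reac eps t - (c2 * S2 t - reac eps t) - (- (c2 - c1))) by ring.
    apply (deriv_minus (fun th => S1 th ^ 2 / 2 - S2 th ^ 2 / 2)).
    + apply (deriv_minus (fun th => S1 th ^ 2 / 2));
      apply front_energy_derive; trivial; lra.
    + auto_derive; [easy|ring].
  - rewrite (front_1 eps c1 S1 H1), (front_1 eps c2 S2 H2). lra.
  - intros t Ht Hp. pose proof (front_le_1 eps c2 S2 He ltac:(lra) H2 t ltac:(lra)).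
    destruct H1 as (_ & P1 & _). destruct H2 as (_ & P2 & _).
    specialize (P1 t). specialize (P2 t).
    assert (0 <= (c2 - c1) * (1 - t)) by nra. assert (S2 t <= S1 t) by nra. nra.
Qed.

(** * The threshold speed *)

(** One explicit size at which all numerical inequalities below hold; the bound [3000000 <= a] in
    [hs2_far] nearly exhausts it. *)
Definition e0 : R := / 10 ^ 8.

Lemma e0_pos : 0 < e0.
Proof. unfold e0. lra. Qed.

(** By [front_mono] at equal speeds, the values on [0,1] do not depend on the choice. *)
Definition front (eps c : R) : R -> R := epsilon (inhabits (fun _ : R => 0)) (is_front eps c).

Lemma front_spec eps c : 0 < eps -> 0 <= c -> is_front eps c (front eps c).
Proof. intros He Hc. apply (epsilon_spec (inhabits (fun _ : R => 0)) (is_front eps c)). now apply front_exists. Qed.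

(** At distance [1 / 32] from theta = 1 the cubic decay of the exponential leaves
    [27 / 2 * 32 ^ 2 * eps] times theta. *)
Lemma reac_small eps th : 0 < eps <= e0 -> 0 <= th <= 31 / 32 -> reac eps th <= th / 100.
Proof.
  intros He Hth. unfold e0 in He.
  assert (H1 : exp (- / eps * (1 - th)) <= 27 / (/ eps * (1 - th)) ^ 3).
  { replace (- / eps * (1 - th)) with (- (/ eps * (1 - th))) by ring. apply exp_neg_cube.
    apply Rmult_lt_0_compat; [apply Rinv_0_lt_compat|]; lra. }
  unfold reac.
  apply Rle_trans with (1 / (2 * eps ^ 2) * (th * (1 - th) * (27 / (/ eps * (1 - th)) ^ 3))).
  { apply Rmult_le_compat_l; [|apply Rmult_le_compat_l; [nra|assumption]].
    left. apply Rdiv_lt_0_compat; [lra|]. pose proof (pow_lt eps 2). lra. }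
  replace (1 / (2 * eps ^ 2) * (th * (1 - th) * (27 / (/ eps * (1 - th)) ^ 3)))
    with (th * (27 / 2 * eps * (/ (1 - th)) ^ 2)) by (field; lra).
  assert (/ (1 - th) <= 32).
  { replace 32 with (/ (1 / 32)) by field. apply Rinv_le_contravar; lra. }
  assert (0 < / (1 - th)) by (apply Rinv_0_lt_compat; lra).
  assert ((/ (1 - th)) ^ 2 <= 32 ^ 2) by (apply pow_incr; lra).
  unfold Rdiv. apply Rmult_le_compat_l; [lra|]. nra.
Qed.

Lemma hs2_far eps th : 0 < eps <= e0 -> th = 31 / 32 -> 99 / 100 <= hs2 (lay eps th).
Proof.
  intros He ->. unfold e0 in He. unfold hs2, lay.
  set (a := 1 / 32 / eps).
  replace ((31 / 32 - 1) / eps) with (- a) by (unfold a; field; lra).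
  assert (Ha : 3000000 <= a).
  { unfold a. apply Rmult_le_reg_r with eps; [lra|]. unfold Rdiv. rewrite Rmult_assoc, Rinv_l by lra. lra. }
  assert (H := exp_neg_cube a ltac:(lra)).
  assert (H2 : (a + 1) * exp (- a) <= (a + 1) * (27 / a ^ 3)) by (apply Rmult_le_compat_l; lra).
  assert (H3 : (a + 1) * (27 / a ^ 3) <= 1 / 100).
  { apply Rmult_le_reg_r with (a ^ 3); [apply pow_lt; lra|].
    replace ((a + 1) * (27 / a ^ 3) * a ^ 3) with (27 * (a + 1)) by (field; lra). nra. }
  lra.
Qed.

Section Threshold.
Variable eps : R.
Hypothesis He : 0 < eps <= e0.

Let He' : 0 < eps. Proof. lra. Qed.
Let T := 31 / 32.

Lemma front_vanish_of_trap c th1 : 0 <= c -> 0 < th1 <= T -> forall P, 0 < P < c -> 1 / 100 <= P * (c - P) ->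
  front eps c th1 <= P * th1 -> front eps c 0 = 0.
Proof.
  intros Hc Hth1 P HP HPc H1. pose proof (front_spec eps c He' Hc) as HF.
  assert (H := front_trap eps c (front eps c) He' HF th1 P ltac:(unfold T in *; lra) ltac:(lra)).
  specialize (H ltac:(intros th Hth; pose proof (reac_small eps th He ltac:(unfold T in *; lra)); nra) H1 0 ltac:(lra)).
  destruct HF as (_ & Hp & _). specialize (Hp 0). lra.
Qed.

(** The cap makes the set bounded; at speed 2 the front already vanishes at 0. *)
Definition slow_speed (c : R) : Prop := 0 <= c <= 2 /\ 0 < front eps c 0.

Lemma slow_speed_0 : slow_speed 0.
Proof.
  split; [lra|].
  pose proof (front_spec eps 0 He' ltac:(lra)) as HF.
  assert (H := front_energy_lower_far eps 0 (front eps 0) He' ltac:(lra) HF 0 ltac:(lra)).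
  assert (Hh : 99 / 100 <= hs2 (lay eps 0)).
  { apply Rle_trans with (1 := hs2_far eps (31 / 32) He eq_refl). apply hs2_antitone. split.
    - unfold lay, Rdiv. pose proof (Rinv_0_lt_compat eps He'). nra.
    - apply lay_neg; lra. }
  unfold e0 in He. destruct HF as (_ & Hp & _). specialize (Hp 0). nra.
Qed.

Lemma front_2_vanish : front eps 2 0 = 0.
Proof.
  (* [32 / 31] is the reciprocal of [T], so [S <= 1] alone puts the front below the line at [T]. *)
  apply (front_vanish_of_trap 2 T ltac:(lra) ltac:(unfold T; lra) (32 / 31) ltac:(lra) ltac:(lra)).
  pose proof (front_le_1 eps 2 (front eps 2) He' ltac:(lra) (front_spec eps 2 He' ltac:(lra)) T ltac:(unfold T; lra)).
  unfold T in *. lra.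
Qed.

Lemma front_T_ge c : 0 <= c <= 2 -> 84 / 100 <= front eps c T ^ 2.
Proof.
  intros Hc. pose proof (front_spec eps c He' ltac:(lra)) as HF.
  assert (H := front_energy_lower_far eps c (front eps c) He' ltac:(lra) HF T ltac:(unfold T; lra)).
  pose proof (hs2_far eps T He eq_refl). unfold e0 in He. unfold T in *. nra.
Qed.

(** Mean value theorem from the origin: the slope of the front is [c] minus a positive quotient. *)
Lemma front_below_line c : 0 <= c -> front eps c 0 = 0 ->
  forall th, 0 < th < 1 -> front eps c th < c * th.
Proof.
  intros Hc H0 th Hth. pose proof (front_spec eps c He' Hc) as HF.
  destruct (mvt_open (fun th => front eps c th - c * th) (fun th => c - reac eps th / front eps c th - c) 0 th) as [xi [Hxi E]].
  - lra.
  - intros t Ht. cont. apply HF.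
  - intros t Ht. apply (deriv_minus (front eps c) (fun th => c * th)); [apply HF; lra|].
    auto_derive; [easy|ring].
  - assert (0 < front eps c xi) by (apply HF; lra).
    assert (0 < reac eps xi) by (apply reac_pos; lra).
    assert (0 < reac eps xi / front eps c xi) by (apply Rdiv_lt_0_compat; lra).
    rewrite H0 in E. nra.
Qed.

(** Supremum of the slow speeds. Monotonicity gives positivity below it, and a positive value at the
    supremum would persist at a slightly larger speed. The lower bound [9 / 10] combines
    [front_T_ge] with [front_below_line]. *)
Lemma threshold_exists : exists c,
  9 / 10 <= c <= 2 /\ front eps c 0 = 0 /\ (forall c', 0 <= c' < c -> 0 < front eps c' 0).
Proof.
  destruct (completeness slow_speed) as [c [Hub Hlub]].
  { exists 2. intros c [? _]. lra. }
  { exists 0. apply slow_speed_0. }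
  assert (Hc0 : 0 <= c) by (apply Hub, slow_speed_0).
  assert (Hc2 : c <= 2) by (apply Hlub; intros x [? _]; lra).
  assert (Hlow : forall c', 0 <= c' < c -> 0 < front eps c' 0).
  { intros c' Hc'. destruct (Rlt_le_dec 0 (front eps c' 0)) as [|Hle]; [assumption|exfalso].
    assert (c <= c').
    { apply Hlub. intros x [Hx Hx0]. destruct (Rle_lt_dec x c') as [|Hlt]; [assumption|exfalso].
      pose proof (front_mono eps c' x (front eps c') (front eps x) He' ltac:(lra)
        (front_spec eps c' He' ltac:(lra)) (front_spec eps x He' ltac:(lra)) 0 ltac:(lra)). lra. }
    lra. }
  assert (Hz : front eps c 0 = 0).
  { destruct Hc2 as [Hc2| ->]; [|apply front_2_vanish].
    pose proof (front_spec eps c He' Hc0) as HF.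
    assert (Hn : 0 <= front eps c 0) by apply HF.
    destruct Hn as [Hn|Hn]; [exfalso|lra].
    (* Raising the speed by a quarter of the square lowers that square by at most one half. *)
    set (c' := Rmin 2 (c + (front eps c 0) ^ 2 / 4)).
    assert (Hsq : 0 < front eps c 0 ^ 2) by (apply pow_lt; lra).
    assert (Hc' : c < c' <= 2) by (unfold c', Rmin; destruct Rle_dec; lra).
    assert (c' <= c + (front eps c 0) ^ 2 / 4) by apply Rmin_r.
    pose proof (front_spec eps c' He' ltac:(lra)) as HF'.
    pose proof (front_cont_speed eps c c' (front eps c) (front eps c') He' ltac:(lra) HF HF' 0 ltac:(lra)).
    assert (c' <= c).
    { apply Hub. split; [lra|]. assert (0 <= front eps c' 0) by apply HF'. nra. }
    lra. }
  exists c. split; [|split; assumption]. split; [|assumption].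
  pose proof (front_T_ge c ltac:(lra)).
  pose proof (front_below_line c Hc0 Hz T ltac:(unfold T; lra)).
  assert (0 <= front eps c T) by (apply front_spec; lra).
  unfold T in *. nra.
Qed.
End Threshold.

Definition cb (eps : R) : R :=
  epsilon (inhabits 0) (fun c => 9 / 10 <= c <= 2 /\ front eps c 0 = 0 /\
    (forall c', 0 <= c' < c -> 0 < front eps c' 0)).

Lemma cb_spec eps : 0 < eps <= e0 ->
  9 / 10 <= cb eps <= 2 /\ front eps (cb eps) 0 = 0 /\
  (forall c', 0 <= c' < cb eps -> 0 < front eps c' 0).
Proof. intros He. unfold cb. apply (epsilon_spec (inhabits 0) (fun c => 9 / 10 <= c <= 2 /\ front eps c 0 = 0 /\ (forall c', 0 <= c' < c -> 0 < front eps c' 0))). now apply threshold_exists. Qed.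

(* The threshold front never enters the region where slightly slower fronts would be trapped below a line through the origin. *)
Lemma strong_front_lower eps th : 0 < eps <= e0 -> 0 < th <= 31 / 32 ->
  cb eps / 2 * th <= front eps (cb eps) th.
Proof.
  intros He Hth. destruct (cb_spec eps He) as [Hc [H0 Hlow]]. set (c := cb eps) in *.
  destruct (Rle_lt_dec (c / 2 * th) (front eps c th)) as [|Hlt]; [assumption|exfalso].
  pose proof (front_spec eps c ltac:(lra) ltac:(lra)) as HF.
  assert (Hn : 0 <= front eps c th) by apply HF.
  set (g := (c / 2 * th) ^ 2 - front eps c th ^ 2).
  assert (Hg : 0 < g) by (unfold g; nra).
  (* Slowing down by [eta] raises the squared front by at most [2 * eta] and lowers the square of
     the line of half slope by at most [eta]; [3 * eta < g] keeps the slower front below its own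
     line. *)
  set (eta := Rmin (g / 4) (1 / 2)).
  assert (Heta : 0 < eta <= 1 / 2) by (unfold eta, Rmin; destruct Rle_dec; lra).
  assert (Heta' : eta <= g / 4) by apply Rmin_l.
  pose proof (front_spec eps (c - eta) ltac:(lra) ltac:(lra)) as HF'.
  pose proof (front_cont_speed eps (c - eta) c (front eps (c - eta)) (front eps c) ltac:(lra) ltac:(lra) HF' HF th ltac:(lra)) as Hs.
  assert (Hn' : 0 <= front eps (c - eta) th) by apply HF'.
  assert (front eps (c - eta) 0 = 0).
  { apply (front_vanish_of_trap eps He (c - eta) th ltac:(lra) ltac:(lra) ((c - eta) / 2)); [lra|nra|].
    assert (front eps (c - eta) th ^ 2 <= ((c - eta) / 2 * th) ^ 2); [|apply le_of_sq_le; [|assumption]; apply Rmult_le_pos; lra].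
    assert ((c / 2 * th) ^ 2 - ((c - eta) / 2 * th) ^ 2 <= eta).
    { replace ((c / 2 * th) ^ 2 - ((c - eta) / 2 * th) ^ 2) with (th ^ 2 * (eta * (2 * c - eta) / 4)) by field.
      assert (th ^ 2 <= 1) by nra. assert (0 <= eta * (2 * c - eta) / 4 <= eta) by nra. nra. }
    unfold g in *. lra. }
  specialize (Hlow (c - eta) ltac:(lra)). lra.
Qed.

(** The near energy bound serves for [lay >= -1], the far one otherwise: there [24 / 100], less at
    most [4 / 32] and a multiple of [eps], still exceeds [1 / 9]. *)
Lemma strong_front_lower_layer eps th : 0 < eps <= e0 -> 31 / 32 <= th <= 1 ->
  Rmin 1 (- lay eps th) / 3 <= front eps (cb eps) th.
Proof.
  intros He Hth. destruct (cb_spec eps He) as [Hc _]. set (c := cb eps) in *.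
  pose proof (front_spec eps c ltac:(lra) ltac:(lra)) as HF.
  assert (Hn : 0 <= front eps c th) by apply HF.
  pose proof (lay_neg eps ltac:(lra) th ltac:(lra)) as HX.
  pose proof (front_energy_lower_far eps c _ ltac:(lra) ltac:(lra) HF th ltac:(lra)) as Hf.
  pose proof (front_energy_lower_near eps c _ ltac:(lra) ltac:(lra) HF th ltac:(lra)) as Hnr.
  unfold e0 in He. set (x := lay eps th) in *.
  destruct (Rle_lt_dec (-1) x) as [H1|H1].
  - rewrite Rmin_right by lra. pose proof (hs2_ge_quad x ltac:(lra)) as Hq.
    assert (- x ^ 3 / 3 <= x ^ 2 / 3) by nra.
    assert (x ^ 2 / 9 <= front eps c th ^ 2).
    { assert (0 <= x ^ 2) by nra. assert (eps * (- x ^ 3 / 3) <= eps * (x ^ 2 / 3)) by (apply Rmult_le_compat_l; lra).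
      assert (c * eps * x ^ 2 <= 2 * eps * x ^ 2) by (apply Rmult_le_compat_r; nra). nra. }
    nra.
  - rewrite Rmin_left by lra. pose proof (hs2_ge_far x ltac:(lra)).
    assert (1 / 9 <= front eps c th ^ 2) by nra. nra.
Qed.

(** This is [a / 2 <= sinh (a / 2)]. It trades the factor [- x] of [- x * exp x] for [1 - exp x], at
    the price of half the exponential rate. *)
Lemma sinh_ge (a : R) : 0 <= a -> a * exp (- a / 2) <= 1 - exp (- a).
Proof.
  intros Ha.
  enough (a <= exp (a / 2) - exp (- a / 2)).
  { assert (E1 : exp (a / 2) * exp (- a / 2) = 1).
    { rewrite <- exp_plus. replace (a / 2 + - a / 2) with 0 by field. apply exp_0. }
    assert (E2 : exp (- a) = exp (- a / 2) * exp (- a / 2)).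
    { rewrite <- exp_plus. f_equal. field. }
    pose proof (exp_pos (- a / 2)). rewrite E2. nra. }
  assert (H := nondecreasing_of_derive (fun a => exp (a / 2) - exp (- a / 2) - a)
    (fun a => (exp (a / 2) + exp (- a / 2)) / 2 - 1) 0 a Ha).
  cbv beta in H. replace (exp (0 / 2) - exp (- 0 / 2) - 0) with 0 in H.
  2:{ replace (0 / 2) with 0 by field. replace (- 0 / 2) with 0 by field. ring. }
  enough (0 <= exp (a / 2) - exp (- a / 2) - a) by lra. apply H.
  - intros t _. cont.
  - intros t _. auto_derive; [easy|]. unfold Rdiv. ring_simplify. field.
  - intros t Ht.
    assert (E1 : exp (t / 2) * exp (- t / 2) = 1).
    { rewrite <- exp_plus. replace (t / 2 + - t / 2) with 0 by field. apply exp_0. }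
    pose proof (exp_pos (t / 2)). pose proof (exp_pos (- t / 2)).
    pose proof (Rle_0_sqr (exp (t / 2) - exp (- t / 2))). unfold Rsqr in *. nra.
Qed.

(** Convexity of sinh on the positive axis, obtained by differentiating in [b], since
    [cosh (t * b) <= cosh b]. *)
Lemma sinh_convex (t b : R) : 0 <= t <= 1 -> 0 <= b ->
  exp (t * b) - exp (- (t * b)) <= t * (exp b - exp (- b)).
Proof.
  intros Ht Hb.
  assert (H := nondecreasing_of_derive (fun b => t * (exp b - exp (- b)) - (exp (t * b) - exp (- (t * b))))
    (fun b => t * ((exp b + exp (- b)) - (exp (t * b) + exp (- (t * b))))) 0 b Hb).
  cbv beta in H. rewrite Rmult_0_r, Ropp_0, exp_0 in H.
  enough (t * (1 - 1) - (1 - 1) <= t * (exp b - exp (- b)) - (exp (t * b) - exp (- (t * b)))) by lra.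
  apply H.
  - intros s _. cont.
  - intros s _. auto_derive; [easy|]. ring.
  - intros s Hs. apply Rmult_le_pos; [lra|].
    assert (exp (t * s) <= exp s) by (apply exp_mono; nra).
    assert (exp (- s - t * s) <= 1) by (apply exp_le_1; nra).
    assert (E1 : exp (- s) = exp (t * s) * exp (- s - t * s)) by (rewrite <- exp_plus; f_equal; ring).
    assert (E2 : exp (- (t * s)) = exp s * exp (- s - t * s)) by (rewrite <- exp_plus; f_equal; ring).
    rewrite E1, E2. pose proof (exp_pos (t * s)). nra.
Qed.

(* The weight [exp (k x / 2)] dominates the average over [-1/eps, x] of [k exp (k x) / eps]. *)
Lemma avg_exp (k eps th : R) : 0 < k -> 0 < eps -> 0 <= th <= 1 ->
  exp (k * lay eps th) - exp (- (k / eps)) <= th * exp (k * lay eps th / 2).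
Proof.
  intros Hk He Hth. set (b := k / eps / 2).
  assert (Hb : 0 <= b) by (unfold b; left; apply Rdiv_lt_0_compat; [now apply Rdiv_lt_0_compat|lra]).
  assert (H := sinh_convex th b Hth Hb).
  set (w := exp (k * lay eps th / 2)).
  assert (Ew : w = exp (- b) * exp (th * b)).
  { unfold w. rewrite <- exp_plus. f_equal. unfold lay, b. field. lra. }
  assert (E1 : exp (k * lay eps th) = w * w).
  { unfold w. rewrite <- exp_plus. f_equal. field. }
  assert (E2 : exp (- (k / eps)) = w * (exp (- b) * exp (- (th * b)))).
  { rewrite Ew, <- !exp_plus. f_equal. unfold b. field. lra. }
  rewrite E1, E2. assert (Hw : 0 < w) by apply exp_pos.
  enough (w - exp (- b) * exp (- (th * b)) <= th) by nra.
  rewrite Ew.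
  assert (E3 : exp (- b) * exp b = 1) by (rewrite <- exp_plus, Rplus_opp_l; apply exp_0).
  pose proof (exp_pos (- b)). apply Rmult_le_compat_l with (r := exp (- b)) in H; [|lra].
  assert (0 <= exp (- b) * exp (- b)) by nra. nra.
Qed.

Section StrongFront.
Variable eps : R.
Hypothesis He : 0 < eps <= e0.
Let c := cb eps.
Let S := front eps c.

Lemma cb_bounds : 9 / 10 <= c <= 2.
Proof. apply cb_spec, He. Qed.

Lemma strong_is_front : is_front eps c S.
Proof. apply front_spec; [lra|]. pose proof cb_bounds. lra. Qed.

Lemma one_minus_exp_le x : 1 - exp x <= Rmin 1 (- x).
Proof. apply Rmin_glb; [pose proof (exp_pos x)|pose proof (exp_ineq1_le x)]; lra. Qed.

(** Joins the bounds in the interior and in the layer into one weight with simple zeros at both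
    ends. *)
Lemma strong_lower th : 0 < th <= 1 -> th * (1 - exp (lay eps th)) / 3 <= S th.
Proof.
  intros Hth. pose proof cb_bounds.
  pose proof (one_minus_exp_le (lay eps th)) as H1.
  pose proof (exp_le_1 (lay eps th) (lay_neg eps ltac:(lra) th ltac:(lra))) as H2.
  destruct (Rle_lt_dec th (31 / 32)) as [Hle|Hlt].
  - pose proof (strong_front_lower eps th He ltac:(lra)). fold c S in H0.
    pose proof (Rmin_l 1 (- lay eps th)). nra.
  - pose proof (strong_front_lower_layer eps th He ltac:(lra)). fold c S in H0. nra.
Qed.

Lemma one_minus_exp_ge x : -1 <= x <= 0 -> - x / 3 <= 1 - exp x.
Proof.
  intros Hx. pose proof (exp_mono (-1) x ltac:(lra)). pose proof exp_m1_ge.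
  assert (1 + - x <= exp (- x)) by apply exp_ineq1_le.
  assert (E : exp x * exp (- x) = 1) by (rewrite <- exp_plus, Rplus_opp_r; apply exp_0). nra.
Qed.

Lemma strong_below th : 0 <= th <= 1 -> S th <= c * th.
Proof.
  intros Hth. pose proof cb_bounds.
  destruct (cb_spec eps He) as [_ [H0 _]].
  destruct (Req_dec th 0) as [->|Hn]; [unfold S; fold c in H0; lra|].
  destruct (Req_dec th 1) as [->|Hn1].
  { pose proof (front_1 eps c S strong_is_front). lra. }
  left. unfold S. apply (front_below_line eps He c); [lra|assumption|lra].
Qed.

Lemma strong_upper th : 0 < th <= 1 -> S th <= 4 * (1 - exp (lay eps th)) * th.
Proof.
  intros Hth. pose proof cb_bounds.
  destruct (Rle_lt_dec (lay eps th) (-1)) as [H1|H1].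
  - pose proof (strong_below th ltac:(lra)). pose proof exp_m1_le.
    pose proof (exp_mono (lay eps th) (-1) H1). nra.
  - pose proof (lay_neg eps ltac:(lra) th ltac:(lra)) as H2.
    pose proof (front_le_lay eps c S ltac:(lra) ltac:(lra) strong_is_front th ltac:(lra)).
    pose proof (one_minus_exp_ge (lay eps th) ltac:(lra)).
    assert (1 - eps <= th).
    { unfold lay in H1. apply Rmult_lt_compat_r with (r := eps) in H1; [|lra].
      unfold Rdiv in H1. rewrite Rmult_assoc, Rinv_l in H1 by lra. lra. }
    unfold e0 in He. nra.
Qed.

(** In the layer variable the reaction is [th * (- x) * exp x / (2 * eps)]. The lower bound for [S]
    cancels [th], and [sinh_ge] cancels [- x] against [1 - exp x]. *)
Lemma strong_reac_ratio th : 0 < th < 1 ->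
  0 < reac eps th / S th <= 3 / (2 * eps) * exp (lay eps th / 2).
Proof.
  intros Hth.
  assert (HSp : 0 < S th) by (apply strong_is_front; lra).
  split; [apply Rdiv_lt_0_compat; [apply reac_pos; lra|assumption]|].
  apply Rmult_le_reg_r with (S th); [assumption|].
  unfold Rdiv at 1. rewrite Rmult_assoc, Rinv_l, Rmult_1_r by lra.
  set (x := lay eps th).
  assert (Er : reac eps th = 1 / (2 * eps) * th * (- x) * exp x).
  { unfold reac, x, lay. replace (- / eps * (1 - th)) with ((th - 1) / eps) by (field; lra). field. lra. }
  assert (Hx : x <= 0) by (apply lay_neg; lra).
  assert (Hs := sinh_ge (- x) ltac:(lra)).
  rewrite !Ropp_involutive in Hs.
  assert (Hl := strong_lower th ltac:(lra)). fold x in Hl.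
  apply Rle_trans with (3 / (2 * eps) * exp (x / 2) * (th * (1 - exp x) / 3)).
  2:{ apply Rmult_le_compat_l; [|assumption]. apply Rmult_le_pos; [|left; apply exp_pos].
      left; apply Rdiv_lt_0_compat; lra. }
  rewrite Er.
  replace (3 / (2 * eps) * exp (x / 2) * (th * (1 - exp x) / 3))
    with (1 / (2 * eps) * th * exp (x / 2) * (1 - exp x)) by (field; lra).
  assert (0 < 1 / (2 * eps) * th).
  { apply Rmult_lt_0_compat; [apply Rdiv_lt_0_compat|]; lra. }
  assert (E : exp x = exp (x / 2) * exp (x / 2)) by (rewrite <- exp_plus; f_equal; field).
  rewrite E at 1. rewrite !Rmult_assoc. rewrite <- Rmult_assoc.
  rewrite <- (Rmult_assoc (1 / (2 * eps))).
  apply Rmult_le_compat_l; [lra|].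
  pose proof (exp_pos (x / 2)). nra.
Qed.

(** Integrate [reac / S] from the origin, where [c * th - S] vanishes. Keeping the boundary term
    [exp (lay eps 0 / 2)] lets [avg_exp] extract the factor [th], by which the estimate is later
    divided. *)
Lemma strong_defect th : 0 < th <= 1 -> 0 <= c * th - S th <= 3 * th * exp (lay eps th / 4).
Proof.
  intros Hth. split; [pose proof (strong_below th ltac:(lra)); lra|].
  assert (H := nondecreasing_of_derive (fun th => 3 * exp (lay eps th / 2) - (c * th - S th))
    (fun th => 3 / (2 * eps) * exp (lay eps th / 2) - (c - (c - reac eps th / S th))) 0 th ltac:(lra)).
  cbv beta in H.
  assert (H0 : S 0 = 0) by apply (cb_spec eps He).
  assert (Ha := avg_exp (1 / 2) eps th ltac:(lra) ltac:(lra) ltac:(lra)).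
  assert (3 * exp (lay eps 0 / 2) - (c * 0 - S 0) <= 3 * exp (lay eps th / 2) - (c * th - S th)).
  { apply H.
    - intros t Ht. unfold lay. cont. apply strong_is_front.
    - intros t Ht. apply (deriv_minus (fun th => 3 * exp (lay eps th / 2))).
      + unfold lay. auto_derive; [easy|]. field_simplify; [|lra..].
        replace ((t + - (1)) * / eps * / 2) with ((t - 1) / eps / 2) by (field; lra). field. lra.
      + apply (deriv_minus (fun th => c * th) S).
        * auto_derive; [easy|ring].
        * apply strong_is_front. lra.
    - intros t Ht. destruct (strong_reac_ratio t ltac:(lra)). lra. }
  replace (1 / 2 * lay eps th) with (lay eps th / 2) in Ha by field.
  replace (- (1 / 2 / eps)) with (lay eps 0 / 2) in Ha by (unfold lay; field; lra).
  replace (lay eps th / 2 / 2) with (lay eps th / 4) in Ha by field.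
  rewrite H0 in H1. nra.
Qed.
End StrongFront.

(** * The threshold front in logarithmic coordinates *)

(** Freezing the coordinate for [y >= 0] keeps theta in (0,1] and makes all functions of [y]
    continuous on the line. *)
Definition thy (eps y : R) : R := exp (eps * Rmin y 0).
Definition X (eps y : R) : R := lay eps (thy eps y).
(** Model for the size of the profile: a simple zero at [y = 0] and a value close to 1 outside the
    layer. *)
Definition tau (eps y : R) : R := 1 - exp (X eps y).
Definition prof (eps y : R) : R := front eps (cb eps) (thy eps y) / thy eps y.
Definition forc (eps y : R) : R := X eps y * exp (X eps y).

Lemma thy_bounds eps y : 0 < eps -> 0 < thy eps y <= 1.
Proof.
  intros He. split; [apply exp_pos|]. apply exp_le_1. pose proof (Rmin_r y 0). nra.
Qed.

Lemma thy_lt_1 eps y : 0 < eps -> y < 0 -> thy eps y < 1.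
Proof. intros He Hy. unfold thy. rewrite Rmin_left by lra. rewrite <- exp_0. apply exp_increasing. nra. Qed.

Lemma X_le_0 eps y : 0 < eps -> X eps y <= 0.
Proof. intros He. apply lay_neg; [lra|]. apply thy_bounds, He. Qed.

Lemma X_neg eps y : 0 < eps -> y < 0 -> X eps y < 0.
Proof.
  intros He Hy. unfold X, lay. pose proof (thy_lt_1 eps y He Hy). pose proof (Rinv_0_lt_compat eps He).
  unfold Rdiv. nra.
Qed.

Lemma X_thy eps y : 0 < eps -> thy eps y = 1 + eps * X eps y.
Proof. intros He. unfold X, lay. field. lra. Qed.

Lemma X_ge eps y : 0 < eps -> y <= 0 -> y <= X eps y.
Proof.
  intros He Hy. unfold X, lay, thy. rewrite Rmin_left by lra.
  apply Rmult_le_reg_r with eps; [assumption|].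
  unfold Rdiv. rewrite Rmult_assoc, Rinv_l by lra. pose proof (exp_ineq1_le (eps * y)). lra.
Qed.

Lemma X_le_lin eps y : 0 < eps -> y <= 0 -> X eps y <= y * thy eps y.
Proof.
  intros He Hy. unfold X, lay, thy. rewrite Rmin_left by lra.
  apply Rmult_le_reg_r with eps; [assumption|].
  unfold Rdiv. rewrite Rmult_assoc, Rinv_l by lra. pose proof (exp_ineq1_le (- (eps * y))).
  assert (E : exp (eps * y) * exp (- (eps * y)) = 1) by (rewrite <- exp_plus, Rplus_opp_r; apply exp_0).
  pose proof (exp_pos (eps * y)). nra.
Qed.

Lemma thy_deriv eps y : y < 0 -> is_derive (thy eps) y (eps * thy eps y).
Proof.
  intros Hy. apply (is_derive_ext_loc (fun y => exp (eps * y))).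
  - assert (H : locally y (fun y => y < 0)) by now apply open_lt.
    revert H. apply filter_imp. intros t Ht. unfold thy. rewrite Rmin_left by lra. easy.
  - unfold thy. rewrite Rmin_left by lra. auto_derive; [easy|]. ring.
Qed.

Lemma thy_cont eps y : continuous (thy eps) y.
Proof. unfold thy. cont. Qed.

Lemma X_cont eps y : continuous (X eps) y.
Proof.
  apply (continuous_comp (thy eps) (lay eps)); [apply thy_cont|].
  apply (ex_derive_continuous (lay eps)). unfold lay. auto_derive. easy.
Qed.

Lemma X_deriv eps y : 0 < eps -> y < 0 -> is_derive (X eps) y (thy eps y).
Proof.
  intros He Hy. deriv_as (eps * thy eps y * / eps); [|field; lra].
  apply (deriv_comp (lay eps) (thy eps)); [|now apply thy_deriv].
  unfold lay. auto_derive; [easy|]. ring.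
Qed.

Lemma tau_bounds eps y : 0 < eps -> 0 <= tau eps y <= 1.
Proof.
  intros He. unfold tau. pose proof (exp_pos (X eps y)). pose proof (exp_le_1 _ (X_le_0 eps y He)). lra.
Qed.

Lemma tau_pos eps y : 0 < eps -> y < 0 -> 0 < tau eps y.
Proof.
  intros He Hy. unfold tau.
  pose proof (exp_increasing _ _ (X_neg eps y He Hy)). rewrite exp_0 in *. lra.
Qed.

Lemma tau_le eps y : 0 < eps -> y <= 0 -> tau eps y <= - y.
Proof.
  intros He Hy. unfold tau. pose proof (exp_ineq1_le (X eps y)). pose proof (X_ge eps y He Hy). lra.
Qed.

Lemma tau_anti eps y y' : 0 < eps -> y <= y' -> tau eps y' <= tau eps y.
Proof.
  intros He Hy. unfold tau. enough (exp (X eps y) <= exp (X eps y')) by lra. apply exp_mono.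
  unfold X, lay. apply Rmult_le_compat_r; [left; now apply Rinv_0_lt_compat|].
  enough (thy eps y <= thy eps y') by lra. apply exp_mono. apply Rmult_le_compat_l; [lra|].
  now apply Rle_min_compat_r.
Qed.

(* The second bound on [eps] keeps [exp (- eps)] near 1. *)
Lemma tau_ge_near eps y : 0 < eps <= e0 -> -1 <= y <= 0 -> - y / 4 <= tau eps y.
Proof.
  intros He Hy.
  pose proof (X_ge eps y ltac:(lra) ltac:(lra)). pose proof (X_le_0 eps y ltac:(lra)).
  pose proof (one_minus_exp_ge (X eps y) ltac:(lra)).
  pose proof (X_le_lin eps y ltac:(lra) ltac:(lra)).
  assert (9 / 10 <= thy eps y).
  { unfold thy. rewrite Rmin_left by lra. pose proof (exp_ineq1_le (eps * y)). unfold e0 in He. nra. }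
  unfold tau. nra.
Qed.

Lemma tau_ge_far eps y : 0 < eps <= e0 -> y <= -1 -> 1 / 2 <= tau eps y.
Proof.
  intros He Hy. apply Rle_trans with (tau eps (-1)); [|apply tau_anti; lra].
  unfold tau.
  assert (9 / 10 <= thy eps (-1)).
  { unfold thy. rewrite Rmin_left by lra. pose proof (exp_ineq1_le (eps * -1)). unfold e0 in He. nra. }
  pose proof (X_le_lin eps (-1) ltac:(lra) ltac:(lra)).
  assert (exp (X eps (-1)) <= exp (1 / 10 + -1)) by (apply exp_mono; lra).
  rewrite exp_plus in *. pose proof exp_m1_le. pose proof (exp_pos (-1)).
  assert (exp (1 / 10) <= 10 / 9).
  { replace (10 / 9) with (/ (1 - 1 / 10)) by field. replace (1 / 10) with (- - (1 / 10)) at 1 by ring.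
    rewrite exp_Ropp. apply Rinv_le_contravar; [lra|]. pose proof (exp_ineq1_le (- (1 / 10))). lra. }
  nra.
Qed.

Section Profile.
Variable eps : R.
Hypothesis He : 0 < eps <= e0.

Lemma prof_lower y : tau eps y / 3 <= prof eps y.
Proof.
  pose proof (thy_bounds eps y ltac:(lra)). unfold prof.
  apply Rmult_le_reg_r with (thy eps y); [lra|].
  unfold Rdiv at 2. rewrite Rmult_assoc, Rinv_l, Rmult_1_r by lra.
  pose proof (strong_lower eps He (thy eps y) ltac:(lra)). unfold tau, X. lra.
Qed.

Lemma prof_upper y : prof eps y <= 4 * tau eps y.
Proof.
  pose proof (thy_bounds eps y ltac:(lra)). unfold prof.
  apply Rmult_le_reg_r with (thy eps y); [lra|].
  unfold Rdiv. rewrite Rmult_assoc, Rinv_l, Rmult_1_r by lra.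
  pose proof (strong_upper eps He (thy eps y) ltac:(lra)). unfold tau, X. lra.
Qed.

Lemma prof_pos y : y < 0 -> 0 < prof eps y.
Proof. intros Hy. pose proof (prof_lower y). pose proof (tau_pos eps y ltac:(lra) Hy). lra. Qed.

Lemma prof_defect y : 0 <= cb eps - prof eps y <= 3 * exp (X eps y / 4).
Proof.
  pose proof (thy_bounds eps y ltac:(lra)).
  pose proof (strong_defect eps He (thy eps y) ltac:(lra)) as [H1 H2]. fold (X eps y) in H2.
  assert (E : cb eps * thy eps y - front eps (cb eps) (thy eps y) = (cb eps - prof eps y) * thy eps y).
  { unfold prof. field. lra. }
  rewrite E in *. split.
  - apply Rmult_le_reg_r with (thy eps y); lra.
  - apply Rmult_le_reg_r with (thy eps y); lra.
Qed.

(** The factor [eps] from differentiating [thy] cancels the remaining [1 / eps] of the reaction, so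
    the equation keeps bounded coefficients as eps tends to 0. *)
Lemma prof_deriv y : y < 0 ->
  is_derive (prof eps) y (eps * (cb eps - prof eps y) + forc eps y / (2 * prof eps y)).
Proof.
  intros Hy. pose proof (thy_bounds eps y ltac:(lra)). pose proof (thy_lt_1 eps y ltac:(lra) Hy).
  destruct (strong_is_front eps He) as (_ & _ & _ & HS).
  destruct (HS (thy eps y) ltac:(lra)) as [Hp Hd].
  set (S := front eps (cb eps)) in *. set (t := thy eps y) in *.
  deriv_as ((eps * t * (cb eps - reac eps t / S t) * t - S t * (eps * t)) / t ^ 2).
  - apply (deriv_div (fun y => S (thy eps y)) (thy eps)); [|now apply thy_deriv|fold t; lra].
    apply (deriv_comp S (thy eps)); [assumption|now apply thy_deriv].
  - unfold forc, prof. fold S t.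
    assert (Er : reac eps t = 1 / (2 * eps) * t * (- X eps y) * exp (X eps y)).
    { unfold reac, X, lay. fold t. replace (- / eps * (1 - t)) with ((t - 1) / eps) by (field; lra).
      field. lra. }
    rewrite Er. field. lra.
Qed.

Lemma prof_cont y : continuous (prof eps) y.
Proof.
  unfold prof. apply cont_div; [|apply thy_cont|apply Rgt_not_eq, exp_pos].
  apply (continuous_comp (thy eps) (front eps (cb eps))); [apply thy_cont|].
  apply (strong_is_front eps He).
Qed.

Lemma forc_prof y : y < 0 -> Rabs (forc eps y / prof eps y) <= 3 * exp (X eps y / 2).
Proof.
  intros Hy. pose proof (prof_pos y Hy) as Hp. pose proof (prof_lower y) as Hl.
  pose proof (X_neg eps y ltac:(lra) Hy) as HX.
  assert (Hs := sinh_ge (- X eps y) ltac:(lra)). rewrite !Ropp_involutive in Hs. fold (tau eps y) in Hs.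
  unfold forc. set (x := X eps y) in *.
  rewrite Rabs_left.
  2:{ unfold Rdiv. pose proof (exp_pos x). pose proof (Rinv_0_lt_compat _ Hp).
      assert (0 < (- x) * exp x * / prof eps y) by (repeat apply Rmult_lt_0_compat; lra). lra. }
  apply Rmult_le_reg_r with (prof eps y); [assumption|].
  replace (- (x * exp x / prof eps y) * prof eps y) with (- x * exp x) by (field; lra).
  assert (E : exp x = exp (x / 2) * exp (x / 2)) by (rewrite <- exp_plus; f_equal; field).
  pose proof (exp_pos (x / 2)).
  apply Rle_trans with (exp (x / 2) * tau eps y); [rewrite E; nra|nra].
Qed.
End Profile.

(** * Integrals over left half-lines *)

(** The base point -1 stays away from [y = 0], where integrands may be uncontrolled. *)
Definition tail (g : R -> R) : R := real (Lim_seq (fun n => RInt g (- INR n) (-1))).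
Definition prim (g : R -> R) (y : R) : R := tail g + RInt g (-1) y.

(** A nonnegative [G] whose derivative majorizes [|g|] on the left of [b] gives at once convergence
    of the integral from minus infinity and the bound [G] for it. *)
Definition dominated (g G dG : R -> R) (b : R) : Prop :=
  (forall y, y < 0 -> continuous g y) /\
  (forall y, y <= b -> continuous G y /\ 0 <= G y) /\
  (forall y, y < b -> is_derive G y (dG y) /\ Rabs (g y) <= dG y).

Section Tail.
Variables (g G dG : R -> R) (b : R).
Hypothesis Hb : b < 0.
Hypothesis Hd : dominated g G dG b.

Lemma dominated_exRI u v : u < 0 -> v < 0 -> ex_RInt g u v.
Proof.
  intros Hu Hv. apply exRI_on. intros x Hx. apply Hd.
  revert Hx. unfold Rmin, Rmax. destruct Rle_dec; lra.
Qed.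

Lemma dominated_increment u v : u <= v <= b -> Rabs (RInt g u v) <= G v - G u.
Proof.
  intros Huv. destruct Hd as (H1 & H2 & H3).
  apply (RI_le_increment g G dG); [lra|..].
  - intros; apply H1; lra.
  - intros; apply H2; lra.
  - intros; apply H3; lra.
  - intros; apply H3; lra.
Qed.

Lemma dominated_mono u v : u <= v <= b -> G u <= G v.
Proof. intros H. pose proof (dominated_increment u v H). pose proof (Rabs_pos (RInt g u v)). lra. Qed.

Lemma dominated_Chasles u v w : u < 0 -> v < 0 -> w < 0 -> RInt g u v + RInt g v w = RInt g u w.
Proof. intros. apply RI_Chasles; now apply dominated_exRI. Qed.

(** [G (- INR n)] is eventually decreasing and bounded below by 0, hence Cauchy; its increments
    dominate those of the integrals. *)
Lemma tail_ex : ex_finite_lim_seq (fun n => RInt g (- INR n) (-1)).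
Proof.
  destruct (nfloor_ex (- b) ltac:(lra)) as [n0 Hn0].
  set (N := S n0). assert (HN : forall n, (N <= n)%nat -> - INR n <= b).
  { intros n Hn. apply le_INR in Hn. unfold N in Hn. rewrite S_INR in Hn. lra. }
  assert (HG : ex_finite_lim_seq (fun n => G (- INR (n + N)))).
  { apply ex_finite_lim_seq_decr with 0.
    - intros n. apply dominated_mono. split; [|apply HN; lia].
      apply Ropp_le_contravar, le_INR. lia.
    - intros n. apply Hd. apply HN. lia. }
  apply ex_lim_seq_cauchy_corr. apply ex_lim_seq_cauchy_corr in HG.
  intros e. destruct (HG e) as [M HM]. exists (M + N)%nat. intros n m Hn Hm.
  assert (K : forall n m, (n <= m)%nat -> (M + N <= n)%nat -> Rabs (RInt g (- INR n) (-1) - RInt g (- INR m) (-1)) < e).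
  { clear n m Hn Hm. intros n m Hnm Hn.
    assert (Hneg : forall k, (n <= k)%nat -> - INR k < 0).
    { intros k Hk. pose proof (HN k ltac:(lia)). lra. }
    rewrite <- (dominated_Chasles (- INR m) (- INR n) (-1)); try (apply Hneg; lia); [|lra].
    replace (RInt g (- INR n) (-1) - (RInt g (- INR m) (- INR n) + RInt g (- INR n) (-1)))
      with (- RInt g (- INR m) (- INR n)) by ring.
    rewrite Rabs_Ropp.
    eapply Rle_lt_trans; [apply dominated_increment|].
    - split; [|apply HN; lia]. apply Ropp_le_contravar, le_INR. lia.
    - specialize (HM (n - N)%nat (m - N)%nat ltac:(lia) ltac:(lia)).
      rewrite !Nat.sub_add in HM by lia.
      eapply Rle_lt_trans; [|exact HM]. apply Rle_abs. }
  destruct (Nat.le_ge_cases n m); [now apply K|rewrite Rabs_minus_sym; now apply K].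
Qed.

Lemma prim_lim y : y < 0 -> is_lim_seq (fun n => RInt g (- INR n) y) (prim g y).
Proof.
  intros Hy. unfold prim.
  apply (is_lim_seq_ext_loc (fun n => RInt g (- INR n) (-1) + RInt g (-1) y)).
  - exists 1%nat. intros n Hn. apply dominated_Chasles; [|lra|assumption].
    pose proof (lt_0_INR n ltac:(lia)). lra.
  - apply is_lim_seq_plus'; [|apply is_lim_seq_const]. apply Lim_seq_correct', tail_ex.
Qed.

Lemma prim_bound y : y <= b -> Rabs (prim g y) <= G y.
Proof.
  intros Hy.
  assert (H := is_lim_seq_abs _ _ (prim_lim y ltac:(lra))).
  destruct (nfloor_ex (- y) ltac:(lra)) as [n0 Hn0].
  refine (is_lim_seq_le_loc _ (fun _ => G y) _ _ _ H (is_lim_seq_const _)).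
  exists (S n0). intros n Hn. apply le_INR in Hn. rewrite S_INR in Hn.
  assert (- INR n <= y) by lra.
  pose proof (dominated_increment (- INR n) y ltac:(lra)).
  assert (0 <= G (- INR n)) by (apply Hd; lra). lra.
Qed.

Lemma prim_deriv y : y < 0 -> is_derive (prim g) y (g y).
Proof.
  intros Hy. unfold prim. deriv_as (0 + g y); [|ring].
  apply (deriv_plus (fun _ => tail g)); [auto_derive; easy|].
  apply RI_deriv.
  - intros x Hx. apply Hd. revert Hx. unfold Rmin, Rmax. destruct Rle_dec; lra.
  - assert (H : locally y (fun y => y < 0)) by now apply open_lt.
    revert H. apply filter_imp. apply Hd.
Qed.
End Tail.

Lemma tail_ext g1 g2 : (forall y, y < 0 -> g1 y = g2 y) -> tail g1 = tail g2.
Proof.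
  intros H. unfold tail. f_equal. apply Lim_seq_ext_loc. exists 1%nat. intros n Hn.
  apply RInt_ext. intros y Hy. apply H. pose proof (lt_0_INR n ltac:(lia)).
  revert Hy. unfold Rmin, Rmax. destruct Rle_dec; lra.
Qed.

Lemma prim_ext g1 g2 y : y <= 0 -> (forall y, y < 0 -> g1 y = g2 y) -> prim g1 y = prim g2 y.
Proof.
  intros Hy H. unfold prim. f_equal; [now apply tail_ext|]. apply RInt_ext. intros x Hx. apply H.
  revert Hx. unfold Rmin, Rmax. destruct Rle_dec; lra.
Qed.

Definition integrable_tail (g : R -> R) : Prop :=
  (forall y, y < 0 -> continuous g y) /\ ex_finite_lim_seq (fun n => RInt g (- INR n) (-1)).

Lemma tail_lin g1 g2 k : integrable_tail g1 -> integrable_tail g2 ->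
  tail (fun y => g1 y + k * g2 y) = tail g1 + k * tail g2.
Proof.
  intros [C1 H1] [C2 H2]. unfold tail at 1.
  apply Lim_seq_correct' in H1. apply Lim_seq_correct' in H2.
  erewrite (is_lim_seq_unique _ (Finite (tail g1 + k * tail g2))); [easy|].
  assert (Hex : forall (g : R -> R) n, (forall y, y < 0 -> continuous g y) -> (1 <= n)%nat -> ex_RInt g (- INR n) (-1)).
  { intros g n C Hn. apply exRI_on. intros x Hx. apply C. pose proof (lt_0_INR n ltac:(lia)).
    revert Hx. unfold Rmin, Rmax. destruct Rle_dec; lra. }
  apply (is_lim_seq_ext_loc (fun n => RInt g1 (- INR n) (-1) + k * RInt g2 (- INR n) (-1))).
  - exists 1%nat. intros n Hn. rewrite RI_plus, RI_scal; [easy|..]; auto.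
    apply (ex_RInt_scal (V := R_NormedModule)). auto.
  - apply is_lim_seq_plus'; [exact H1|]. apply (is_lim_seq_scal_l _ k _ H2).
Qed.

Lemma prim_lin g1 g2 k y : y < 0 -> integrable_tail g1 -> integrable_tail g2 ->
  prim (fun y => g1 y + k * g2 y) y = prim g1 y + k * prim g2 y.
Proof.
  intros Hy H1 H2. unfold prim. rewrite tail_lin by assumption.
  assert (Hex : forall g : R -> R, (forall y, y < 0 -> continuous g y) -> ex_RInt g (-1) y).
  { intros g C. apply exRI_on. intros x Hx. apply C.
    revert Hx. unfold Rmin, Rmax. destruct Rle_dec; lra. }
  assert (E1 := Hex g1 (proj1 H1)). assert (E2 := Hex g2 (proj1 H2)).
  rewrite RI_plus, RI_scal; [ring|..]; trivial.
  apply (ex_RInt_scal (V := R_NormedModule)). assumption.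
Qed.

(** * The linearized front equation *)

(** The constants 8 leave room for the mean of the profiles at two values of eps, measured in the
    weights at one of them. *)
Definition admissible (eps c : R) (p : R -> R) : Prop :=
  0 < eps <= e0 /\
  forall y, y < 0 -> continuous p y /\ tau eps y / 8 <= p y <= 8 * tau eps y /\
    0 <= c - p y <= 8 * exp (X eps y / 8).

(** The equation to solve is V' = 2 eps (c / (2 p) - 1) V + 2 eps g p + S, for V a difference
    quotient of squared profiles and g one of speeds. The coefficient of V is [rho - eps], so [ifac]
    is an integrating factor: (ifac V)' = ifac (S + 2 eps g p). *)
Definition rho (eps c : R) (p : R -> R) (y : R) : R := eps * (c - p y) / p y.
Definition ifac (eps c : R) (p : R -> R) (y : R) : R := exp (eps * y - RInt (rho eps c p) (-1) y).
(** The value 0 for [y >= 0] replaces [ifac], whose exponent would integrate [rho] across the zero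
    of [p]. *)
Definition glue (eps c : R) (p S : R -> R) (y : R) : R :=
  if Rlt_dec y 0 then ifac eps c p y * S y else 0.
Definition total (eps c : R) (p S : R -> R) : R := prim (glue eps c p S) 0.
(** Solvability condition: if [ifac * V] vanishes at both ends, then the integral of
    [ifac * (S + 2 * eps * g * p)] is 0, which determines g. *)
Definition lin_speed (eps c : R) (p S : R -> R) : R :=
  - total eps c p S / (2 * eps * total eps c p p).
Definition lin_sol (eps c : R) (p S : R -> R) (y : R) : R :=
  prim (glue eps c p (fun y => S y + 2 * eps * lin_speed eps c p S * p y)) y / ifac eps c p y.

(** [exp (k * X)] only decreases to [exp (- k / eps)]. The summand [eps] absorbs this residue and is
    harmless, because [eps * exp (eps * y)] has an integral of order 1. *)
Definition forcing (eps k A : R) (S : R -> R) : Prop :=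
  forall y, y < 0 -> continuous S y /\ Rabs (S y) <= A * (tau eps y * (exp (k * X eps y) + eps)).

(** Either theta is at least [1 / 2], or X lies below [- 1 / (2 * eps)] and the exponential is below
    a multiple of [eps]. Up to a factor, the first term is the y-derivative of [exp (k * X)], hence
    integrable. *)
Lemma exp_weight_split eps k y : 0 < eps -> 0 < k ->
  exp (k * X eps y) <= 2 * thy eps y * exp (k * X eps y) + 2 / k * eps.
Proof.
  intros He Hk. pose proof (exp_pos (k * X eps y)).
  assert (0 < 2 / k * eps) by (apply Rmult_lt_0_compat; [apply Rdiv_lt_0_compat|]; lra).
  pose proof (thy_bounds eps y He).
  destruct (Rle_lt_dec (1 / 2) (thy eps y)) as [Hle|Hlt]; [nra|].
  rewrite (X_thy eps y He) in Hlt.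
  enough (exp (k * X eps y) <= 2 / k * eps).
  { assert (0 < thy eps y * exp (k * X eps y)) by (apply Rmult_lt_0_compat; lra). lra. }
  set (a := - (k * X eps y)).
  assert (Ha : k / (2 * eps) <= a).
  { unfold a. apply Rmult_le_reg_r with (2 * eps); [lra|].
    unfold Rdiv. rewrite Rmult_assoc, Rinv_l by lra. nra. }
  assert (Ha0 : 0 < k / (2 * eps)) by (apply Rdiv_lt_0_compat; lra).
  replace (k * X eps y) with (- a) by (unfold a; ring). rewrite exp_Ropp.
  replace (2 / k * eps) with (/ (k / (2 * eps))) by (field; lra).
  apply Rinv_le_contravar; [assumption|]. pose proof (exp_ineq1_le a). lra.
Qed.

Section Linear.
Variables (eps c : R) (p : R -> R).
Hypothesis Hadm : admissible eps c p.

Let He : 0 < eps <= e0. Proof. apply Hadm. Qed.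

Lemma adm_p_pos y : y < 0 -> 0 < p y.
Proof.
  intros Hy. pose proof (tau_pos eps y ltac:(lra) Hy).
  destruct Hadm as [_ H']. destruct (H' y Hy) as (_ & ? & _). lra.
Qed.

Lemma rho_cont y : y < 0 -> continuous (rho eps c p) y.
Proof.
  intros Hy. pose proof (adm_p_pos y Hy). destruct Hadm as [_ H']. destruct (H' y Hy) as (Hc & _).
  unfold rho. cont.
Qed.

Lemma rho_pos y : y < 0 -> 0 <= rho eps c p y.
Proof.
  intros Hy. pose proof (adm_p_pos y Hy). destruct Hadm as [_ H']. destruct (H' y Hy) as (_ & _ & ? & _).
  unfold rho. apply Rmult_le_pos; [nra|]. left. now apply Rinv_0_lt_compat.
Qed.

Lemma rho_far y : y <= -1 -> rho eps c p y <= 128 * eps * exp (X eps y / 8).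
Proof.
  intros Hy. pose proof (adm_p_pos y ltac:(lra)) as Hp. destruct Hadm as [_ H'].
  destruct (H' y ltac:(lra)) as (_ & H1 & H2).
  pose proof (tau_ge_far eps y ltac:(lra) Hy). pose proof (exp_pos (X eps y / 8)).
  apply Rmult_le_reg_r with (p y); [assumption|]. unfold rho, Rdiv.
  rewrite Rmult_assoc, Rinv_l, Rmult_1_r by lra.
  assert (1 / 16 <= p y) by lra.
  assert (8 * exp (X eps y / 8) <= 128 * exp (X eps y / 8) * p y) by nra. unfold Rdiv in *. nra.
Qed.

Lemma rho_exRI u v : u < 0 -> v < 0 -> ex_RInt (rho eps c p) u v.
Proof.
  intros Hu Hv. apply exRI_on. intros x Hx. apply rho_cont.
  revert Hx. unfold Rmin, Rmax. destruct Rle_dec; lra.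
Qed.

Lemma ifac_pos y : 0 < ifac eps c p y.
Proof. apply exp_pos. Qed.

Lemma ifac_deriv y : y < 0 -> is_derive (ifac eps c p) y (ifac eps c p y * (eps - rho eps c p y)).
Proof.
  intros Hy. unfold ifac at 1.
  deriv_as ((eps - rho eps c p y) * exp (eps * y - RInt (rho eps c p) (-1) y)).
  2:{ unfold ifac. ring. }
  apply (deriv_comp exp); [auto_derive; [easy|ring]|].
  apply (deriv_minus (fun y => eps * y)); [auto_derive; [easy|ring]|].
  apply RI_deriv.
  - intros x Hx. apply rho_cont. revert Hx. unfold Rmin, Rmax. destruct Rle_dec; lra.
  - assert (H : locally y (fun y => y < 0)) by now apply open_lt.
    revert H. apply filter_imp. apply rho_cont.
Qed.

Lemma ifac_cont y : y < 0 -> continuous (ifac eps c p) y.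
Proof. intros Hy. exact (deriv_cont _ _ _ (ifac_deriv y Hy)). Qed.

Lemma rho_RInt_pos u v : u <= v < 0 -> 0 <= RInt (rho eps c p) u v.
Proof.
  intros H. apply RInt_ge_0; [lra|apply rho_exRI; lra|]. intros; apply rho_pos; lra.
Qed.

Lemma ifac_le_1 y : -1 <= y < 0 -> ifac eps c p y <= 1.
Proof.
  intros Hy. apply exp_le_1. pose proof (rho_RInt_pos (-1) y ltac:(lra)). nra.
Qed.

Lemma ifac_far_ge y : y <= -1 -> exp (eps * y) <= ifac eps c p y.
Proof.
  intros Hy. apply exp_mono. rewrite RI_swap by (apply rho_exRI; lra).
  pose proof (rho_RInt_pos y (-1) ltac:(lra)). lra.
Qed.

(** As [rho >= 0], the factor can grow only through [exp (eps * y)], which is negligible over a unit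
    length. *)
Lemma ifac_ratio y s : -1 <= y <= s -> s < 0 -> ifac eps c p s <= 2 * ifac eps c p y.
Proof.
  intros Hy Hs.
  assert (E : ifac eps c p s = ifac eps c p y * exp (eps * (s - y) - RInt (rho eps c p) y s)).
  { unfold ifac. rewrite <- exp_plus. f_equal.
    rewrite <- (RI_Chasles _ (-1) y s); try (apply rho_exRI; lra). ring. }
  rewrite E, Rmult_comm. apply Rmult_le_compat_r; [left; apply ifac_pos|].
  pose proof (rho_RInt_pos y s ltac:(lra)).
  apply Rle_trans with (exp (1 / 2)); [apply exp_mono; unfold e0 in He; nra|].
  assert (E2 : exp (1 / 2) * exp (1 / 2) = exp 1) by (rewrite <- exp_plus; f_equal; field).
  pose proof exp_le_3. pose proof (exp_pos (1 / 2)). nra.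
Qed.

(** Constants dictated by [sup_sol_dominates]. [c2 k * k = 2] matches the first term of
    [exp_weight_split]; [c1] pays for [1 + 2 / k] multiples of [eps] and keeps as much in reserve
    for the part of [rho] of order [eps ^ 2]. The third term of [shape] absorbs the rest of
    [rho]. *)
Definition c2 (k : R) := 2 / k.
Definition c1 (k : R) := 2 * (1 + 2 / k).
Definition csup (k : R) := 2 * (c1 k + c2 k).

(* [ifac * shape] is a supersolution: its derivative dominates [ifac * (exp (k X) + eps)] for [y <= -1]. *)
Definition shape (k y : R) : R :=
  c1 k + c2 k * exp (k * X eps y) + (c1 k + c2 k) * exp (X eps y / 8).
Definition dshape (k y : R) : R :=
  thy eps y * (c2 k * k * exp (k * X eps y) + (c1 k + c2 k) / 8 * exp (X eps y / 8)).

Lemma shape_bounds k y : 0 < k -> c1 k <= shape k y <= csup k.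
Proof.
  intros Hk. assert (0 < 2 / k) by (apply Rdiv_lt_0_compat; lra).
  unfold shape, csup, c1, c2. pose proof (X_le_0 eps y ltac:(lra)).
  pose proof (exp_pos (k * X eps y)). pose proof (exp_pos (X eps y / 8)).
  pose proof (exp_le_1 (k * X eps y) ltac:(nra)). pose proof (exp_le_1 (X eps y / 8) ltac:(lra)).
  split; nra.
Qed.

Lemma exp_X_deriv k y : y < 0 -> is_derive (fun y => exp (k * X eps y)) y (thy eps y * (k * exp (k * X eps y))).
Proof.
  intros Hy. apply (deriv_comp (fun x => exp (k * x)) (X eps)); [auto_derive; [easy|ring]|].
  apply X_deriv; [lra|assumption].
Qed.

Lemma shape_deriv k y : y < 0 -> is_derive (shape k) y (dshape k y).
Proof.
  intros Hy. unfold shape.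
  deriv_as (0 + c2 k * (thy eps y * (k * exp (k * X eps y)))
            + (c1 k + c2 k) * (thy eps y * (1 / 8 * exp (1 / 8 * X eps y)))).
  2:{ unfold dshape. replace (1 / 8 * X eps y) with (X eps y / 8) by field. field. }
  apply (deriv_plus (fun y => c1 k + c2 k * exp (k * X eps y))).
  - apply (deriv_plus (fun y => c1 k)); [auto_derive; easy|].
    apply (is_derive_scal (fun y => exp (k * X eps y))). now apply exp_X_deriv.
  - apply (is_derive_scal (fun y => exp (X eps y / 8))).
    apply (is_derive_ext (fun y => exp (1 / 8 * X eps y))); [intros; f_equal; field|].
    now apply exp_X_deriv.
Qed.

Definition sup_sol (k y : R) : R := ifac eps c p y * shape k y.
Definition dsup_sol (k y : R) : R :=
  ifac eps c p y * (eps - rho eps c p y) * shape k y + ifac eps c p y * dshape k y.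

Lemma sup_sol_deriv k y : y < 0 -> is_derive (sup_sol k) y (dsup_sol k y).
Proof. intros Hy. apply deriv_mult; [now apply ifac_deriv|now apply shape_deriv]. Qed.

Lemma rho_split y : y <= -1 -> rho eps c p y <= 256 * eps * (thy eps y * exp (X eps y / 8)) + 2048 * eps ^ 2.
Proof.
  intros Hy. pose proof (rho_far y Hy) as H. pose proof (exp_weight_split eps (1 / 8) y ltac:(lra) ltac:(lra)) as H2.
  replace (1 / 8 * X eps y) with (X eps y / 8) in H2 by field.
  apply Rmult_le_compat_l with (r := 128 * eps) in H2; lra.
Qed.

Lemma sup_sol_dominates k y : 0 < k -> y <= -1 ->
  ifac eps c p y * (exp (k * X eps y) + eps) <= dsup_sol k y.
Proof.
  intros Hk Hy. unfold dsup_sol.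
  rewrite Rmult_assoc, <- Rmult_plus_distr_l. apply Rmult_le_compat_l; [left; apply ifac_pos|].
  pose proof (rho_split y Hy) as Hr. pose proof (rho_pos y ltac:(lra)) as Hr0.
  pose proof (shape_bounds k y Hk) as [Hs1 Hs2].
  pose proof (exp_weight_split eps k y ltac:(lra) Hk) as Hw.
  assert (Hk2 : 0 < 2 / k) by (apply Rdiv_lt_0_compat; lra).
  assert (Hth := thy_bounds eps y ltac:(lra)).
  unfold dshape. unfold csup in *. unfold c1, c2 in *.
  set (q := 2 / k) in *. replace (q * k) with 2 by (unfold q; field; lra).
  set (f := exp (k * X eps y)) in *. set (f8 := thy eps y * exp (X eps y / 8)) in *.
  assert (Hf8 : 0 < f8) by (apply Rmult_lt_0_compat; [lra|apply exp_pos]).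
  set (s := shape k y) in *. unfold e0 in He.
  assert (H1 : rho eps c p y * s <= (256 * eps * f8 + 2048 * eps ^ 2) * (2 * (2 * (1 + q) + q))).
  { apply Rmult_le_compat; lra. }
  assert (H2 : eps * (2 * (1 + q)) <= eps * s) by (apply Rmult_le_compat_l; lra).
  assert (H3 : 256 * eps * f8 * (2 * (2 * (1 + q) + q)) <= (2 * (1 + q) + q) / 8 * f8).
  { replace (256 * eps * f8 * (2 * (2 * (1 + q) + q))) with (f8 * (2 * (1 + q) + q) * (512 * eps)) by ring.
    replace ((2 * (1 + q) + q) / 8 * f8) with (f8 * (2 * (1 + q) + q) * (1 / 8)) by field.
    apply Rmult_le_compat_l; [|lra]. apply Rmult_le_pos; lra. }
  assert (H4 : 2048 * eps ^ 2 * (2 * (2 * (1 + q) + q)) <= eps * (1 + q)).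
  { replace (2048 * eps ^ 2 * (2 * (2 * (1 + q) + q))) with (eps * (4096 * eps * (2 + 3 * q))) by ring.
    apply Rmult_le_compat_l; [lra|]. nra. }
  fold f8.
  replace (thy eps y * (2 * f + (2 * (1 + q) + q) / 8 * exp (X eps y / 8)))
    with (2 * thy eps y * f + (2 * (1 + q) + q) / 8 * f8) by (unfold f8; ring).
  nra.
Qed.

Lemma glue_cont k A S : forcing eps k A S -> forall y, y < 0 -> continuous (glue eps c p S) y.
Proof.
  intros HS y Hy.
  apply (continuous_ext_loc _ (fun y => ifac eps c p y * S y)).
  - assert (H : locally y (fun y => y < 0)) by now apply open_lt.
    revert H. apply filter_imp. intros t Ht. unfold glue. destruct Rlt_dec; lra.
  - apply cont_mult; [now apply ifac_cont|]. now apply HS.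
Qed.

Lemma forcing_nonneg k A S : forcing eps k A S -> 0 <= A.
Proof.
  intros HS. destruct (HS (-1) ltac:(lra)) as [_ H]. pose proof (Rabs_pos (S (-1))).
  pose proof (tau_pos eps (-1) ltac:(lra) ltac:(lra)). pose proof (exp_pos (k * X eps (-1))).
  assert (0 < tau eps (-1) * (exp (k * X eps (-1)) + eps)) by (apply Rmult_lt_0_compat; lra). nra.
Qed.

Lemma glue_dominated k A S : 0 < k -> forcing eps k A S ->
  dominated (glue eps c p S) (fun y => A * sup_sol k y) (fun y => A * dsup_sol k y) (-1).
Proof.
  intros Hk HS. pose proof (forcing_nonneg k A S HS) as HA. split; [now apply (glue_cont k A)|split].
  - intros y Hy. split.
    + apply cont_mult; [apply cont_const|]. exact (deriv_cont _ _ _ (sup_sol_deriv k y ltac:(lra))).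
    + apply Rmult_le_pos; [assumption|]. unfold sup_sol.
      apply Rmult_le_pos; [left; apply ifac_pos|]. pose proof (shape_bounds k y Hk).
      assert (0 < 2 / k) by (apply Rdiv_lt_0_compat; lra). unfold c1 in *. lra.
  - intros y Hy. split.
    + apply (is_derive_scal (sup_sol k)). apply sup_sol_deriv. lra.
    + unfold glue. destruct Rlt_dec; [|lra].
      destruct (HS y ltac:(lra)) as [_ H].
      rewrite Rabs_mult, Rabs_right by (apply Rle_ge; left; apply ifac_pos).
      apply Rle_trans with (A * (ifac eps c p y * (exp (k * X eps y) + eps))).
      * replace (A * (ifac eps c p y * (exp (k * X eps y) + eps)))
          with (ifac eps c p y * (A * (1 * (exp (k * X eps y) + eps)))) by ring.
        apply Rmult_le_compat_l; [left; apply ifac_pos|]. apply Rle_trans with (1 := H).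
        apply Rmult_le_compat_l; [assumption|]. apply Rmult_le_compat_r; [|apply tau_bounds; lra].
        pose proof (exp_pos (k * X eps y)). lra.
      * apply Rmult_le_compat_l; [assumption|]. apply sup_sol_dominates; lra.
Qed.

Lemma glue_abs_near k A S y : 0 < k -> forcing eps k A S -> -1 <= y <= 0 ->
  Rabs (glue eps c p S y) <= 2 * A * tau eps y.
Proof.
  intros Hk HS Hy. pose proof (forcing_nonneg k A S HS) as HA.
  pose proof (tau_bounds eps y ltac:(lra)). unfold glue. destruct Rlt_dec as [Hlt|].
  2:{ rewrite Rabs_R0. nra. }
  rewrite Rabs_mult, Rabs_right by (apply Rle_ge; left; apply ifac_pos).
  destruct (HS y Hlt) as [_ H']. pose proof (ifac_le_1 y ltac:(lra)). pose proof (ifac_pos y).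
  pose proof (X_le_0 eps y ltac:(lra)). pose proof (exp_le_1 (k * X eps y) ltac:(nra)). unfold e0 in He.
  assert (A * (tau eps y * (exp (k * X eps y) + eps)) <= A * (tau eps y * 2)).
  { apply Rmult_le_compat_l; [assumption|]. apply Rmult_le_compat_l; lra. }
  pose proof (Rabs_pos (S y)). nra.
Qed.

Lemma glue_cont_0 k A S : 0 < k -> forcing eps k A S -> forall y, continuous (glue eps c p S) y.
Proof.
  intros Hk HS y. destruct (Rlt_le_dec y 0) as [Hy|Hy]; [now apply (glue_cont k A)|].
  pose proof (forcing_nonneg k A S HS) as HA.
  apply cont_eps. intros e He'. 
  assert (Hd : 0 < Rmin 1 (e / (2 * A + 1))) by (apply Rmin_glb_lt; [lra|apply Rdiv_lt_0_compat; lra]).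
  exists (Rmin 1 (e / (2 * A + 1))). split; [assumption|]. intros z Hz.
  replace (glue eps c p S y) with 0 by (unfold glue; destruct Rlt_dec; lra). rewrite Rminus_0_r.
  destruct (Rlt_le_dec z 0) as [Hz0|Hz0].
  - assert (- z < Rmin 1 (e / (2 * A + 1))).
    { eapply Rle_lt_trans; [|exact Hz]. rewrite Rabs_left; lra. }
    pose proof (Rmin_l 1 (e / (2 * A + 1))). pose proof (Rmin_r 1 (e / (2 * A + 1))).
    pose proof (glue_abs_near k A S z Hk HS ltac:(lra)). pose proof (tau_le eps z ltac:(lra) ltac:(lra)).
    assert (- z * (2 * A + 1) < e).
    { apply Rmult_lt_reg_r with (/ (2 * A + 1)); [apply Rinv_0_lt_compat; lra|].
      rewrite Rmult_assoc, Rinv_r by lra. unfold Rdiv in *. lra. }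
    assert (2 * A * tau eps z <= 2 * A * - z) by (apply Rmult_le_compat_l; lra). nra.
  - unfold glue. destruct Rlt_dec; [lra|]. now rewrite Rabs_R0.
Qed.

Lemma glue_integrable k A S : 0 < k -> forcing eps k A S -> integrable_tail (glue eps c p S).
Proof.
  intros Hk HS. split; [now apply (glue_cont k A)|].
  apply (tail_ex _ _ _ (-1) ltac:(lra) (glue_dominated k A S Hk HS)).
Qed.

Lemma sup_sol_le k y : 0 < k -> sup_sol k y <= csup k * ifac eps c p y.
Proof.
  intros Hk. unfold sup_sol. rewrite Rmult_comm. apply Rmult_le_compat_r; [left; apply ifac_pos|].
  now apply shape_bounds.
Qed.

Lemma total_bound k A S : 0 < k -> forcing eps k A S -> Rabs (total eps c p S) <= A * (csup k + 2).
Proof.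
  intros Hk HS. pose proof (forcing_nonneg k A S HS) as HA.
  assert (H1 := prim_bound _ _ _ (-1) ltac:(lra) (glue_dominated k A S Hk HS) (-1) ltac:(lra)).
  assert (H2 := glue_cont_0 k A S Hk HS).
  assert (H3 : Rabs (RInt (glue eps c p S) (-1) 0) <= Rabs (0 - -1) * (2 * A)).
  { apply RI_abs_const; [now apply exRI|]. intros t Ht. rewrite Rmin_left, Rmax_right in Ht by lra.
    eapply Rle_trans; [apply (glue_abs_near k A); assumption|].
    pose proof (tau_bounds eps t ltac:(lra)). nra. }
  unfold total, prim in *. rewrite RI_point, Rplus_0_r in H1.
  replace (Rabs (0 - -1)) with 1 in H3 by (rewrite Rabs_right; lra).
  pose proof (sup_sol_le k (-1) Hk). pose proof (ifac_le_1 (-1) ltac:(lra)).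
  assert (0 <= csup k) by (pose proof (shape_bounds k (-1) Hk); assert (0 < 2 / k) by (apply Rdiv_lt_0_compat; lra); unfold c1 in *; lra).
  assert (A * sup_sol k (-1) <= A * csup k) by (apply Rmult_le_compat_l; [assumption|nra]).
  eapply Rle_trans; [apply Rabs_triang|]. lra.
Qed.

(** [p] does not decay, so only the [eps] in the weight carries it. The large constant serves
    integrability and linearity; the quantitative information is [total_p_lower]. *)
Lemma p_forcing : forcing eps 1 (8 / eps) p.
Proof.
  intros y Hy. destruct Hadm as [_ H]. destruct (H y Hy) as (Hc & Hp & _). split; [assumption|].
  pose proof (adm_p_pos y Hy). rewrite Rabs_right by lra.
  pose proof (tau_pos eps y ltac:(lra) Hy). pose proof (exp_pos (1 * X eps y)).
  replace (8 / eps * (tau eps y * (exp (1 * X eps y) + eps)))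
    with (8 * tau eps y + 8 * tau eps y * exp (1 * X eps y) / eps) by (field; lra).
  assert (0 < 8 * tau eps y * exp (1 * X eps y) / eps) by (apply Rdiv_lt_0_compat; nra). lra.
Qed.

(** Nondegeneracy of the solvability condition, uniformly in eps: for [y <= -1] the integrand is at
    least [exp (eps * y) / 16], with integral [exp (- eps) / (16 * eps)]. *)
Lemma total_p_lower : 1 / 20 <= eps * total eps c p p.
Proof.
  pose proof p_forcing as HF.
  assert (Hint := glue_cont_0 1 _ p ltac:(lra) HF).
  assert (Hpos : forall y, 0 <= glue eps c p p y).
  { intros y. unfold glue. destruct Rlt_dec; [|lra]. pose proof (adm_p_pos y r). pose proof (ifac_pos y). nra. }
  assert (H0 : 0 <= RInt (glue eps c p p) (-1) 0) by (apply RInt_ge_0; [lra|now apply exRI|auto]).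
  unfold total, prim. 
  enough (1 / 20 / eps <= tail (glue eps c p p)).
  { apply Rmult_le_compat_l with (r := eps) in H; [|lra].
    replace (eps * (1 / 20 / eps)) with (1 / 20) in H by (field; lra). nra. }
  assert (Hlim := prim_lim _ _ _ (-1) ltac:(lra) (glue_dominated 1 _ p ltac:(lra) HF) (-1) ltac:(lra)).
  unfold prim in Hlim. rewrite RI_point, Rplus_0_r in Hlim.
  assert (Hexp : is_lim_seq (fun n => (exp (- eps) - exp (eps * - INR n)) / 16 / eps) ((exp (- eps) - 0) / 16 / eps)).
  { apply (is_lim_seq_scal_r _ (/ eps) (Finite ((exp (- eps) - 0) / 16))).
    apply (is_lim_seq_scal_r _ (/ 16) (Finite (exp (- eps) - 0))).
    apply is_lim_seq_minus'; [apply is_lim_seq_const|].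
    apply (is_lim_comp_seq exp (fun n => eps * - INR n) m_infty 0).
    - apply is_lim_exp_m.
    - exists 0%nat. easy.
    - replace m_infty with (Rbar_mult eps m_infty).
      2:{ unfold Rbar_mult, Rbar_mult'. destruct Rle_dec; [|lra]. destruct Rle_lt_or_eq_dec; [easy|lra]. }
      apply is_lim_seq_scal_l. apply (is_lim_seq_opp INR p_infty), is_lim_seq_INR. }
  refine (Rle_trans _ _ _ _ (is_lim_seq_le_loc _ _ _ _ _ Hexp Hlim)).
  - assert (9 / 10 <= exp (- eps)) by (pose proof (exp_ineq1_le (- eps)); unfold e0 in He; lra).
    unfold Rdiv at 1 3. apply Rmult_le_compat_r; [left; apply Rinv_0_lt_compat; lra|]. lra.
  - exists 1%nat. intros n Hn. apply le_INR in Hn. simpl in Hn.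
    assert (Hi : is_RInt (fun y => exp (eps * y) / 16) (- INR n) (-1)
      ((exp (- eps) - exp (eps * - INR n)) / 16 / eps)).
    { replace ((exp (- eps) - exp (eps * - INR n)) / 16 / eps)
        with (minus ((fun y => exp (eps * y) / 16 / eps) (-1)) ((fun y => exp (eps * y) / 16 / eps) (- INR n))).
      - apply (is_RInt_derive (V := R_CompleteNormedModule) (fun y => exp (eps * y) / 16 / eps)).
        + intros x _. auto_derive; [easy|]. field. lra.
        + intros x _. cont.
      - unfold minus, plus, opp; simpl. replace (eps * -1) with (- eps) by ring. field. lra. }
    rewrite <- (is_RInt_unique _ _ _ _ Hi).
    apply RInt_le; [lra|eexists; apply Hi|now apply exRI|].
    intros y Hy. unfold glue. destruct Rlt_dec; [|lra].
    pose proof (ifac_far_ge y ltac:(lra)). pose proof (tau_ge_far eps y ltac:(lra) ltac:(lra)).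
    destruct Hadm as [_ H']. destruct (H' y ltac:(lra)) as (_ & ? & _). pose proof (exp_pos (eps * y)). nra.
Qed.

Lemma lin_speed_bound k A S : 0 < k -> forcing eps k A S ->
  Rabs (lin_speed eps c p S) <= 10 * (csup k + 2) * A.
Proof.
  intros Hk HS. pose proof (total_bound k A S Hk HS) as H. pose proof total_p_lower as H'.
  unfold lin_speed, Rdiv. rewrite Rabs_mult, Rabs_Ropp, Rabs_inv.
  rewrite (Rabs_right (2 * eps * _)) by lra.
  assert (/ (2 * eps * total eps c p p) <= 10).
  { replace 10 with (/ (1 / 10)) by field. apply Rinv_le_contravar; lra. }
  assert (0 < / (2 * eps * total eps c p p)) by (apply Rinv_0_lt_compat; lra).
  pose proof (Rabs_pos (total eps c p S)). nra.
Qed.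

Definition full (S : R -> R) (y : R) : R := S y + 2 * eps * lin_speed eps c p S * p y.

Definition ckk (k : R) : R := 1 + 160 * (csup k + 2).

Lemma full_forcing k A S : 0 < k -> forcing eps k A S -> forcing eps k (ckk k * A) (full S).
Proof.
  intros Hk HS y Hy. pose proof (lin_speed_bound k A S Hk HS) as Hg.
  destruct (HS y Hy) as [HSc HSb]. destruct Hadm as [_ H]. destruct (H y Hy) as (Hc & Hp & _).
  unfold full. split; [cont|].
  eapply Rle_trans; [apply Rabs_triang|]. rewrite !Rabs_mult.
  rewrite (Rabs_right 2), (Rabs_right eps), (Rabs_right (p y)) by (pose proof (adm_p_pos y Hy); lra).
  pose proof (adm_p_pos y Hy). pose proof (tau_pos eps y ltac:(lra) Hy). pose proof (exp_pos (k * X eps y)).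
  set (g := Rabs (lin_speed eps c p S)) in *. assert (0 <= g) by apply Rabs_pos.
  assert (2 * eps * g * p y <= 2 * eps * (10 * (csup k + 2) * A) * (8 * tau eps y)).
  { apply Rmult_le_compat; [nra|lra| |lra]. apply Rmult_le_compat_l; lra. }
  assert (0 <= 160 * (csup k + 2) * A * (tau eps y * exp (k * X eps y))).
  { apply Rmult_le_pos; [|apply Rmult_le_pos; lra]. lra. }
  unfold ckk. lra.
Qed.

Lemma total_lin k A B S1 S2 h : 0 < k -> forcing eps k A S1 -> forcing eps k B S2 ->
  total eps c p (fun y => S1 y + h * S2 y) = total eps c p S1 + h * total eps c p S2.
Proof.
  intros Hk H1 H2. unfold total, prim.
  assert (E : forall y, glue eps c p (fun y => S1 y + h * S2 y) y = glue eps c p S1 y + h * glue eps c p S2 y).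
  { intros y. unfold glue. destruct Rlt_dec; ring. }
  rewrite (tail_ext _ (fun y => glue eps c p S1 y + h * glue eps c p S2 y)) by (intros; apply E).
  rewrite (RInt_ext _ (fun y => glue eps c p S1 y + h * glue eps c p S2 y)) by (intros; apply E).
  rewrite tail_lin; try (eapply glue_integrable; eassumption).
  assert (C1 := glue_cont_0 k A S1 Hk H1). assert (C2 := glue_cont_0 k B S2 Hk H2).
  rewrite RI_plus, RI_scal; [ring|now apply exRI..|].
  apply (ex_RInt_scal (V := R_NormedModule)). now apply exRI.
Qed.

Lemma lin_speed_lin k A B S1 S2 h : 0 < k -> forcing eps k A S1 -> forcing eps k B S2 ->
  lin_speed eps c p (fun y => S1 y + h * S2 y) = lin_speed eps c p S1 + h * lin_speed eps c p S2.
Proof.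
  intros Hk H1 H2. unfold lin_speed. rewrite (total_lin k A B) by assumption.
  pose proof total_p_lower. field. split; [|lra]. intros E. rewrite E in *. lra.
Qed.

Lemma lin_sol_lin k A B S1 S2 h y : 0 < k -> forcing eps k A S1 -> forcing eps k B S2 -> y < 0 ->
  lin_sol eps c p (fun y => S1 y + h * S2 y) y = lin_sol eps c p S1 y + h * lin_sol eps c p S2 y.
Proof.
  intros Hk H1 H2 Hy. unfold lin_sol. rewrite (lin_speed_lin k A B) by assumption.
  rewrite (prim_ext _ (fun y => glue eps c p (full S1) y + h * glue eps c p (full S2) y)); [|lra|].
  - rewrite prim_lin; [unfold full; field; apply Rgt_not_eq, ifac_pos|assumption|..].
    + apply (glue_integrable k (ckk k * A)); [assumption|now apply full_forcing].
    + apply (glue_integrable k (ckk k * B)); [assumption|now apply full_forcing].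
  - intros t Ht. unfold glue, full. destruct Rlt_dec; [ring|lra].
Qed.

Lemma full_total_0 k A S : 0 < k -> forcing eps k A S -> total eps c p (full S) = 0.
Proof.
  intros Hk HS. unfold full.
  pose proof p_forcing as HF.
  (* Linearity is stated for one common rate. Lowering a rate only weakens the bound, because X is
     nonpositive. *)
  assert (HF' : forcing eps (Rmin k 1) (8 / eps) p).
  { intros y Hy. destruct (HF y Hy) as [Hc Hb]. split; [assumption|]. apply Rle_trans with (1 := Hb).
    apply Rmult_le_compat_l; [left; apply Rdiv_lt_0_compat; lra|].
    apply Rmult_le_compat_l; [left; apply tau_pos; lra|].
    apply Rplus_le_compat_r, exp_mono. pose proof (X_le_0 eps y ltac:(lra)). pose proof (Rmin_r k 1). nra. }
  assert (HS' : forcing eps (Rmin k 1) A S).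
  { intros y Hy. destruct (HS y Hy) as [Hc Hb]. split; [assumption|]. apply Rle_trans with (1 := Hb).
    apply Rmult_le_compat_l; [eapply forcing_nonneg; eassumption|].
    apply Rmult_le_compat_l; [left; apply tau_pos; lra|].
    apply Rplus_le_compat_r, exp_mono. pose proof (X_le_0 eps y ltac:(lra)). pose proof (Rmin_l k 1). nra. }
  rewrite (total_lin (Rmin k 1) A (8 / eps) S p (2 * eps * lin_speed eps c p S)); [|apply Rmin_glb_lt; lra|assumption..].
  unfold lin_speed. pose proof total_p_lower. field. split; [|lra]. intros E. rewrite E in *. lra.
Qed.

Definition cls (k : R) : R := 16 * ckk k * (csup k + 1).

Lemma csup_pos k : 0 < k -> 0 < csup k.
Proof. intros Hk. assert (0 < 2 / k) by (apply Rdiv_lt_0_compat; lra). unfold csup, c1, c2. lra. Qed.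

(** Far from 0 the supersolution suffices, as [tau >= 1 / 2]. Near 0 the vanishing total turns the
    integral from minus infinity into minus the integral over [[y, 0]], whose length is at most
    [4 * tau]; the integrand supplies the second factor [tau]. *)
Lemma lin_sol_bound k A S y : 0 < k -> forcing eps k A S -> y < 0 ->
  Rabs (lin_sol eps c p S y) <= cls k * A * tau eps y ^ 2.
Proof.
  intros Hk HS Hy. pose proof (full_forcing k A S Hk HS) as HF.
  pose proof (forcing_nonneg _ _ _ HF) as HA'. pose proof (csup_pos k Hk) as Hcs.
  pose proof (ifac_pos y) as HE.
  unfold lin_sol. fold (full S). unfold Rdiv. rewrite Rabs_mult, Rabs_inv, (Rabs_right (ifac eps c p y)) by lra.
  apply Rmult_le_reg_r with (ifac eps c p y); [assumption|].
  rewrite Rmult_assoc, Rinv_l, Rmult_1_r by lra.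
  set (B := ckk k * A) in *.
  replace (cls k * A * tau eps y ^ 2 * ifac eps c p y) with (16 * B * (csup k + 1) * (tau eps y ^ 2 * ifac eps c p y))
    by (unfold cls, B; ring).
  assert (0 <= B * (tau eps y ^ 2 * ifac eps c p y)).
  { apply Rmult_le_pos; [assumption|]. apply Rmult_le_pos; [apply pow2_ge_0|lra]. }
  destruct (Rle_lt_dec y (-1)) as [H1|H1].
  - eapply Rle_trans; [apply (prim_bound _ _ _ (-1) ltac:(lra) (glue_dominated k B _ Hk HF) y H1)|].
    pose proof (sup_sol_le k y Hk). pose proof (tau_ge_far eps y He H1).
    assert (B * sup_sol k y <= B * (csup k * ifac eps c p y)) by (apply Rmult_le_compat_l; assumption).
    assert (1 / 4 <= tau eps y ^ 2) by nra.
    assert (B * (csup k * ifac eps c p y) <= 4 * csup k * (B * (tau eps y ^ 2 * ifac eps c p y))).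
    { replace (4 * csup k * (B * (tau eps y ^ 2 * ifac eps c p y))) with (B * (csup k * ifac eps c p y) * (4 * tau eps y ^ 2)) by ring.
      rewrite <- (Rmult_1_r (B * (csup k * ifac eps c p y))) at 1. apply Rmult_le_compat_l; [|lra].
      apply Rmult_le_pos; [assumption|nra]. }
    nra.
  - assert (Hint := glue_cont_0 k B _ Hk HF).
    assert (E0 : prim (glue eps c p (full S)) y = - RInt (glue eps c p (full S)) y 0).
    { pose proof (full_total_0 k A S Hk HS) as E. unfold total, prim in *.
      rewrite <- (RI_Chasles _ (-1) y 0) in E by now apply exRI. lra. }
    rewrite E0, Rabs_Ropp.
    apply Rle_trans with (Rabs (0 - y) * (4 * B * tau eps y * ifac eps c p y)).
    + apply RI_abs_const; [now apply exRI|]. intros t Ht. rewrite Rmin_left, Rmax_right in Ht by lra.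
      unfold glue. destruct Rlt_dec as [Hlt|].
      2:{ rewrite Rabs_R0. pose proof (tau_bounds eps y ltac:(lra)). apply Rmult_le_pos; [|lra]. apply Rmult_le_pos; lra. }
      rewrite Rabs_mult, (Rabs_right (ifac eps c p t)) by (apply Rle_ge; left; apply ifac_pos).
      pose proof (ifac_ratio y t ltac:(lra) Hlt). destruct (HF t Hlt) as [_ Hb].
      pose proof (tau_anti eps y t ltac:(lra) ltac:(lra)). pose proof (tau_pos eps t ltac:(lra) Hlt).
      pose proof (X_le_0 eps t ltac:(lra)). pose proof (exp_le_1 (k * X eps t) ltac:(nra)).
      pose proof (exp_pos (k * X eps t)). unfold e0 in He.
      assert (Rabs (full S t) <= B * (tau eps y * 2)).
      { apply Rle_trans with (1 := Hb). apply Rmult_le_compat_l; [assumption|]. apply Rmult_le_compat; lra. }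
      apply Rle_trans with (2 * ifac eps c p y * (B * (tau eps y * 2))); [|right; ring].
      apply Rmult_le_compat; [left; apply ifac_pos|apply Rabs_pos|lra|assumption].
    + rewrite Rabs_right by lra. pose proof (tau_ge_near eps y He ltac:(lra)).
      pose proof (tau_pos eps y ltac:(lra) Hy).
      assert (0 <= B * (tau eps y * ifac eps c p y)) by (apply Rmult_le_pos; [assumption|nra]). nra.
Qed.

Lemma lin_sol_cont k A S y : 0 < k -> forcing eps k A S -> y < 0 -> continuous (lin_sol eps c p S) y.
Proof.
  intros Hk HS Hy. unfold lin_sol. fold (full S).
  apply cont_div; [|now apply ifac_cont|apply Rgt_not_eq, ifac_pos].
  pose proof (full_forcing k A S Hk HS) as HF.
  exact (deriv_cont _ _ _ (prim_deriv _ _ _ (-1) (glue_dominated k _ _ Hk HF) y Hy)).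
Qed.

(* [ifac * exp (- eps y / 2) * exp (exp (X / 8))] increases, so [ifac] decays at least like [exp (eps y / 2)]. *)
Lemma ifac_lim : is_lim_seq (fun n => ifac eps c p (- INR n)) 0.
Proof.
  set (Q := fun y => ifac eps c p y * exp (exp (1 / 8 * X eps y) - eps * y / 2)).
  set (dQ := fun y => ifac eps c p y * (eps - rho eps c p y) * exp (exp (1 / 8 * X eps y) - eps * y / 2)
    + ifac eps c p y * ((thy eps y * (1 / 8 * exp (1 / 8 * X eps y)) - eps / 2) * exp (exp (1 / 8 * X eps y) - eps * y / 2))).
  assert (HQ : forall y, y < 0 -> is_derive Q y (dQ y)).
  { intros y Hy. apply (deriv_mult (ifac eps c p) (fun y => exp (exp (1 / 8 * X eps y) - eps * y / 2))); [now apply ifac_deriv|].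
    apply (deriv_comp exp (fun y => exp (1 / 8 * X eps y) - eps * y / 2)); [auto_derive; [easy|ring]|].
    apply (deriv_minus (fun y => exp (1 / 8 * X eps y))); [now apply exp_X_deriv|]. auto_derive; [easy|field]. }
  assert (HQm : forall y, y <= -1 -> Q y <= Q (-1)).
  { intros y Hy. apply (nondecreasing_of_derive Q dQ y (-1) Hy).
    - intros t Ht. exact (deriv_cont _ _ _ (HQ t ltac:(lra))).
    - intros t Ht. apply HQ. lra.
    - intros t Ht. unfold dQ.
      set (w := exp (exp (1 / 8 * X eps t) - eps * t / 2)). assert (0 < w) by apply exp_pos.
      replace (ifac eps c p t * (eps - rho eps c p t) * w
        + ifac eps c p t * ((thy eps t * (1 / 8 * exp (1 / 8 * X eps t)) - eps / 2) * w))
        with (ifac eps c p t * w * (eps / 2 - rho eps c p t + 1 / 8 * (thy eps t * exp (1 / 8 * X eps t)))) by field.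
      pose proof (ifac_pos t). apply Rmult_le_pos; [apply Rmult_le_pos; lra|].
      pose proof (rho_split t ltac:(lra)) as Hr.
      replace (1 / 8 * X eps t) with (X eps t / 8) by field.
      assert (0 < thy eps t * exp (X eps t / 8)) by (apply Rmult_lt_0_compat; [apply thy_bounds; lra|apply exp_pos]).
      unfold e0 in He. nra. }
  apply (is_lim_seq_le_le_loc (fun _ => 0) _ (fun n => Q (-1) * exp (eps / 2 * - INR n))).
  - exists 1%nat. intros n Hn. apply le_INR in Hn. simpl in Hn. split; [left; apply ifac_pos|].
    pose proof (HQm (- INR n) ltac:(lra)) as H. unfold Q at 1 in H.
    assert (exp (- (eps / 2 * - INR n)) <= exp (exp (1 / 8 * X eps (- INR n)) - eps * - INR n / 2)).
    { apply exp_mono. pose proof (exp_pos (1 / 8 * X eps (- INR n))). lra. }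
    pose proof (ifac_pos (- INR n)).
    assert (E : exp (- (eps / 2 * - INR n)) * exp (eps / 2 * - INR n) = 1) by (rewrite <- exp_plus, Rplus_opp_l; apply exp_0).
    pose proof (exp_pos (eps / 2 * - INR n)).
    apply Rle_trans with (ifac eps c p (- INR n) * (exp (- (eps / 2 * - INR n)) * exp (eps / 2 * - INR n))); [rewrite E; lra|].
    rewrite <- Rmult_assoc. apply Rmult_le_compat_r; [lra|]. apply Rle_trans with (2 := H).
    apply Rmult_le_compat_l; lra.
  - apply is_lim_seq_const.
  - replace 0 with (Q (-1) * 0) by ring. apply (is_lim_seq_scal_l _ (Q (-1)) (Finite 0)).
    apply (is_lim_comp_seq exp (fun n => eps / 2 * - INR n) m_infty 0).
    + apply is_lim_exp_m.
    + exists 0%nat. easy.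
    + replace m_infty with (Rbar_mult (eps / 2) m_infty).
      2:{ unfold Rbar_mult, Rbar_mult'. destruct Rle_dec; [|lra]. destruct Rle_lt_or_eq_dec; [easy|lra]. }
      apply is_lim_seq_scal_l. apply (is_lim_seq_opp INR p_infty), is_lim_seq_INR.
Qed.

(** [ifac * V] has derivative [glue] and tends to 0 at both ends: at minus infinity by [ifac_lim],
    at 0 by the bound on V. The first limit identifies V, the second is the solvability condition
    that fixes [g]. *)
Lemma lin_unique k A S V g M : 0 < k -> forcing eps k A S ->
  (forall y, y < 0 -> Rabs (V y) <= M * tau eps y ^ 2) ->
  (forall y, y < 0 -> is_derive V y (2 * eps * (c / (2 * p y) - 1) * V y + 2 * eps * g * p y + S y)) ->
  g = lin_speed eps c p S /\ forall y, y < 0 -> V y = lin_sol eps c p S y.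
Proof.
  intros Hk HS HV HdV.
  set (S' := fun y => S y + 2 * eps * g * p y).
  assert (HS' : forcing eps k (A + 16 * Rabs g) S').
  { intros y Hy. destruct (HS y Hy) as [HSc HSb]. destruct Hadm as [_ H]. destruct (H y Hy) as (Hc & Hp & _).
    unfold S'. split; [cont|].
    eapply Rle_trans; [apply Rabs_triang|]. rewrite !Rabs_mult.
    rewrite (Rabs_right 2), (Rabs_right eps), (Rabs_right (p y)) by (pose proof (adm_p_pos y Hy); lra).
    pose proof (adm_p_pos y Hy). pose proof (tau_pos eps y ltac:(lra) Hy). pose proof (exp_pos (k * X eps y)).
    assert (0 <= Rabs g) by apply Rabs_pos.
    assert (2 * eps * Rabs g * p y <= 2 * eps * Rabs g * (8 * tau eps y)) by (apply Rmult_le_compat_l; nra).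
    assert (0 <= Rabs g * (tau eps y * exp (k * X eps y))) by (apply Rmult_le_pos; [lra|apply Rmult_le_pos; lra]).
    lra. }
  set (W := fun y => ifac eps c p y * V y).
  assert (HW : forall y, y < 0 -> is_derive W y (glue eps c p S' y)).
  { intros y Hy. deriv_as (ifac eps c p y * (eps - rho eps c p y) * V y
      + ifac eps c p y * (2 * eps * (c / (2 * p y) - 1) * V y + 2 * eps * g * p y + S y)).
    - apply deriv_mult; [now apply ifac_deriv|now apply HdV].
    - unfold glue, S', rho. destruct Rlt_dec; [|lra]. pose proof (adm_p_pos y Hy). field. lra. }
  assert (HM : 0 <= M).
  { pose proof (HV (-1) ltac:(lra)). pose proof (Rabs_pos (V (-1))).
    pose proof (tau_pos eps (-1) ltac:(lra) ltac:(lra)). assert (0 < tau eps (-1) ^ 2) by (apply pow_lt; lra). nra. }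
  assert (Hgc := glue_cont_0 k _ S' Hk HS').
  assert (Hinc : forall u v, u < 0 -> v < 0 -> RInt (glue eps c p S') u v = W v - W u).
  { intros u v Hu Hv. apply is_RInt_unique.
    apply (is_RInt_derive (V := R_CompleteNormedModule) W).
    - intros x Hx. apply HW. revert Hx. unfold Rmin, Rmax. destruct Rle_dec; lra.
    - intros; apply Hgc. }
  assert (HW0 : is_lim_seq (fun n => W (- INR n)) 0).
  { apply (is_lim_seq_le_le_loc (fun n => - (M * ifac eps c p (- INR n))) _ (fun n => M * ifac eps c p (- INR n))).
    - exists 1%nat. intros n Hn. apply le_INR in Hn. simpl in Hn.
      pose proof (HV (- INR n) ltac:(lra)) as H. pose proof (tau_bounds eps (- INR n) ltac:(lra)).
      assert (H3 : M * tau eps (- INR n) ^ 2 <= M * 1).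
      { apply Rmult_le_compat_l; [assumption|]. nra. }
      assert (H2 : Rabs (V (- INR n)) <= M) by lra. apply Rabs_le_between in H2.
      pose proof (ifac_pos (- INR n)). unfold W. nra.
    - replace (Finite 0) with (Rbar_opp (Rbar_mult M 0)).
      2:{ simpl. f_equal. ring. }
      apply (is_lim_seq_opp (fun n => M * ifac eps c p (- INR n))). apply (is_lim_seq_scal_l _ M 0), ifac_lim.
    - replace 0 with (M * 0) by ring. apply (is_lim_seq_scal_l _ M 0), ifac_lim. }
  assert (Hprim : forall y, y < 0 -> prim (glue eps c p S') y = W y).
  { intros y Hy.
    assert (H := prim_lim _ _ _ (-1) ltac:(lra) (glue_dominated k _ S' Hk HS') y Hy).
    apply is_lim_seq_unique in H.
    assert (H2 : is_lim_seq (fun n => RInt (glue eps c p S') (- INR n) y) (W y - 0)).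
    { apply (is_lim_seq_ext_loc (fun n => W y - W (- INR n))).
      - exists 1%nat. intros n Hn. apply le_INR in Hn. simpl in Hn. rewrite Hinc; lra.
      - apply is_lim_seq_minus'; [apply is_lim_seq_const|apply HW0]. }
    apply is_lim_seq_unique in H2. rewrite H in H2. injection H2. lra. }
  assert (Htot : total eps c p S' = 0).
  { unfold total. 
    assert (Hc : continuous (prim (glue eps c p S')) 0).
    { unfold prim. apply cont_plus; [apply cont_const|]. now apply RI_cont. }
    destruct (Req_dec (prim (glue eps c p S') 0) 0) as [|Hn]; [assumption|exfalso].
    set (a := Rabs (prim (glue eps c p S') 0)). assert (Ha : 0 < a) by now apply Rabs_pos_lt.
    destruct (proj1 (cont_eps _ _) Hc (a / 2) ltac:(lra)) as [d [Hd Hd']].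
    (* At this point [W] is within [a / 2] of the total, yet at most [a / 4] in absolute value. *)
    set (y := - Rmin 1 (Rmin (d / 2) (a / (4 * (M + 1))))).
    assert (Hy : 0 < Rmin 1 (Rmin (d / 2) (a / (4 * (M + 1))))).
    { apply Rmin_glb_lt; [lra|]. apply Rmin_glb_lt; [lra|]. apply Rdiv_lt_0_compat; lra. }
    pose proof (Rmin_l 1 (Rmin (d / 2) (a / (4 * (M + 1))))).
    pose proof (Rmin_r 1 (Rmin (d / 2) (a / (4 * (M + 1))))).
    pose proof (Rmin_l (d / 2) (a / (4 * (M + 1)))). pose proof (Rmin_r (d / 2) (a / (4 * (M + 1)))).
    specialize (Hd' y). rewrite Rminus_0_r in Hd'. specialize (Hd' ltac:(unfold y; rewrite Rabs_left; lra)).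
    rewrite Hprim in Hd' by (unfold y; lra).
    assert (Rabs (W y) <= a / 4).
    { unfold W. rewrite Rabs_mult, Rabs_right by (apply Rle_ge; left; apply ifac_pos).
      pose proof (ifac_le_1 y ltac:(unfold y; lra)). pose proof (ifac_pos y).
      pose proof (HV y ltac:(unfold y; lra)). pose proof (tau_bounds eps y ltac:(lra)).
      pose proof (tau_le eps y ltac:(lra) ltac:(unfold y; lra)).
      assert (tau eps y <= a / (4 * (M + 1))) by (unfold y in *; lra).
      assert (M * tau eps y ^ 2 <= M * (a / (4 * (M + 1)))) by (apply Rmult_le_compat_l; nra).
      assert (M * (a / (4 * (M + 1))) <= a / 4).
      { apply Rmult_le_reg_r with (4 * (M + 1)); [lra|].
        replace (M * (a / (4 * (M + 1))) * (4 * (M + 1))) with (M * a) by (field; lra). nra. }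
      pose proof (Rabs_pos (V y)). nra. }
    assert (a <= Rabs (W y) + Rabs (W y - prim (glue eps c p S') 0)).
    { unfold a. rewrite <- (Rabs_Ropp (prim _ 0)). replace (- prim (glue eps c p S') 0) with
        (- W y + (W y - prim (glue eps c p S') 0)) by ring.
      rewrite <- (Rabs_Ropp (W y)). apply Rabs_triang. }
    lra. }
  assert (Eg : g = lin_speed eps c p S).
  { assert (HP : total eps c p S' = total eps c p S + (2 * eps * g) * total eps c p p).
    { assert (HF' : forcing eps (Rmin k 1) (8 / eps) p).
      { intros y Hy. destruct (p_forcing y Hy) as [Hc Hb]. split; [assumption|]. apply Rle_trans with (1 := Hb).
        apply Rmult_le_compat_l; [left; apply Rdiv_lt_0_compat; lra|].
        apply Rmult_le_compat_l; [left; apply tau_pos; lra|].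
        apply Rplus_le_compat_r, exp_mono. pose proof (X_le_0 eps y ltac:(lra)). pose proof (Rmin_r k 1). nra. }
      assert (HS2 : forcing eps (Rmin k 1) A S).
      { intros y Hy. destruct (HS y Hy) as [Hc Hb]. split; [assumption|]. apply Rle_trans with (1 := Hb).
        apply Rmult_le_compat_l; [eapply forcing_nonneg; eassumption|].
        apply Rmult_le_compat_l; [left; apply tau_pos; lra|].
        apply Rplus_le_compat_r, exp_mono. pose proof (X_le_0 eps y ltac:(lra)). pose proof (Rmin_l k 1). nra. }
      apply (total_lin (Rmin k 1) A (8 / eps)); [apply Rmin_glb_lt; lra|assumption..]. }
    rewrite Htot in HP. pose proof total_p_lower.
    assert (total eps c p p <> 0) by (intros E; rewrite E in *; lra).
    unfold lin_speed. replace (- total eps c p S) with (2 * eps * g * total eps c p p) by lra. field. split; lra. }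
  split; [assumption|]. intros y Hy.
  unfold lin_sol. rewrite <- Eg. change (fun y0 => S y0 + 2 * eps * g * p y0) with S'.
  rewrite Hprim by assumption. unfold W. field. apply Rgt_not_eq, ifac_pos.
Qed.
End Linear.

(** * Families with uniform expansions in the increment of [eps] *)

(** The bound [eps / 2] keeps eps and eps + h comparable, so that weights at the two values control
    each other. *)
Definition increment (eps h : R) : Prop :=
  0 < eps < e0 /\ h <> 0 /\ Rabs h <= eps / 2 /\ eps + h < e0.

Lemma increment_bounds eps h : increment eps h ->
  0 < eps <= e0 /\ 0 < eps + h <= e0 /\ eps / 2 <= eps + h <= 3 / 2 * eps.
Proof. intros (H1 & _ & H2 & H3). apply Rabs_le_between in H2. lra. Qed.

Lemma increment_exists eps : 0 < eps < e0 -> exists h, increment eps h.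
Proof.
  intros He. exists (Rmin (eps / 2) ((e0 - eps) / 2)).
  assert (0 < Rmin (eps / 2) ((e0 - eps) / 2)) by (apply Rmin_glb_lt; lra).
  pose proof (Rmin_l (eps / 2) ((e0 - eps) / 2)). pose proof (Rmin_r (eps / 2) ((e0 - eps) / 2)).
  repeat split; try lra. rewrite Rabs_right; lra.
Qed.

(** Continuity in [y] is part of the notion, so that the integral operators apply to such
    families. *)
Definition Bd (w : R -> R -> R) (G : R -> R -> R -> R) : Prop :=
  exists C, 0 <= C /\ forall eps h y, increment eps h -> y < 0 ->
    Rabs (G eps h y) <= C * w eps y /\ continuous (G eps h) y.

(* [Expd n w G]: [G eps h y = a_0 + a_1 h + ... + a_(n-1) h^(n-1) + O(w h^n)] with [a_i = O(w)], uniformly in [eps], [h], [y]. *)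
Fixpoint Expd (n : nat) (w : R -> R -> R) (G : R -> R -> R -> R) : Prop :=
  match n with
  | O => Bd w G
  | S n => exists (a : R -> R -> R) (G1 : R -> R -> R -> R),
      Bd w (fun eps _ => a eps) /\ Expd n w G1 /\
      forall eps h y, increment eps h -> y < 0 -> G eps h y = a eps y + h * G1 eps h y
  end.

Definition nonneg_weight (w : R -> R -> R) : Prop :=
  forall eps y, 0 < eps < e0 -> y < 0 -> 0 <= w eps y.

Lemma locally_neg y : y < 0 -> locally y (fun t => t < 0).
Proof. intros Hy. now apply open_lt. Qed.

Lemma continuous_ext_neg (f g : R -> R) y : y < 0 -> (forall t, t < 0 -> f t = g t) ->
  continuous f y -> continuous g y.
Proof.
  intros Hy H. apply continuous_ext_loc. apply (filter_imp _ _ H). now apply locally_neg.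
Qed.

Lemma Bd_ext w G G' : (forall eps h y, increment eps h -> y < 0 -> G eps h y = G' eps h y) ->
  Bd w G -> Bd w G'.
Proof.
  intros E [C [HC H]]. exists C. split; [assumption|]. intros eps h y Hh Hy.
  destruct (H eps h y Hh Hy) as [H1 H2]. split; [now rewrite <- E|].
  apply (continuous_ext_neg (G eps h)); auto.
Qed.

Lemma Expd_ext n w G G' : (forall eps h y, increment eps h -> y < 0 -> G eps h y = G' eps h y) ->
  Expd n w G -> Expd n w G'.
Proof.
  intros E. destruct n as [|n]; simpl; [now apply Bd_ext|].
  intros (a & G1 & Ha & HG1 & EG). exists a, G1. repeat split; trivial.
  intros. rewrite <- E by assumption. auto.
Qed.

Lemma Bd_weak w w' K G : 0 <= K ->
  (forall eps y, 0 < eps < e0 -> y < 0 -> w eps y <= K * w' eps y) -> Bd w G -> Bd w' G.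
Proof.
  intros HK Hw [C [HC H]]. exists (C * K). split; [nra|]. intros eps h y Hh Hy.
  destruct (H eps h y Hh Hy) as [H1 H2]. split; [|assumption].
  specialize (Hw eps y (proj1 Hh) Hy). nra.
Qed.

Lemma Expd_weak n w w' K G : 0 <= K ->
  (forall eps y, 0 < eps < e0 -> y < 0 -> w eps y <= K * w' eps y) -> Expd n w G -> Expd n w' G.
Proof.
  intros HK Hw. revert G. induction n as [|n IH]; intros G; simpl; [now apply (Bd_weak w w' K)|].
  intros (a & G1 & Ha & HG1 & EG). exists a, G1. split; [now apply (Bd_weak w w' K)|]. split; auto.
Qed.

Lemma Bd_plus w G G' : Bd w G -> Bd w G' -> Bd w (fun e h y => G e h y + G' e h y).
Proof.
  intros [C [HC H]] [C' [HC' H']]. exists (C + C'). split; [lra|]. intros eps h y Hh Hy.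
  destruct (H eps h y Hh Hy) as [H1 H2]. destruct (H' eps h y Hh Hy) as [H3 H4].
  split; [|now apply cont_plus]. eapply Rle_trans; [apply Rabs_triang|]. lra.
Qed.

Lemma Bd_mult w w' G G' : Bd w G -> Bd w' G' ->
  Bd (fun e y => w e y * w' e y) (fun e h y => G e h y * G' e h y).
Proof.
  intros [C [HC H]] [C' [HC' H']]. exists (C * C'). split; [nra|]. intros eps h y Hh Hy.
  destruct (H eps h y Hh Hy) as [H1 H2]. destruct (H' eps h y Hh Hy) as [H3 H4].
  split; [|now apply cont_mult]. rewrite Rabs_mult.
  replace (C * C' * (w eps y * w' eps y)) with ((C * w eps y) * (C' * w' eps y)) by ring.
  apply Rmult_le_compat; trivial; apply Rabs_pos.
Qed.

Lemma Bd_h w G : Bd w G -> Bd w (fun e h y => h * G e h y).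
Proof.
  intros [C [HC H]]. exists C. split; [assumption|]. intros eps h y Hh Hy.
  destruct (H eps h y Hh Hy) as [H1 H2]. split; [|cont].
  rewrite Rabs_mult. destruct Hh as (He & _ & Hh & _). unfold e0 in He.
  pose proof (Rabs_pos (G eps h y)). pose proof (Rabs_pos h). nra.
Qed.

Lemma Bd_zero w : nonneg_weight w -> Bd w (fun _ _ _ => 0).
Proof.
  intros Hw. exists 0. split; [lra|]. intros eps h y Hh Hy. split; [|apply cont_const].
  rewrite Rabs_R0. lra.
Qed.

Lemma Expd_bd n w G : Expd n w G -> Bd w G.
Proof.
  revert G. induction n as [|n IH]; intros G; simpl; [easy|].
  intros (a & G1 & Ha & HG1 & EG).
  apply (Bd_ext w (fun e h y => a e y + h * G1 e h y)); [intros; symmetry; auto|].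
  apply Bd_plus; [assumption|]. apply Bd_h. auto.
Qed.

Lemma Expd_S n w G : Expd (S n) w G -> Expd n w G.
Proof.
  revert G. induction n as [|n IH]; intros G H; [now apply (Expd_bd 1)|].
  destruct H as (a & G1 & Ha & HG1 & EG). exists a, G1. auto.
Qed.

Lemma Expd_const n w a : nonneg_weight w -> Bd w (fun eps _ => a eps) -> Expd n w (fun eps _ => a eps).
Proof.
  intros Hw Ha. destruct n as [|n]; simpl; [assumption|].
  exists a, (fun _ _ _ => 0). split; [assumption|]. split; [|intros; ring].
  clear Ha a. induction n as [|n IH]; simpl; [now apply Bd_zero|].
  exists (fun _ _ => 0), (fun _ _ _ => 0). split; [now apply Bd_zero|]. split; [assumption|intros; ring].
Qed.

Lemma Expd_plus n w G G' : Expd n w G -> Expd n w G' -> Expd n w (fun e h y => G e h y + G' e h y).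
Proof.
  revert G G'. induction n as [|n IH]; intros G G'; simpl; [apply Bd_plus|].
  intros (a & G1 & Ha & HG1 & EG) (a' & G1' & Ha' & HG1' & EG').
  exists (fun e y => a e y + a' e y), (fun e h y => G1 e h y + G1' e h y).
  split; [now apply (Bd_plus w (fun e _ => a e))|]. split; [auto|].
  intros. rewrite EG, EG' by assumption. ring.
Qed.

(** Discrete Leibniz rule: the product is a a' + h (a G1' + G1 G'), where G' itself is needed to one
    order less. *)
Lemma Expd_mult n w w' G G' : Expd n w G -> Expd n w' G' ->
  Expd n (fun e y => w e y * w' e y) (fun e h y => G e h y * G' e h y).
Proof.
  revert G G'. induction n as [|n IH]; intros G G' H H'; [now apply Bd_mult|].
  pose proof (Expd_S _ _ _ H') as H's.
  destruct H as (a & G1 & Ha & HG1 & EG). destruct H' as (a' & G1' & Ha' & HG1' & EG').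
  exists (fun e y => a e y * a' e y), (fun e h y => a e y * G1' e h y + G1 e h y * G' e h y).
  split; [now apply (Bd_mult w w' (fun e _ => a e))|]. split.
  - apply Expd_plus; [|auto]. 
    apply (IH (fun e h y => a e y)); [|assumption].
    destruct n as [|n]; [assumption|]. simpl.
    exists a, (fun _ _ _ => 0). split; [assumption|]. split; [|intros; ring].
    (* The sign of the weight that a zero family requires is read off from the bound on [a]. *)
    assert (HZ : Bd w (fun _ _ _ => 0)).
    { destruct Ha as [C [HC Ha]]. exists C. split; [assumption|]. intros eps h y Hh Hy.
      split; [|apply cont_const]. rewrite Rabs_R0.
      destruct (Ha eps h y Hh Hy) as [Hb _]. pose proof (Rabs_pos (a eps y)). lra. }
    clear - HZ. induction n as [|n IHn]; simpl; [assumption|].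
    exists (fun _ _ => 0), (fun _ _ _ => 0). split; [assumption|]. split; [assumption|intros; ring].
  - intros. rewrite EG, EG' by assumption. ring.
Qed.

Lemma Expd_h n w G : nonneg_weight w -> Expd n w G -> Expd (S n) w (fun e h y => h * G e h y).
Proof.
  intros Hw H. exists (fun _ _ => 0), G. split; [now apply Bd_zero|]. split; [assumption|]. intros; ring.
Qed.

Definition w1 (eps y : R) : R := 1.
Definition wtau2 (eps y : R) : R := tau eps y ^ 2.
Definition wexp (k eps y : R) : R := exp (k * X eps y).
Definition wsource (k eps y : R) : R := tau eps y * (exp (k * X eps y) + eps).

Lemma Expd_cst n (f : R -> R) C : (forall eps, 0 < eps < e0 -> Rabs (f eps) <= C) ->
  Expd n w1 (fun eps _ _ => f eps).
Proof.
  intros H. apply (Expd_const n w1 (fun eps _ => f eps)); [intros ? ? _ _; unfold w1; lra|].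
  exists (Rmax 0 C). split; [apply Rmax_l|]. intros eps h y Hh Hy. split; [|apply cont_const].
  specialize (H eps (proj1 Hh)). pose proof (Rmax_r 0 C). unfold w1. lra.
Qed.

Lemma Expd_scal n w G (f : R -> R) C : (forall eps, 0 < eps < e0 -> Rabs (f eps) <= C) ->
  nonneg_weight w -> Expd n w G -> Expd n w (fun eps h y => f eps * G eps h y).
Proof.
  intros Hf Hw HG.
  apply (Expd_weak n (fun e y => w1 e y * w e y) w 1); [lra|intros; unfold w1; lra|].
  apply Expd_mult; [now apply (Expd_cst n f C)|assumption].
Qed.

Lemma nw_tau : nonneg_weight tau.
Proof. intros eps y He _. apply tau_bounds. lra. Qed.

Lemma nw_tau2 : nonneg_weight wtau2.
Proof. intros eps y He _. apply pow2_ge_0. Qed.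

Lemma nw_exp k : nonneg_weight (wexp k).
Proof. intros eps y He _. left. apply exp_pos. Qed.

Lemma nw_source k : nonneg_weight (wsource k).
Proof.
  intros eps y He _. unfold wsource. pose proof (tau_bounds eps y ltac:(lra)).
  pose proof (exp_pos (k * X eps y)). apply Rmult_le_pos; lra.
Qed.

Lemma wexp_le k k' eps y : 0 < eps < e0 -> k' <= k -> wexp k eps y <= wexp k' eps y.
Proof. intros He Hk. apply exp_mono. pose proof (X_le_0 eps y ltac:(lra)). nra. Qed.

Lemma Expd_wexp_le n k k' G : k' <= k -> Expd n (wexp k) G -> Expd n (wexp k') G.
Proof.
  intros Hk. apply (Expd_weak n _ _ 1); [lra|]. intros eps y He Hy.
  pose proof (wexp_le k k' eps y He Hk). lra.
Qed.

(** With l = e1 / e2 and z = e2 y the claim reads exp (l z) - 1 <= (l / 2) (exp z - 1). It follows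
    from convexity of exp if l <= 1, and from its monotonicity if 1 < l <= 2. *)
Lemma X_compare e1 e2 y : 0 < e1 -> 0 < e2 -> e1 <= 2 * e2 -> y < 0 -> X e1 y <= X e2 y / 2.
Proof.
  intros H1 H2 H12 Hy. unfold X, lay, thy. rewrite Rmin_left by lra.
  set (l := e1 / e2). set (z := e2 * y). assert (Ez : e1 * y = l * z) by (unfold l, z; field; lra).
  assert (Hz : z < 0) by (unfold z; nra).
  assert (Hl : 0 < l <= 2).
  { unfold l. split; [now apply Rdiv_lt_0_compat|]. apply Rmult_le_reg_r with e2; [assumption|].
    unfold Rdiv. rewrite Rmult_assoc, Rinv_l by lra. lra. }
  rewrite Ez.
  assert (Hez : exp z < 1) by (rewrite <- exp_0; now apply exp_increasing).
  assert (H : exp (l * z) - 1 <= l / 2 * (exp z - 1)).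
  { destruct (Rle_lt_dec l 1) as [Hl1|Hl1].
    - assert (A1 : exp (l * z) * (1 + (z - l * z)) <= exp z).
      { assert (E : exp z = exp (l * z) * exp (z - l * z)) by (rewrite <- exp_plus; f_equal; ring). rewrite E.
        apply Rmult_le_compat_l; [left; apply exp_pos|apply exp_ineq1_le]. }
      assert (A2 : exp (l * z) * (1 - l * z) <= 1).
      { assert (E : 1 = exp (l * z) * exp (- (l * z))) by (rewrite <- exp_plus, Rplus_opp_r; symmetry; apply exp_0).
        rewrite E at 2. apply Rmult_le_compat_l; [left; apply exp_pos|]. pose proof (exp_ineq1_le (- (l * z))). lra. }
      assert (A3 : exp (l * z) <= l * exp z + (1 - l)).
      { apply Rmult_le_compat_l with (r := l) in A1; [|lra].
        apply Rmult_le_compat_l with (r := 1 - l) in A2; [|lra]. lra. }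
      nra.
    - assert (exp (l * z) <= exp z) by (apply exp_mono; nra). nra. }
  apply Rmult_le_reg_r with e1; [assumption|].
  replace ((exp (l * z) - 1) / e1 * e1) with (exp (l * z) - 1) by (field; lra).
  replace ((exp z - 1) / e2 / 2 * e1) with (l / 2 * (exp z - 1)) by (unfold l; field; lra).
  assumption.
Qed.

(** [1 - u ^ 2 <= 2 * (1 - u)] with [u = exp (X e2 y / 2)], after [X_compare]. *)
Lemma tau_compare e1 e2 y : 0 < e1 -> 0 < e2 -> e1 <= 2 * e2 -> y < 0 -> tau e2 y <= 2 * tau e1 y.
Proof.
  intros H1 H2 H12 Hy. pose proof (X_compare e1 e2 y H1 H2 H12 Hy) as H. unfold tau.
  pose proof (exp_mono _ _ H) as H3.
  assert (E : exp (X e2 y) = exp (X e2 y / 2) * exp (X e2 y / 2)) by (rewrite <- exp_plus; f_equal; field).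
  pose proof (Rle_0_sqr (1 - exp (X e2 y / 2))). unfold Rsqr in *. lra.
Qed.

Lemma prof_admissible eps : 0 < eps <= e0 -> admissible eps (cb eps) (prof eps).
Proof.
  intros He. split; [assumption|]. intros y Hy.
  pose proof (prof_lower eps He y). pose proof (prof_upper eps He y). pose proof (prof_defect eps He y).
  pose proof (tau_bounds eps y ltac:(lra)).
  assert (exp (X eps y / 4) <= exp (X eps y / 8)).
  { apply exp_mono. pose proof (X_le_0 eps y ltac:(lra)). lra. }
  pose proof (exp_pos (X eps y / 8)).
  split; [now apply prof_cont|lra].
Qed.

Lemma Bd_forcing k G : Bd (wsource k) G ->
  exists C, 0 <= C /\ forall eps h, increment eps h -> forcing eps k C (G eps h).
Proof.
  intros [C [HC H]]. exists C. split; [assumption|]. intros eps h Hh y Hy.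
  destruct (H eps h y Hh Hy). now split.
Qed.

Lemma glue_ext eps c p S S' : (forall y, y < 0 -> S y = S' y) -> glue eps c p S = glue eps c p S'.
Proof.
  intros H. apply FunctionalExtensionality.functional_extensionality. intros y.
  unfold glue. destruct Rlt_dec; [now rewrite H|easy].
Qed.

Lemma lin_speed_ext eps c p S S' : (forall y, y < 0 -> S y = S' y) -> lin_speed eps c p S = lin_speed eps c p S'.
Proof. intros H. unfold lin_speed, total. now rewrite (glue_ext _ _ _ _ _ H). Qed.

Lemma lin_sol_ext eps c p S S' : (forall y, y < 0 -> S y = S' y) -> lin_sol eps c p S = lin_sol eps c p S'.
Proof.
  intros H. unfold lin_sol. rewrite (lin_speed_ext _ _ _ _ _ H).
  rewrite (glue_ext _ _ _ _ (fun y => S' y + 2 * eps * lin_speed eps c p S' * p y)); [easy|].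
  intros y Hy. now rewrite H.
Qed.

Lemma Bd_lin k G : 0 < k -> Bd (wsource k) G ->
  Bd w1 (fun eps h _ => lin_speed eps (cb eps) (prof eps) (G eps h)) /\
  Bd wtau2 (fun eps h => lin_sol eps (cb eps) (prof eps) (G eps h)).
Proof.
  intros Hk HG. destruct (Bd_forcing k G HG) as [C [HC HF]]. pose proof (csup_pos k Hk).
  split.
  - exists (10 * (csup k + 2) * C). split; [apply Rmult_le_pos; lra|]. intros eps h y Hh Hy.
    split; [|apply cont_const]. unfold w1. rewrite Rmult_1_r.
    apply lin_speed_bound; auto. apply prof_admissible, (increment_bounds eps h Hh).
  - exists (cls k * C). split.
    { apply Rmult_le_pos; [|assumption]. unfold cls, ckk. apply Rmult_le_pos; lra. }
    intros eps h y Hh Hy. pose proof (prof_admissible eps ltac:(apply (increment_bounds eps h Hh))).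
    split; [apply (lin_sol_bound _ _ _ H0); auto|]. apply (lin_sol_cont _ _ _ H0 k C); auto.
Qed.

(** At fixed [eps] both operators are linear and independent of [h], so they act on each coefficient
    of the expansion. *)
Lemma Expd_lin n k G : 0 < k -> Expd n (wsource k) G ->
  Expd n w1 (fun eps h _ => lin_speed eps (cb eps) (prof eps) (G eps h)) /\
  Expd n wtau2 (fun eps h => lin_sol eps (cb eps) (prof eps) (G eps h)).
Proof.
  intros Hk. revert G. induction n as [|n IH]; intros G HG; [now apply (Bd_lin k)|].
  destruct HG as (a & G1 & Ha & HG1 & EG).
  destruct (Bd_lin k (fun eps _ => a eps) Hk Ha) as [B1 B2]. destruct (IH G1 HG1) as [I1 I2].
  destruct (Bd_forcing k _ Ha) as [C [HC HF]].
  destruct (Bd_forcing k _ (Expd_bd _ _ _ HG1)) as [C1 [HC1 HF1]].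
  split.
  - exists (fun eps _ => lin_speed eps (cb eps) (prof eps) (a eps)), (fun eps h _ => lin_speed eps (cb eps) (prof eps) (G1 eps h)).
    split; [assumption|]. split; [assumption|]. intros eps h y Hh Hy.
    rewrite (lin_speed_ext _ _ _ _ (fun y => a eps y + h * G1 eps h y)) by (intros; auto).
    apply (lin_speed_lin eps _ _ (prof_admissible eps ltac:(apply (increment_bounds eps h Hh))) k C C1); auto.
    now apply (HF eps h).
  - exists (fun eps => lin_sol eps (cb eps) (prof eps) (a eps)), (fun eps h => lin_sol eps (cb eps) (prof eps) (G1 eps h)).
    split; [assumption|]. split; [assumption|]. intros eps h y Hh Hy.
    rewrite (lin_sol_ext _ _ _ _ (fun y => a eps y + h * G1 eps h y)) by (intros; auto).
    apply (lin_sol_lin eps _ _ (prof_admissible eps ltac:(apply (increment_bounds eps h Hh))) k C C1); auto.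
    now apply (HF eps h).
Qed.

(** The solution of r' = - eps r + H that stays bounded at minus infinity. *)
Definition avg (eps : R) (H : R -> R) (y : R) : R := prim (fun y => exp (eps * y) * H y) y / exp (eps * y).

(** Subtracting the limit [exp (- (k / eps))] makes the majorant vanish at minus infinity, the form
    in which [avg_exp] applies. *)
Lemma exp_source_dominated eps k C (H : R -> R) b : 0 < eps -> 0 < k -> 0 <= C -> b < 0 ->
  (forall y, y < 0 -> continuous H y /\ Rabs (H y) <= C * exp (k * X eps y)) ->
  dominated (fun y => exp (eps * y) * H y)
    (fun y => C / k * (exp (k * X eps y) - exp (- (k / eps))))
    (fun y => C / k * (thy eps y * (k * exp (k * X eps y)))) b.
Proof.
  intros He Hk HC Hb HH.
  assert (HCk : 0 <= C / k) by (apply Rmult_le_pos; [assumption|left; now apply Rinv_0_lt_compat]).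
  split; [|split].
  - intros y Hy. destruct (HH y Hy) as [Hc _]. cont.
  - intros y Hy. split.
    + pose proof (X_cont eps y). cont.
    + apply Rmult_le_pos; [assumption|].
      enough (exp (- (k / eps)) <= exp (k * X eps y)) by lra. apply exp_mono.
      pose proof (thy_bounds eps y He) as Ht. rewrite (X_thy eps y He) in Ht.
      apply Rmult_le_reg_r with eps; [assumption|]. replace (- (k / eps) * eps) with (- k) by (field; lra). nra.
  - intros y Hy. split.
    + apply (is_derive_scal (fun y => exp (k * X eps y) - exp (- (k / eps)))).
      deriv_as (thy eps y * (k * exp (k * X eps y)) - 0); [|ring].
      apply (deriv_minus (fun y => exp (k * X eps y))); [|auto_derive; easy].
      apply (deriv_comp (fun x => exp (k * x)) (X eps)); [auto_derive; [easy|ring]|].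
      apply X_deriv; lra.
    + destruct (HH y ltac:(lra)) as [_ Hb']. rewrite Rabs_mult, Rabs_right by (apply Rle_ge; left; apply exp_pos).
      unfold thy. rewrite Rmin_left by lra.
      replace (C / k * (exp (eps * y) * (k * exp (k * X eps y)))) with (exp (eps * y) * (C * exp (k * X eps y))) by (field; lra).
      apply Rmult_le_compat_l; [left; apply exp_pos|assumption].
Qed.

(** The division by [exp (eps * y)], which is theta, would destroy uniformity; [avg_exp] supplies
    this factor in exchange for half the rate. *)
Lemma avg_bound eps k C H y : 0 < eps -> 0 < k -> 0 <= C ->
  (forall y, y < 0 -> continuous H y /\ Rabs (H y) <= C * exp (k * X eps y)) ->
  y < 0 -> Rabs (avg eps H y) <= C / k * exp (k / 2 * X eps y) /\ continuous (avg eps H) y.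
Proof.
  intros He Hk HC HH Hy. pose proof (exp_source_dominated eps k C H y He Hk HC Hy HH) as Hd.
  split.
  - unfold avg, Rdiv at 1. rewrite Rabs_mult, Rabs_inv, (Rabs_right (exp _)) by (apply Rle_ge; left; apply exp_pos).
    apply Rmult_le_reg_r with (exp (eps * y)); [apply exp_pos|].
    rewrite Rmult_assoc, Rinv_l, Rmult_1_r by (apply Rgt_not_eq, exp_pos).
    eapply Rle_trans; [apply (prim_bound _ _ _ y Hy Hd); lra|].
    rewrite Rmult_assoc. apply Rmult_le_compat_l.
    { apply Rmult_le_pos; [assumption|left; now apply Rinv_0_lt_compat]. }
    pose proof (thy_bounds eps y He).
    pose proof (avg_exp k eps (thy eps y) Hk He ltac:(lra)) as Ha. fold (X eps y) in Ha.
    replace (k / 2 * X eps y) with (k * X eps y / 2) by field.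
    unfold thy in Ha at 1. rewrite Rmin_left in Ha by lra. lra.
  - unfold avg. apply cont_div; [|cont|apply Rgt_not_eq, exp_pos].
    exact (deriv_cont _ _ _ (prim_deriv _ _ _ y Hd y Hy)).
Qed.

Lemma avg_lin eps k C C' H H' h y : 0 < eps -> 0 < k -> 0 <= C -> 0 <= C' ->
  (forall y, y < 0 -> continuous H y /\ Rabs (H y) <= C * exp (k * X eps y)) ->
  (forall y, y < 0 -> continuous H' y /\ Rabs (H' y) <= C' * exp (k * X eps y)) ->
  y < 0 -> avg eps (fun y => H y + h * H' y) y = avg eps H y + h * avg eps H' y.
Proof.
  intros He Hk HC HC' HH HH' Hy.
  pose proof (exp_source_dominated eps k C H y He Hk HC Hy HH) as Hd.
  pose proof (exp_source_dominated eps k C' H' y He Hk HC' Hy HH') as Hd'.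
  unfold avg.
  rewrite (prim_ext _ (fun y => exp (eps * y) * H y + h * (exp (eps * y) * H' y))); [|lra|intros; ring].
  rewrite prim_lin; [field; apply Rgt_not_eq, exp_pos|assumption|..].
  - split; [apply Hd|apply (tail_ex _ _ _ y Hy Hd)].
  - split; [apply Hd'|apply (tail_ex _ _ _ y Hy Hd')].
Qed.

Lemma avg_ext eps H H' y : y < 0 -> (forall y, y < 0 -> H y = H' y) -> avg eps H y = avg eps H' y.
Proof.
  intros Hy E. unfold avg. f_equal. apply prim_ext; [lra|]. intros t Ht. now rewrite E.
Qed.

Lemma Expd_avg n k G : 0 < k -> Expd n (wexp k) G -> Expd n (wexp (k / 2)) (fun eps h => avg eps (G eps h)).
Proof.
  intros Hk.
  assert (HB : forall G, Bd (wexp k) G -> Bd (wexp (k / 2)) (fun eps h => avg eps (G eps h))).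
  { intros G0 [C [HC H]]. exists (C / k). split.
    { apply Rmult_le_pos; [assumption|left; now apply Rinv_0_lt_compat]. }
    intros eps h y Hh Hy. apply avg_bound; trivial; [apply (increment_bounds eps h Hh)|].
    intros t Ht. destruct (H eps h t Hh Ht). now split. }
  revert G. induction n as [|n IH]; intros G HG; [now apply HB|].
  destruct HG as (a & G1 & Ha & HG1 & EG).
  exists (fun eps => avg eps (a eps)), (fun eps h => avg eps (G1 eps h)).
  split; [now apply (HB (fun eps _ => a eps))|]. split; [auto|]. intros eps h y Hh Hy.
  rewrite (avg_ext _ _ (fun y => a eps y + h * G1 eps h y)) by (intros; auto).
  destruct Ha as [C [HC Ha]]. destruct (Expd_bd _ _ _ HG1) as [C' [HC' HG1']].
  apply (avg_lin eps k C C'); trivial; [apply (increment_bounds eps h Hh)|..].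
  - intros t Ht. destruct (Ha eps h t Hh Ht). now split.
  - intros t Ht. destruct (HG1' eps h t Hh Ht). now split.
Qed.

Lemma avg_unique eps k C H r M : 0 < eps -> 0 < k -> 0 <= C ->
  (forall y, y < 0 -> continuous H y /\ Rabs (H y) <= C * exp (k * X eps y)) ->
  (forall y, y < 0 -> Rabs (r y) <= M) ->
  (forall y, y < 0 -> is_derive r y (- eps * r y + H y)) ->
  forall y, y < 0 -> r y = avg eps H y.
Proof.
  intros He Hk HC HH Hr Hdr y Hy.
  pose proof (exp_source_dominated eps k C H y He Hk HC Hy HH) as Hd.
  set (W := fun y => exp (eps * y) * r y).
  assert (HW : forall t, t < 0 -> is_derive W t (exp (eps * t) * H t)).
  { intros t Ht. deriv_as (eps * exp (eps * t) * r t + exp (eps * t) * (- eps * r t + H t)); [|ring].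
    apply (deriv_mult (fun y => exp (eps * y)) r); [auto_derive; [easy|ring]|auto]. }
  assert (Hl : is_lim_seq (fun n => W (- INR n)) 0).
  { assert (HM : 0 <= M) by (pose proof (Hr (-1) ltac:(lra)); pose proof (Rabs_pos (r (-1))); lra).
    assert (Hex : is_lim_seq (fun n => exp (eps * - INR n)) 0).
    { apply (is_lim_comp_seq exp (fun n => eps * - INR n) m_infty 0).
      - apply is_lim_exp_m.
      - exists 0%nat. easy.
      - replace m_infty with (Rbar_mult eps m_infty).
        2:{ unfold Rbar_mult, Rbar_mult'. destruct Rle_dec; [|lra]. destruct Rle_lt_or_eq_dec; [easy|lra]. }
        apply is_lim_seq_scal_l. apply (is_lim_seq_opp INR p_infty), is_lim_seq_INR. }
    apply (is_lim_seq_le_le_loc (fun n => - (M * exp (eps * - INR n))) _ (fun n => M * exp (eps * - INR n))).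
    - exists 1%nat. intros n Hn. apply le_INR in Hn. simpl in Hn.
      pose proof (Hr (- INR n) ltac:(lra)) as Hb. apply Rabs_le_between in Hb.
      pose proof (exp_pos (eps * - INR n)). unfold W. nra.
    - replace (Finite 0) with (Rbar_opp (Rbar_mult M 0)) by (simpl; f_equal; ring).
      apply (is_lim_seq_opp (fun n => M * exp (eps * - INR n))). now apply (is_lim_seq_scal_l _ M 0).
    - replace 0 with (M * 0) by ring. now apply (is_lim_seq_scal_l _ M 0). }
  assert (E : prim (fun y => exp (eps * y) * H y) y = W y).
  { assert (H1 := prim_lim _ _ _ y Hy Hd y Hy). apply is_lim_seq_unique in H1.
    assert (H2 : is_lim_seq (fun n => RInt (fun y => exp (eps * y) * H y) (- INR n) y) (W y - 0)).
    { apply (is_lim_seq_ext_loc (fun n => W y - W (- INR n))).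
      - exists 1%nat. intros n Hn. apply le_INR in Hn. simpl in Hn. symmetry. apply is_RInt_unique.
        apply (is_RInt_derive (V := R_CompleteNormedModule) W).
        + intros x Hx. apply HW. revert Hx. unfold Rmin, Rmax. destruct Rle_dec; lra.
        + intros x Hx. apply Hd. revert Hx. unfold Rmin, Rmax. destruct Rle_dec; lra.
      - apply is_lim_seq_minus'; [apply is_lim_seq_const|apply Hl]. }
    apply is_lim_seq_unique in H2. rewrite H1 in H2. injection H2. lra. }
  unfold avg. rewrite E. unfold W. field. apply Rgt_not_eq, exp_pos.
Qed.

(** * Taylor polynomials and remainders *)

Fixpoint psum (a : nat -> R) (h : R) (n : nat) : R :=
  match n with O => 0 | S n => psum a h n + a n * h ^ n end.

Lemma pow_succ_deriv n h : is_derive (fun h => h ^ S n) h (INR (S n) * h ^ n).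
Proof.
  deriv_as (INR (S n) * 1 * h ^ Nat.pred (S n)); [|rewrite Nat.pred_succ; ring].
  apply (is_derive_pow (fun h => h) (S n)). auto_derive; easy.
Qed.

Lemma psum_deriv a h n : is_derive (fun h => psum a h (S n)) h (psum (fun k => INR (S k) * a (S k)) h n).
Proof.
  induction n as [|n IH].
  - simpl. auto_derive; [easy|ring].
  - change (is_derive (fun h => psum a h (S n) + a (S n) * h ^ S n) h
      (psum (fun k => INR (S k) * a (S k)) h n + INR (S n) * a (S n) * h ^ n)).
    apply (deriv_plus (fun h => psum a h (S n))); [assumption|].
    deriv_as (a (S n) * (INR (S n) * h ^ n)); [|ring].
    apply (is_derive_scal (fun h => h ^ S n)), pow_succ_deriv.
Qed.

Lemma psum_0 a n : psum a 0 (S n) = a 0%nat.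
Proof. induction n as [|n IH]; [simpl; ring|]. change (psum a 0 (S n) + a (S n) * 0 ^ S n = a 0%nat). rewrite IH, pow_ne_zero by lia. ring. Qed.

Lemma psum_ext a b h n : (forall k, (k < n)%nat -> a k = b k) -> psum a h n = psum b h n.
Proof. induction n as [|n IH]; intros H; simpl; [easy|]. rewrite IH, H; auto. Qed.

Definition remainder (d : nat -> R -> R) (j n : nat) (x h : R) : R :=
  d j (x + h) - psum (fun k => d (j + k)%nat x / INR (fact k)) h n.

(** The derivative in [h] of the remainder of [d j] is the remainder of [d (S j)] with one term
    less; hence induction on [n] for all [j], with the mean value theorem. *)
Lemma taylor_bound (d : nat -> R -> R) (x r M : R) (n : nat) : forall j,
  (forall k t, Rabs (t - x) <= r -> is_derive (d k) t (d (S k) t)) ->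
  (forall t, Rabs (t - x) <= r -> Rabs (d (j + n)%nat t) <= M) ->
  forall h, Rabs h <= r -> Rabs (remainder d j n x h) <= M * Rabs h ^ n.
Proof.
  intros j Hd. revert j. induction n as [|n IH]; intros j HM h Hh.
  - unfold remainder. simpl. rewrite Rminus_0_r, Rmult_1_r. rewrite Nat.add_0_r in HM. apply HM.
    replace (x + h - x) with h by ring. assumption.
  - assert (Hder : forall t, Rabs t <= r -> is_derive (remainder d j (S n) x) t (remainder d (S j) n x t)).
    { intros t Ht. unfold remainder.
      apply (deriv_minus (fun h => d j (x + h))).
      - deriv_as (1 * d (S j) (x + t)); [|ring].
        apply (deriv_comp (d j) (fun h => x + h)); [|auto_derive; [easy|ring]].
        apply Hd. replace (x + t - x) with t by ring. assumption.
      - deriv_as (psum (fun k => INR (S k) * (d (j + S k)%nat x / INR (fact (S k)))) t n).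
        + apply (psum_deriv (fun k => d (j + k)%nat x / INR (fact k))).
        + apply psum_ext. intros k _. rewrite Nat.add_succ_r.
          change (fact (S k)) with ((S k * fact k)%nat). rewrite mult_INR. simpl (S j + k)%nat.
          field. split; [apply not_0_INR, fact_neq_0|apply not_0_INR; lia]. }
    destruct (MVT_gen (remainder d j (S n) x) 0 h (remainder d (S j) n x)) as [xi [Hxi E]].
    + intros t Ht. apply Hder. revert Ht Hh. unfold Rmin, Rmax, Rabs. repeat destruct Rle_dec; repeat destruct Rcase_abs; lra.
    + intros t Ht. apply cont_pt. apply (deriv_cont _ _ (remainder d (S j) n x t)). apply Hder.
      revert Ht Hh. unfold Rmin, Rmax, Rabs. repeat destruct Rle_dec; repeat destruct Rcase_abs; lra.
    + assert (E0 : remainder d j (S n) x 0 = 0).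
      { unfold remainder. rewrite psum_0, Rplus_0_r, Nat.add_0_r. simpl. field. }
      rewrite E0, !Rminus_0_r in E. rewrite E, Rabs_mult. simpl.
      assert (Hx : Rabs xi <= Rabs h).
      { revert Hxi. unfold Rmin, Rmax, Rabs. repeat destruct Rle_dec; repeat destruct Rcase_abs; lra. }
      assert (HI : Rabs (remainder d (S j) n x xi) <= M * Rabs xi ^ n).
      { apply IH; [|lra]. intros t Ht. rewrite Nat.add_succ_comm. now apply HM. }
      assert (0 <= M).
      { specialize (HM x). rewrite Rminus_diag, Rabs_R0 in HM. pose proof (Rabs_pos (d (j + S n)%nat x)).
        pose proof (Rabs_pos h). specialize (HM ltac:(lra)). lra. }
      assert (Rabs xi ^ n <= Rabs h ^ n) by (apply pow_incr; split; [apply Rabs_pos|assumption]).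
      rewrite (Rmult_comm (Rabs h)), <- Rmult_assoc. apply Rmult_le_compat_r; [apply Rabs_pos|]. nra.
Qed.

(** * Derivatives of the forcing with respect to [eps] *)

Lemma exp_pow_nat x n : exp x ^ n = exp (INR n * x).
Proof.
  induction n as [|n IH]; [simpl; now rewrite Rmult_0_l, exp_0|].
  rewrite S_INR. simpl pow. rewrite IH, <- exp_plus. f_equal. ring.
Qed.

(** The k-th derivative of X in eps: differentiate e X = exp (e y) - 1 by the Leibniz rule and solve
    for the top derivative. *)
Fixpoint XD (k : nat) (e y : R) : R :=
  match k with
  | O => (exp (e * y) - 1) / e
  | S k => (y ^ S k * exp (e * y) - INR (S k) * XD k e y) / e
  end.

Lemma XD_X e y : y <= 0 -> XD 0 e y = X e y.
Proof. intros Hy. simpl. unfold X, lay, thy. rewrite Rmin_left by lra. easy. Qed.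

Lemma XD_deriv_eps k e y : 0 < e -> is_derive (fun e => XD k e y) e (XD (S k) e y).
Proof.
  intros He. induction k as [|k IH].
  - simpl. auto_derive; [lra|]. field. lra.
  - deriv_as (((y ^ S k * (y * exp (e * y)) - INR (S k) * XD (S k) e y) * e - (y ^ S k * exp (e * y) - INR (S k) * XD k e y) * 1) / e ^ 2).
    + change (fun e => XD (S k) e y) with (fun e => (y ^ S k * exp (e * y) - INR (S k) * XD k e y) / e).
      apply (deriv_div (fun e => y ^ S k * exp (e * y) - INR (S k) * XD k e y) (fun e => e)); [|auto_derive; easy|lra].
      apply (deriv_minus (fun e => y ^ S k * exp (e * y))).
      * apply (is_derive_scal (fun e => exp (e * y))). auto_derive; [easy|ring].
      * now apply (is_derive_scal (fun e => XD k e y)).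
    + change (XD (S (S k)) e y) with ((y ^ S (S k) * exp (e * y) - INR (S (S k)) * XD (S k) e y) / e).
      rewrite (S_INR (S k)).
      change (XD (S k) e y) with ((y ^ S k * exp (e * y) - INR (S k) * XD k e y) / e).
      simpl pow. field. lra.
Qed.

(** Hence [XD k e y] is minus the integral of s^k exp (e s) over [y, 0], a form in which the
    negative powers of [e] have disappeared. *)
Lemma XD_deriv_y k e y : 0 < e -> is_derive (XD k e) y (y ^ k * exp (e * y)).
Proof.
  intros He. induction k as [|k IH].
  - simpl. auto_derive; [easy|]. field. lra.
  - change (XD (S k) e) with (fun y => (y ^ S k * exp (e * y) - INR (S k) * XD k e y) / e).
    deriv_as ((INR (S k) * y ^ k * exp (e * y) + y ^ S k * (e * exp (e * y)) - INR (S k) * (y ^ k * exp (e * y))) * / e).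
    + apply (is_derive_scal_l (fun y => y ^ S k * exp (e * y) - INR (S k) * XD k e y) y _ (/ e)).
      apply (deriv_minus (fun y => y ^ S k * exp (e * y))).
      * apply (deriv_mult (fun y => y ^ S k) (fun y => exp (e * y))); [apply pow_succ_deriv|]. auto_derive; [easy|ring].
      * now apply (is_derive_scal (XD k e)).
    + field. lra.
Qed.

Lemma XD_cont k e y : 0 < e -> continuous (XD k e) y.
Proof. intros He. exact (deriv_cont _ _ _ (XD_deriv_y k e y He)). Qed.

Lemma XD_0 k e : 0 < e -> XD k e 0 = 0.
Proof.
  intros He. induction k as [|k IH]; simpl.
  - rewrite Rmult_0_r, exp_0. field. lra.
  - rewrite IH. field. lra.
Qed.

(** Half of the exponential is distributed over the [k] factors as [w ^ k], and [sinh_ge] bounds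
    each [- s * w] by [k] times [- XD 0 e s]. For [k = 0] the convention [0 ^ 0 = 1] applies. *)
Lemma pow_le_XD k e s : 0 < e -> s <= 0 ->
  Rabs (s ^ k * exp (e * s)) <= INR k ^ k * (- XD 0 e s) ^ k * exp (e * s / 2).
Proof.
  intros He Hs.
  destruct k as [|k].
  { simpl. rewrite !Rmult_1_l, Rabs_right by (apply Rle_ge; left; apply exp_pos). apply exp_mono. nra. }
  assert (Hk : 0 < INR (S k)) by (apply lt_0_INR; lia).
  rewrite Rabs_mult, (Rabs_right (exp _)) by (apply Rle_ge; left; apply exp_pos).
  rewrite <- RPow_abs, (Rabs_left1 s) by lra. rewrite <- Rpow_mult_distr.
  set (w := exp (e * s / (2 * INR (S k)))).
  assert (Ew : exp (e * s / 2) = w ^ S k).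
  { unfold w. rewrite exp_pow_nat. f_equal. field. lra. }
  replace (exp (e * s)) with (w ^ S k * exp (e * s / 2)).
  2:{ rewrite <- Ew, <- exp_plus. f_equal. field. }
  rewrite <- Rmult_assoc, <- Rpow_mult_distr.
  apply Rmult_le_compat_r; [left; apply exp_pos|].
  assert (Hw : 0 < w) by apply exp_pos.
  apply pow_incr. split; [nra|].
  set (a := - (e * s / INR (S k))).
  assert (Ha : 0 <= a).
  { unfold a. enough (0 <= - (e * s) / INR (S k)) by (unfold Rdiv in *; lra).
    apply Rmult_le_pos; [nra|left; now apply Rinv_0_lt_compat]. }
  pose proof (sinh_ge a Ha) as H.
  replace (- a / 2) with (e * s / (2 * INR (S k))) in H by (unfold a; field; lra). fold w in H.
  assert (H2 : exp (e * s) <= exp (- a)).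
  { apply exp_mono. unfold a. rewrite Ropp_involutive.
    assert (1 <= INR (S k)) by (rewrite S_INR; pose proof (pos_INR k); lra).
    apply Rmult_le_reg_r with (INR (S k)); [assumption|].
    replace (e * s / INR (S k) * INR (S k)) with (e * s) by (field; lra).
    assert (e * s <= 0) by nra. nra. }
  simpl XD.
  apply Rmult_le_reg_r with (e / INR (S k)); [now apply Rdiv_lt_0_compat|].
  replace (INR (S k) * - ((exp (e * s) - 1) / e) * (e / INR (S k))) with (1 - exp (e * s)) by (field; lra).
  replace (- s * w * (e / INR (S k))) with (a * w) by (unfold a; field; lra). lra.
Qed.

Lemma XD0_mono e y s : 0 < e -> y <= s -> XD 0 e y <= XD 0 e s.
Proof.
  intros He Hs. simpl. apply Rmult_le_compat_r; [left; now apply Rinv_0_lt_compat|].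
  enough (exp (e * y) <= exp (e * s)) by lra. apply exp_mono. nra.
Qed.

Lemma XD_bound k e y : 0 < e -> y <= 0 -> Rabs (XD k e y) <= 2 * INR k ^ k * (- XD 0 e y) ^ S k.
Proof.
  intros He Hy.
  set (K := INR k ^ k * (- XD 0 e y) ^ k).
  assert (Hx : 0 <= - XD 0 e y).
  { pose proof (XD0_mono e y 0 He Hy). rewrite XD_0 in H by assumption. lra. }
  assert (HK : 0 <= K) by (apply Rmult_le_pos; apply pow_le; [apply pos_INR|assumption]).
  assert (Hb : forall s, y <= s <= 0 -> Rabs (s ^ k * exp (e * s)) <= K * exp (e * s / 2)).
  { intros s Hs. eapply Rle_trans; [apply pow_le_XD; lra|].
    apply Rmult_le_compat_r; [left; apply exp_pos|]. apply Rmult_le_compat_l; [apply pow_le, pos_INR|].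
    apply pow_incr. pose proof (XD0_mono e y s He ltac:(lra)).
    pose proof (XD0_mono e s 0 He ltac:(lra)). rewrite XD_0 in H0 by assumption. lra. }
  set (B := fun s => K * (2 / e) * exp (e * s / 2)).
  assert (HB : forall s, is_derive B s (K * exp (e * s / 2))).
  { intros s. unfold B. auto_derive; [easy|]. unfold Rdiv. field. lra. }
  assert (H1 : B y - XD k e y <= B 0 - XD k e 0).
  { apply (nondecreasing_of_derive (fun s => B s - XD k e s) (fun s => K * exp (e * s / 2) - s ^ k * exp (e * s)) y 0 Hy).
    - intros t _. apply cont_minus; [exact (deriv_cont _ _ _ (HB t))|now apply XD_cont].
    - intros t _. apply deriv_minus; [apply HB|now apply XD_deriv_y].
    - intros t Ht. specialize (Hb t ltac:(lra)). apply Rabs_le_between in Hb. lra. }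
  assert (H2 : B y + XD k e y <= B 0 + XD k e 0).
  { apply (nondecreasing_of_derive (fun s => B s + XD k e s) (fun s => K * exp (e * s / 2) + s ^ k * exp (e * s)) y 0 Hy).
    - intros t _. apply cont_plus; [exact (deriv_cont _ _ _ (HB t))|now apply XD_cont].
    - intros t _. apply deriv_plus; [apply HB|now apply XD_deriv_y].
    - intros t Ht. specialize (Hb t ltac:(lra)). apply Rabs_le_between in Hb. lra. }
  rewrite XD_0 in H1, H2 by assumption.
  assert (H3 : B 0 - B y <= 2 * K * (- XD 0 e y)).
  { unfold B. simpl XD. replace (e * 0 / 2) with 0 by field. rewrite exp_0.
    assert (exp (e * y) <= exp (e * y / 2)) by (apply exp_mono; nra).
    replace (K * (2 / e) * 1 - K * (2 / e) * exp (e * y / 2)) with (K * (2 / e) * (1 - exp (e * y / 2))) by ring.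
    replace (2 * K * - ((exp (e * y) - 1) / e)) with (K * (2 / e) * (1 - exp (e * y))) by (field; lra).
    apply Rmult_le_compat_l; [|lra]. apply Rmult_le_pos; [assumption|].
    left. apply Rdiv_lt_0_compat; lra. }
  replace (2 * INR k ^ k * (- XD 0 e y) ^ S k) with (2 * K * (- XD 0 e y)) by (unfold K; simpl; ring).
  apply Rabs_le. lra.
Qed.

(** Polynomials without constant term in the derivatives of X, kept as syntax so that
    differentiation stays inside the class and bounds go by induction. The missing constant term
    yields a factor X, and so the weight [tau]. *)
Inductive xterm : Type := XV (k : nat) | XAdd (a b : xterm) | XMul (a b : xterm).

Fixpoint xeval (t : xterm) (e y : R) : R :=
  match t with
  | XV k => XD k e y
  | XAdd a b => xeval a e y + xeval b e y
  | XMul a b => xeval a e y * xeval b e y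
  end.

Fixpoint xderiv (t : xterm) : xterm :=
  match t with
  | XV k => XV (S k)
  | XAdd a b => XAdd (xderiv a) (xderiv b)
  | XMul a b => XAdd (XMul (xderiv a) b) (XMul a (xderiv b))
  end.

Lemma xeval_deriv t e y : 0 < e -> is_derive (fun e => xeval t e y) e (xeval (xderiv t) e y).
Proof.
  intros He. induction t as [k|a IHa b IHb|a IHa b IHb].
  - now apply XD_deriv_eps.
  - now apply (deriv_plus (fun e => xeval a e y) (fun e => xeval b e y)).
  - now apply (deriv_mult (fun e => xeval a e y) (fun e => xeval b e y)).
Qed.

Lemma xeval_cont t e y : 0 < e -> continuous (xeval t e) y.
Proof.
  intros He. induction t as [k|a IHa b IHb|a IHa b IHb].
  - now apply XD_cont.
  - now apply (cont_plus (xeval a e) (xeval b e)).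
  - now apply (cont_mult (xeval a e) (xeval b e)).
Qed.

Lemma xeval_bound t : exists C j, 0 <= C /\ forall e y, 0 < e -> y <= 0 ->
  Rabs (xeval t e y) <= C * (- XD 0 e y) * (1 + - XD 0 e y) ^ j.
Proof.
  assert (Hx : forall e y, 0 < e -> y <= 0 -> 0 <= - XD 0 e y).
  { intros e y He Hy. pose proof (XD0_mono e y 0 He Hy). rewrite XD_0 in H by assumption. lra. }
  induction t as [k|a (C1 & j1 & HC1 & H1) b (C2 & j2 & HC2 & H2)|a (C1 & j1 & HC1 & H1) b (C2 & j2 & HC2 & H2)].
  - exists (2 * INR k ^ k), k. split; [apply Rmult_le_pos; [lra|apply pow_le, pos_INR]|].
    intros e y He Hy. eapply Rle_trans; [now apply XD_bound|]. specialize (Hx e y He Hy).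
    set (x := - XD 0 e y) in *. simpl pow. rewrite <- Rmult_assoc. apply Rmult_le_compat_l.
    + apply Rmult_le_pos; [|assumption]. apply Rmult_le_pos; [lra|apply pow_le, pos_INR].
    + apply pow_incr. lra.
  - exists (C1 + C2), (j1 + j2)%nat. split; [lra|]. intros e y He Hy. specialize (Hx e y He Hy).
    specialize (H1 e y He Hy). specialize (H2 e y He Hy). simpl xeval. set (x := - XD 0 e y) in *.
    rewrite pow_add.
    assert (P1 : 1 <= (1 + x) ^ j1) by (apply pow_R1_Rle; lra).
    assert (P2 : 1 <= (1 + x) ^ j2) by (apply pow_R1_Rle; lra).
    eapply Rle_trans; [apply Rabs_triang|].
    assert (C1 * x * (1 + x) ^ j1 <= C1 * x * ((1 + x) ^ j1 * (1 + x) ^ j2)) by (apply Rmult_le_compat_l; nra).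
    assert (C2 * x * (1 + x) ^ j2 <= C2 * x * ((1 + x) ^ j1 * (1 + x) ^ j2)) by (apply Rmult_le_compat_l; nra).
    lra.
  - exists (C1 * C2), (S (j1 + j2))%nat. split; [nra|]. intros e y He Hy. specialize (Hx e y He Hy).
    specialize (H1 e y He Hy). specialize (H2 e y He Hy). simpl xeval. set (x := - XD 0 e y) in *.
    rewrite Rabs_mult. simpl pow. rewrite pow_add.
    eapply Rle_trans; [apply Rmult_le_compat; [apply Rabs_pos|apply Rabs_pos|exact H1|exact H2]|].
    assert (P1 : 1 <= (1 + x) ^ j1) by (apply pow_R1_Rle; lra).
    assert (P2 : 1 <= (1 + x) ^ j2) by (apply pow_R1_Rle; lra).
    replace (C1 * x * (1 + x) ^ j1 * (C2 * x * (1 + x) ^ j2)) with (C1 * C2 * x * ((1 + x) ^ j1 * (1 + x) ^ j2) * x) by ring.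
    replace (C1 * C2 * x * ((1 + x) * ((1 + x) ^ j1 * (1 + x) ^ j2))) with (C1 * C2 * x * ((1 + x) ^ j1 * (1 + x) ^ j2) * (1 + x)) by ring.
    apply Rmult_le_compat_l; [|lra]. repeat apply Rmult_le_pos; lra.
Qed.

(** Cofactor of exp X in the n-th derivative of X exp X, from (exp X T)' = exp X (T' + X' T). *)
Fixpoint forc_term (n : nat) : xterm :=
  match n with
  | O => XV 0
  | S n => XAdd (xderiv (forc_term n)) (XMul (XV 1) (forc_term n))
  end.

Definition forc_deriv (n : nat) (e y : R) : R := exp (XD 0 e y) * xeval (forc_term n) e y.

Lemma forc_deriv_0 e y : y <= 0 -> forc_deriv 0 e y = forc e y.
Proof. intros Hy. unfold forc_deriv, forc. change (xeval (forc_term 0) e y) with (XD 0 e y). rewrite XD_X by assumption. ring. Qed.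

Lemma forc_deriv_derive n e y : 0 < e ->
  is_derive (fun e => forc_deriv n e y) e (forc_deriv (S n) e y).
Proof.
  intros He. unfold forc_deriv.
  deriv_as (XD 1 e y * exp (XD 0 e y) * xeval (forc_term n) e y + exp (XD 0 e y) * xeval (xderiv (forc_term n)) e y).
  - apply (deriv_mult (fun e => exp (XD 0 e y)) (fun e => xeval (forc_term n) e y)); [|now apply xeval_deriv].
    apply (deriv_comp exp (fun e => XD 0 e y)); [auto_derive; [easy|ring]|]. now apply XD_deriv_eps.
  - change (forc_term (S n)) with (XAdd (xderiv (forc_term n)) (XMul (XV 1) (forc_term n))).
    cbn [xeval]. ring.
Qed.

Lemma forc_deriv_cont n e y : 0 < e -> continuous (forc_deriv n e) y.
Proof.
  intros He. unfold forc_deriv. pose proof (XD_cont 0 e y He). pose proof (xeval_cont (forc_term n) e y He). cont.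
Qed.

Lemma pow_exp_bound (m : nat) (a : R) : 0 <= a -> (1 + a) ^ S m <= (2 * INR (S m)) ^ S m * exp (a / 2).
Proof.
  intros Ha. assert (Hm : 1 <= INR (S m)) by (rewrite S_INR; pose proof (pos_INR m); lra).
  set (w := exp (a / (2 * INR (S m)))).
  replace (exp (a / 2)) with (w ^ S m).
  2:{ unfold w. rewrite exp_pow_nat. f_equal. field. lra. }
  rewrite <- Rpow_mult_distr. apply pow_incr. split; [lra|].
  assert (1 + a / (2 * INR (S m)) <= w) by apply exp_ineq1_le.
  apply Rmult_le_compat_l with (r := 2 * INR (S m)) in H; [|lra].
  replace (2 * INR (S m) * (1 + a / (2 * INR (S m)))) with (2 * INR (S m) + a) in H by (field; lra). lra.
Qed.

(** Half of the exponential absorbs the powers of [a = - X], and [a <= (1 + a) * (1 - exp (- a))]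
    converts the remaining factor [a] into [tau]. *)
Lemma forc_deriv_bound n : exists C, 0 <= C /\ forall e y, 0 < e -> y < 0 ->
  Rabs (forc_deriv n e y) <= C * (tau e y * exp (X e y / 2)).
Proof.
  destruct (xeval_bound (forc_term n)) as (C & j & HC & H).
  exists (C * (2 * INR (S j)) ^ S j). split.
  { apply Rmult_le_pos; [assumption|]. apply pow_le. pose proof (pos_INR (S j)). lra. }
  intros e y He Hy. specialize (H e y He ltac:(lra)). unfold forc_deriv.
  rewrite XD_X in * by lra. pose proof (X_neg e y He Hy) as HX. set (a := - X e y) in *.
  rewrite Rabs_mult, Rabs_right by (apply Rle_ge; left; apply exp_pos).
  assert (Hta : a <= (1 + a) * tau e y).
  { unfold tau. pose proof (exp_ineq1_le a).
    assert (E : exp (X e y) * exp a = 1) by (unfold a; rewrite <- exp_plus, Rplus_opp_r; apply exp_0).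
    pose proof (exp_pos (X e y)). unfold a in *. nra. }
  assert (Ha : 0 < a) by (unfold a; lra).
  assert (E : exp (X e y) = exp (X e y / 2) * exp (- (a / 2))).
  { rewrite <- exp_plus. f_equal. unfold a. field. }
  pose proof (pow_exp_bound j a ltac:(lra)) as Hp.
  assert (E2 : exp (a / 2) * exp (- (a / 2)) = 1) by (rewrite <- exp_plus, Rplus_opp_r; apply exp_0).
  pose proof (exp_pos (X e y / 2)). pose proof (exp_pos (- (a / 2))).
  assert (H3 : C * a * (1 + a) ^ j <= C * (tau e y * (1 + a) ^ S j)).
  { simpl pow. rewrite Rmult_assoc. apply Rmult_le_compat_l; [assumption|].
    rewrite <- Rmult_assoc. apply Rmult_le_compat_r; [apply pow_le; lra|]. lra. }
  pose proof (tau_pos e y He Hy).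
  assert (H4 : exp (- (a / 2)) * (tau e y * (1 + a) ^ S j) <= tau e y * (2 * INR (S j)) ^ S j).
  { apply Rmult_le_compat_l with (r := tau e y * exp (- (a / 2))) in Hp; [|apply Rmult_le_pos; lra].
    replace (tau e y * exp (- (a / 2)) * ((2 * INR (S j)) ^ S j * exp (a / 2)))
      with (tau e y * (2 * INR (S j)) ^ S j * (exp (a / 2) * exp (- (a / 2)))) in Hp by ring.
    rewrite E2 in Hp. lra. }
  rewrite E, Rmult_assoc.
  apply Rle_trans with (exp (X e y / 2) * (C * (tau e y * (2 * INR (S j)) ^ S j))); [|right; ring].
  apply Rmult_le_compat_l; [lra|].
  apply Rle_trans with (exp (- (a / 2)) * (C * (tau e y * (1 + a) ^ S j))).
  - apply Rmult_le_compat_l; lra.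
  - rewrite <- Rmult_assoc, (Rmult_comm _ C), Rmult_assoc. apply Rmult_le_compat_l; assumption.
Qed.

Definition wforc (eps y : R) : R := tau eps y * wexp (1 / 4) eps y.

Lemma forc_deriv_bound_near n : exists C, 0 <= C /\ forall eps t y, 0 < eps < e0 -> y < 0 -> Rabs (t - eps) <= eps / 2 ->
  Rabs (forc_deriv n t y) <= C * wforc eps y.
Proof.
  destruct (forc_deriv_bound n) as (C & HC & H). exists (2 * C). split; [lra|].
  intros eps t y He Hy Ht. apply Rabs_le_between in Ht.
  specialize (H t y ltac:(lra) Hy). unfold wforc, wexp.
  pose proof (tau_compare eps t y ltac:(lra) ltac:(lra) ltac:(lra) Hy).
  pose proof (X_compare t eps y ltac:(lra) ltac:(lra) ltac:(lra) Hy).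
  assert (exp (X t y / 2) <= exp (1 / 4 * X eps y)) by (apply exp_mono; lra).
  pose proof (exp_pos (X t y / 2)). pose proof (tau_pos t y ltac:(lra) Hy).
  assert (tau t y * exp (X t y / 2) <= (2 * tau eps y) * exp (1 / 4 * X eps y)) by (apply Rmult_le_compat; lra).
  nra.
Qed.

Definition forc_quot (eps h y : R) : R := (forc (eps + h) y - forc eps y) / h.

(** [G k] is the Taylor remainder of order [S k] divided by [h ^ S k]. It equals the next Taylor
    coefficient plus [h * G (S k)], so all [k] are treated together. *)
Lemma Expd_forc n : Expd n wforc forc_quot.
Proof.
  set (G := fun k eps h y => remainder (fun k e => forc_deriv k e y) 0 (S k) eps h / h ^ S k).
  apply (Expd_ext n wforc (G 0%nat)).
  { intros eps h y Hh Hy. unfold G, remainder, forc_quot. simpl.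
    rewrite !forc_deriv_0 by lra. destruct Hh as (_ & Hh & _). field. assumption. }
  assert (Hder : forall k eps t y, 0 < eps < e0 -> Rabs (t - eps) <= eps / 2 ->
     is_derive (fun e => forc_deriv k e y) t (forc_deriv (S k) t y)).
  { intros k eps t y He Ht. apply Rabs_le_between in Ht. apply forc_deriv_derive. lra. }
  assert (HG : forall k, Bd wforc (G k)).
  { intros k. destruct (forc_deriv_bound_near (S k)) as (C & HC & HB). exists C. split; [assumption|].
    intros eps h y Hh Hy. destruct (Hh) as (He & Hh0 & Hh1 & _). split.
    - unfold G, Rdiv. rewrite Rabs_mult, Rabs_inv, <- RPow_abs.
      assert (Hp : 0 < Rabs h ^ S k) by (apply pow_lt; now apply Rabs_pos_lt).
      apply Rmult_le_reg_r with (Rabs h ^ S k); [assumption|].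
      rewrite Rmult_assoc, Rinv_l, Rmult_1_r by lra.
      apply (taylor_bound (fun k e => forc_deriv k e y) eps (eps / 2)); [|intros t Ht; now apply HB|assumption].
      intros m t Ht. now apply (Hder m eps).
    - unfold G, remainder. apply cont_mult; [|apply cont_const]. apply cont_minus.
      + apply forc_deriv_cont. pose proof (increment_bounds eps h Hh). lra.
      + generalize (S k). intros m. induction m as [|m IH]; simpl; [apply cont_const|].
        apply cont_plus; [assumption|]. apply cont_mult; [|apply cont_const].
        apply cont_div; [|apply cont_const|apply not_0_INR, fact_neq_0].
        apply forc_deriv_cont. lra. }
  assert (HD : forall k, Bd wforc (fun eps _ y => forc_deriv k eps y / INR (fact k))).
  { intros k. destruct (forc_deriv_bound_near k) as (C & HC & HB).
    assert (Hf : 1 <= INR (fact k)) by (apply (le_INR 1); apply lt_O_fact).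
    exists C. split; [assumption|]. intros eps h y Hh Hy. destruct (Hh) as (He & _). split.
    - unfold Rdiv. rewrite Rabs_mult, Rabs_inv, (Rabs_right (INR _)) by lra.
      specialize (HB eps eps y He Hy). rewrite Rminus_diag, Rabs_R0 in HB. specialize (HB ltac:(lra)).
      assert (/ INR (fact k) <= 1) by (rewrite <- Rinv_1; apply Rinv_le_contravar; lra).
      assert (0 < / INR (fact k)) by (apply Rinv_0_lt_compat; lra).
      pose proof (Rabs_pos (forc_deriv k eps y)). nra.
    - apply cont_div; [|apply cont_const|lra]. apply forc_deriv_cont. lra. }
  generalize 0%nat. induction n as [|n IH]; intros k; [apply HG|].
  exists (fun eps y => forc_deriv (S k) eps y / INR (fact (S k))), (G (S k)).
  split; [apply (HD (S k))|]. split; [apply IH|]. intros eps h y Hh Hy.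
  destruct Hh as (_ & Hh & _). unfold G, remainder.
  change (psum (fun k0 => forc_deriv (0 + k0) eps y / INR (fact k0)) h (S (S k)))
    with (psum (fun k0 => forc_deriv (0 + k0) eps y / INR (fact k0)) h (S k) + forc_deriv (S k) eps y / INR (fact (S k)) * h ^ S k).
  change (h ^ S (S k)) with (h * h ^ S k).
  field. repeat split; first [assumption|now apply pow_nonzero|apply not_0_INR, fact_neq_0].
Qed.

(** * Expansion of the threshold speed *)

Definition cb_quot (eps h y : R) : R := (cb (eps + h) - cb eps) / h.
Definition prof_quot (eps h y : R) : R := (prof (eps + h) y - prof eps y) / h.
Definition sq_quot (eps h y : R) : R := (prof (eps + h) y ^ 2 - prof eps y ^ 2) / h.
(** The equation for this difference has a decaying source, so it inherits the exponential weight
    that [source0] requires of the next order of [gap']; bounds on the two quotients separately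
    would not give it. *)
Definition gap_quot (eps h y : R) : R := cb_quot eps h y - prof_quot eps h y.
Definition gap (eps y : R) : R := cb eps - prof eps y.
Definition gap' (eps h y : R) : R := gap (eps + h) y.
Definition prof' (eps h y : R) : R := prof (eps + h) y.
Definition iprof' (eps h y : R) : R := / prof (eps + h) y.
(** Source left when linearizing about the mean of two profiles: it contains no quotient of the
    unknowns. *)
Definition source0 (eps h y : R) : R := 2 * (prof' eps h y * gap' eps h y) + forc_quot eps h y.
(** Source when linearizing about the profile at [eps] alone; the quadratic remainder carries
    [h]. *)
Definition source1 (eps h y : R) : R :=
  source0 eps h y + h * (eps * (2 * (cb_quot eps h y * prof_quot eps h y)
    - cb eps * (prof_quot eps h y * prof_quot eps h y * / prof eps y))).
Definition gap_source (eps h y : R) : R :=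
  - (gap' eps h y + / 2 * (forc_quot eps h y * iprof' eps h y
      - forc eps y * / prof eps y * (prof_quot eps h y * iprof' eps h y))).
Definition wtaui (eps y : R) : R := / tau eps y.
Definition weps (eps y : R) : R := eps.

Lemma nw_taui : nonneg_weight wtaui.
Proof. intros eps y He Hy. left. apply Rinv_0_lt_compat, tau_pos; lra. Qed.

Lemma nw_eps : nonneg_weight weps.
Proof. intros eps y He Hy. unfold weps. lra. Qed.

Section Increment.
Variables (eps h : R).
Hypothesis Hh : increment eps h.

Let He : 0 < eps <= e0. Proof. apply (increment_bounds eps h Hh). Qed.
Let He' : 0 < eps + h <= e0. Proof. apply (increment_bounds eps h Hh). Qed.
Let Hr : eps / 2 <= eps + h <= 3 / 2 * eps. Proof. apply (increment_bounds eps h Hh). Qed.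
Let Hh0 : h <> 0. Proof. apply Hh. Qed.

Lemma incr_prof_bounds y : y < 0 -> tau eps y / 6 <= prof' eps h y <= 8 * tau eps y.
Proof.
  intros Hy. unfold prof'. pose proof (prof_lower (eps + h) He' y). pose proof (prof_upper (eps + h) He' y).
  pose proof (tau_compare (eps + h) eps y ltac:(lra) ltac:(lra) ltac:(lra) Hy).
  pose proof (tau_compare eps (eps + h) y ltac:(lra) ltac:(lra) ltac:(lra) Hy). lra.
Qed.

Lemma incr_gap_bounds y : y < 0 -> 0 <= gap' eps h y <= 3 * wexp (1 / 8) eps y.
Proof.
  intros Hy. unfold gap', gap. pose proof (prof_defect (eps + h) He' y).
  pose proof (X_compare (eps + h) eps y ltac:(lra) ltac:(lra) ltac:(lra) Hy).
  assert (exp (X (eps + h) y / 4) <= wexp (1 / 8) eps y) by (apply exp_mono; lra). lra.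
Qed.

Lemma incr_prof_cont y : continuous (prof' eps h) y.
Proof. apply prof_cont, He'. Qed.

Lemma sq_quot_derive y : y < 0 ->
  is_derive (sq_quot eps h) y
   ((2 * (eps + h) * (prof' eps h y * gap' eps h y) - 2 * eps * (prof eps y * gap eps y)) / h + forc_quot eps h y).
Proof.
  intros Hy. unfold sq_quot, prof', gap', gap.
  pose proof (prof_pos eps He y Hy). pose proof (prof_pos (eps + h) He' y Hy).
  assert (D : forall e, 0 < e <= e0 -> is_derive (fun y => prof e y ^ 2) y (2 * e * (prof e y * (cb e - prof e y)) + forc e y)).
  { intros e Hee. pose proof (prof_pos e Hee y Hy).
    deriv_as ((e * (cb e - prof e y) + forc e y / (2 * prof e y)) * (2 * prof e y)).
    - apply (deriv_comp (fun u => u ^ 2) (prof e)); [auto_derive; [easy|ring]|]. now apply prof_deriv.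
    - field. lra. }
  deriv_as ((2 * (eps + h) * (prof (eps + h) y * (cb (eps + h) - prof (eps + h) y)) + forc (eps + h) y
             - (2 * eps * (prof eps y * (cb eps - prof eps y)) + forc eps y)) * / h).
  - apply (is_derive_scal_l (fun y => prof (eps + h) y ^ 2 - prof eps y ^ 2) y _ (/ h)).
    apply (deriv_minus (fun y => prof (eps + h) y ^ 2) (fun y => prof eps y ^ 2)); now apply D.
  - unfold forc_quot. field. assumption.
Qed.

Definition mean_speed : R := (cb eps + cb (eps + h)) / 2.
Definition mean_prof (y : R) : R := (prof eps y + prof (eps + h) y) / 2.

Lemma mean_admissible : admissible eps mean_speed mean_prof.
Proof.
  split; [assumption|]. intros y Hy. unfold mean_speed, mean_prof.
  pose proof (prof_cont eps He y). pose proof (incr_prof_cont y) as C2.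
  pose proof (incr_prof_bounds y Hy) as B1. pose proof (incr_gap_bounds y Hy) as B2.
  pose proof (prof_lower eps He y). pose proof (prof_upper eps He y). pose proof (prof_defect eps He y).
  pose proof (tau_pos eps y ltac:(lra) Hy).
  assert (exp (X eps y / 4) <= wexp (1 / 8) eps y) by (apply exp_mono; pose proof (X_le_0 eps y ltac:(lra)); lra).
  assert (E : wexp (1 / 8) eps y = exp (X eps y / 8)) by (unfold wexp; f_equal; field).
  rewrite E in *. unfold prof', gap', gap in *. pose proof (exp_pos (X eps y / 8)).
  split; [cont|lra].
Qed.

(** An exact identity: the increment of c p is the mean speed times the increment of p plus the mean
    profile times the increment of c, and the increment of p is that of p^2 over twice the mean
    profile. *)
Lemma sq_quot_mean y : y < 0 ->
  is_derive (sq_quot eps h) y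
   (2 * eps * (mean_speed / (2 * mean_prof y) - 1) * sq_quot eps h y
    + 2 * eps * cb_quot eps h 0 * mean_prof y + source0 eps h y).
Proof.
  intros Hy. eapply deriv_eq; [now apply sq_quot_derive|].
  pose proof (prof_pos eps He y Hy). pose proof (prof_pos (eps + h) He' y Hy).
  unfold mean_speed, mean_prof, source0, sq_quot, cb_quot, prof', gap', gap.
  field. repeat split; first [assumption|lra].
Qed.

Lemma sq_quot_base y : y < 0 ->
  is_derive (sq_quot eps h) y
   (2 * eps * (cb eps / (2 * prof eps y) - 1) * sq_quot eps h y
    + 2 * eps * cb_quot eps h 0 * prof eps y + source1 eps h y).
Proof.
  intros Hy. eapply deriv_eq; [now apply sq_quot_derive|].
  pose proof (prof_pos eps He y Hy). pose proof (prof_pos (eps + h) He' y Hy).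
  unfold source1, source0, sq_quot, cb_quot, prof_quot, prof', gap', gap.
  field. repeat split; first [assumption|lra].
Qed.

Lemma gap_quot_derive y : y < 0 ->
  is_derive (gap_quot eps h) y (- eps * gap_quot eps h y + gap_source eps h y).
Proof.
  intros Hy. pose proof (prof_pos eps He y Hy). pose proof (prof_pos (eps + h) He' y Hy).
  unfold gap_quot at 1. unfold prof_quot.
  deriv_as (0 - ((eps + h) * (cb (eps + h) - prof (eps + h) y) + forc (eps + h) y / (2 * prof (eps + h) y)
        - (eps * (cb eps - prof eps y) + forc eps y / (2 * prof eps y))) * / h).
  - apply (deriv_minus (fun y => cb_quot eps h y)).
    + unfold cb_quot. auto_derive; easy.
    + apply (is_derive_scal_l (fun y => prof (eps + h) y - prof eps y) y _ (/ h)).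
      apply (deriv_minus (prof (eps + h)) (prof eps)); now apply prof_deriv.
  - unfold gap_source, gap_quot, forc_quot, cb_quot, prof_quot, prof', gap', iprof', gap. field. repeat split; lra.
Qed.

(** The constant blows up with [h]; it only certifies the growth condition of [lin_unique]. *)
Lemma sq_quot_crude y : y < 0 -> Rabs (sq_quot eps h y) <= 80 / Rabs h * tau eps y ^ 2.
Proof.
  intros Hy. unfold sq_quot, Rdiv. rewrite Rabs_mult, Rabs_inv.
  assert (0 < / Rabs h) by (apply Rinv_0_lt_compat; now apply Rabs_pos_lt).
  rewrite (Rmult_comm 80), Rmult_assoc, (Rmult_comm _ (/ Rabs h)).
  apply Rmult_le_compat_l; [lra|].
  pose proof (incr_prof_bounds y Hy) as B1. unfold prof' in B1.
  pose proof (prof_lower eps He y). pose proof (prof_upper eps He y). pose proof (tau_pos eps y ltac:(lra) Hy).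
  apply Rabs_le. split; nra.
Qed.
End Increment.

Lemma wforc_source k : k <= 1 / 4 -> forall eps y, 0 < eps < e0 -> y < 0 -> wforc eps y <= 1 * wsource k eps y.
Proof.
  intros Hk eps y He Hy. unfold wforc, wsource. pose proof (wexp_le (1 / 4) k eps y He Hk) as H. unfold wexp in *.
  pose proof (tau_pos eps y ltac:(lra) Hy). nra.
Qed.

Lemma wtauexp_source k : forall eps y, 0 < eps < e0 -> y < 0 -> tau eps y * wexp k eps y <= 1 * wsource k eps y.
Proof.
  intros eps y He Hy. unfold wsource, wexp. pose proof (tau_pos eps y ltac:(lra) Hy).
  pose proof (exp_pos (k * X eps y)). nra.
Qed.

Lemma Bd_prof : Bd tau (fun eps _ => prof eps).
Proof.
  exists 8. split; [lra|]. intros eps h y Hh Hy. destruct (increment_bounds eps h Hh) as (He & _).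
  destruct (prof_admissible eps He) as [_ H]. destruct (H y Hy) as (Hc & Hb & _). split; [|assumption].
  pose proof (prof_pos eps He y Hy). rewrite Rabs_right; lra.
Qed.

Lemma Bd_iprof : Bd wtaui (fun eps _ y => / prof eps y).
Proof.
  exists 8. split; [lra|]. intros eps h y Hh Hy. destruct (increment_bounds eps h Hh) as (He & _).
  destruct (prof_admissible eps He) as [_ H]. destruct (H y Hy) as (Hc & Hb & _).
  pose proof (prof_pos eps He y Hy). pose proof (tau_pos eps y ltac:(lra) Hy). split; [|apply cont_inv; [assumption|lra]].
  rewrite Rabs_right by (apply Rle_ge; left; now apply Rinv_0_lt_compat). unfold wtaui.
  replace (8 * / tau eps y) with (/ (tau eps y / 8)) by (field; lra). apply Rinv_le_contravar; lra.
Qed.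

Lemma Bd_iprof' : Bd wtaui iprof'.
Proof.
  exists 6. split; [lra|]. intros eps h y Hh Hy. destruct (increment_bounds eps h Hh) as (He & He' & _).
  pose proof (incr_prof_bounds eps h Hh y Hy) as Hb. unfold iprof', prof' in *.
  pose proof (tau_pos eps y ltac:(lra) Hy).
  split; [|apply cont_inv; [apply prof_cont, He'|lra]].
  rewrite Rabs_right by (apply Rle_ge; left; apply Rinv_0_lt_compat; lra). unfold wtaui.
  replace (6 * / tau eps y) with (/ (tau eps y / 6)) by (field; lra). apply Rinv_le_contravar; lra.
Qed.

Lemma Bd_gap : Bd (wexp (1 / 4)) (fun eps _ => gap eps).
Proof.
  exists 3. split; [lra|]. intros eps h y Hh Hy. destruct (increment_bounds eps h Hh) as (He & _).
  pose proof (prof_cont eps He y). pose proof (prof_defect eps He y) as H0. unfold gap. split; [|cont].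
  unfold wexp. replace (1 / 4 * X eps y) with (X eps y / 4) by field. rewrite Rabs_right; lra.
Qed.

Lemma Bd_gap' : Bd (wexp (1 / 8)) gap'.
Proof.
  exists 3. split; [lra|]. intros eps h y Hh Hy. pose proof (incr_prof_cont eps h Hh y).
  pose proof (incr_gap_bounds eps h Hh y Hy). split; [rewrite Rabs_right; lra|].
  unfold gap', gap. unfold prof' in H. cont.
Qed.

Lemma Bd_prof' : Bd tau prof'.
Proof.
  exists 8. split; [lra|]. intros eps h y Hh Hy. pose proof (incr_prof_cont eps h Hh y).
  pose proof (incr_prof_bounds eps h Hh y Hy). pose proof (tau_pos eps y ltac:(destruct Hh; lra) Hy).
  split; [rewrite Rabs_right; lra|assumption].
Qed.

Lemma Bd_forc_iprof : Bd (wexp (1 / 4)) (fun eps _ y => forc eps y * / prof eps y).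
Proof.
  exists 3. split; [lra|]. intros eps h y Hh Hy. destruct (increment_bounds eps h Hh) as (He & _).
  pose proof (prof_pos eps He y Hy). pose proof (prof_cont eps He y). split.
  - pose proof (forc_prof eps He y Hy) as Hf. apply Rle_trans with (1 := Hf). apply Rmult_le_compat_l; [lra|].
    apply exp_mono. pose proof (X_le_0 eps y ltac:(lra)). lra.
  - pose proof (X_cont eps y). unfold forc. apply cont_mult; [cont|apply cont_inv; [assumption|lra]].
Qed.

Lemma Bd_eps : Bd weps (fun eps _ _ => eps).
Proof.
  exists 1. split; [lra|]. intros eps h y ((He & _) & _) Hy. split; [|apply cont_const].
  unfold weps. rewrite Rabs_right; lra.
Qed.

Lemma Expd_source0 n k : 0 < k <= 1 / 4 -> Expd n tau prof' -> Expd n (wexp k) gap' -> Expd n (wsource k) source0.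
Proof.
  intros Hk Hp Hg. apply Expd_plus.
  - apply (Expd_scal n (wsource k) (fun eps h y => prof' eps h y * gap' eps h y) (fun _ => 2) 2);
      [intros; rewrite Rabs_right; lra|apply nw_source|].
    apply (Expd_weak n (fun e y => tau e y * wexp k e y) _ 1); [lra|apply wtauexp_source|].
    now apply Expd_mult.
  - apply (Expd_weak n wforc _ 1); [lra|apply wforc_source; lra|apply Expd_forc].
Qed.

Lemma Expd_gap_source n k : 0 < k <= 1 / 4 -> Expd n (wexp k) gap' -> Expd n tau prof_quot ->
  Expd n wtaui iprof' -> Expd n (wexp k) gap_source.
Proof.
  intros Hk Hg Hq Hi.
  assert (H1 : Expd n (wexp k) (fun eps h y => forc_quot eps h y * iprof' eps h y)).
  { apply (Expd_weak n (fun e y => wforc e y * wtaui e y) _ 1); [lra| |apply Expd_mult; [apply Expd_forc|assumption]].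
    intros eps y He Hy. pose proof (tau_pos eps y ltac:(lra) Hy). unfold wforc, wtaui.
    pose proof (wexp_le (1 / 4) k eps y He ltac:(lra)).
    replace (tau eps y * wexp (1 / 4) eps y * / tau eps y) with (wexp (1 / 4) eps y) by (field; lra). lra. }
  assert (H2 : Expd n (wexp k) (fun eps h y => forc eps y * / prof eps y * (prof_quot eps h y * iprof' eps h y))).
  { apply (Expd_weak n (fun e y => wexp (1 / 4) e y * (tau e y * wtaui e y)) _ 1); [lra| |].
    - intros eps y He Hy. pose proof (tau_pos eps y ltac:(lra) Hy). unfold wtaui.
      pose proof (wexp_le (1 / 4) k eps y He ltac:(lra)).
      replace (wexp (1 / 4) eps y * (tau eps y * / tau eps y)) with (wexp (1 / 4) eps y) by (field; lra). lra.
    - apply (Expd_mult n (wexp (1 / 4)) (fun e y => tau e y * wtaui e y) (fun eps h y => forc eps y * / prof eps y)).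
      + apply (Expd_const n (wexp (1 / 4)) (fun eps y => forc eps y * / prof eps y)); [apply nw_exp|apply Bd_forc_iprof].
      + now apply Expd_mult. }
  assert (Hs : forall G a, Expd n (wexp k) G -> Expd n (wexp k) (fun eps h y => a * G eps h y)).
  { intros G a HG. apply (Expd_scal n (wexp k) G (fun _ => a) (Rabs a)); [intros; lra|apply nw_exp|assumption]. }
  apply (Expd_ext n _ (fun eps h y => (-1) * (gap' eps h y + / 2 * (forc_quot eps h y * iprof' eps h y
      + (-1) * (forc eps y * / prof eps y * (prof_quot eps h y * iprof' eps h y)))))).
  { intros eps h y _ _. unfold gap_source. ring. }
  apply Hs. apply Expd_plus; [assumption|]. apply Hs. apply Expd_plus; [assumption|]. now apply Hs.
Qed.

(** Start of the bootstrap. About the mean profile the source is bounded a priori, so the linear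
    theory bounds [cb_quot] and [sq_quot] uniformly; dividing the latter by the sum of the profiles
    costs one of its two factors [tau]. *)
Lemma quot_bounds : Bd w1 cb_quot /\ Bd tau prof_quot.
Proof.
  assert (HS : Bd (wsource (1 / 8)) source0) by (apply (Expd_source0 0 (1 / 8)); [lra|apply Bd_prof'|apply Bd_gap']).
  destruct (Bd_forcing _ _ HS) as [C [HC HF]].
  assert (HU : forall eps h, increment eps h ->
    cb_quot eps h 0 = lin_speed eps (mean_speed eps h) (mean_prof eps h) (source0 eps h) /\
    forall y, y < 0 -> sq_quot eps h y = lin_sol eps (mean_speed eps h) (mean_prof eps h) (source0 eps h) y).
  { intros eps h Hh. apply (lin_unique eps _ _ (mean_admissible eps h Hh) (1 / 8) C _ _ _ (80 / Rabs h)); [lra|auto|..].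
    - now apply sq_quot_crude.
    - now apply sq_quot_mean. }
  pose proof (csup_pos (1 / 8) ltac:(lra)) as Hcs.
  split.
  - exists (10 * (csup (1 / 8) + 2) * C). split; [apply Rmult_le_pos; lra|].
    intros eps h y Hh Hy. split; [|apply cont_const]. unfold w1. rewrite Rmult_1_r.
    destruct (HU eps h Hh) as [E _]. change (cb_quot eps h y) with (cb_quot eps h 0). rewrite E.
    apply lin_speed_bound; [now apply mean_admissible|lra|auto].
  - assert (Hcl : 0 <= cls (1 / 8) * C).
    { apply Rmult_le_pos; [|assumption]. unfold cls, ckk. apply Rmult_le_pos; lra. }
    exists (3 * (cls (1 / 8) * C)). split; [lra|].
    intros eps h y Hh Hy. destruct (increment_bounds eps h Hh) as (He & He' & _). split.
    + destruct (HU eps h Hh) as [_ E].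
      pose proof (lin_sol_bound eps _ _ (mean_admissible eps h Hh) (1 / 8) C _ y ltac:(lra) (HF eps h Hh) Hy) as Hb.
      rewrite <- E in Hb by assumption.
      pose proof (prof_pos (eps + h) He' y Hy). pose proof (prof_lower eps He y).
      pose proof (tau_pos eps y ltac:(lra) Hy).
      assert (Eq : sq_quot eps h y = prof_quot eps h y * (prof (eps + h) y + prof eps y)).
      { unfold sq_quot, prof_quot. field. apply Hh. }
      rewrite Eq, Rabs_mult, (Rabs_right (prof (eps + h) y + prof eps y)) in Hb by lra.
      pose proof (Rabs_pos (prof_quot eps h y)).
      apply Rmult_le_reg_r with (tau eps y / 3); [lra|].
      apply Rle_trans with (Rabs (prof_quot eps h y) * (prof (eps + h) y + prof eps y)).
      * apply Rmult_le_compat_l; lra.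
      * replace (3 * (cls (1 / 8) * C) * tau eps y * (tau eps y / 3)) with (cls (1 / 8) * C * tau eps y ^ 2) by field.
        assumption.
    + unfold prof_quot. pose proof (prof_cont eps He y). pose proof (prof_cont (eps + h) He' y).
      apply cont_mult; [cont|apply cont_const].
Qed.

Lemma gap_quot_avg k : 0 < k -> Bd (wexp k) gap_source -> forall eps h y, increment eps h -> y < 0 ->
  gap_quot eps h y = avg eps (gap_source eps h) y.
Proof.
  intros Hk [C [HC H]] eps h y Hh Hy. destruct quot_bounds as [[C1 [HC1 H1]] [C2 [HC2 H2]]].
  destruct (increment_bounds eps h Hh) as (He & _).
  apply (avg_unique eps k C _ _ (C1 + C2)); trivial; [lra|..].
  - intros t Ht. destruct (H eps h t Hh Ht). now split.
  - intros t Ht. destruct (H1 eps h t Hh Ht) as [B1 _]. destruct (H2 eps h t Hh Ht) as [B2 _].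
    pose proof (tau_bounds eps t ltac:(lra)). unfold w1 in B1. unfold gap_quot.
    assert (C2 * tau eps t <= C2 * 1) by (apply Rmult_le_compat_l; lra).
    unfold Rminus. eapply Rle_trans; [apply Rabs_triang|]. rewrite Rabs_Ropp. lra.
  - intros t Ht. now apply gap_quot_derive.
Qed.

(** The rate is existential because every passage through [avg] halves it. *)
Definition expands (n : nat) : Prop :=
  Expd n w1 cb_quot /\ Expd n tau prof_quot /\ Expd n wtaui iprof' /\
  exists k, 0 < k <= 1 / 8 /\ Expd n (wexp k) gap_quot.

Lemma Expd_gap_quot n k : 0 < k <= 1 / 8 -> Expd n (wexp k) gap' -> Expd n tau prof_quot ->
  Expd n wtaui iprof' -> exists k, 0 < k <= 1 / 8 /\ Expd n (wexp k) gap_quot.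
Proof.
  intros Hk H1 H2 H3. pose proof (Expd_gap_source n k ltac:(lra) H1 H2 H3) as HS.
  exists (k / 2). split; [lra|].
  apply (Expd_ext n _ (fun eps h => avg eps (gap_source eps h))).
  - intros eps h y Hh Hy. symmetry. apply (gap_quot_avg k); trivial; [lra|]. now apply (Expd_bd n).
  - apply Expd_avg; [lra|assumption].
Qed.

Lemma expands_0 : expands 0.
Proof.
  destruct quot_bounds as [H1 H2]. split; [assumption|]. split; [assumption|]. split; [apply Bd_iprof'|].
  apply (Expd_gap_quot 0 (1 / 8)); trivial; [lra|apply Bd_gap'|apply Bd_iprof'].
Qed.

(* Each quantity at [eps + h] is its value at [eps] plus [h] times a difference quotient, so one order is gained at every round. *)
Lemma expands_S n : expands n -> expands (S n).
Proof.
  intros (Hg & Hq & Hi & k & Hk & Hr).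
  (* With p' the profile at [eps + h] and q the quotient [prof_quot], use 1 / p' = 1 / p - h q / (p
     p'). *)
  assert (Hi' : Expd (S n) wtaui iprof').
  { exists (fun eps y => / prof eps y), (fun eps h y => (-1) * (prof_quot eps h y * / prof eps y * iprof' eps h y)).
    split; [apply Bd_iprof|]. split.
    - apply (Expd_scal n wtaui _ (fun _ => -1) 1); [intros; rewrite Rabs_left; lra|apply nw_taui|].
      apply (Expd_weak n (fun e y => tau e y * wtaui e y * wtaui e y) _ 1); [lra| |].
      + intros eps y He Hy. pose proof (tau_pos eps y ltac:(lra) Hy). unfold wtaui. right. field. lra.
      + apply Expd_mult; [|assumption]. apply Expd_mult; [assumption|].
        apply (Expd_const n wtaui (fun eps y => / prof eps y)); [apply nw_taui|apply Bd_iprof].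
    - intros eps h y Hh Hy. destruct (increment_bounds eps h Hh) as (He & He' & _).
      pose proof (prof_pos eps He y Hy). pose proof (prof_pos (eps + h) He' y Hy).
      unfold iprof', prof_quot. field. repeat split; try lra. apply Hh. }
  assert (Hgap : Expd (S n) (wexp k) gap').
  { exists gap, gap_quot. split; [|split; [assumption|]].
    - apply (Expd_wexp_le 0 (1 / 4) k); [lra|apply Bd_gap].
    - intros eps h y Hh Hy. unfold gap', gap_quot, gap, cb_quot, prof_quot. field. apply Hh. }
  assert (Hp : Expd (S n) tau prof').
  { exists prof, prof_quot. split; [apply Bd_prof|]. split; [assumption|].
    intros eps h y Hh Hy. unfold prof', prof_quot. field. apply Hh. }
  (* The quotients are known only to order [n], but in [source1] they occur with a factor [h]. *)
  assert (HS : Expd (S n) (wsource k) source1).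
  { apply Expd_plus; [apply Expd_source0; [lra|assumption..]|].
    apply Expd_h; [apply nw_source|].
    apply (Expd_weak n (fun e y => weps e y * tau e y) _ 1); [lra| |].
    { intros eps y He Hy. unfold weps, wsource. pose proof (tau_pos eps y ltac:(lra) Hy).
      pose proof (exp_pos (k * X eps y)). nra. }
    apply (Expd_mult n weps tau (fun eps h y => eps)).
    { apply (Expd_const n weps (fun eps y => eps)); [apply nw_eps|apply Bd_eps]. }
    apply (Expd_ext n _ (fun eps h y => 2 * (cb_quot eps h y * prof_quot eps h y)
      + (- cb eps) * (prof_quot eps h y * prof_quot eps h y * / prof eps y))); [intros; ring|].
    apply Expd_plus.
    - apply (Expd_scal n tau _ (fun _ => 2) 2); [intros; rewrite Rabs_right; lra|apply nw_tau|].
      apply (Expd_weak n (fun e y => w1 e y * tau e y) _ 1); [lra|intros; unfold w1; lra|].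
      now apply Expd_mult.
    - apply (Expd_scal n tau _ (fun eps => - cb eps) 2).
      + intros eps He. pose proof (cb_bounds eps ltac:(lra)). rewrite Rabs_Ropp, Rabs_right; lra.
      + apply nw_tau.
      + apply (Expd_weak n (fun e y => tau e y * tau e y * wtaui e y) _ 1); [lra| |].
        * intros eps y He Hy. pose proof (tau_pos eps y ltac:(lra) Hy). unfold wtaui. right. field. lra.
        * apply Expd_mult; [now apply Expd_mult|].
          apply (Expd_const n wtaui (fun eps y => / prof eps y)); [apply nw_taui|apply Bd_iprof]. }
  destruct (Expd_lin (S n) k source1 ltac:(lra) HS) as [HG HV].
  destruct (Bd_forcing k source1 (Expd_bd _ _ _ HS)) as [C [HC HF]].
  assert (HU : forall eps h, increment eps h ->
    cb_quot eps h 0 = lin_speed eps (cb eps) (prof eps) (source1 eps h) /\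
    forall y, y < 0 -> sq_quot eps h y = lin_sol eps (cb eps) (prof eps) (source1 eps h) y).
  { intros eps h Hh.
    apply (lin_unique eps _ _ (prof_admissible eps ltac:(apply (increment_bounds eps h Hh))) k C _ _ _ (80 / Rabs h));
      [lra|auto|..].
    - now apply sq_quot_crude.
    - now apply sq_quot_base. }
  assert (Hg' : Expd (S n) w1 cb_quot).
  { apply (Expd_ext _ _ _ _ (fun eps h y Hh Hy => eq_sym (proj1 (HU eps h Hh)))). exact HG. }
  assert (Hv' : Expd (S n) wtau2 sq_quot).
  { apply (Expd_ext _ _ _ _ (fun eps h y Hh Hy => eq_sym (proj2 (HU eps h Hh) y Hy))). exact HV. }
  assert (Hq' : Expd (S n) tau prof_quot).
  { apply (Expd_ext (S n) _ (fun eps h y => (sq_quot eps h y + h * ((-1) * (prof_quot eps h y * prof_quot eps h y))) * (/ 2 * / prof eps y))).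
    { intros eps h y Hh Hy. destruct (increment_bounds eps h Hh) as (He & He' & _).
      pose proof (prof_pos eps He y Hy). unfold sq_quot, prof_quot. field. repeat split; first [apply Hh|lra]. }
    apply (Expd_weak (S n) (fun e y => wtau2 e y * wtaui e y) _ 1); [lra| |].
    { intros eps y He Hy. pose proof (tau_pos eps y ltac:(lra) Hy). unfold wtau2, wtaui. right. field. lra. }
    apply Expd_mult.
    - apply Expd_plus; [assumption|]. apply Expd_h; [apply nw_tau2|].
      apply (Expd_scal n wtau2 _ (fun _ => -1) 1); [intros; rewrite Rabs_left; lra|apply nw_tau2|].
      apply (Expd_weak n (fun e y => tau e y * tau e y) _ 1); [lra| |now apply Expd_mult].
      intros eps y He Hy. unfold wtau2. right. ring.
    - apply (Expd_scal (S n) wtaui (fun eps h y => / prof eps y) (fun _ => / 2) 1); [intros; rewrite Rabs_right; lra|apply nw_taui|].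
      apply (Expd_const (S n) wtaui (fun eps y => / prof eps y)); [apply nw_taui|apply Bd_iprof]. }
  split; [assumption|]. split; [assumption|]. split; [assumption|].
  now apply (Expd_gap_quot (S n) k).
Qed.

Lemma cb_expands n : Expd n w1 cb_quot.
Proof.
  assert (H : expands n) by (induction n; [apply expands_0|now apply expands_S]). apply H.
Qed.

(** * Converse of Taylor's theorem *)

Lemma psum_plus a b h n : psum (fun k => a k + b k) h n = psum a h n + psum b h n.
Proof. induction n as [|n IH]; simpl; [ring|rewrite IH; ring]. Qed.

Lemma psum_scal a c h n : psum (fun k => c * a k) h n = c * psum a h n.
Proof. induction n as [|n IH]; simpl; [ring|rewrite IH; ring]. Qed.

Lemma psum_dilate a s t n : psum a (s * t) n = psum (fun k => a k * s ^ k) t n.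
Proof. induction n as [|n IH]; simpl; [easy|rewrite IH, Rpow_mult_distr; ring]. Qed.

Definition pcons (a0 : R) (a : nat -> R) (k : nat) : R := match k with O => a0 | S k => a k end.

Lemma psum_cons a0 a h n : psum (pcons a0 a) h (S n) = a0 + h * psum a h n.
Proof.
  induction n as [|n IH]; [simpl; ring|].
  change (psum (pcons a0 a) h (S n) + a n * h ^ S n = a0 + h * (psum a h n + a n * h ^ n)).
  rewrite IH. simpl. ring.
Qed.

Lemma psum_abs a h n M : (forall k, (k < n)%nat -> Rabs (a k) <= M) -> Rabs h <= 1 -> Rabs (psum a h n) <= INR n * M.
Proof.
  intros Ha Hh. induction n as [|n IH]; [simpl; rewrite Rabs_R0; lra|].
  rewrite S_INR. simpl psum. eapply Rle_trans; [apply Rabs_triang|].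
  rewrite Rabs_mult, <- RPow_abs.
  assert (Rabs h ^ n <= 1) by (rewrite <- (pow1 n); apply pow_incr; split; [apply Rabs_pos|assumption]).
  assert (0 <= Rabs h ^ n) by (apply pow_le, Rabs_pos).
  specialize (Ha n ltac:(lia)) as Hn. pose proof (Rabs_pos (a n)).
  assert (Rabs (psum a h n) <= INR n * M) by (apply IH; intros; apply Ha; lia). nra.
Qed.

(* The combination [2^n q(t/2) - q(t)] kills the leading coefficient. *)
Lemma coefficient_bound n : exists K, 0 <= K /\ forall b M, (forall t, 0 <= t <= 1 -> Rabs (psum b t n) <= M) ->
  forall k, (k < n)%nat -> Rabs (b k) <= K * M.
Proof.
  induction n as [|n (K & HK & IH)]; [exists 0; split; [lra|intros; lia]|].
  assert (H2n : 1 <= 2 ^ n) by (apply pow_R1_Rle; lra).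
  exists (K * (2 ^ n + 1) + 1 + INR n * (K * (2 ^ n + 1))).
  assert (HK1 : 0 <= K * (2 ^ n + 1)) by (apply Rmult_le_pos; lra).
  pose proof (pos_INR n) as Hn.
  split; [nra|]. intros b M Hb.
  assert (HM : 0 <= M) by (pose proof (Hb 0 ltac:(lra)); pose proof (Rabs_pos (psum b 0 (S n))); lra).
  set (b' := fun k => (2 ^ n * (1 / 2) ^ k - 1) * b k).
  assert (Hb' : forall k, (k < n)%nat -> Rabs (b' k) <= K * ((2 ^ n + 1) * M)).
  { apply IH. intros t Ht.
    assert (E : psum b' t n = 2 ^ n * psum b (1 / 2 * t) (S n) - psum b t (S n)).
    { rewrite psum_dilate. simpl psum. unfold b'.
      rewrite (psum_ext (fun k => (2 ^ n * (1 / 2) ^ k - 1) * b k) (fun k => 2 ^ n * (b k * (1 / 2) ^ k) + (-1) * b k)) by (intros; ring).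
      rewrite psum_plus, !psum_scal.
      assert (E1 : 2 ^ n * (1 / 2) ^ n = 1) by (rewrite <- Rpow_mult_distr; replace (2 * (1 / 2)) with 1 by field; apply pow1).
      replace (2 ^ n * (psum (fun k => b k * (1 / 2) ^ k) t n + b n * (1 / 2) ^ n * t ^ n))
        with (2 ^ n * psum (fun k => b k * (1 / 2) ^ k) t n + b n * (2 ^ n * (1 / 2) ^ n) * t ^ n) by ring.
      rewrite E1. ring. }
    rewrite E. pose proof (Hb (1 / 2 * t) ltac:(lra)) as H1. pose proof (Hb t ltac:(lra)) as H2.
    unfold Rminus. eapply Rle_trans; [apply Rabs_triang|]. rewrite Rabs_Ropp, Rabs_mult, (Rabs_right (2 ^ n)) by lra.
    assert (2 ^ n * Rabs (psum b (1 / 2 * t) (S n)) <= 2 ^ n * M) by (apply Rmult_le_compat_l; lra). lra. }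
  assert (Hlow : forall k, (k < n)%nat -> Rabs (b k) <= K * (2 ^ n + 1) * M).
  { intros k Hk. specialize (Hb' k Hk). unfold b' in Hb'. rewrite Rabs_mult in Hb'.
    assert (2 <= 2 ^ n * (1 / 2) ^ k).
    { replace n with (S (n - S k) + k)%nat by lia. rewrite pow_add, Rmult_assoc, <- Rpow_mult_distr.
      replace (2 * (1 / 2)) with 1 by field. rewrite pow1, Rmult_1_r. simpl.
      assert (1 <= 2 ^ (n - S k)) by (apply pow_R1_Rle; lra). lra. }
    rewrite (Rabs_right (2 ^ n * _ - 1)) in Hb' by lra. pose proof (Rabs_pos (b k)). nra. }
  intros k Hk. destruct (Nat.eq_dec k n) as [-> |Hkn].
  - pose proof (Hb 1 ltac:(lra)) as H1. simpl psum in H1. rewrite pow1, Rmult_1_r in H1.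
    pose proof (psum_abs b 1 n _ Hlow ltac:(rewrite Rabs_R1; lra)) as H2.
    replace (b n) with ((psum b 1 n + b n) + - psum b 1 n) by ring.
    eapply Rle_trans; [apply Rabs_triang|]. rewrite Rabs_Ropp. nra.
  - specialize (Hlow k ltac:(lia)). assert (0 <= INR n * (K * (2 ^ n + 1)) * M) by (apply Rmult_le_pos; nra). nra.
Qed.

Lemma psum_affine_pow m n : exists b, forall t, (1 + m * t) ^ n = psum b t (S n).
Proof.
  induction n as [|n [b IH]].
  - exists (fun _ => 1). intros t. simpl. ring.
  - exists (fun k => (if Nat.eq_dec k (S n) then 0 else b k) + pcons 0 (fun k => m * b k) k). intros t.
    rewrite psum_plus, psum_cons, psum_scal.
    change (psum (fun k => if Nat.eq_dec k (S n) then 0 else b k) t (S (S n)))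
      with (psum (fun k => if Nat.eq_dec k (S n) then 0 else b k) t (S n)
            + (if Nat.eq_dec (S n) (S n) then 0 else b (S n)) * t ^ S n).
    destruct (Nat.eq_dec (S n) (S n)) as [_|]; [|easy].
    rewrite (psum_ext (fun k => if Nat.eq_dec k (S n) then 0 else b k) b).
    + change ((1 + m * t) ^ S n) with ((1 + m * t) * (1 + m * t) ^ n). rewrite IH. ring.
    + intros k Hk. destruct Nat.eq_dec; [lia|easy].
Qed.

(** An affine substitution does not raise the degree, so two expansions can be compared coefficient
    by coefficient. *)
Lemma psum_affine a s m n : exists b, forall t, psum a (s * (1 + m * t)) n = psum b t n.
Proof.
  induction n as [|n [b IH]]; [exists (fun _ => 0); easy|].
  destruct (psum_affine_pow m n) as [c Hc].
  exists (fun k => (if Nat.eq_dec k n then 0 else b k) + a n * s ^ n * c k). intros t.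
  rewrite psum_plus, psum_scal, <- Hc. simpl psum at 1. rewrite IH, Rpow_mult_distr.
  simpl psum. destruct (Nat.eq_dec n n) as [_|]; [|easy].
  rewrite (psum_ext (fun k => if Nat.eq_dec k n then 0 else b k) b); [ring|].
  intros k Hk. destruct Nat.eq_dec; [lia|easy].
Qed.

Definition small_step (eps h : R) : Prop := 0 < eps < e0 /\ Rabs h <= eps / 2 /\ eps + h < e0.

(** One constant serves all base points; this uniformity is what the converse of Taylor's theorem
    uses. *)
Definition taylor_order (n : nat) (f : R -> R) : Prop :=
  exists (a : nat -> R -> R) (C : R), 0 <= C /\
    (forall k eps, 0 < eps < e0 -> Rabs (a k eps) <= C) /\
    forall eps h, small_step eps h -> Rabs (f (eps + h) - psum (fun k => a k eps) h n) <= C * Rabs h ^ n.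

Lemma taylor_order_S n f : taylor_order (S n) f -> taylor_order n f.
Proof.
  intros (a & C & HC & Ha & H). exists a, (2 * C). split; [lra|]. split.
  { intros k eps He. specialize (Ha k eps He). lra. }
  intros eps h Hh. specialize (H eps h Hh). simpl psum in H. destruct Hh as (He & Hh & _).
  specialize (Ha n eps He).
  replace (f (eps + h) - psum (fun k => a k eps) h n)
    with ((f (eps + h) - (psum (fun k => a k eps) h n + a n eps * h ^ n)) + a n eps * h ^ n) by ring.
  eapply Rle_trans; [apply Rabs_triang|]. rewrite Rabs_mult, <- RPow_abs. simpl in H.
  assert (0 <= Rabs h ^ n) by (apply pow_le, Rabs_pos). unfold e0 in He.
  assert (C * (Rabs h * Rabs h ^ n) <= C * (1 * Rabs h ^ n)).
  { apply Rmult_le_compat_l; [assumption|]. apply Rmult_le_compat_r; lra. }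
  nra.
Qed.

Lemma taylor_order_value n f a C : (forall eps h, small_step eps h ->
   Rabs (f (eps + h) - psum (fun k => a k eps) h (S n)) <= C * Rabs h ^ S n) ->
  forall eps, 0 < eps < e0 -> f eps = a 0%nat eps.
Proof.
  intros H eps He. specialize (H eps 0 ltac:(repeat split; rewrite ?Rabs_R0; lra)).
  rewrite psum_0, Rplus_0_r, Rabs_R0, pow_ne_zero, Rmult_0_r in H by lia.
  pose proof (Rabs_pos (f eps - a 0%nat eps)). apply Rminus_diag_uniq.
  destruct (Req_dec (f eps - a 0%nat eps) 0) as [|Hn]; [assumption|].
  pose proof (Rabs_pos_lt _ Hn). lra.
Qed.

Lemma taylor_order_derive f a C : (forall eps h, small_step eps h ->
   Rabs (f (eps + h) - psum (fun k => a k eps) h 2) <= C * Rabs h ^ 2) -> 0 <= C ->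
  forall eps, 0 < eps < e0 -> is_derive f eps (a 1%nat eps).
Proof.
  intros H HC eps He. pose proof (taylor_order_value 1 f a C H eps He) as E0.
  apply is_derive_eps. intros e He'.
  exists (Rmin (Rmin (eps / 2) (e0 - eps)) (e / (C + 1))). split.
  { apply Rmin_glb_lt; [apply Rmin_glb_lt; lra|]. apply Rdiv_lt_0_compat; lra. }
  intros y Hy.
  pose proof (Rmin_l (Rmin (eps / 2) (e0 - eps)) (e / (C + 1))). pose proof (Rmin_r (Rmin (eps / 2) (e0 - eps)) (e / (C + 1))).
  pose proof (Rmin_l (eps / 2) (e0 - eps)). pose proof (Rmin_r (eps / 2) (e0 - eps)).
  assert (Hs : small_step eps (y - eps)).
  { repeat split; try lra. pose proof (Rle_abs (y - eps)). lra. }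
  specialize (H eps (y - eps) Hs). replace (eps + (y - eps)) with y in H by ring.
  simpl psum in H. rewrite <- E0 in H.
  replace (f y - f eps - a 1%nat eps * (y - eps)) with (f y - (0 + f eps * (y - eps) ^ 0 + a 1%nat eps * (y - eps) ^ 1)) by ring.
  eapply Rle_trans; [exact H|].
  replace (C * Rabs (y - eps) ^ 2) with (C * Rabs (y - eps) * Rabs (y - eps)) by ring.
  apply Rmult_le_compat_r; [apply Rabs_pos|].
  assert (Rabs (y - eps) * (C + 1) <= e).
  { apply Rmult_le_reg_r with (/ (C + 1)); [apply Rinv_0_lt_compat; lra|].
    rewrite Rmult_assoc, Rinv_r by lra. unfold Rdiv in *. lra. }
  pose proof (Rabs_pos (y - eps)). nra.
Qed.

(* Compare the expansions at [eps] and at [eps + s] on the points between [eps + s/2] and [eps + s]. *)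
Lemma taylor_order_shift n f a C : 0 <= C ->
  (forall k eps, 0 < eps < e0 -> Rabs (a k eps) <= C) ->
  (forall eps h, small_step eps h -> Rabs (f (eps + h) - psum (fun k => a k eps) h (S (S n))) <= C * Rabs h ^ S (S n)) ->
  taylor_order (S n) (a 1%nat).
Proof.
  intros HC Ha H. destruct (coefficient_bound (S (S n))) as (K & HK & HKb).
  (* Coefficients of the differentiated expansion. The cut-off keeps them bounded in [k], as
     [taylor_order] asks for all [k]. *)
  set (g := fun k eps => if le_lt_dec k n then INR (S k) * a (S k) eps else 0).
  assert (Hn1 : 0 <= INR (S n)) by apply pos_INR.
  exists g, (INR (S n) * C + 4 * K * C).
  assert (0 <= K * C) by (apply Rmult_le_pos; assumption).
  split; [nra|]. split.
  { intros k eps He. unfold g. destruct le_lt_dec as [Hk|Hk]; [|rewrite Rabs_R0; nra].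
    rewrite Rabs_mult, (Rabs_right (INR _)) by (apply Rle_ge, pos_INR).
    specialize (Ha (S k) eps He). assert (INR (S k) <= INR (S n)) by (apply le_INR; lia).
    assert (0 <= INR (S k)) by apply pos_INR.
    assert (INR (S k) * Rabs (a (S k) eps) <= INR (S n) * C) by (apply Rmult_le_compat; auto using Rabs_pos). lra. }
  intros eps s Hs.
  rewrite (psum_ext (fun k => g k eps) (fun k => INR (S k) * a (S k) eps)).
  2:{ intros k Hk. unfold g. destruct le_lt_dec; [easy|lia]. }
  destruct (Req_dec s 0) as [-> |Hs0].
  { rewrite psum_0, Rplus_0_r. simpl. rewrite Rmult_1_l, Rminus_diag, Rabs_R0, Rmult_0_l, Rmult_0_r. lra. }
  destruct (psum_affine (fun k => a k eps) s (- / 2) (S (S n))) as [b Hb].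
  set (c := fun k => a k (eps + s) * (- / 2 * s) ^ k).
  assert (Habs : 0 < Rabs s) by now apply Rabs_pos_lt.
  assert (Hstep : forall t, 0 <= t <= 1 -> Rabs (psum (fun k => b k + (-1) * c k) t (S (S n))) <= 2 * C * Rabs s ^ S (S n)).
  { intros t Ht. rewrite psum_plus, psum_scal. unfold c. rewrite <- psum_dilate, <- Hb.
    destruct Hs as (He & Hs1 & Hs2).
    assert (A1 : Rabs (s * (1 + - / 2 * t)) <= Rabs s).
    { rewrite Rabs_mult, (Rabs_right (1 + - / 2 * t)) by lra. nra. }
    assert (A2 : Rabs (- / 2 * s * t) <= Rabs s / 2).
    { rewrite !Rabs_mult, (Rabs_right t), Rabs_Ropp, Rabs_inv, (Rabs_right 2) by lra. nra. }
    assert (B1 := H eps (s * (1 + - / 2 * t))). assert (B2 := H (eps + s) (- / 2 * s * t)).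
    apply Rabs_le_between in Hs1 as Hs1'.
    replace (eps + s + - / 2 * s * t) with (eps + s * (1 + - / 2 * t)) in B2 by ring.
    specialize (B1 ltac:(repeat split; try lra; nra)).
    assert (Hab : Rabs s / 2 <= (eps + s) / 2) by (unfold Rabs in *; destruct Rcase_abs; lra).
    specialize (B2 ltac:(repeat split; try lra; nra)).
    assert (P1 : Rabs (s * (1 + - / 2 * t)) ^ S (S n) <= Rabs s ^ S (S n)) by (apply pow_incr; split; [apply Rabs_pos|assumption]).
    assert (P2 : Rabs (- / 2 * s * t) ^ S (S n) <= Rabs s ^ S (S n)) by (apply pow_incr; split; [apply Rabs_pos|lra]).
    apply Rmult_le_compat_l with (r := C) in P1; [|assumption]. apply Rmult_le_compat_l with (r := C) in P2; [|assumption].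
    set (u := psum (fun k => a k eps) (s * (1 + - / 2 * t)) (S (S n))) in *.
    set (v := psum (fun k => a k (eps + s)) (- / 2 * s * t) (S (S n))) in *.
    set (w := f (eps + s * (1 + - / 2 * t))) in *.
    replace (u + -1 * v) with ((w - v) - (w - u)) by ring.
    unfold Rminus at 1. eapply Rle_trans; [apply Rabs_triang|]. rewrite Rabs_Ropp. lra. }
  assert (H1 := HKb _ _ Hstep 1%nat ltac:(lia)). cbv beta in H1.
  (* The coefficient of [t] is the derivative at [t = 0]. On the other side it is [a 1 (eps + s)]
     times the same factor [- s / 2], whose removal costs one power of [s]. *)
  assert (Eb : b 1%nat = - / 2 * s * psum (fun k => INR (S k) * a (S k) eps) s (S n)).
  { assert (D1 := psum_deriv b 0 (S n)). rewrite psum_0 in D1. simpl INR in D1. rewrite Rmult_1_l in D1.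
    assert (D2 : is_derive (fun t => psum b t (S (S n))) 0 (- / 2 * s * psum (fun k => INR (S k) * a (S k) eps) s (S n))).
    { apply (is_derive_ext (fun t => psum (fun k => a k eps) (s * (1 + - / 2 * t)) (S (S n)))); [intros; apply Hb|].
      apply (deriv_comp (fun h => psum (fun k => a k eps) h (S (S n))) (fun t => s * (1 + - / 2 * t))).
      - replace (s * (1 + - / 2 * 0)) with s by ring. apply (psum_deriv (fun k => a k eps)).
      - auto_derive; [easy|ring]. }
    apply is_derive_unique in D1. apply is_derive_unique in D2. rewrite <- D1. exact D2. }
  set (p := psum (fun k => INR (S k) * a (S k) eps) s (S n)) in *.
  unfold c in H1. rewrite Eb, pow_1 in H1.
  replace (- / 2 * s * p + -1 * (a 1%nat (eps + s) * (- / 2 * s))) with (/ 2 * s * (a 1%nat (eps + s) - p)) in H1 by ring.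
  rewrite !Rabs_mult, (Rabs_right (/ 2)) in H1 by lra.
  change (Rabs s ^ S (S n)) with (Rabs s * Rabs s ^ S n) in H1.
  set (q := Rabs s ^ S n) in *. assert (Hq : 0 <= q) by (apply pow_le, Rabs_pos).
  assert (H2 : Rabs (a 1%nat (eps + s) - p) <= 4 * K * C * q).
  { apply Rmult_le_reg_l with (/ 2 * Rabs s); [lra|]. eapply Rle_trans; [exact H1|]. right. field. }
  assert (0 <= INR (S n) * C * q) by (apply Rmult_le_pos; nra). lra.
Qed.

Definition uniformly_smooth (f : R -> R) : Prop := forall n, taylor_order n f.

Lemma taylor_order_ext n f g : (forall eps, 0 < eps < e0 -> f eps = g eps) -> taylor_order n f -> taylor_order n g.
Proof.
  intros E (a & C & HC & Ha & H). exists a, C. split; [assumption|]. split; [assumption|].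
  intros eps h Hh. rewrite <- E; [auto|]. destruct Hh as (He & Hh & H3).
  apply Rabs_le_between in Hh. lra.
Qed.

Lemma uniformly_smooth_derive f : uniformly_smooth f ->
  (forall eps, 0 < eps < e0 -> is_derive f eps (Derive f eps)) /\ uniformly_smooth (Derive f).
Proof.
  intros Hf.
  assert (K : forall n, exists a, (forall eps, 0 < eps < e0 -> is_derive f eps (a eps)) /\ taylor_order (S n) a).
  { intros n. destruct (Hf (S (S n))) as (a & C & HC & Ha & H).
    exists (a 1%nat). split; [|now apply (taylor_order_shift n f a C)].
    (* The expansion of order [S (S n)] is truncated with its own coefficients, so that the
       derivative found is the same [a 1] to which [taylor_order_shift] applies. *)
    assert (H2 : taylor_order 2 f /\ exists C', 0 <= C' /\ forall eps h, small_step eps h ->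
       Rabs (f (eps + h) - psum (fun k => a k eps) h 2) <= C' * Rabs h ^ 2).
    { split; [apply Hf|]. clear - HC Ha H. revert C HC Ha H. induction n as [|n IH]; intros C HC Ha H.
      - exists C. split; assumption.
      - apply (IH (2 * C)); [lra|intros k eps He; specialize (Ha k eps He); lra|].
        intros eps h Hh. specialize (H eps h Hh). destruct Hh as (He & Hh & _).
        change (psum (fun k => a k eps) h (S (S (S n)))) with (psum (fun k => a k eps) h (S (S n)) + a (S (S n)) eps * h ^ S (S n)) in H.
        specialize (Ha (S (S n)) eps He). set (p := psum (fun k => a k eps) h (S (S n))) in *.
        replace (f (eps + h) - p) with ((f (eps + h) - (p + a (S (S n)) eps * h ^ S (S n))) + a (S (S n)) eps * h ^ S (S n)) by ring.
        eapply Rle_trans; [apply Rabs_triang|]. rewrite Rabs_mult, <- RPow_abs.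
        change (Rabs h ^ S (S (S n))) with (Rabs h * Rabs h ^ S (S n)) in H.
        assert (0 <= Rabs h ^ S (S n)) by (apply pow_le, Rabs_pos). set (q := Rabs h ^ S (S n)) in *. unfold e0 in He.
        assert (C * (Rabs h * q) <= C * (1 * q)) by (apply Rmult_le_compat_l; [assumption|]; apply Rmult_le_compat_r; lra).
        nra. }
    destruct H2 as (_ & C' & HC' & H2). now apply (taylor_order_derive f a C'). }
  split.
  - intros eps He. destruct (K 0%nat) as (a & Hd & _). specialize (Hd eps He).
    rewrite (is_derive_unique _ _ _ Hd). exact Hd.
  - intros n. destruct (K n) as (a & Hd & Ht). apply taylor_order_S.
    apply (taylor_order_ext (S n) a); [|assumption]. intros eps He. symmetry. apply is_derive_unique. now apply Hd.
Qed.

(** Any sample point would do in place of -1 for [cb_quot], which is constant in [y]. *)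
Lemma Expd_taylor n G : Expd n w1 G -> exists (a : nat -> R -> R) (C : R), 0 <= C /\
  (forall k eps, 0 < eps < e0 -> Rabs (a k eps) <= C) /\
  forall eps h, increment eps h -> Rabs (G eps h (-1) - psum (fun k => a k eps) h n) <= C * Rabs h ^ n.
Proof.
  revert G. induction n as [|n IH]; intros G.
  - intros [C [HC H]]. exists (fun _ _ => 0), C. split; [assumption|]. split; [intros; rewrite Rabs_R0; lra|].
    intros eps h Hh. destruct (H eps h (-1) Hh ltac:(lra)) as [Hb _]. unfold w1 in Hb. simpl. rewrite Rminus_0_r. lra.
  - intros (a0 & G1 & [C0 [HC0 H0]] & HG1 & EG). destruct (IH G1 HG1) as (a & C & HC & Ha & H).
    exists (fun k eps => pcons (a0 eps (-1)) (fun k => a k eps) k), (C0 + C). split; [lra|]. split.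
    + intros [|k] eps He; simpl.
      * destruct (increment_exists eps He) as [h Hh]. destruct (H0 eps h (-1) Hh ltac:(lra)) as [Hb _]. unfold w1 in Hb. lra.
      * specialize (Ha k eps He). lra.
    + intros eps h Hh. change (fun k => pcons (a0 eps (-1)) (fun k0 => a k0 eps) k) with (pcons (a0 eps (-1)) (fun k => a k eps)).
      rewrite psum_cons, EG by (trivial; lra).
      replace (a0 eps (-1) + h * G1 eps h (-1) - (a0 eps (-1) + h * psum (fun k => a k eps) h n))
        with (h * (G1 eps h (-1) - psum (fun k => a k eps) h n)) by ring.
      rewrite Rabs_mult. specialize (H eps h Hh). simpl.
      assert (0 <= Rabs h ^ n) by (apply pow_le, Rabs_pos). pose proof (Rabs_pos h).
      apply Rle_trans with (Rabs h * (C * Rabs h ^ n)); [now apply Rmult_le_compat_l|].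
      assert (0 <= C0 * (Rabs h * Rabs h ^ n)) by (apply Rmult_le_pos; nra). lra.
Qed.

Lemma cb_uniformly_smooth : uniformly_smooth cb.
Proof.
  assert (K : forall n, taylor_order (S n) cb).
  { intros n. destruct (Expd_taylor n cb_quot (cb_expands n)) as (a & C & HC & Ha & H).
    (* Multiplying the quotient by [h] shifts the coefficients by one place; the added 2 bounds the
       new leading coefficient [cb eps]. *)
    exists (fun k eps => pcons (cb eps) (fun k => a k eps) k), (C + 2). split; [lra|]. split.
    - intros [|k] eps He; simpl.
      + pose proof (cb_bounds eps ltac:(lra)). rewrite Rabs_right; lra.
      + specialize (Ha k eps He). lra.
    - intros eps h Hh. change (fun k => pcons (cb eps) (fun k0 => a k0 eps) k) with (pcons (cb eps) (fun k => a k eps)).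
      rewrite psum_cons.
      assert (Hp : 0 <= Rabs h ^ S n) by (apply pow_le, Rabs_pos).
      destruct (Req_dec h 0) as [-> |Hh0].
      { rewrite Rmult_0_l, !Rplus_0_r, Rminus_diag, Rabs_R0. apply Rmult_le_pos; [lra|]. rewrite Rabs_R0 in Hp. assumption. }
      destruct Hh as (H1 & H2 & H3). specialize (H eps h ltac:(repeat split; lra)).
      replace (cb (eps + h) - (cb eps + h * psum (fun k => a k eps) h n)) with (h * (cb_quot eps h (-1) - psum (fun k => a k eps) h n)).
      2:{ unfold cb_quot. field. assumption. }
      rewrite Rabs_mult. simpl. pose proof (Rabs_pos h).
      apply Rle_trans with (Rabs h * (C * Rabs h ^ n)); [now apply Rmult_le_compat_l|].
      simpl in Hp. nra. }
  intros [|n]; [apply taylor_order_S|]; apply K.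
Qed.

Lemma cb_Derive_n n : uniformly_smooth (Derive_n cb n).
Proof. induction n as [|n IH]; [apply cb_uniformly_smooth|]. simpl. now apply uniformly_smooth_derive. Qed.

Lemma cb_Derive_n_derive n eps : 0 < eps < e0 -> is_derive (Derive_n cb n) eps (Derive_n cb (S n) eps).
Proof. apply (uniformly_smooth_derive _ (cb_Derive_n n)). Qed.

Lemma cb_Derive_n_bounded n : exists B, 0 <= B /\ forall eps, 0 < eps < e0 -> Rabs (Derive_n cb n eps) <= B.
Proof.
  destruct (cb_Derive_n n 0%nat) as (a & C & HC & _ & H). exists C. split; [assumption|]. intros eps He.
  specialize (H eps 0 ltac:(repeat split; rewrite ?Rabs_R0; lra)).
  simpl in H. rewrite Rplus_0_r, Rminus_0_r in H. lra.
Qed.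

(** * One-sided smoothness at the origin *)

(** A sequence that tends to 0; the summand 2 keeps even its first term strictly below [e0]. *)
Definition start (m : nat) : R := e0 / (INR m + 2).

Lemma start_bounds m : 0 < start m < e0.
Proof.
  unfold start. pose proof (pos_INR m). pose proof e0_pos. split; [apply Rdiv_lt_0_compat; lra|].
  apply Rmult_lt_reg_r with (INR m + 2); [lra|]. unfold Rdiv. rewrite Rmult_assoc, Rinv_l by lra. nra.
Qed.

Lemma start_lim : is_lim_seq start 0.
Proof.
  unfold start. replace 0 with (e0 * 0) by ring. apply (is_lim_seq_scal_l _ e0 (Finite 0)).
  apply (is_lim_seq_inv (fun n => INR n + 2) p_infty); [|easy].
  apply (is_lim_seq_plus INR (fun _ => 2) p_infty 2 p_infty); [apply is_lim_seq_INR|apply is_lim_seq_const|easy].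
Qed.

Definition cb0 (n : nat) : R := real (Lim_seq (fun m => Derive_n cb n (start m))).

Lemma cb_Derive_n_mvt n x y : 0 < x -> x < y -> y < e0 ->
  exists xi, x < xi < y /\ Derive_n cb n y - Derive_n cb n x = Derive_n cb (S n) xi * (y - x).
Proof.
  intros Hx Hxy Hy. apply mvt_open; [assumption|..]; intros t Ht.
  - apply (deriv_cont _ _ _ (cb_Derive_n_derive n t ltac:(lra))).
  - apply cb_Derive_n_derive. lra.
Qed.

Lemma cb0_rate n : exists B, 0 <= B /\ forall x, 0 < x < e0 -> Rabs (Derive_n cb n x - cb0 n) <= B * x.
Proof.
  destruct (cb_Derive_n_bounded (S n)) as [B [HB H]]. exists B. split; [assumption|].
  assert (Hl : forall x y, 0 < x < e0 -> 0 < y < e0 -> Rabs (Derive_n cb n x - Derive_n cb n y) <= B * x + B * y).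
  { assert (K : forall x y, 0 < x -> x < y -> y < e0 -> Rabs (Derive_n cb n y - Derive_n cb n x) <= B * (y - x)).
    { intros x y Hx Hxy Hy. destruct (cb_Derive_n_mvt n x y Hx Hxy Hy) as [xi [Hxi E]].
      rewrite E, Rabs_mult, (Rabs_right (y - x)) by lra. apply Rmult_le_compat_r; [lra|]. apply H. lra. }
    intros x y Hx Hy. destruct (Rtotal_order x y) as [Hlt|[->|Hgt]].
    - rewrite Rabs_minus_sym. specialize (K x y ltac:(lra) Hlt ltac:(lra)). nra.
    - rewrite Rminus_diag, Rabs_R0. nra.
    - specialize (K y x ltac:(lra) Hgt ltac:(lra)). nra. }
  assert (HBl : is_lim_seq (fun m => B * start m) 0).
  { replace 0 with (B * 0) by ring. apply (is_lim_seq_scal_l _ B (Finite 0)), start_lim. }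
  intros x Hx.
  enough (Rabs (Derive_n cb n x - cb0 n) - B * x <= 0) by lra.
  apply (le_of_lim0 (fun m => B * start m + B * start m)).
  - replace 0 with (0 + 0) by ring. now apply is_lim_seq_plus'.
  - intros m.
    assert (H1 : Rabs (Derive_n cb n (start m) - cb0 n) <= B * start m).
    { apply (cauchy_rate (fun m => Derive_n cb n (start m)) (fun m => B * start m) HBl).
      intros p q. apply Hl; apply start_bounds. }
    pose proof (Hl x (start m) Hx (start_bounds m)) as H2.
    replace (Derive_n cb n x - cb0 n) with ((Derive_n cb n x - Derive_n cb n (start m)) + (Derive_n cb n (start m) - cb0 n)) by ring.
    pose proof (Rabs_triang (Derive_n cb n x - Derive_n cb n (start m)) (Derive_n cb n (start m) - cb0 n)). lra.
Qed.

(** Mean value theorem on [[y, x]], with the next derivative within [B * xi] of its limit, and then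
    [y] tending to 0. *)
Lemma cb0_derive n : exists B, 0 <= B /\ forall x, 0 < x < e0 -> Rabs (Derive_n cb n x - cb0 n - cb0 (S n) * x) <= B * x ^ 2.
Proof.
  destruct (cb0_rate (S n)) as [B [HB H]]. destruct (cb0_rate n) as [B0 [HB0 H0]].
  exists B. split; [assumption|]. intros x Hx.
  set (D := B0 + Rabs (cb0 (S n))). assert (HD : 0 <= D) by (unfold D; pose proof (Rabs_pos (cb0 (S n))); lra).
  enough (Rabs (Derive_n cb n x - cb0 n - cb0 (S n) * x) - B * x ^ 2 <= 0) by lra.
  destruct (lim0_eps _ start_lim x ltac:(lra)) as [m0 Hm0].
  destruct (Rle_lt_dec (Rabs (Derive_n cb n x - cb0 n - cb0 (S n) * x) - B * x ^ 2) 0) as [|Hp]; [assumption|exfalso].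
  set (gap := Rabs (Derive_n cb n x - cb0 n - cb0 (S n) * x) - B * x ^ 2) in *.
  (* So small that the errors at [y], at most [D * y], do not fill the supposed gap. *)
  set (y := Rmin (x / 2) (gap / (2 * (D + 1)))).
  assert (Hy : 0 < y) by (apply Rmin_glb_lt; [lra|apply Rdiv_lt_0_compat; lra]).
  assert (Hyx : y <= x / 2) by apply Rmin_l.
  assert (Hyg : y * (D + 1) < gap).
  { assert (y <= gap / (2 * (D + 1))) by apply Rmin_r.
    apply Rle_lt_trans with (gap / (2 * (D + 1)) * (D + 1)); [apply Rmult_le_compat_r; lra|].
    replace (gap / (2 * (D + 1)) * (D + 1)) with (gap / 2) by (field; lra). lra. }
  destruct (cb_Derive_n_mvt n y x ltac:(lra) ltac:(lra) ltac:(lra)) as [xi [Hxi E]].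
  specialize (H xi ltac:(lra)). specialize (H0 y ltac:(lra)).
  assert (E2 : Derive_n cb n x - cb0 n - cb0 (S n) * x
    = (Derive_n cb (S n) xi - cb0 (S n)) * (x - y) + (Derive_n cb n y - cb0 n) - cb0 (S n) * y).
  { replace (Derive_n cb n x) with (Derive_n cb (S n) xi * (x - y) + Derive_n cb n y) by lra. ring. }
  assert (Hb : Rabs (Derive_n cb n x - cb0 n - cb0 (S n) * x) <= B * x ^ 2 + D * y).
  { rewrite E2. unfold Rminus at 1.
    eapply Rle_trans; [apply Rabs_triang|]. rewrite Rabs_Ropp, (Rabs_mult (cb0 _)), (Rabs_right y) by lra.
    eapply Rle_trans; [apply Rplus_le_compat_r, Rabs_triang|].
    rewrite Rabs_mult, (Rabs_right (x - y)) by lra.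
    assert (Rabs (Derive_n cb (S n) xi - cb0 (S n)) * (x - y) <= B * xi * (x - y)) by (apply Rmult_le_compat_r; lra).
    assert (B * xi * (x - y) <= B * x ^ 2).
    { rewrite Rmult_assoc. apply Rmult_le_compat_l; [assumption|]. nra. }
    unfold D. lra. }
  unfold gap in *. nra.
Qed.

Lemma is_derive_on_intro (D : R -> Prop) (f : R -> R) (x l : R) : D x ->
  (forall e, 0 < e -> exists d, 0 < d /\ forall y, D y -> Rabs (y - x) < d ->
     Rabs (f y - f x - l * (y - x)) <= e * Rabs (y - x)) ->
  is_derive_on D f x l.
Proof.
  intros Dx H. split; [exact (is_linear_scal_l (K := R_AbsRing) (V := R_NormedModule) l)|].
  intros x' Hx' [e He].
  assert (x = x') as <-.
  { destruct (Req_dec x x') as [|Hn]; [assumption|exfalso].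
    assert (Hd : 0 < Rabs (x - x')) by (apply Rabs_pos_lt; lra).
    assert (HL : locally x' (fun z : R => Rabs (z - x') < Rabs (x - x'))).
    { exists (mkposreal _ Hd). intros z Hz. exact Hz. }
    specialize (Hx' _ HL).
    destruct Hx' as [r Hr]. specialize (Hr x (ball_center x r) Dx). simpl in Hr. lra. }
  destruct (H e He) as [d [Hd Hd']]. exists (mkposreal d Hd). intros y Hy Dy.
  specialize (Hd' y Dy Hy).
  unfold norm, minus, plus, opp, scal; simpl. unfold abs, mult; simpl.
  replace (f y + - f x + - ((y + - x) * l)) with (f y - f x - l * (y - x)) by ring. exact Hd'.
Qed.

Definition cbar (eps : R) : R := if Rle_dec eps 0 then 1 else cb eps.
Definition cbar_deriv (n : nat) (eps : R) : R := if Rle_dec eps 0 then cb0 n else Derive_n cb n eps.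

Lemma cbar_deriv_derive n x : 0 <= x < e0 ->
  is_derive_on (fun eps => 0 <= eps < e0) (cbar_deriv n) x (cbar_deriv (S n) x).
Proof.
  intros Hx. apply is_derive_on_intro; [assumption|]. intros e He.
  unfold cbar_deriv. destruct (Rle_dec x 0) as [Hx0|Hx0].
  - assert (x = 0) as -> by lra. destruct (cb0_derive n) as [B [HB H]].
    exists (e / (B + 1)). split; [apply Rdiv_lt_0_compat; lra|]. intros y Hy Hyd.
    rewrite Rminus_0_r in *. destruct (Rle_dec y 0) as [Hy0|Hy0].
    + assert (y = 0) as -> by lra. rewrite Rmult_0_r, Rminus_diag, Rminus_0_r, Rabs_R0. lra.
    + specialize (H y ltac:(lra)). rewrite (Rabs_right y) in * by lra. apply Rle_trans with (1 := H).
      replace (B * y ^ 2) with (B * y * y) by ring. apply Rmult_le_compat_r; [lra|].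
      assert (y * (B + 1) < e).
      { apply Rmult_lt_reg_r with (/ (B + 1)); [apply Rinv_0_lt_compat; lra|].
        rewrite Rmult_assoc, Rinv_r by lra. unfold Rdiv in *. lra. }
      nra.
  - destruct (proj1 (is_derive_eps _ _ _) (cb_Derive_n_derive n x ltac:(lra)) e He) as [d [Hd Hd']].
    exists (Rmin d (x / 2)). split; [apply Rmin_glb_lt; lra|]. intros y Hy Hyd.
    pose proof (Rmin_l d (x / 2)). pose proof (Rmin_r d (x / 2)).
    destruct (Rle_dec y 0) as [Hy0|Hy0].
    + rewrite Rabs_left1 in Hyd; lra.
    + apply Hd'. lra.
Qed.

Lemma cbar_smooth : cb0 0 = 1 -> smooth_on (fun eps => 0 <= eps < e0) cbar.
Proof.
  intros H1. exists cbar_deriv. split; [|intros; now apply cbar_deriv_derive].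
  intros x Hx. unfold cbar_deriv, cbar. destruct Rle_dec; [assumption|easy].
Qed.

(** * The derivative of the threshold speed at the origin *)

Lemma hs2_range x : x <= 0 -> 0 <= hs2 x <= 1.
Proof.
  intros Hx. split.
  - pose proof (hs2_antitone x 0 ltac:(lra)) as H. unfold hs2 at 1 in H. rewrite exp_0 in H. lra.
  - unfold hs2. pose proof (exp_pos x). nra.
Qed.

Definition defect (x : R) : R := 1 - h_s x.

Lemma defect_cont x : continuous defect x.
Proof. unfold defect, h_s. cont. Qed.

(** [1 - sqrt u <= 1 - u] for [u] in [0,1], at [u = hs2 x]. *)
Lemma defect_bounds x : x <= 0 -> 0 <= defect x <= (1 - x) * exp x.
Proof.
  intros Hx. pose proof (hs2_range x Hx) as H. unfold defect, h_s. fold (hs2 x).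
  pose proof (sqrt_pos (hs2 x)). pose proof (sqrt_sqrt (hs2 x) ltac:(lra)).
  assert (sqrt (hs2 x) <= 1) by nra.
  assert (hs2 x <= sqrt (hs2 x)) by nra. unfold hs2 in *. lra.
Qed.

(** The integral of [(1 - x) * exp x] from minus infinity to [a]. *)
Definition layer_tail (a : R) : R := (2 - a) * exp a.

Lemma layer_tail_deriv x : is_derive layer_tail x ((1 - x) * exp x).
Proof. unfold layer_tail. auto_derive; [easy|ring]. Qed.

Lemma defect_increment a b : a <= b <= 0 -> 0 <= RInt defect a b <= layer_tail b - layer_tail a.
Proof.
  intros H. split.
  - apply RInt_ge_0; [lra|apply exRI, defect_cont|]. intros x Hx. apply defect_bounds. lra.
  - eapply Rle_trans; [apply Rle_abs|].
    apply (RI_le_increment defect layer_tail (fun x => (1 - x) * exp x)); [lra|..]; intros x Hx.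
    + apply defect_cont.
    + exact (deriv_cont _ _ _ (layer_tail_deriv x)).
    + apply layer_tail_deriv.
    + pose proof (defect_bounds x ltac:(lra)). rewrite Rabs_right; lra.
Qed.

Lemma layer_tail_pos a : a <= 0 -> 0 <= layer_tail a.
Proof. intros H. unfold layer_tail. pose proof (exp_pos a). nra. Qed.

Lemma layer_tail_small a : a <= -2 -> layer_tail a <= 54 / a ^ 2.
Proof.
  intros Ha. unfold layer_tail. pose proof (exp_neg_cube (- a) ltac:(lra)) as H. rewrite Ropp_involutive in H.
  apply Rle_trans with ((2 - a) * (27 / (- a) ^ 3)); [apply Rmult_le_compat_l; lra|].
  apply Rmult_le_reg_r with ((- a) ^ 3); [apply pow_lt; lra|].
  replace ((2 - a) * (27 / (- a) ^ 3) * (- a) ^ 3) with (27 * (2 - a)) by (field; lra).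
  replace (54 / a ^ 2 * (- a) ^ 3) with (- 54 * a) by (field; lra). lra.
Qed.

Lemma layer_tail_eventually e : 0 < e -> exists A, 2 <= A /\ forall a, a <= - A -> layer_tail a < e.
Proof.
  intros He. exists (2 + 54 / e). assert (0 < 54 / e) by (apply Rdiv_lt_0_compat; lra). split; [lra|].
  intros a Ha. eapply Rle_lt_trans; [apply layer_tail_small; lra|].
  apply Rmult_lt_reg_r with (a ^ 2); [nra|]. replace (54 / a ^ 2 * a ^ 2) with 54 by (field; lra).
  assert (54 / e * e = 54) by (field; lra). nra.
Qed.

(** The explicit tail bound is what identifies the improper integral, the limit of [mass / eps] and
    the decimal value. *)
Lemma defect_integral : exists I, forall a, a <= 0 -> 0 <= I - RInt defect a 0 <= layer_tail a.
Proof.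
  assert (Hch : forall a b, a <= b <= 0 -> RInt defect a 0 = RInt defect a b + RInt defect b 0).
  { intros a b H. symmetry. apply RI_Chasles; apply exRI, defect_cont. }
  assert (Hex : ex_finite_lim_seq (fun n => RInt defect (- INR n) 0)).
  { apply ex_finite_lim_seq_incr with 2.
    - intros n. rewrite S_INR. pose proof (pos_INR n).
      rewrite (Hch (- (INR n + 1)) (- INR n)) by lra.
      pose proof (defect_increment (- (INR n + 1)) (- INR n) ltac:(lra)). lra.
    - intros n. pose proof (pos_INR n). pose proof (defect_increment (- INR n) 0 ltac:(lra)).
      pose proof (layer_tail_pos (- INR n) ltac:(lra)). unfold layer_tail at 1 in H0. rewrite exp_0 in H0. lra. }
  apply Lim_seq_correct' in Hex. set (I := real (Lim_seq (fun n => RInt defect (- INR n) 0))) in *.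
  exists I. intros a Ha.
  destruct (nfloor_ex (- a) ltac:(lra)) as [n0 Hn0].
  assert (Hev : eventually (fun n => RInt defect a 0 <= RInt defect (- INR n) 0 <= RInt defect a 0 + layer_tail a)).
  { exists (S n0). intros n Hn. apply le_INR in Hn. rewrite S_INR in Hn.
    rewrite (Hch (- INR n) a) by lra. pose proof (defect_increment (- INR n) a ltac:(lra)).
    pose proof (layer_tail_pos (- INR n) ltac:(lra)). lra. }
  split.
  - enough (RInt defect a 0 <= I) by lra.
    refine (is_lim_seq_le_loc (fun _ => RInt defect a 0) _ _ _ _ (is_lim_seq_const _) Hex).
    revert Hev. apply filter_imp. intros n Hn. lra.
  - enough (I <= RInt defect a 0 + layer_tail a) by lra.
    refine (is_lim_seq_le_loc _ (fun _ => RInt defect a 0 + layer_tail a) _ _ _ Hex (is_lim_seq_const _)).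
    revert Hev. apply filter_imp. intros n Hn. lra.
Qed.

Lemma defect_RInt_gen I : (forall a, a <= 0 -> 0 <= I - RInt defect a 0 <= layer_tail a) ->
  is_RInt_gen (fun x => 1 - h_s x) (Rbar_locally m_infty) (at_point 0) I.
Proof.
  intros HI P [[d Hd] HP].
  destruct (layer_tail_eventually d Hd) as [A [HA HA']].
  apply (Filter_prod _ _ _ (fun a => a < - A) (fun b => b = 0)).
  - exists (- A). auto.
  - reflexivity.
  - intros a b Ha ->. exists (RInt defect a 0). split.
    + apply (RInt_correct (V := R_CompleteNormedModule)). apply exRI, defect_cont.
    + apply HP. unfold ball; simpl. unfold AbsRing_ball, abs, minus, plus, opp; simpl.
      specialize (HI a ltac:(lra)). specialize (HA' a ltac:(lra)). rewrite Rabs_left1; lra.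
Qed.

Section Asymptotics.
Variable eps : R.
Hypothesis He : 0 < eps <= e0.
Let c := cb eps.
Let S := front eps c.

Let He' : 0 < eps. Proof. lra. Qed.
Let Hc : 9 / 10 <= c <= 2. Proof. apply cb_bounds, He. Qed.
Let HS : is_front eps c S. Proof. apply strong_is_front, He. Qed.

Lemma front_integral : c * RInt S 0 1 = 1 / 2 - eps - reac_prim eps 0.
Proof.
  assert (C : forall t, continuous S t) by apply HS.
  (* The derivative vanishes identically, so the values at 0 and 1 agree; the energy is 0 at both
     ends. *)
  destruct (mvt_open (fun th => S th ^ 2 / 2 + reac_prim eps th - c * RInt S 0 th)
    (fun th => c * S th - reac eps th + reac eps th - c * S th) 0 1 ltac:(lra)) as [xi [_ E]].
  - intros t _. apply cont_minus.
    + apply cont_plus; [now apply (front_energy_cont eps c)|now apply reac_prim_cont].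
    + apply cont_mult; [apply cont_const|now apply RI_cont].
  - intros t Ht. apply deriv_minus.
    + apply (deriv_plus (fun th => S th ^ 2 / 2)); [|now apply reac_prim_derive].
      now apply (front_energy_derive eps c S HS).
    + apply (is_derive_scal (fun th => RInt S 0 th)). apply RI_deriv; [auto|].
      exists (mkposreal 1 Rlt_0_1). auto.
  - rewrite (front_1 eps c S HS), (reac_prim_1 eps He'), RI_point in E.
    assert (H0 : S 0 = 0) by apply (cb_spec eps He). rewrite H0 in E. lra.
Qed.

Definition mass : R := RInt (fun th => c * th - S th) 0 1.

Lemma mass_front : mass = c / 2 - RInt S 0 1.
Proof.
  assert (C : forall t, continuous S t) by apply HS.
  unfold mass. rewrite RI_minus, RI_scal; [|apply exRI; intros; cont|apply exRI; intros; cont|now apply exRI].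
  rewrite (is_RInt_unique (fun th : R => th) 0 1 (1 / 2)); [field|].
  replace (1 / 2) with (minus ((fun x => x ^ 2 / 2) 1) ((fun x => x ^ 2 / 2) 0)).
  - apply (is_RInt_derive (V := R_CompleteNormedModule) (fun x => x ^ 2 / 2)).
    + intros x _. auto_derive; [easy|field].
    + intros x _. cont.
  - unfold minus, plus, opp; simpl. field.
Qed.

Lemma reac_prim_0 : Rabs (reac_prim eps 0) <= 27 * eps ^ 3.
Proof.
  unfold reac_prim, lay. pose proof (exp_neg_cube (1 / eps) ltac:(apply Rdiv_lt_0_compat; lra)) as H.
  replace (27 / (1 / eps) ^ 3) with (27 * eps ^ 3) in H by (field; lra).
  replace ((0 - 1) / eps) with (- (1 / eps)) by (field; lra).
  replace (((1 - - (1 / eps)) * exp (- (1 / eps)) - eps * ((- (1 / eps)) ^ 2 - 2 * - (1 / eps) + 2) * exp (- (1 / eps))) / 2)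
    with (- (exp (- (1 / eps)) * (1 / 2 + eps))) by (field; lra).
  rewrite Rabs_Ropp, Rabs_right by (apply Rle_ge, Rmult_le_pos; [left; apply exp_pos|lra]).
  pose proof (exp_pos (- (1 / eps))). unfold e0 in He. nra.
Qed.

Lemma speed_identity : Rabs (c ^ 2 - 1 + 2 * eps - 2 * c * mass) <= 54 * eps ^ 3.
Proof.
  pose proof front_integral as H1. pose proof mass_front as H2. pose proof reac_prim_0 as H3.
  apply Rabs_le_between in H3. apply Rabs_le. rewrite H2. split; nra.
Qed.

Definition scaled (x : R) : R := c * (1 + eps * x) - S (1 + eps * x).

Lemma scaled_cont x : continuous scaled x.
Proof.
  assert (C : forall t, continuous S t) by apply HS.
  unfold scaled. apply cont_minus; [cont|]. apply (continuous_comp (fun x => 1 + eps * x) S); [cont|auto].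
Qed.

Lemma mass_scaled : mass = eps * RInt scaled (- / eps) 0.
Proof.
  assert (C : forall t, continuous S t) by apply HS.
  unfold mass. rewrite <- RI_scal by apply exRI, scaled_cont.
  assert (E := RInt_comp_lin (V := R_CompleteNormedModule) (fun th => c * th - S th) eps 1 (- / eps) 0).
  replace (eps * - / eps + 1) with 0 in E by (field; lra). replace (eps * 0 + 1) with 1 in E by ring.
  rewrite <- E.
  - apply RInt_ext. intros x _. unfold scal; simpl; unfold mult; simpl. unfold scaled.
    replace (eps * x + 1) with (1 + eps * x) by ring. ring.
  - apply exRI. intros x. cont. auto.
Qed.

Lemma lay_scaled x : lay eps (1 + eps * x) = x.
Proof. unfold lay. field. lra. Qed.

Lemma inv_eps_scaled x : - / eps <= x -> 0 <= 1 + eps * x.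
Proof.
  intros Hx. apply Rmult_le_compat_l with (r := eps) in Hx; [|lra].
  replace (eps * - / eps) with (-1) in Hx by (field; lra). lra.
Qed.

Lemma scaled_bound x : - / eps < x < 0 -> 0 <= scaled x <= 3 * exp (x / 4).
Proof.
  intros Hx. assert (Hth : 0 < 1 + eps * x).
  { destruct Hx as [Hx _]. apply Rmult_lt_compat_l with (r := eps) in Hx; [|lra].
    replace (eps * - / eps) with (-1) in Hx by (field; lra). lra. }
  pose proof (strong_defect eps He (1 + eps * x) ltac:(nra)) as [H1 H2].
  rewrite lay_scaled in H2. fold c S in H1, H2. unfold scaled. split; [assumption|].
  apply Rle_trans with (1 := H2). pose proof (exp_pos (x / 4)).
  assert (eps * x <= 0) by nra. nra.
Qed.

Lemma scaled_increment a b : - / eps <= a -> a <= b <= 0 -> 0 <= RInt scaled a b <= 12 * (exp (b / 4) - exp (a / 4)).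
Proof.
  intros Ha Hab. split.
  - apply RInt_ge_0; [lra|apply exRI, scaled_cont|]. intros x Hx. apply scaled_bound. lra.
  - eapply Rle_trans; [apply Rle_abs|].
    replace (12 * (exp (b / 4) - exp (a / 4))) with ((fun x => 12 * exp (x / 4)) b - (fun x => 12 * exp (x / 4)) a) by (cbv beta; ring).
    apply (RI_le_increment scaled (fun x => 12 * exp (x / 4)) (fun x => 3 * exp (x / 4))); [lra|..]; intros x Hx.
    + apply scaled_cont.
    + cont.
    + auto_derive; [easy|]. unfold Rdiv. field.
    + pose proof (scaled_bound x ltac:(lra)). rewrite Rabs_right; lra.
Qed.

Lemma inv_eps_pos : 0 < / eps. Proof. now apply Rinv_0_lt_compat. Qed.

Lemma mass_bound : 0 <= mass <= 12 * eps.
Proof.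
  rewrite mass_scaled. pose proof inv_eps_pos.
  pose proof (scaled_increment (- / eps) 0 ltac:(lra) ltac:(lra)) as [H1 H2].
  replace (0 / 4) with 0 in H2 by field. rewrite exp_0 in H2. pose proof (exp_pos (- / eps / 4)). nra.
Qed.

(** In [speed_identity] every term besides [c ^ 2 - 1] is of order eps, with [mass <= 12 * eps];
    divide by [c + 1]. *)
Lemma speed_rate : Rabs (c - 1) <= 60 * eps.
Proof.
  pose proof speed_identity as H. pose proof mass_bound as Hm. apply Rabs_le_between in H.
  assert (54 * eps ^ 3 <= eps) by (unfold e0 in He; nra).
  assert (0 <= c * mass <= 24 * eps) by nra.
  apply Rabs_le. split; nra.
Qed.

(** On this window both energy bounds agree with [hs2] up to [6 * eps * A]. Hoelder continuity of
    the square root is used because [hs2] vanishes at 0. *)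
Lemma scaled_limit A x : 1 <= A -> - A <= x <= 0 -> A <= / eps ->
  Rabs (scaled x - defect x) <= 62 * eps * A + sqrt (6 * eps * A).
Proof.
  intros HA Hx HAe. pose proof speed_rate as Hr.
  assert (Hth : 0 <= 1 + eps * x) by (apply inv_eps_scaled; lra).
  assert (Hex : 0 <= - (eps * x) <= eps * A) by nra.
  assert (H1 : Rabs (S (1 + eps * x) - h_s x) <= sqrt (6 * eps * A)).
  { assert (HSp : 0 <= S (1 + eps * x)) by apply HS.
    rewrite <- (sqrt_pow2 (S (1 + eps * x))) by assumption.
    unfold h_s. fold (hs2 x). eapply Rle_trans; [apply sqrt_Hoelder|]. apply sqrt_mono.
    pose proof (front_energy_upper eps c S He' ltac:(lra) HS (1 + eps * x) ltac:(lra)) as U.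
    pose proof (front_energy_lower_far eps c S He' ltac:(lra) HS (1 + eps * x) ltac:(lra)) as L.
    rewrite lay_scaled in U, L. apply Rabs_le. split; nra. }
  unfold scaled, defect.
  replace (c * (1 + eps * x) - S (1 + eps * x) - (1 - h_s x))
    with ((c - 1) + c * (eps * x) + - (S (1 + eps * x) - h_s x)) by ring.
  eapply Rle_trans; [apply Rabs_triang|]. rewrite Rabs_Ropp.
  assert (Rabs (c - 1 + c * (eps * x)) <= 62 * eps * A).
  { apply Rabs_le_between in Hr. apply Rabs_le. split; nra. }
  lra.
Qed.

(** Split at [- A]: convergence on the window is uniform, and the two tails have explicit
    exponential bounds independent of eps. *)
Lemma mass_limit I A : (forall a, a <= 0 -> 0 <= I - RInt defect a 0 <= layer_tail a) ->
  1 <= A -> A <= / eps ->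
  Rabs (mass / eps - I) <= A * (62 * eps * A + sqrt (6 * eps * A)) + 12 * exp (- A / 4) + layer_tail (- A).
Proof.
  intros HI HA HAe.
  assert (E : mass / eps = RInt scaled (- / eps) (- A) + RInt scaled (- A) 0).
  { rewrite mass_scaled, RI_Chasles by apply exRI, scaled_cont. field. lra. }
  pose proof (scaled_increment (- / eps) (- A) ltac:(lra) ltac:(lra)) as H1.
  specialize (HI (- A) ltac:(lra)).
  assert (H2 : Rabs (RInt scaled (- A) 0 - RInt defect (- A) 0) <= A * (62 * eps * A + sqrt (6 * eps * A))).
  { rewrite <- RI_minus by (apply exRI; first [apply scaled_cont|apply defect_cont]).
    replace (A * (62 * eps * A + sqrt (6 * eps * A))) with (Rabs (0 - - A) * (62 * eps * A + sqrt (6 * eps * A))).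
    2:{ rewrite Rabs_right by lra. ring. }
    apply RI_abs_const.
    - apply exRI. intros x. apply cont_minus; [apply scaled_cont|apply defect_cont].
    - intros x Hx. rewrite Rmin_left, Rmax_right in Hx by lra. apply scaled_limit; lra. }
  rewrite E. apply Rabs_le_between in H2. pose proof (exp_pos (- / eps / 4)). apply Rabs_le. split; lra.
Qed.
End Asymptotics.

Lemma exp_quarter_eventually e : 0 < e -> exists A, 1 <= A /\ forall a, A <= a -> exp (- a / 4) < e.
Proof.
  intros He. exists (1 + 4 / e). assert (0 < 4 / e) by (apply Rdiv_lt_0_compat; lra). split; [lra|].
  intros a Ha. replace (- a / 4) with (- (a / 4)) by field. rewrite exp_Ropp.
  pose proof (exp_ineq1_le (a / 4)). apply Rle_lt_trans with (/ (a / 4)).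
  - apply Rinv_le_contravar; lra.
  - apply Rmult_lt_reg_r with (a / 4); [lra|]. rewrite Rinv_l by lra.
    assert (4 / e * e = 4) by (field; lra). nra.
Qed.

Lemma mass_cvg I d : (forall a, a <= 0 -> 0 <= I - RInt defect a 0 <= layer_tail a) -> 0 < d ->
  exists r, 0 < r <= e0 /\ forall eps, 0 < eps < r -> Rabs (mass eps / eps - I) < d.
Proof.
  intros HI Hd.
  destruct (exp_quarter_eventually (d / 50) ltac:(lra)) as [A1 [HA1 H1]].
  destruct (layer_tail_eventually (d / 4) ltac:(lra)) as [A2 [HA2 H2]].
  set (A := A1 + A2).
  assert (Hlim : continuous (fun eps => A * (62 * eps * A + sqrt (6 * eps * A))) 0) by cont.
  destruct (proj1 (cont_eps _ _) Hlim (d / 4) ltac:(lra)) as [r [Hr H3]].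
  pose proof e0_pos. assert (0 < / A) by (apply Rinv_0_lt_compat; unfold A; lra).
  exists (Rmin e0 (Rmin r (/ A))). split.
  { split; [|apply Rmin_l]. repeat apply Rmin_glb_lt; assumption. }
  intros eps Heps. pose proof (Rmin_l e0 (Rmin r (/ A))). pose proof (Rmin_r e0 (Rmin r (/ A))).
  pose proof (Rmin_l r (/ A)). pose proof (Rmin_r r (/ A)).
  assert (HAe : A <= / eps).
  { rewrite <- (Rinv_inv A). apply Rinv_le_contravar; lra. }
  pose proof (mass_limit eps ltac:(lra) I A HI ltac:(unfold A; lra) HAe) as H8.
  specialize (H3 eps ltac:(rewrite Rminus_0_r, Rabs_right; lra)). cbv beta in H3.
  replace (A * (62 * 0 * A + sqrt (6 * 0 * A))) with 0 in H3.
  2:{ rewrite !Rmult_0_r, !Rmult_0_l, sqrt_0. ring. }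
  rewrite Rminus_0_r in H3. apply Rabs_lt_between in H3.
  specialize (H1 A ltac:(unfold A; lra)). specialize (H2 (- A) ltac:(unfold A; lra)). lra.
Qed.

Lemma cb0_0 : cb0 0 = 1.
Proof.
  destruct (cb0_rate 0) as [B [HB H]].
  apply Rminus_diag_uniq. destruct (Req_dec (cb0 0 - 1) 0) as [|Hn]; [assumption|exfalso].
  pose proof (Rabs_pos_lt _ Hn) as Hp. set (g := Rabs (cb0 0 - 1)) in *.
  set (x := Rmin (e0 / 2) (g / (2 * (B + 61)))).
  pose proof e0_pos.
  assert (Hx : 0 < x) by (apply Rmin_glb_lt; [lra|apply Rdiv_lt_0_compat; lra]).
  assert (Hx1 : x <= e0 / 2) by apply Rmin_l.
  assert (Hx2 : x <= g / (2 * (B + 61))) by apply Rmin_r.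
  specialize (H x ltac:(lra)). pose proof (speed_rate x ltac:(lra)) as H1. simpl in H.
  assert (g <= B * x + 60 * x).
  { unfold g. replace (cb0 0 - 1) with (- (cb x - cb0 0) + (cb x - 1)) by ring.
    eapply Rle_trans; [apply Rabs_triang|]. rewrite Rabs_Ropp. lra. }
  assert (x * (B + 61) <= g / 2).
  { apply Rle_trans with (g / (2 * (B + 61)) * (B + 61)); [apply Rmult_le_compat_r; lra|]. right. field. lra. }
  nra.
Qed.

Lemma cb0_1 I : (forall a, a <= 0 -> 0 <= I - RInt defect a 0 <= layer_tail a) -> cb0 1 = I - 1.
Proof.
  intros HI. destruct (cb0_derive 0) as [B [HB H]]. rewrite cb0_0 in H.
  apply Rminus_diag_uniq. destruct (Req_dec (cb0 1 - (I - 1)) 0) as [|Hn]; [assumption|exfalso].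
  pose proof (Rabs_pos_lt _ Hn) as Hp. set (g := Rabs (cb0 1 - (I - 1))) in *.
  destruct (mass_cvg I (g / 8) HI ltac:(lra)) as [r [Hr Hm]].
  pose proof e0_pos.
  set (D := B + 10 ^ 4).
  (* Then [D * x <= g / 2], while the expansions give [g <= (B + 3000) * x + g / 8], which is
     impossible for positive [g]. *)
  set (x := Rmin (r / 2) (g / (2 * D))).
  assert (HD : 0 < D) by (unfold D; lra).
  assert (Hx : 0 < x) by (apply Rmin_glb_lt; [lra|apply Rdiv_lt_0_compat; lra]).
  assert (Hx1 : x <= r / 2) by apply Rmin_l.
  assert (Hx2 : x <= g / (2 * D)) by apply Rmin_r.
  specialize (H x ltac:(lra)). specialize (Hm x ltac:(lra)). simpl Derive_n in H.
  pose proof (speed_rate x ltac:(lra)) as H1. pose proof (speed_identity x ltac:(lra)) as H2.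
  pose proof (mass_bound x ltac:(lra)) as H3.
  set (c := cb x) in *. set (m := mass x) in *.
  set (mu := m / x) in *. assert (Em : m = mu * x) by (unfold mu; field; lra).
  rewrite Em in *. apply Rabs_le_between in H, H1, H2. apply Rabs_lt_between in Hm.
  assert (Hmu : 0 <= mu <= 12) by (split; nra).
  (* [2 (c - 1) = c^2 - 1 - (c - 1)^2] turns the identity for [c^2] into one for [c]. *)
  assert (Hsq : 0 <= (c - 1) ^ 2 <= 3600 * x ^ 2).
  { split; [apply pow2_ge_0|]. assert (0 <= (60 * x - (c - 1)) * (60 * x + (c - 1))) by (apply Rmult_le_pos; lra). lra. }
  assert (Hcm : Rabs ((c - 1) * mu) <= 720 * x).
  { rewrite Rabs_mult, (Rabs_right mu) by lra. assert (Rabs (c - 1) <= 60 * x) by (apply Rabs_le; lra).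
    pose proof (Rabs_pos (c - 1)). apply Rle_trans with (60 * x * 12); [apply Rmult_le_compat; lra|lra]. }
  apply Rabs_le_between in Hcm.
  assert (Hx3 : x ^ 3 <= x ^ 2) by (unfold e0 in *; nra).
  assert (Hcx : Rabs ((c - 1) * mu * x) <= 720 * x ^ 2).
  { rewrite Rabs_mult, (Rabs_right x) by lra. assert (Rabs ((c - 1) * mu) <= 720 * x) by (apply Rabs_le; lra).
    apply Rle_trans with (720 * x * x); [apply Rmult_le_compat_r; lra|lra]. }
  apply Rabs_le_between in Hcx.
  assert (K1 : Rabs (c - 1 - (mu - 1) * x) <= 3000 * x ^ 2) by (apply Rabs_le; lra).
  apply Rabs_le_between in K1.
  assert (K2 : Rabs ((cb0 1 - (I - 1)) * x) <= (B + 3000) * x ^ 2 + g / 8 * x).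
  { assert (Hmx : Rabs ((mu - I) * x) <= g / 8 * x).
    { rewrite Rabs_mult, (Rabs_right x) by lra. apply Rmult_le_compat_r; [lra|]. apply Rabs_le; lra. }
    apply Rabs_le_between in Hmx. apply Rabs_le. lra. }
  rewrite Rabs_mult, (Rabs_right x) in K2 by lra. fold g in K2.
  assert (K3 : g <= (B + 3000) * x + g / 8).
  { apply Rmult_le_reg_r with x; [assumption|]. lra. }
  assert (K4 : D * x <= g / 2).
  { apply Rle_trans with (D * (g / (2 * D))); [apply Rmult_le_compat_l; lra|]. right. field. lra. }
  unfold D in K4. nra.
Qed.

(** * Numerical value of the derivative *)

Lemma hs2_pos x : x < 0 -> 0 < hs2 x.
Proof.
  intros Hx. destruct (Rle_lt_dec x (-1)) as [H|H].
  - pose proof (hs2_ge_far x H). lra.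
  - pose proof (hs2_ge_quad x ltac:(lra)). nra.
Qed.

Definition dh_s (x : R) : R := x * exp x / (2 * h_s x).

Lemma h_s_cont x : continuous h_s x.
Proof. unfold h_s. cont. Qed.

Lemma h_s_pos x : x < 0 -> 0 < h_s x.
Proof. intros Hx. apply sqrt_lt_R0. now apply hs2_pos. Qed.

Lemma h_s_sq x : x < 0 -> h_s x * h_s x = hs2 x.
Proof. intros Hx. apply sqrt_sqrt. left. now apply hs2_pos. Qed.

Lemma h_s_derive x : x < 0 -> is_derive h_s x (dh_s x).
Proof.
  intros Hx. pose proof (hs2_pos x Hx). pose proof (h_s_pos x Hx).
  deriv_as (x * exp x * (/ (2 * sqrt (hs2 x)))).
  - apply (deriv_comp sqrt hs2); [|apply hs2_derive]. auto_derive; [lra|]. ring.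
  - unfold dh_s, h_s, Rdiv. reflexivity.
Qed.

(** Sign of the second derivative of [h_s]. For [x > -1] the difference of the sides is
    [2 + 2 * x - (2 - x ^ 2) * exp x], which increases to 0. *)
Lemma concavity_sign x : x < 0 -> 2 * (1 + x) * hs2 x <= x ^ 2 * exp x.
Proof.
  intros Hx. destruct (Rle_lt_dec x (-1)) as [H|H].
  { pose proof (hs2_pos x Hx). pose proof (exp_pos x).
    assert (0 <= x ^ 2 * exp x) by (apply Rmult_le_pos; nra). nra. }
  assert (Hd1 : forall t, -1 < t <= 0 -> (2 - t ^ 2 - 2 * t) * exp t <= 2).
  { intros t Ht.
    assert (HH := nondecreasing_of_derive (fun t => (2 - t ^ 2 - 2 * t) * exp t) (fun t => - t * (4 + t) * exp t) t 0 ltac:(lra)).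
    cbv beta in HH. rewrite exp_0 in HH.
    enough ((2 - t ^ 2 - 2 * t) * exp t <= (2 - 0 ^ 2 - 2 * 0) * 1) by lra.
    apply HH; intros s Hs.
    - cont.
    - auto_derive; [easy|ring].
    - apply Rmult_le_pos; [nra|left; apply exp_pos]. }
  assert (HH := nondecreasing_of_derive (fun t => 2 + 2 * t - (2 - t ^ 2) * exp t) (fun t => 2 - (2 - t ^ 2 - 2 * t) * exp t) x 0 ltac:(lra)).
  cbv beta in HH. rewrite exp_0 in HH.
  enough (2 + 2 * x - (2 - x ^ 2) * exp x <= 2 + 2 * 0 - (2 - 0 ^ 2) * 1) by (unfold hs2; nra).
  apply HH; intros s Hs.
  - cont.
  - auto_derive; [easy|ring].
  - specialize (Hd1 s ltac:(lra)). lra.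
Qed.

Lemma dh_s_antitone x y : x <= y -> y < 0 -> dh_s y <= dh_s x.
Proof.
  intros Hxy Hy. enough (- dh_s x <= - dh_s y) by lra.
  set (d2 := fun t => exp t * (2 * (1 + t) * hs2 t - t ^ 2 * exp t) / (4 * h_s t ^ 3)).
  assert (D : forall t, t < 0 -> is_derive dh_s t (d2 t)).
  { intros t Ht. pose proof (h_s_pos t Ht). unfold dh_s at 1.
    deriv_as ((((1 + t) * exp t) * (2 * h_s t) - t * exp t * (2 * dh_s t)) / (2 * h_s t) ^ 2).
    - apply (deriv_div (fun t => t * exp t) (fun t => 2 * h_s t)); [auto_derive; [easy|ring]| |lra].
      apply (is_derive_scal h_s). now apply h_s_derive.
    - unfold d2, dh_s. rewrite <- (h_s_sq t Ht). field. lra. }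
  apply (nondecreasing_of_derive (fun t => - dh_s t) (fun t => - d2 t) x y Hxy).
  - intros t Ht. apply cont_opp. exact (deriv_cont _ _ _ (D t ltac:(lra))).
  - intros t Ht. apply (is_derive_opp dh_s). apply D. lra.
  - intros t Ht. pose proof (h_s_pos t ltac:(lra)) as Hp. pose proof (concavity_sign t ltac:(lra)).
    unfold d2. pose proof (exp_pos t). pose proof (pow_lt (h_s t) 3 Hp).
    assert (0 <= exp t * (t ^ 2 * exp t - 2 * (1 + t) * hs2 t) / (4 * h_s t ^ 3)).
    { apply Rmult_le_pos; [apply Rmult_le_pos; lra|]. left. apply Rinv_0_lt_compat. lra. }
    unfold Rdiv in *. lra.
Qed.

Lemma h_s_tangent m x : m < 0 -> x <= 0 -> h_s x <= h_s m + dh_s m * (x - m).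
Proof.
  intros Hm Hx. destruct (Rtotal_order x m) as [H|[-> |H]]; [|lra|].
  - destruct (mvt_open h_s dh_s x m H) as [xi [Hxi E]].
    + intros; apply h_s_cont.
    + intros; apply h_s_derive; lra.
    + pose proof (dh_s_antitone xi m ltac:(lra) Hm). nra.
  - destruct (mvt_open h_s dh_s m x H) as [xi [Hxi E]].
    + intros; apply h_s_cont.
    + intros; apply h_s_derive; lra.
    + pose proof (dh_s_antitone m xi ltac:(lra) ltac:(lra)). nra.
Qed.

Lemma h_s_chord a b x : a < x < b -> b <= 0 -> h_s a * (b - x) + h_s b * (x - a) <= h_s x * (b - a).
Proof.
  intros Hx Hb.
  destruct (mvt_open h_s dh_s a x ltac:(lra)) as [u [Hu Eu]];
    [intros; apply h_s_cont|intros; apply h_s_derive; lra|].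
  destruct (mvt_open h_s dh_s x b ltac:(lra)) as [v [Hv Ev]];
    [intros; apply h_s_cont|intros; apply h_s_derive; lra|].
  pose proof (dh_s_antitone u v ltac:(lra) ltac:(lra)).
  assert (0 <= (dh_s u - dh_s v) * ((x - a) * (b - x))) by (apply Rmult_le_pos; nra). nra.
Qed.

Ltac eqR := match goal with |- ?u = ?v => change (@eq R u v) end.

Lemma linear_RInt (p q a b : R) : is_RInt (fun x => p + q * x) a b (p * (b - a) + q * (b ^ 2 - a ^ 2) / 2).
Proof.
  replace (p * (b - a) + q * (b ^ 2 - a ^ 2) / 2)
    with (minus ((fun x => p * x + q * x ^ 2 / 2) b) ((fun x => p * x + q * x ^ 2 / 2) a)).
  - apply (is_RInt_derive (V := R_CompleteNormedModule) (fun x => p * x + q * x ^ 2 / 2)).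
    + intros x _. auto_derive; [easy|field].
    + intros x _. cont.
  - unfold minus, plus, opp; simpl. field.
Qed.

(** The tangent at the midpoint lies above a concave function. *)
Lemma midpoint_rule a b : a < b <= 0 -> RInt h_s a b <= (b - a) * h_s ((a + b) / 2).
Proof.
  intros H. set (m := (a + b) / 2).
  pose proof (linear_RInt (h_s m - dh_s m * m) (dh_s m) a b) as HL.
  replace ((b - a) * h_s m) with (RInt (fun x => h_s m - dh_s m * m + dh_s m * x) a b).
  - apply RInt_le; [lra|apply exRI, h_s_cont|eexists; exact HL|].
    intros x Hx. pose proof (h_s_tangent m x ltac:(unfold m; lra) ltac:(lra)). lra.
  - rewrite (is_RInt_unique _ _ _ _ HL). unfold m. eqR. field.
Qed.

Lemma trapezoid_rule a b : a < b <= 0 -> (b - a) * (h_s a + h_s b) / 2 <= RInt h_s a b.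
Proof.
  intros H. set (q := (h_s b - h_s a) / (b - a)).
  pose proof (linear_RInt (h_s a - q * a) q a b) as HL.
  replace ((b - a) * (h_s a + h_s b) / 2) with (RInt (fun x => h_s a - q * a + q * x) a b).
  - apply RInt_le; [lra|eexists; exact HL|apply exRI, h_s_cont|].
    intros x Hx. pose proof (h_s_chord a b x Hx ltac:(lra)).
    apply Rmult_le_reg_r with (b - a); [lra|].
    replace ((h_s a - q * a + q * x) * (b - a)) with (h_s a * (b - x) + h_s b * (x - a)) by (unfold q; field; lra).
    assumption.
  - rewrite (is_RInt_unique _ _ _ _ HL). unfold q. eqR. field. lra.
Qed.

(** Each alternating bound is the integral of the previous one. *)
Lemma exp_taylor_bounds y : 0 <= y ->
  1 - y + y ^ 2 / 2 - y ^ 3 / 6 + y ^ 4 / 24 - y ^ 5 / 120 <= exp (- y) <=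
  1 - y + y ^ 2 / 2 - y ^ 3 / 6 + y ^ 4 / 24.
Proof.
  assert (K : forall f df : R -> R, (forall t, is_derive f t (df t)) -> (forall t, 0 <= t -> 0 <= df t) -> f 0 = 0 ->
    forall t, 0 <= t -> 0 <= f t).
  { intros f df Hd Hp H0 t Ht. rewrite <- H0. apply (nondecreasing_of_derive f df 0 t Ht).
    - intros s _. exact (deriv_cont _ _ _ (Hd s)).
    - auto.
    - intros s Hs. apply Hp. lra. }
  assert (E0 : exp (- 0) = 1) by (rewrite Ropp_0; apply exp_0).
  assert (A1 : forall t, 0 <= t -> 0 <= exp (- t) - (1 - t)) by (intros t Ht; pose proof (exp_ineq1_le (- t)); lra).
  assert (A2 : forall t, 0 <= t -> 0 <= 1 - t + t ^ 2 / 2 - exp (- t)).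
  { apply (K _ (fun t => exp (- t) - (1 - t))); [intros t; auto_derive; [easy|field]|assumption|rewrite E0; field]. }
  assert (A3 : forall t, 0 <= t -> 0 <= exp (- t) - (1 - t + t ^ 2 / 2 - t ^ 3 / 6)).
  { apply (K _ (fun t => 1 - t + t ^ 2 / 2 - exp (- t))); [intros t; auto_derive; [easy|field]|assumption|rewrite E0; field]. }
  assert (A4 : forall t, 0 <= t -> 0 <= 1 - t + t ^ 2 / 2 - t ^ 3 / 6 + t ^ 4 / 24 - exp (- t)).
  { apply (K _ (fun t => exp (- t) - (1 - t + t ^ 2 / 2 - t ^ 3 / 6))); [intros t; auto_derive; [easy|field]|assumption|rewrite E0; field]. }
  assert (A5 : forall t, 0 <= t -> 0 <= exp (- t) - (1 - t + t ^ 2 / 2 - t ^ 3 / 6 + t ^ 4 / 24 - t ^ 5 / 120)).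
  { apply (K _ (fun t => 1 - t + t ^ 2 / 2 - t ^ 3 / 6 + t ^ 4 / 24 - exp (- t))); [intros t; auto_derive; [easy|field]|assumption|rewrite E0; field]. }
  intros Hy. specialize (A4 y Hy). specialize (A5 y Hy). lra.
Qed.

(* Fixed-point arithmetic with 60 fractional bits. *)
Definition unit60 : Z := (2 ^ 60)%Z.

Lemma unit60_pos : 0 < IZR unit60.
Proof. apply IZR_lt. reflexivity. Qed.

Lemma div_le (a b : Z) : (0 < b)%Z -> IZR (a / b) <= IZR a / IZR b.
Proof.
  intros Hb. pose proof (IZR_lt _ _ Hb) as Hb'. simpl in Hb'.
  apply Rmult_le_reg_r with (IZR b); [assumption|]. unfold Rdiv. rewrite Rmult_assoc, Rinv_l, Rmult_1_r by lra.
  rewrite <- mult_IZR. apply IZR_le. rewrite Z.mul_comm. now apply Z.mul_div_le.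
Qed.

Lemma div_ge (a b : Z) : (0 < b)%Z -> IZR a / IZR b <= IZR (a / b + 1).
Proof.
  intros Hb. pose proof (IZR_lt _ _ Hb) as Hb'. simpl in Hb'.
  apply Rmult_le_reg_r with (IZR b); [assumption|]. unfold Rdiv. rewrite Rmult_assoc, Rinv_l, Rmult_1_r by lra.
  rewrite <- mult_IZR. apply IZR_le. rewrite Z.mul_comm.
  pose proof (Z.mul_succ_div_gt a b Hb). unfold Z.succ in *. lia.
Qed.

Lemma sqrt60_upper (U : Z) (x : R) : x <= IZR U / IZR unit60 ->
  sqrt x <= IZR (Z.sqrt (U * unit60) + 1) / IZR unit60.
Proof.
  intros Hx. pose proof unit60_pos as HP. set (P := IZR unit60) in *.
  assert (HU : IZR (U * unit60) <= IZR (Z.sqrt (U * unit60) + 1) ^ 2).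
  { rewrite pow_IZR. apply IZR_le. simpl Z.of_nat.
    destruct (Z_le_gt_dec 0 (U * unit60)) as [H|H].
    - pose proof (Z.sqrt_spec (U * unit60) H). unfold Z.succ in *. lia.
    - rewrite Z.sqrt_neg by lia. lia. }
  assert (0 <= IZR (Z.sqrt (U * unit60) + 1)) by (apply IZR_le; pose proof (Z.sqrt_nonneg (U * unit60)); lia).
  rewrite mult_IZR in HU. fold P in HU.
  set (s := IZR (Z.sqrt (U * unit60) + 1)) in *.
  rewrite <- (sqrt_pow2 (s / P)) by (apply Rmult_le_pos; [assumption|left; now apply Rinv_0_lt_compat]).
  apply sqrt_mono. apply Rle_trans with (1 := Hx).
  apply Rmult_le_reg_r with (P * P); [nra|].
  replace (IZR U / P * (P * P)) with (IZR U * P) by (field; lra).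
  replace ((s / P) ^ 2 * (P * P)) with (s ^ 2) by (field; lra). assumption.
Qed.

Lemma sqrt60_lower (U : Z) (x : R) : IZR U / IZR unit60 <= x ->
  IZR (Z.sqrt (U * unit60)) / IZR unit60 <= sqrt x.
Proof.
  intros Hx. pose proof unit60_pos as HP. set (P := IZR unit60) in *.
  destruct (Z_le_gt_dec 0 (U * unit60)) as [H|H].
  2:{ rewrite Z.sqrt_neg by lia. unfold Rdiv. rewrite Rmult_0_l. apply sqrt_pos. }
  assert (HU : IZR (Z.sqrt (U * unit60)) ^ 2 <= IZR (U * unit60)).
  { rewrite pow_IZR. apply IZR_le. change (Z.of_nat 2) with 2%Z. rewrite Z.pow_2_r.
    apply (Z.sqrt_spec (U * unit60) H). }
  assert (0 <= IZR (Z.sqrt (U * unit60))) by (apply IZR_le, Z.sqrt_nonneg).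
  rewrite mult_IZR in HU. fold P in HU. set (s := IZR (Z.sqrt (U * unit60))) in *.
  rewrite <- (sqrt_pow2 (s / P)) by (apply Rmult_le_pos; [assumption|left; now apply Rinv_0_lt_compat]).
  apply sqrt_mono. apply Rle_trans with (2 := Hx).
  apply Rmult_le_reg_r with (P * P); [nra|].
  replace (IZR U / P * (P * P)) with (IZR U * P) by (field; lra).
  replace ((s / P) ^ 2 * (P * P)) with (s ^ 2) by (field; lra). assumption.
Qed.

(** This and the next number approximate 2^60 exp (- 1/512) and 2^60 exp (- 1/1024) from below;
    rounding down raises the bound for [h_s]. *)
Definition mid_ratio : Z := 1150671902385460292.
Definition mid_start : Z := 1151796154276904951.

(* [E] is a lower bound for [2^60 exp (- (2k+1)/1024)]; the sum bounds [2^60 h_s] from above at the midpoints. *)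
Fixpoint mid_sum (n : nat) (k E : Z) : Z :=
  match n with
  | O => 0
  | S n => (Z.sqrt ((unit60 - (1025 + 2 * k) * E / 1024) * unit60) + 1) + mid_sum n (k + 1) (E * mid_ratio / unit60)
  end.

Lemma mid_sum_upper n : forall k E, (0 <= k)%Z -> (0 <= E)%Z ->
  IZR E <= IZR unit60 * exp (- ((2 * IZR k + 1) / 1024)) ->
  RInt h_s (- ((IZR k + INR n) / 512)) (- (IZR k / 512)) <= IZR (mid_sum n k E) / IZR unit60 / 512.
Proof.
  pose proof unit60_pos as HP.
  induction n as [|n IH]; intros k E Hk HE HEb.
  - simpl. rewrite Rplus_0_r, RI_point. unfold Rdiv. rewrite !Rmult_0_l. lra.
  - pose proof (IZR_le _ _ Hk) as HkR. simpl in HkR. pose proof (pos_INR n) as Hn.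
    assert (Hr : IZR mid_ratio <= IZR unit60 * exp (- (1 / 512))).
    { pose proof (exp_taylor_bounds (1 / 512) ltac:(lra)) as [H _].
      apply Rle_trans with (IZR unit60 * (1 - 1 / 512 + (1 / 512) ^ 2 / 2 - (1 / 512) ^ 3 / 6 + (1 / 512) ^ 4 / 24 - (1 / 512) ^ 5 / 120)).
      - unfold mid_ratio, unit60. lra.
      - apply Rmult_le_compat_l; lra. }
    assert (HE' : IZR (E * mid_ratio / unit60) <= IZR unit60 * exp (- ((2 * IZR (k + 1) + 1) / 1024))).
    { eapply Rle_trans; [apply div_le; reflexivity|]. rewrite mult_IZR, plus_IZR.
      apply Rmult_le_reg_r with (IZR unit60); [assumption|].
      replace (IZR E * IZR mid_ratio / IZR unit60 * IZR unit60) with (IZR E * IZR mid_ratio) by (field; lra).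
      replace (- ((2 * (IZR k + 1) + 1) / 1024)) with (- ((2 * IZR k + 1) / 1024) + - (1 / 512)) by field.
      rewrite exp_plus.
      apply Rle_trans with ((IZR unit60 * exp (- ((2 * IZR k + 1) / 1024))) * (IZR unit60 * exp (- (1 / 512)))).
      - apply Rmult_le_compat; try assumption; apply IZR_le; [assumption|discriminate].
      - right. ring. }
    assert (HE0 : (0 <= E * mid_ratio / unit60)%Z) by (apply Z.div_pos; [apply Z.mul_nonneg_nonneg; [assumption|discriminate]|reflexivity]).
    specialize (IH (k + 1)%Z (E * mid_ratio / unit60)%Z ltac:(lia) HE0 HE').
    rewrite plus_IZR in IH. rewrite S_INR. cbn [mid_sum].
    rewrite plus_IZR.
    rewrite <- (RI_Chasles h_s _ (- ((IZR k + 1) / 512))) by (apply exRI, h_s_cont).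
    replace (IZR k + (INR n + 1)) with (IZR k + 1 + INR n) by ring.
    assert (Hm := midpoint_rule (- ((IZR k + 1) / 512)) (- (IZR k / 512)) ltac:(lra)).
    replace ((- ((IZR k + 1) / 512) + - (IZR k / 512)) / 2) with (- ((2 * IZR k + 1) / 1024)) in Hm by field.
    replace (- (IZR k / 512) - - ((IZR k + 1) / 512)) with (1 / 512) in Hm by field.
    set (m := - ((2 * IZR k + 1) / 1024)) in *.
    assert (Hh : h_s m <= IZR (Z.sqrt ((unit60 - (1025 + 2 * k) * E / 1024) * unit60) + 1) / IZR unit60).
    { apply sqrt60_upper. rewrite minus_IZR.
      pose proof (div_le ((1025 + 2 * k) * E) 1024 ltac:(reflexivity)) as Hd. rewrite mult_IZR, plus_IZR, mult_IZR in Hd.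
      apply Rmult_le_reg_r with (IZR unit60); [assumption|].
      replace ((IZR unit60 - IZR ((1025 + 2 * k) * E / 1024)) / IZR unit60 * IZR unit60)
        with (IZR unit60 - IZR ((1025 + 2 * k) * E / 1024)) by (field; lra).
      assert (Em : 1 - m = (1025 + 2 * IZR k) / 1024) by (unfold m; field).
      assert ((1 - m) * IZR E <= (1 - m) * (IZR unit60 * exp m)) by (apply Rmult_le_compat_l; [rewrite Em; lra|assumption]).
      rewrite Em in H. replace ((1025 + 2 * IZR k) / 1024) with (1 - m) in H by lra.
      replace ((1025 + 2 * IZR k) * IZR E / 1024) with ((1 - m) * IZR E) in Hd by (rewrite Em; field). nra. }
    lra.
Qed.

(** Upper approximation of 2^60 exp (- 1/128). *)
Definition trap_ratio : Z := 1143949398277182806.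

Definition trap_node (k E : Z) : Z := Z.sqrt ((unit60 - ((128 + k) * E / 128 + 1)) * unit60).

(* Here [E] is an upper bound for [2^60 exp (- k/128)], and the nodes bound [2^60 h_s] from below. *)
Fixpoint trap_sum (n : nat) (k E : Z) : Z :=
  match n with
  | O => 0
  | S n => (trap_node k E + trap_node (k + 1) (E * trap_ratio / unit60 + 1)) + trap_sum n (k + 1) (E * trap_ratio / unit60 + 1)
  end.

Lemma trap_node_lower k E : (0 <= k)%Z -> IZR unit60 * exp (- (IZR k / 128)) <= IZR E ->
  IZR (trap_node k E) / IZR unit60 <= h_s (- (IZR k / 128)).
Proof.
  intros Hk HE. pose proof unit60_pos as HP. pose proof (IZR_le _ _ Hk) as HkR. simpl in HkR.
  apply sqrt60_lower. rewrite minus_IZR.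
  pose proof (div_ge ((128 + k) * E) 128 ltac:(reflexivity)) as Hd. rewrite mult_IZR, plus_IZR in Hd.
  apply Rmult_le_reg_r with (IZR unit60); [assumption|].
  replace ((IZR unit60 - IZR ((128 + k) * E / 128 + 1)) / IZR unit60 * IZR unit60)
    with (IZR unit60 - IZR ((128 + k) * E / 128 + 1)) by (field; lra).
  set (x := - (IZR k / 128)) in *.
  assert (Ex : 1 - x = (128 + IZR k) / 128) by (unfold x; field).
  assert ((1 - x) * (IZR unit60 * exp x) <= (1 - x) * IZR E) by (apply Rmult_le_compat_l; [rewrite Ex; lra|assumption]).
  replace ((128 + IZR k) * IZR E / 128) with ((1 - x) * IZR E) in Hd by (rewrite Ex; field). nra.
Qed.

Lemma trap_sum_lower n : forall k E, (0 <= k)%Z ->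
  IZR unit60 * exp (- (IZR k / 128)) <= IZR E ->
  IZR (trap_sum n k E) / IZR unit60 / 256 <= RInt h_s (- ((IZR k + INR n) / 128)) (- (IZR k / 128)).
Proof.
  pose proof unit60_pos as HP.
  induction n as [|n IH]; intros k E Hk HEb.
  - simpl. rewrite Rplus_0_r, RI_point. unfold Rdiv. rewrite !Rmult_0_l. lra.
  - pose proof (IZR_le _ _ Hk) as HkR. simpl in HkR. pose proof (pos_INR n) as Hn.
    assert (Hr : IZR unit60 * exp (- (1 / 128)) <= IZR trap_ratio).
    { pose proof (exp_taylor_bounds (1 / 128) ltac:(lra)) as [_ H].
      apply Rle_trans with (IZR unit60 * (1 - 1 / 128 + (1 / 128) ^ 2 / 2 - (1 / 128) ^ 3 / 6 + (1 / 128) ^ 4 / 24)).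
      - apply Rmult_le_compat_l; lra.
      - unfold trap_ratio, unit60. lra. }
    assert (HE' : IZR unit60 * exp (- (IZR (k + 1) / 128)) <= IZR (E * trap_ratio / unit60 + 1)).
    { eapply Rle_trans; [|apply div_ge; reflexivity]. rewrite mult_IZR, plus_IZR.
      apply Rmult_le_reg_r with (IZR unit60); [assumption|].
      replace (IZR E * IZR trap_ratio / IZR unit60 * IZR unit60) with (IZR E * IZR trap_ratio) by (field; lra).
      replace (- ((IZR k + 1) / 128)) with (- (IZR k / 128) + - (1 / 128)) by field.
      rewrite exp_plus.
      apply Rle_trans with ((IZR unit60 * exp (- (IZR k / 128))) * (IZR unit60 * exp (- (1 / 128)))).
      - right. ring.
      - apply Rmult_le_compat; try assumption; apply Rmult_le_pos; try lra; left; apply exp_pos. }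
    specialize (IH (k + 1)%Z (E * trap_ratio / unit60 + 1)%Z ltac:(lia) HE').
    pose proof (trap_node_lower k E Hk HEb) as N1.
    pose proof (trap_node_lower (k + 1) (E * trap_ratio / unit60 + 1) ltac:(lia) HE') as N2.
    rewrite (plus_IZR k 1) in IH, N2. rewrite S_INR. cbn [trap_sum].
    set (E1 := (E * trap_ratio / unit60 + 1)%Z) in *. rewrite !(plus_IZR (_ + _)), plus_IZR.
    rewrite <- (RI_Chasles h_s _ (- ((IZR k + 1) / 128))) by (apply exRI, h_s_cont).
    replace (IZR k + (INR n + 1)) with (IZR k + 1 + INR n) by ring.
    pose proof (trapezoid_rule (- ((IZR k + 1) / 128)) (- (IZR k / 128)) ltac:(lra)) as Ht.
    replace (- (IZR k / 128) - - ((IZR k + 1) / 128)) with (1 / 128) in Ht by field. lra.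
Qed.

(** The midpoint side leaves only 4e-7 to the end of the allowed interval, hence its finer grid of
    10240 cells against 2560 trapezoids. *)
Lemma h_s_integral_bounds : 20 - 1344050 / 1000000 <= RInt h_s (-20) 0 <= 20 - 13440454 / 10000000.
Proof.
  pose proof unit60_pos as HP. split.
  - pose proof (trap_sum_lower 2560 0 unit60 ltac:(lia)) as H.
    specialize (H ltac:(replace (- (0 / 128)) with 0 by field; rewrite exp_0; lra)).
    replace (- ((0 + INR 2560) / 128)) with (-20) in H by (rewrite INR_IZR_INZ; simpl Z.of_nat; field).
    replace (- (0 / 128)) with 0 in H by field.
    (* [4775.9232] is [256 * 18.65595], the claimed lower bound in units of the trapezoid weight. *)
    assert (B : (47759232 * unit60 <=? 10000 * trap_sum 2560 0 unit60)%Z = true) by (vm_compute; reflexivity).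
    (* [field] and [lra] would otherwise try to evaluate the sum. *)
    revert H B. generalize (trap_sum 2560 0 unit60). intros s H B.
    apply Z.leb_le, IZR_le in B. rewrite !mult_IZR in B.
    apply Rle_trans with (2 := H).
    apply Rmult_le_reg_r with (256 * IZR unit60); [lra|].
    replace (IZR s / IZR unit60 / 256 * (256 * IZR unit60)) with (IZR s) by (field; lra).
    lra.
  - pose proof (mid_sum_upper 10240 0 mid_start ltac:(lia) ltac:(discriminate)) as H.
    assert (H0 : IZR mid_start <= IZR unit60 * exp (- ((2 * 0 + 1) / 1024))).
    { replace ((2 * 0 + 1) / 1024) with (1 / 1024) by field.
      pose proof (exp_taylor_bounds (1 / 1024) ltac:(lra)) as [H0 _].
      apply Rle_trans with (IZR unit60 * (1 - 1 / 1024 + (1 / 1024) ^ 2 / 2 - (1 / 1024) ^ 3 / 6 + (1 / 1024) ^ 4 / 24 - (1 / 1024) ^ 5 / 120)).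
      - unfold mid_start, unit60. lra.
      - apply Rmult_le_compat_l; lra. }
    specialize (H H0).
    replace (- ((0 + INR 10240) / 512)) with (-20) in H by (rewrite INR_IZR_INZ; simpl Z.of_nat; field).
    replace (- (0 / 512)) with 0 in H by field.
    (* [9551.8487552] is [512 * 18.6559546]. *)
    assert (B : (10000000 * mid_sum 10240 0 mid_start <=? 95518487552 * unit60)%Z = true) by (vm_compute; reflexivity).
    revert H B. generalize (mid_sum 10240 0 mid_start). intros s H B.
    apply Z.leb_le, IZR_le in B. rewrite !mult_IZR in B.
    apply Rle_trans with (1 := H).
    apply Rmult_le_reg_r with (512 * IZR unit60); [lra|].
    replace (IZR s / IZR unit60 / 512 * (512 * IZR unit60)) with (IZR s) by (field; lra).
    lra.
Qed.

Lemma defect_integral_value I : (forall a, a <= 0 -> 0 <= I - RInt defect a 0 <= layer_tail a) ->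
  Rabs ((I - 1) - 34405 / 100000) < 5 / 1000000 /\ 0 < I - 1.
Proof.
  intros HI. specialize (HI (-20) ltac:(lra)). pose proof h_s_integral_bounds as Hb.
  assert (E : RInt defect (-20) 0 = 20 - RInt h_s (-20) 0).
  { unfold defect. rewrite RI_minus; [|apply exRI; intros; cont|apply exRI, h_s_cont].
    rewrite (RInt_const (V := R_CompleteNormedModule)). unfold scal; simpl; unfold mult; simpl. ring. }
  assert (Ht : layer_tail (-20) <= 1 / 1000000).
  { unfold layer_tail. replace (-20) with (- (1) * 20) at 2 by ring.
    assert (E2 : exp (- (1) * 20) = exp (-1) ^ 20).
    { rewrite exp_pow_nat. f_equal. rewrite INR_IZR_INZ. simpl. ring. }
    rewrite E2. pose proof exp_m1_le. pose proof (exp_pos (-1)).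
    assert (exp (-1) ^ 20 <= (38 / 100) ^ 20) by (apply pow_incr; lra). lra. }
  split; [apply Rabs_def1; lra|lra].
Qed.

(** * Orbits carried by a graph over [(0,1)] *)

Lemma norm_pair (a b : R) : norm ((a, b) : R * R) = sqrt (a ^ 2 + b ^ 2).
Proof.
  unfold norm; simpl. unfold prod_norm; simpl. unfold norm; simpl. unfold abs; simpl.
  now rewrite !Rmult_1_r, <- !Rabs_mult, !(Rabs_right (_ * _)) by nra.
Qed.

Lemma norm_pair_le (a b : R) : norm ((a, b) : R * R) <= Rabs a + Rabs b.
Proof.
  rewrite norm_pair. pose proof (Rabs_pos a). pose proof (Rabs_pos b).
  rewrite <- (sqrt_pow2 (Rabs a + Rabs b)) by lra. apply sqrt_mono.
  rewrite <- (pow2_abs a), <- (pow2_abs b). nra.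
Qed.

Lemma norm_pair_fst (a b : R) : Rabs a <= norm ((a, b) : R * R).
Proof.
  rewrite norm_pair, <- (sqrt_pow2 (Rabs a)) by apply Rabs_pos. apply sqrt_mono. rewrite pow2_abs. nra.
Qed.

Lemma norm_pair_snd (a b : R) : Rabs b <= norm ((a, b) : R * R).
Proof.
  rewrite norm_pair, <- (sqrt_pow2 (Rabs b)) by apply Rabs_pos. apply sqrt_mono. rewrite pow2_abs. nra.
Qed.

Lemma locally_pair (p : R * R) (P : R * R -> Prop) :
  locally p P <-> exists e, 0 < e /\ forall a b, Rabs (a - fst p) < e -> Rabs (b - snd p) < e -> P (a, b).
Proof.
  split.
  - intros [[e He] H]. exists e. split; [assumption|]. intros a b Ha Hb. apply H. split; assumption.
  - intros [e [He H]]. exists (mkposreal e He). intros [a b] [Ha Hb]. now apply H.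
Qed.

Lemma filterlim_pair_R (T : Type) (F : (T -> Prop) -> Prop) {FF : Filter F} (g : T -> R * R) (p : R * R) :
  filterlim g F (locally p) <->
  filterlim (fun t => fst (g t)) F (locally (fst p)) /\ filterlim (fun t => snd (g t)) F (locally (snd p)).
Proof.
  rewrite !(filterlim_R T F (FF := FF)). split.
  - intros H. split; intros e He.
    + apply (H (fun q => Rabs (fst q - fst p) < e)). apply locally_pair. exists e. split; [assumption|].
      intros a b Ha Hb. exact Ha.
    + apply (H (fun q => Rabs (snd q - snd p) < e)). apply locally_pair. exists e. split; [assumption|].
      intros a b Ha Hb. exact Hb.
  - intros [H1 H2] P HP. apply locally_pair in HP. destruct HP as [e [He HP]].
    specialize (H1 e He). specialize (H2 e He). unfold filtermap.
    assert (H := filter_and _ _ H1 H2). revert H. apply filter_imp.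
    intros t [A B]. rewrite (surjective_pairing (g t)). now apply HP.
Qed.

Lemma is_derive_pair (g : R -> R * R) (z : R) (v : R * R) :
  is_derive (K := R_AbsRing) (V := prod_NormedModule R_AbsRing R_NormedModule R_NormedModule) g z v <->
  is_derive (fun z => fst (g z)) z (fst v) /\ is_derive (fun z => snd (g z)) z (snd v).
Proof.
  split.
  - intros [_ H].
    assert (K : forall e, 0 < e -> exists d, 0 < d /\ forall y, Rabs (y - z) < d ->
       norm ((fst (g y) - fst (g z) - fst v * (y - z), snd (g y) - snd (g z) - snd v * (y - z)) : R * R) <= e * Rabs (y - z)).
    { intros e He. destruct (H z (fun P HP => HP) (mkposreal e He)) as [[d Hd] Hd'].
      exists d. split; [assumption|]. intros y Hy. specialize (Hd' y Hy).
      unfold minus, plus, opp, scal in Hd'; simpl in Hd'. unfold prod_plus, prod_opp, prod_scal in Hd'; simpl in Hd'.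
      unfold plus, opp, scal in Hd'; simpl in Hd'. unfold mult in Hd'; simpl in Hd'.
      replace (fst (g y) - fst (g z) - fst v * (y - z)) with (fst (g y) + - fst (g z) + - ((y + - z) * fst v)) by ring.
      replace (snd (g y) - snd (g z) - snd v * (y - z)) with (snd (g y) + - snd (g z) + - ((y + - z) * snd v)) by ring.
      exact Hd'. }
    split; apply is_derive_eps; intros e He; destruct (K e He) as [d [Hd HK]]; exists d; (split; [assumption|]);
      intros y Hy; specialize (HK y Hy); eapply Rle_trans; [| exact HK | | exact HK].
    + apply norm_pair_fst.
    + apply norm_pair_snd.
  - intros [H1 H2]. split; [apply is_linear_scal_l|].
    intros x Hx [e He].
    assert (x = z) as -> by (symmetry; now apply (is_filter_lim_locally_unique (K := R_AbsRing) (V := R_NormedModule))).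
    destruct (proj1 (is_derive_eps _ _ _) H1 (e / 2) ltac:(lra)) as [d1 [Hd1 K1]].
    destruct (proj1 (is_derive_eps _ _ _) H2 (e / 2) ltac:(lra)) as [d2 [Hd2 K2]].
    assert (Hd : 0 < Rmin d1 d2) by now apply Rmin_glb_lt.
    exists (mkposreal _ Hd). intros y Hy.
    assert (Hy' : Rabs (y - z) < Rmin d1 d2) by exact Hy.
    specialize (K1 y ltac:(pose proof (Rmin_l d1 d2); lra)). specialize (K2 y ltac:(pose proof (Rmin_r d1 d2); lra)).
    cbv beta in K1, K2.
    unfold minus, plus, opp, scal; simpl. unfold prod_plus, prod_opp, prod_scal; simpl.
    unfold plus, opp, scal; simpl. unfold mult; simpl.
    eapply Rle_trans; [apply norm_pair_le|].
    replace (fst (g y) - fst (g z) - fst v * (y - z)) with (fst (g y) + - fst (g z) + - ((y + - z) * fst v)) in K1 by ring.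
    replace (snd (g y) - snd (g z) - snd v * (y - z)) with (snd (g y) + - snd (g z) + - ((y + - z) * snd v)) in K2 by ring.
    change (norm (y + - z)) with (Rabs (y - z)). lra.
Qed.

Lemma ivt_on (f : R -> R) (a b y : R) : a <= b -> (forall t, a <= t <= b -> continuous f t) ->
  f a <= y <= f b -> exists x, a <= x <= b /\ f x = y.
Proof.
  intros Hab Hc Hy.
  set (f' := fun x => f (Rmax a (Rmin x b))).
  assert (Hcl : forall x, a <= Rmax a (Rmin x b) <= b).
  { intros x. split; [apply Rmax_l|]. apply Rmax_lub; [assumption|apply Rmin_r]. }
  assert (Hf' : continuity f').
  { intros x. apply cont_pt. unfold f'. apply (continuous_comp (fun x => Rmax a (Rmin x b)) f); [cont|]. apply Hc, Hcl. }
  assert (Ea : f' a = f a) by (unfold f'; rewrite Rmin_left, Rmax_left by lra; easy).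
  assert (Eb : f' b = f b) by (unfold f'; rewrite Rmin_left, Rmax_right by lra; easy).
  destruct (IVT_gen f' a b y Hf') as [x [_ Hx]].
  - rewrite Ea, Eb, Rmin_left, Rmax_right by lra. assumption.
  - exists (Rmax a (Rmin x b)). split; [apply Hcl|exact Hx].
Qed.

Section GraphOrbit.
Variables (S : R -> R) (M : R).
Hypothesis S_cont : forall t, continuous S t.
Hypothesis S_pos : forall t, 0 < t < 1 -> 0 < S t.
Hypothesis M_pos : 0 < M.
Hypothesis S_left : forall t, 0 < t < 1 -> S t <= M * t.
Hypothesis S_right : forall t, 0 < t < 1 -> S t <= M * (1 - t).

(** Travel time along the graph, since theta' = S(theta) on the orbit. *)
Definition clock (th : R) : R := RInt (fun t => / S t) (1 / 2) th.

Lemma inv_S_cont t : 0 < t < 1 -> continuous (fun t => / S t) t.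
Proof. intros Ht. apply cont_inv; [apply S_cont|]. pose proof (S_pos t Ht). lra. Qed.

Lemma clock_derive th : 0 < th < 1 -> is_derive clock th (/ S th).
Proof.
  intros Hth. apply (RI_deriv (fun t => / S t)).
  - intros x Hx. apply inv_S_cont. revert Hx. unfold Rmin, Rmax. destruct Rle_dec; lra.
  - assert (H : locally th (fun x => 0 < x /\ x < 1)).
    { apply (open_and (fun x => 0 < x) (fun x => x < 1)); [apply open_gt|apply open_lt|lra]. }
    revert H. apply filter_imp. intros x Hx. now apply inv_S_cont.
Qed.

Lemma clock_mvt a b : 0 < a -> a < b -> b < 1 -> exists xi, a < xi < b /\ S xi * (clock b - clock a) = b - a.
Proof.
  intros Ha Hab Hb. destruct (mvt_open clock (fun t => / S t) a b Hab) as [xi [Hxi E]].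
  - intros t Ht. exact (deriv_cont _ _ _ (clock_derive t ltac:(lra))).
  - intros t Ht. apply clock_derive. lra.
  - exists xi. split; [assumption|]. rewrite E. pose proof (S_pos xi ltac:(lra)). field. lra.
Qed.

Lemma clock_incr a b : 0 < a -> a < b -> b < 1 -> clock a < clock b.
Proof.
  intros Ha Hab Hb. destruct (clock_mvt a b Ha Hab Hb) as [xi [Hxi E]]. pose proof (S_pos xi ltac:(lra)). nra.
Qed.

Lemma clock_half : clock (1 / 2) = 0.
Proof. unfold clock. apply RI_point. Qed.

(** The linear bound [S <= M * t] makes the time to the equilibrium diverge logarithmically, so the
    orbit is defined for all times. *)
Lemma clock_low th : 0 < th <= 1 / 2 -> clock th <= (ln th - ln (1 / 2)) / M.
Proof.
  intros Hth.
  enough (ln th / M - clock th >= ln (1 / 2) / M - clock (1 / 2)) by (rewrite clock_half in H; unfold Rdiv in *; lra).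
  apply Rle_ge. enough (- (ln th / M - clock th) <= - (ln (1 / 2) / M - clock (1 / 2))) by lra.
  apply (nondecreasing_of_derive (fun t => - (ln t / M - clock t)) (fun t => / S t - / (M * t)) th (1 / 2) ltac:(lra)).
  - intros t Ht. apply cont_opp, cont_minus.
    + apply (ex_derive_continuous (fun t => ln t / M)). auto_derive. lra.
    + exact (deriv_cont _ _ _ (clock_derive t ltac:(lra))).
  - intros t Ht. deriv_as (- (/ (M * t) - / S t)); [|ring].
    apply (is_derive_opp (fun t => ln t / M - clock t)). apply (deriv_minus (fun t => ln t / M)).
    + auto_derive; [lra|]. field. lra.
    + apply clock_derive. lra.
  - intros t Ht. enough (/ (M * t) <= / S t) by lra. apply Rinv_le_contravar; [apply S_pos; lra|apply S_left; lra].
Qed.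

Lemma clock_high th : 1 / 2 <= th < 1 -> (ln (1 / 2) - ln (1 - th)) / M <= clock th.
Proof.
  intros Hth.
  enough (- (ln (1 - 1 / 2) / M) - clock (1 / 2) >= - (ln (1 - th) / M) - clock th).
  { rewrite clock_half in H. replace (1 - 1 / 2) with (1 / 2) in H by field. unfold Rdiv in *. lra. }
  apply Rle_ge. enough (ln (1 - 1 / 2) / M + clock (1 / 2) <= ln (1 - th) / M + clock th) by lra.
  apply (nondecreasing_of_derive (fun t => ln (1 - t) / M + clock t) (fun t => - / (M * (1 - t)) + / S t) (1 / 2) th ltac:(lra)).
  - intros t Ht. apply cont_plus.
    + apply (ex_derive_continuous (fun t => ln (1 - t) / M)). auto_derive. lra.
    + exact (deriv_cont _ _ _ (clock_derive t ltac:(lra))).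
  - intros t Ht. apply (deriv_plus (fun t => ln (1 - t) / M)).
    + auto_derive; [lra|]. field. lra.
    + apply clock_derive. lra.
  - intros t Ht. enough (/ (M * (1 - t)) <= / S t) by lra. apply Rinv_le_contravar; [apply S_pos; lra|apply S_right; lra].
Qed.

Lemma clock_surj z : exists th, 0 < th < 1 /\ clock th = z.
Proof.
  set (K := exp (- (M * Rabs z)) / 2).
  pose proof (exp_pos (- (M * Rabs z))). pose proof (Rabs_pos z).
  assert (HK : 0 < K <= 1 / 2).
  { unfold K. pose proof (exp_le_1 (- (M * Rabs z)) ltac:(nra)). lra. }
  assert (EK : ln K = - (M * Rabs z) + ln (1 / 2)).
  { unfold K, Rdiv. rewrite ln_mult by lra. rewrite ln_exp. rewrite Rmult_1_l. easy. }
  pose proof (clock_low K HK) as H1. pose proof (clock_high (1 - K) ltac:(lra)) as H2.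
  replace (1 - (1 - K)) with K in H2 by ring. rewrite EK in H1, H2.
  replace ((- (M * Rabs z) + ln (1 / 2) - ln (1 / 2)) / M) with (- Rabs z) in H1 by (field; lra).
  replace ((ln (1 / 2) - (- (M * Rabs z) + ln (1 / 2))) / M) with (Rabs z) in H2 by (field; lra).
  destruct (ivt_on clock K (1 - K) z) as [th [Hth E]].
  - lra.
  - intros t Ht. exact (deriv_cont _ _ _ (clock_derive t ltac:(lra))).
  - pose proof (Rle_abs z). pose proof (Rle_abs (- z)). rewrite Rabs_Ropp in *. lra.
  - exists th. split; [lra|assumption].
Qed.

Definition hand (z : R) : R := epsilon (inhabits 0) (fun th => 0 < th < 1 /\ clock th = z).

Lemma hand_spec z : 0 < hand z < 1 /\ clock (hand z) = z.
Proof. apply (epsilon_spec (inhabits 0) (fun th => 0 < th < 1 /\ clock th = z)), clock_surj. Qed.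

Lemma hand_clock th : 0 < th < 1 -> hand (clock th) = th.
Proof.
  intros Hth. destruct (hand_spec (clock th)) as [H E].
  destruct (Rtotal_order (hand (clock th)) th) as [Hl|[He|Hg]]; [|assumption|].
  - pose proof (clock_incr (hand (clock th)) th ltac:(lra) Hl ltac:(lra)). lra.
  - pose proof (clock_incr th (hand (clock th)) ltac:(lra) Hg ltac:(lra)). lra.
Qed.

Lemma hand_lt z th : 0 < th < 1 -> z < clock th -> hand z < th.
Proof.
  intros Hth Hz. destruct (hand_spec z) as [H E]. destruct (Rlt_le_dec (hand z) th) as [|Hl]; [assumption|exfalso].
  destruct Hl as [Hl| Hl]; [|subst th; lra]. pose proof (clock_incr th (hand z) ltac:(lra) Hl ltac:(lra)). lra.
Qed.

Lemma hand_gt z th : 0 < th < 1 -> clock th < z -> th < hand z.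
Proof.
  intros Hth Hz. destruct (hand_spec z) as [H E]. destruct (Rlt_le_dec th (hand z)) as [|Hl]; [assumption|exfalso].
  destruct Hl as [Hl| Hl]; [|subst th; lra]. pose proof (clock_incr (hand z) th ltac:(lra) Hl ltac:(lra)). lra.
Qed.

(** Inverse function argument: increments of [hand] are those of [z] times a value of [S] at an
    intermediate point, and monotonicity of [clock] confines that point near [hand z]. *)
Lemma hand_derive z : is_derive hand z (S (hand z)).
Proof.
  destruct (hand_spec z) as [H E]. apply is_derive_eps. intros e He.
  destruct (proj1 (cont_eps _ _) (S_cont (hand z)) e He) as [d [Hd HS]].
  set (r := Rmin d (Rmin (hand z / 2) ((1 - hand z) / 2))).
  assert (Hr : 0 < r) by (unfold r; repeat apply Rmin_glb_lt; lra).
  assert (r <= d) by apply Rmin_l.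
  assert (r <= Rmin (hand z / 2) ((1 - hand z) / 2)) by apply Rmin_r.
  pose proof (Rmin_l (hand z / 2) ((1 - hand z) / 2)). pose proof (Rmin_r (hand z / 2) ((1 - hand z) / 2)).
  pose proof (clock_incr (hand z - r) (hand z) ltac:(lra) ltac:(lra) ltac:(lra)).
  pose proof (clock_incr (hand z) (hand z + r) ltac:(lra) ltac:(lra) ltac:(lra)).
  exists (Rmin (z - clock (hand z - r)) (clock (hand z + r) - z)). split; [apply Rmin_glb_lt; lra|].
  intros y Hy.
  pose proof (Rmin_l (z - clock (hand z - r)) (clock (hand z + r) - z)).
  pose proof (Rmin_r (z - clock (hand z - r)) (clock (hand z + r) - z)).
  assert (Hy' : z - Rmin (z - clock (hand z - r)) (clock (hand z + r) - z) < y < z + Rmin (z - clock (hand z - r)) (clock (hand z + r) - z)).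
  { apply Rabs_lt_between in Hy. lra. }
  pose proof (hand_lt y (hand z + r) ltac:(lra) ltac:(lra)). pose proof (hand_gt y (hand z - r) ltac:(lra) ltac:(lra)).
  destruct (hand_spec y) as [Hy1 Ey].
  assert (K : exists xi, Rabs (xi - hand z) < d /\ hand y - hand z = S xi * (y - z)).
  { destruct (Rtotal_order (hand y) (hand z)) as [Hl|[He'|Hg]].
    - destruct (clock_mvt (hand y) (hand z) ltac:(lra) Hl ltac:(lra)) as [xi [Hxi Exi]].
      exists xi. rewrite E, Ey in Exi. split; [apply Rabs_def1; lra|lra].
    - exists (hand z). rewrite Rminus_diag, Rabs_R0. split; [assumption|].
      assert (Eyz : y = z) by (rewrite <- Ey, <- E; now f_equal). rewrite Eyz. ring.
    - destruct (clock_mvt (hand z) (hand y) ltac:(lra) Hg ltac:(lra)) as [xi [Hxi Exi]].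
      exists xi. rewrite E, Ey in Exi. split; [apply Rabs_def1; lra|lra]. }
  destruct K as [xi [Hxi Exi]]. rewrite Exi, <- Rmult_minus_distr_r, Rabs_mult.
  apply Rmult_le_compat_r; [apply Rabs_pos|]. left. now apply HS.
Qed.

Lemma hand_m_infty : filterlim hand (Rbar_locally m_infty) (locally 0).
Proof.
  apply (filterlim_R R (Rbar_locally m_infty)). intros e He. set (th := Rmin (1 / 2) e).
  assert (Hth : 0 < th < 1) by (unfold th; split; [apply Rmin_glb_lt; lra|pose proof (Rmin_l (1 / 2) e); lra]).
  exists (clock th). intros z Hz. pose proof (hand_lt z th Hth Hz). destruct (hand_spec z) as [H1 _].
  pose proof (Rmin_r (1 / 2) e). fold th in H0. rewrite Rminus_0_r, Rabs_right; lra.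
Qed.

Lemma hand_p_infty : filterlim hand (Rbar_locally p_infty) (locally 1).
Proof.
  apply (filterlim_R R (Rbar_locally p_infty)). intros e He. set (th := Rmax (1 / 2) (1 - e)).
  assert (Hth : 0 < th < 1) by (unfold th; split; [pose proof (Rmax_l (1 / 2) (1 - e)); lra|apply Rmax_lub_lt; lra]).
  exists (clock th). intros z Hz. pose proof (hand_gt z th Hth Hz). destruct (hand_spec z) as [H1 _].
  pose proof (Rmax_r (1 / 2) (1 - e)). fold th in H0. rewrite Rabs_left; lra.
Qed.

Definition graph_orbit (z : R) : plane := (hand z, S (hand z)).

Lemma graph_orbit_points p : orbit graph_orbit p <-> 0 < fst p < 1 /\ snd p = S (fst p).
Proof.
  split.
  - intros [z ->]. simpl. split; [apply hand_spec|easy].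
  - intros [H E]. exists (clock (fst p)). unfold graph_orbit. rewrite hand_clock by assumption. rewrite <- E.
    now apply surjective_pairing.
Qed.
End GraphOrbit.

Section FrontOrbit.
Variables (eps c M : R) (S : R -> R).
Hypothesis He : 0 < eps.
Hypothesis Hc : 0 <= c.
Hypothesis HS : is_front eps c S.
Hypothesis HM : 0 < M.
Hypothesis S_line : forall t, 0 < t < 1 -> S t <= M * t.

(** One constant for both ends: [M] bounds the slope from the node, [/ eps] comes from [S <= - lay]
    at theta = 1. *)
Let M' := M + / eps.

Lemma front_M_pos : 0 < M'.
Proof. unfold M'. pose proof (Rinv_0_lt_compat eps He). lra. Qed.

Lemma front_left t : 0 < t < 1 -> S t <= M' * t.
Proof. intros Ht. specialize (S_line t Ht). pose proof (Rinv_0_lt_compat eps He). unfold M'. nra. Qed.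

Lemma front_right t : 0 < t < 1 -> S t <= M' * (1 - t).
Proof.
  intros Ht. pose proof (front_le_lay eps c S He Hc HS t ltac:(lra)) as H. pose proof (Rinv_0_lt_compat eps He).
  unfold lay, Rdiv in H. unfold M'. nra.
Qed.

Let S_cont : forall t, continuous S t. Proof. apply HS. Qed.
Let S_pos : forall t, 0 < t < 1 -> 0 < S t. Proof. intros; now apply HS. Qed.

Lemma front_heteroclinic : heteroclinic (zfk_field eps c) p_minus p_plus (graph_orbit S).
Proof.
  pose proof (hand_derive S M' S_cont S_pos front_M_pos front_left front_right) as Hd.
  pose proof (hand_spec S M' S_cont S_pos front_M_pos front_left front_right) as Hsp.
  assert (S0 : S 0 = 0).
  { assert (0 <= S 0) by apply HS. destruct H as [H|H]; [exfalso|lra].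
    destruct (proj1 (cont_eps _ _) (S_cont 0) (S 0 / 2) ltac:(lra)) as [d [Hd' K]].
    set (t := Rmin (d / 2) (Rmin (1 / 2) (S 0 / (4 * M)))).
    assert (Ht : 0 < t) by (unfold t; repeat apply Rmin_glb_lt; try lra; apply Rdiv_lt_0_compat; lra).
    assert (t <= d / 2) by apply Rmin_l. assert (t <= Rmin (1 / 2) (S 0 / (4 * M))) by apply Rmin_r.
    pose proof (Rmin_l (1 / 2) (S 0 / (4 * M))). pose proof (Rmin_r (1 / 2) (S 0 / (4 * M))).
    specialize (K t ltac:(rewrite Rminus_0_r, Rabs_right; lra)). specialize (S_line t ltac:(lra)).
    assert (M * t <= S 0 / 4).
    { apply Rle_trans with (M * (S 0 / (4 * M))); [apply Rmult_le_compat_l; lra|]. right. field. lra. }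
    apply Rabs_lt_between in K. lra. }
  split; [|split].
  - intros z. apply is_derive_pair. unfold graph_orbit, zfk_field. simpl fst. simpl snd. split; [apply Hd|].
    destruct (Hsp z) as [Hz _]. pose proof (S_pos (hand S z) Hz).
    deriv_as (S (hand S z) * (c - reac eps (hand S z) / S (hand S z))).
    + apply (deriv_comp S (hand S)); [now apply HS|apply Hd].
    + unfold reac. field. lra.
  - apply (filterlim_pair_R _ _ (graph_orbit S) p_minus). split.
    + exact (hand_m_infty S M' S_cont S_pos front_M_pos front_left front_right).
    + simpl. rewrite <- S0.
      apply (filterlim_comp _ _ _ (hand S) S _ (locally 0)); [|apply S_cont].
      exact (hand_m_infty S M' S_cont S_pos front_M_pos front_left front_right).
  - apply (filterlim_pair_R _ _ (graph_orbit S) p_plus). split.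
    + exact (hand_p_infty S M' S_cont S_pos front_M_pos front_left front_right).
    + simpl. rewrite <- (front_1 eps c S HS).
      apply (filterlim_comp _ _ _ (hand S) S _ (locally 1)); [|apply S_cont].
      exact (hand_p_infty S M' S_cont S_pos front_M_pos front_left front_right).
Qed.

Lemma front_orbit_points p : orbit (graph_orbit S) p <-> 0 < fst p < 1 /\ snd p = S (fst p).
Proof. apply (graph_orbit_points S M'); auto using front_M_pos, front_left, front_right. Qed.

(** * Linearization at the unstable node *)

Definition reac_rate : R := exp (- / eps) / (2 * eps ^ 2).

Definition node_lin (p : plane) : plane := (snd p, c * snd p - reac_rate * fst p).

Lemma reac_rate_pos : 0 < reac_rate.
Proof.
  unfold reac_rate. pose proof (pow_lt eps 2 He). apply Rdiv_lt_0_compat; [apply exp_pos|lra].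
Qed.

(** Factor the reaction as [th * g th] with [g 0 = reac_rate] and bound the derivative of [g]. *)
Lemma reac_linear_error : exists K, 0 <= K /\ forall th, -1 <= th <= 1 -> Rabs (reac eps th - reac_rate * th) <= K * th ^ 2.
Proof.
  set (g := fun th => reac_rate * ((1 - th) * exp (th / eps))).
  set (dg := fun th => reac_rate * ((- exp (th / eps)) + (1 - th) * (exp (th / eps) / eps))).
  assert (Er : forall th, reac eps th = th * g th).
  { intros th. unfold reac, g, reac_rate. replace (- / eps * (1 - th)) with (- / eps + th / eps) by (field; lra).
    rewrite exp_plus. field. lra. }
  set (K := reac_rate * (exp (/ eps) + 2 * (exp (/ eps) / eps))).
  pose proof reac_rate_pos as Hq. pose proof (exp_pos (/ eps)) as Hx. pose proof (Rinv_0_lt_compat eps He) as Hi.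
  assert (HK : 0 <= K).
  { unfold K, Rdiv. apply Rmult_le_pos; [lra|]. nra. }
  assert (Hd : forall th, is_derive g th (dg th)).
  { intros th. unfold g, dg. auto_derive; [easy|]. unfold Rdiv. field. lra. }
  assert (Hb : forall th, -1 <= th <= 1 -> Rabs (dg th) <= K).
  { intros th Hth. unfold dg, K. rewrite Rabs_mult, (Rabs_right reac_rate) by lra.
    apply Rmult_le_compat_l; [lra|].
    assert (E : exp (th / eps) <= exp (/ eps)) by (apply exp_mono; unfold Rdiv; nra).
    pose proof (exp_pos (th / eps)).
    eapply Rle_trans; [apply Rabs_triang|]. rewrite Rabs_Ropp, Rabs_mult.
    rewrite (Rabs_right (exp _)), (Rabs_right (1 - th)), (Rabs_right (_ / eps)); try lra.
    - apply Rplus_le_compat; [assumption|]. apply Rmult_le_compat; try lra.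
      + apply Rmult_le_pos; lra.
      + unfold Rdiv. apply Rmult_le_compat_r; lra.
    - apply Rle_ge, Rmult_le_pos; lra. }
  exists K. split; [assumption|]. intros th Hth. rewrite Er.
  assert (E0 : g 0 = reac_rate) by (unfold g; unfold Rdiv; rewrite Rmult_0_l, exp_0; ring).
  rewrite <- E0. replace (th * g th - g 0 * th) with (th * (g th - g 0)) by ring.
  destruct (MVT_gen g 0 th dg) as [xi [Hxi E]].
  - intros; apply Hd.
  - intros t _. apply cont_pt. exact (deriv_cont _ _ _ (Hd t)).
  - rewrite E, !Rabs_mult, Rminus_0_r.
    assert (Rabs (dg xi) <= K).
    { apply Hb. revert Hxi. unfold Rmin, Rmax. destruct Rle_dec; lra. }
    rewrite <- (pow2_abs th). pose proof (Rabs_pos th). nra.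
Qed.

Lemma zfk_linearization : linearization (zfk_field eps c) p_minus node_lin.
Proof.
  pose proof reac_rate_pos as Hq.
  split.
  - split.
    + intros [x1 x2] [y1 y2]. unfold node_lin, plus; simpl. unfold prod_plus; simpl. f_equal. unfold plus; simpl. ring.
    + intros k [x1 x2]. unfold node_lin, scal; simpl. unfold prod_scal, scal; simpl. f_equal. unfold mult; simpl. ring.
    + exists (1 + c + reac_rate). split; [lra|]. intros [x1 x2].
      unfold node_lin. simpl fst; simpl snd. eapply Rle_trans; [apply norm_pair_le|].
      pose proof (norm_pair_fst x1 x2). pose proof (norm_pair_snd x1 x2).
      assert (Rabs (c * x2 - reac_rate * x1) <= c * Rabs x2 + reac_rate * Rabs x1).
      { unfold Rminus. eapply Rle_trans; [apply Rabs_triang|]. rewrite Rabs_Ropp, !Rabs_mult, (Rabs_right c), (Rabs_right reac_rate) by lra. lra. }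
      assert (G : forall n, Rabs x1 <= n -> Rabs x2 <= n ->
        Rabs x2 + Rabs (c * x2 - reac_rate * x1) <= (1 + c + reac_rate) * n).
      { intros n N1 N2. apply Rmult_le_compat_l with (r := c) in N2 as N3; [|assumption].
        apply Rmult_le_compat_l with (r := reac_rate) in N1 as N4; [|lra]. lra. }
      apply G; [exact H|exact H0].
  - intros x Hx [e Hee].
    assert (Ex : p_minus = x).
    { apply (is_filter_lim_locally_unique (K := R_AbsRing)
        (V := prod_NormedModule R_AbsRing R_NormedModule R_NormedModule)). exact Hx. }
    rewrite <- Ex. clear x Hx Ex.
    destruct reac_linear_error as [K [HK HKb]].
    apply locally_pair. exists (Rmin 1 (e / (K + 1))). split.
    { apply Rmin_glb_lt; [lra|apply Rdiv_lt_0_compat; lra]. }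
    intros a b Ha Hb. simpl in Ha, Hb. rewrite Rminus_0_r in Ha, Hb.
    pose proof (Rmin_l 1 (e / (K + 1))). pose proof (Rmin_r 1 (e / (K + 1))).
    unfold zfk_field, node_lin, minus, plus, opp; simpl. unfold prod_plus, prod_opp; simpl.
    unfold plus, opp; simpl.
    eapply Rle_trans; [apply norm_pair_le|].
    assert (Hab : Rabs a <= norm ((a + - 0, b + - 0) : R * R)).
    { rewrite Ropp_0, !Rplus_0_r. apply norm_pair_fst. }
    replace (b + - 0 + - (b + - 0)) with 0 by ring. rewrite Rabs_R0, Rplus_0_l.
    assert (Ha1 : -1 <= a <= 1) by (apply Rabs_lt_between in Ha; lra).
    specialize (HKb a Ha1).
    assert (Heq : c * b - 1 / (2 * (eps * (eps * 1))) * (a * (1 - a) * exp (- / eps * (1 - a)))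
      + - (c * 0 - 1 / (2 * (eps * (eps * 1))) * (0 * (1 - 0) * exp (- / eps * (1 - 0))))
      + - (c * (b + - 0) - reac_rate * (a + - 0)) = - (reac eps a - reac_rate * a)).
    { unfold reac. simpl. ring. }
    rewrite Heq, Rabs_Ropp. apply Rle_trans with (1 := HKb).
    apply Rle_trans with (e * Rabs a); [|now apply Rmult_le_compat_l; [lra|]].
    rewrite <- (pow2_abs a).
    assert (K * Rabs a <= e).
    { assert (Rabs a * (K + 1) <= e / (K + 1) * (K + 1)) by (apply Rmult_le_compat_r; lra).
      replace (e / (K + 1) * (K + 1)) with e in H1 by (field; lra). pose proof (Rabs_pos a). lra. }
    pose proof (Rabs_pos a). nra.
Qed.

Lemma node_eigenvector l : l ^ 2 - c * l + reac_rate = 0 -> eigenvector node_lin l (1, l).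
Proof.
  intros H. split.
  - intros E. injection E. lra.
  - unfold node_lin. simpl. f_equal; lra.
Qed.

Definition slow_root : R := (c - sqrt (c ^ 2 - 4 * reac_rate)) / 2.
Definition fast_root : R := (c + sqrt (c ^ 2 - 4 * reac_rate)) / 2.

Lemma roots_spec : 0 < c -> 4 * reac_rate < c ^ 2 ->
  0 < slow_root < c / 2 /\ c / 2 < fast_root /\ slow_root + fast_root = c /\ slow_root * fast_root = reac_rate.
Proof.
  intros Hc0 H. pose proof reac_rate_pos as Hq. unfold slow_root, fast_root.
  pose proof (sqrt_lt_R0 (c ^ 2 - 4 * reac_rate) ltac:(lra)) as Hs.
  pose proof (sqrt_sqrt (c ^ 2 - 4 * reac_rate) ltac:(lra)) as Hss.
  set (s := sqrt (c ^ 2 - 4 * reac_rate)) in *. repeat split; try lra; nra.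
Qed.

Lemma front_node : 0 < c -> 4 * reac_rate < c ^ 2 -> proper_unstable_node node_lin slow_root fast_root.
Proof.
  intros Hc0 H. destruct (roots_spec Hc0 H) as (H1 & H2 & H3 & H4). repeat split; try lra.
  - exists (1, slow_root). apply node_eigenvector. rewrite <- H4, <- H3. ring.
  - exists (1, fast_root). apply node_eigenvector. rewrite <- H4, <- H3. ring.
Qed.

(** The unit direction of a point on the graph depends only on the slope [S / theta], and does so
    continuously. *)
Lemma front_leaves_along l : l ^ 2 - c * l + reac_rate = 0 ->
  (forall e, 0 < e -> exists d, 0 < d < 1 /\ forall th, 0 < th < d -> Rabs (S th / th - l) < e) ->
  leaves_along node_lin l p_minus (graph_orbit S).
Proof.
  intros Hl Hlim. exists (1, l). split; [now apply node_eigenvector|].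
  pose proof (hand_spec S M' S_cont S_pos front_M_pos front_left front_right) as Hsp.
  assert (HP : filterlim (fun z => S (hand S z) / hand S z) (Rbar_locally m_infty) (locally l)).
  { apply (filterlim_R R (Rbar_locally m_infty)). intros e Hee. destruct (Hlim e Hee) as [d [Hd K]].
    pose proof (hand_m_infty S M' S_cont S_pos front_M_pos front_left front_right) as Hm.
    assert (Hm' := proj1 (filterlim_R R (Rbar_locally m_infty) _ _) Hm d ltac:(lra)). revert Hm'. apply filter_imp. intros z Hz.
    destruct (Hsp z) as [Hz1 _]. apply K. rewrite Rminus_0_r, Rabs_right in Hz; lra. }
  assert (Hn : forall z, unit_dir (fst (graph_orbit S z) - fst p_minus, snd (graph_orbit S z) - snd p_minus)
     = (/ sqrt (1 + (S (hand S z) / hand S z) ^ 2), (S (hand S z) / hand S z) / sqrt (1 + (S (hand S z) / hand S z) ^ 2))).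
  { intros z. destruct (Hsp z) as [Hz _]. unfold unit_dir, graph_orbit. simpl fst; simpl snd.
    rewrite !Rminus_0_r, norm_pair. set (t := hand S z) in *. set (P := S t / t).
    assert (ES : S t = t * P) by (unfold P; field; lra). rewrite ES.
    replace (t ^ 2 + (t * P) ^ 2) with (t ^ 2 * (1 + P ^ 2)) by ring.
    rewrite sqrt_mult by nra. rewrite sqrt_pow2 by lra.
    assert (0 < sqrt (1 + P ^ 2)) by (apply sqrt_lt_R0; nra). f_equal; field; split; lra. }
  assert (Hl1 : unit_dir (1, l) = (/ sqrt (1 + l ^ 2), l / sqrt (1 + l ^ 2))).
  { unfold unit_dir. simpl fst; simpl snd. rewrite norm_pair, pow1. f_equal. unfold Rdiv. apply Rmult_1_l. }
  rewrite Hl1.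
  apply (filterlim_ext (fun z => (/ sqrt (1 + (S (hand S z) / hand S z) ^ 2), (S (hand S z) / hand S z) / sqrt (1 + (S (hand S z) / hand S z) ^ 2)))).
  { intros z. now rewrite Hn. }
  apply (filterlim_pair_R _ _ _ (/ sqrt (1 + l ^ 2), l / sqrt (1 + l ^ 2))). simpl fst. simpl snd.
  assert (Hs : sqrt (1 + l ^ 2) <> 0) by (apply Rgt_not_eq, sqrt_lt_R0; nra).
  split.
  - apply (filterlim_comp _ _ _ (fun z => S (hand S z) / hand S z) (fun P => / sqrt (1 + P ^ 2)) _ (locally l)); [assumption|].
    change (continuous (fun P => / sqrt (1 + P ^ 2)) l). cont.
  - apply (filterlim_comp _ _ _ (fun z => S (hand S z) / hand S z) (fun P => P / sqrt (1 + P ^ 2)) _ (locally l)); [assumption|].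
    change (continuous (fun P => P / sqrt (1 + P ^ 2)) l). apply cont_mult; [cont|]. cont.
Qed.
End FrontOrbit.

(** * Tangency at the node *)

Section Decay.
Variables (f df : R -> R) (k B t1 : R).
Hypothesis Hk : 0 < k.
Hypothesis Ht1 : 0 < t1.
Hypothesis Hd : forall t, 0 < t < t1 -> is_derive f t (df t).
Hypothesis HB : forall t, 0 < t < t1 -> f t <= B.

Let weighted_derive m t : 0 < t < t1 ->
  is_derive (fun s => f s * exp (m * ln s)) t ((t * df t + m * f t) * (exp (m * ln t) / t)).
Proof.
  intros Ht. deriv_as (df t * exp (m * ln t) + f t * (exp (m * ln t) * m / t)); [|field; lra].
  apply (deriv_mult f (fun s => exp (m * ln s))); [now apply Hd|].
  auto_derive; [lra|]. field. lra.
Qed.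

Lemma bounded_repelled : (forall t, 0 < t < t1 -> t * df t <= - k * f t) -> forall t, 0 < t < t1 -> f t <= 0.
Proof.
  intros Hode t Ht. destruct (Rle_lt_dec (f t) 0) as [|Hf]; [assumption|exfalso].
  pose proof (HB t Ht) as HBt.
  (* [t ^ k * f] is nonincreasing, and here [(t / s) ^ k] is [exp (B / f t)], so [f s >= f t + B]
     exceeds the bound. *)
  set (s := t * exp (- (B / (k * f t)))).
  assert (Hkf : 0 < k * f t) by now apply Rmult_lt_0_compat.
  assert (Ha : 0 < B / (k * f t)) by (apply Rdiv_lt_0_compat; lra).
  assert (Hx : exp (- (B / (k * f t))) < 1) by (rewrite <- exp_0; apply exp_increasing; lra).
  pose proof (exp_pos (- (B / (k * f t)))) as Hx0.
  assert (Hs : 0 < s < t) by (unfold s; split; nra).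
  assert (Els : ln s = ln t - B / (k * f t)) by (unfold s; rewrite ln_mult, ln_exp by lra; ring).
  assert (H : - (f s * exp (k * ln s)) <= - (f t * exp (k * ln t))).
  { apply (nondecreasing_of_derive (fun s => - (f s * exp (k * ln s)))
      (fun t => - ((t * df t + k * f t) * (exp (k * ln t) / t))) s t ltac:(lra)).
    - intros u Hu. apply cont_opp. exact (deriv_cont _ _ _ (weighted_derive k u ltac:(lra))).
    - intros u Hu. apply (is_derive_opp (V := R_NormedModule)), weighted_derive. lra.
    - intros u Hu. specialize (Hode u ltac:(lra)).
      assert (0 < exp (k * ln u) / u) by (apply Rdiv_lt_0_compat; [apply exp_pos|lra]). nra. }
  assert (Ex : exp (k * ln t) = exp (k * ln s) * exp (B / f t)).
  { rewrite <- exp_plus. f_equal. rewrite Els. field. lra. }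
  assert (1 + B / f t <= exp (B / f t)) by apply exp_ineq1_le.
  pose proof (exp_pos (k * ln s)). pose proof (HB s ltac:(lra)).
  assert (f t * exp (B / f t) <= f s).
  { apply Rmult_le_reg_r with (exp (k * ln s)); [assumption|]. rewrite Ex in H. lra. }
  assert (f t * (1 + B / f t) = f t + B) by (field; lra).
  assert (f t * (1 + B / f t) <= f t * exp (B / f t)) by (apply Rmult_le_compat_l; lra). lra.
Qed.

(** [t ^ (- k) * f] is nondecreasing, so a positive [f] decays at least like [t ^ k] towards 0. *)
Lemma bounded_attracted : (forall t, 0 < t < t1 -> k * f t <= t * df t) ->
  forall e, 0 < e -> exists d, 0 < d <= t1 /\ forall t, 0 < t < d -> f t <= e.
Proof.
  intros Hode e He. set (t2 := t1 / 2). assert (Ht2 : 0 < t2 < t1) by (unfold t2; lra).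
  set (a := Rabs B / (k * e)). assert (Ha : 0 <= a).
  { unfold a, Rdiv. apply Rmult_le_pos; [apply Rabs_pos|]. left. apply Rinv_0_lt_compat, Rmult_lt_0_compat; assumption. }
  exists (t2 * exp (- a)). pose proof (exp_pos (- a)). pose proof (exp_le_1 (- a) ltac:(lra)).
  split; [split; nra|]. intros s Hs. assert (Hs2 : s < t2) by nra.
  assert (H1 : f s * exp (- k * ln s) <= f t2 * exp (- k * ln t2)).
  { apply (nondecreasing_of_derive (fun s => f s * exp (- k * ln s))
      (fun t => (t * df t + - k * f t) * (exp (- k * ln t) / t)) s t2 ltac:(lra)).
    - intros u Hu. exact (deriv_cont _ _ _ (weighted_derive (- k) u ltac:(lra))).
    - intros u Hu. apply weighted_derive. lra.
    - intros u Hu. specialize (Hode u ltac:(lra)).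
      assert (0 < exp (- k * ln u) / u) by (apply Rdiv_lt_0_compat; [apply exp_pos|lra]). nra. }
  set (b := ln t2 - ln s). assert (Hb : a <= b).
  { unfold b. assert (ln s < ln (t2 * exp (- a))) by (apply ln_increasing; lra).
    rewrite ln_mult, ln_exp in H2 by lra. lra. }
  assert (Ex : exp (- k * ln s) = exp (- k * ln t2) * exp (k * b)).
  { rewrite <- exp_plus. f_equal. unfold b. ring. }
  rewrite Ex in H1. pose proof (exp_pos (- k * ln t2)).
  assert (H3 : f s * exp (k * b) <= f t2).
  { apply Rmult_le_reg_r with (exp (- k * ln t2)); [assumption|]. lra. }
  pose proof (HB t2 ltac:(lra)). pose proof (Rle_abs B).
  assert (H6 : 1 + k * b <= exp (k * b)) by apply exp_ineq1_le.
  assert (H7 : Rabs B <= e * (k * b)).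
  { apply Rle_trans with (e * (k * a)); [right; unfold a; field; lra|].
    apply Rmult_le_compat_l; [lra|]. apply Rmult_le_compat_l; lra. }
  destruct (Rle_lt_dec (f s) e) as [|Hfe]; [assumption|exfalso].
  assert (e * (1 + k * b) <= e * exp (k * b)) by (apply Rmult_le_compat_l; lra).
  assert (e * exp (k * b) < f s * exp (k * b)) by (apply Rmult_lt_compat_r; [apply exp_pos|assumption]). lra.
Qed.
End Decay.

Section Slope.
Variables (eps c l M t1 : R) (S : R -> R).
Hypothesis He : 0 < eps.
Hypothesis HS : is_front eps c S.
Hypothesis Hl : l ^ 2 - c * l + reac_rate eps = 0.
Hypothesis Hl0 : 0 < l.
Hypothesis HM : 0 < M.
Hypothesis Ht1 : 0 < t1 < 1.
Hypothesis S_line : forall t, 0 < t < 1 -> S t <= M * t.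

Let slope t := S t / t.
(** Using the square of the slope P removes [S] from the denominator. Up to order t, t d(P^2)/dt is
    - 2 (P - l) (P - (c - l)), since [c - l] is the other root; the outer square makes the sign
    depend on the last factor alone. *)
Let gap t := (slope t ^ 2 - l ^ 2) ^ 2.
Let dgap t := 4 * (slope t ^ 2 - l ^ 2) * (slope t * (c - slope t) - reac eps t / t) / t.

Let slope_range t : 0 < t < t1 -> 0 < slope t <= M.
Proof.
  intros Ht. destruct HS as (_ & _ & _ & H). destruct (H t ltac:(lra)) as [Hp _]. specialize (S_line t ltac:(lra)).
  unfold slope. split; [apply Rdiv_lt_0_compat; lra|]. apply Rmult_le_reg_r with t; [lra|].
  unfold Rdiv. rewrite Rmult_assoc, Rinv_l by lra. lra.
Qed.

Let gap_derive t : 0 < t < t1 -> is_derive gap t (dgap t).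
Proof.
  intros Ht. destruct HS as (_ & _ & _ & H). destruct (H t ltac:(lra)) as [Hp Hd]. unfold gap.
  deriv_as (((c - reac eps t / S t) * t - S t * 1) / t ^ 2 * (4 * (slope t ^ 2 - l ^ 2) * slope t)).
  - apply (deriv_comp (fun P => (P ^ 2 - l ^ 2) ^ 2) slope).
    + auto_derive; [easy|ring].
    + apply (deriv_div S (fun t => t)); [assumption|auto_derive; easy|lra].
  - unfold dgap, slope. field. lra.
Qed.

Let gap_bounds : exists C, 0 <= C /\ forall t, 0 < t < t1 ->
  Rabs (t * dgap t + 4 * (slope t + l) * (slope t - l) ^ 2 * (slope t - (c - l))) <= C * t.
Proof.
  destruct (reac_linear_error eps He) as [K [HK H]].
  exists (4 * (M ^ 2 + l ^ 2) * K). split; [apply Rmult_le_pos; nra|]. intros t Ht.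
  specialize (H t ltac:(lra)). pose proof (slope_range t Ht) as Hs.
  assert (E : t * dgap t + 4 * (slope t + l) * (slope t - l) ^ 2 * (slope t - (c - l))
    = 4 * (slope t ^ 2 - l ^ 2) * ((reac_rate eps * t - reac eps t) / t)).
  { unfold dgap. replace (reac_rate eps) with (c * l - l ^ 2) by lra. field. lra. }
  rewrite E, !Rabs_mult, (Rabs_right 4) by lra.
  assert (H1 : Rabs (slope t ^ 2 - l ^ 2) <= M ^ 2 + l ^ 2) by (apply Rabs_le; nra).
  assert (H2 : Rabs ((reac_rate eps * t - reac eps t) / t) <= K * t).
  { unfold Rdiv. rewrite Rabs_mult, Rabs_minus_sym, (Rabs_right (/ t)).
    - apply Rmult_le_reg_r with t; [lra|]. rewrite Rmult_assoc, Rinv_l by lra. lra.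
    - apply Rle_ge. left. apply Rinv_0_lt_compat. lra. }
  rewrite !Rmult_assoc. apply Rmult_le_compat_l; [lra|].
  apply Rmult_le_compat; [apply Rabs_pos|apply Rabs_pos|assumption|assumption].
Qed.

Let gap_le t : 0 < t < t1 -> gap t <= (M ^ 2 + l ^ 2) ^ 2.
Proof.
  intros Ht. pose proof (slope_range t Ht). unfold gap. rewrite <- (pow2_abs (slope t ^ 2 - l ^ 2)).
  apply pow_incr. split; [apply Rabs_pos|apply Rabs_le; nra].
Qed.

Let slope_near (e : R) t : 0 < e -> 0 < t < t1 -> gap t <= e ^ 2 * l ^ 2 / 2 -> Rabs (S t / t - l) < e.
Proof.
  intros Hee Ht Hg. fold (slope t). pose proof (slope_range t Ht) as Hs.
  assert (E : gap t = (slope t - l) ^ 2 * (slope t + l) ^ 2) by (unfold gap; ring).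
  destruct (Rlt_le_dec (Rabs (slope t - l)) e) as [|Hle]; [assumption|exfalso].
  assert (H1 : e ^ 2 <= (slope t - l) ^ 2) by (rewrite <- (pow2_abs (slope t - l)); apply pow_incr; lra).
  assert (H2 : l ^ 2 <= (slope t + l) ^ 2) by (apply pow_incr; lra).
  assert (0 < e ^ 2) by now apply pow_lt. assert (0 < l ^ 2) by now apply pow_lt.
  assert (e ^ 2 * l ^ 2 <= gap t) by (rewrite E; apply Rmult_le_compat; lra). nra.
Qed.

Let gap_split a t : 0 <= a -> 0 < t < t1 -> 4 * a / (M + l) * gap t <= 4 * (slope t + l) * (slope t - l) ^ 2 * a.
Proof.
  intros Ha Ht. pose proof (slope_range t Ht) as Hs.
  replace (4 * (slope t + l) * (slope t - l) ^ 2 * a) with (4 * a / (M + l) * ((slope t + l) * (slope t - l) ^ 2 * (M + l))) by (field; lra).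
  apply Rmult_le_compat_l; [apply Rmult_le_pos; [lra|left; apply Rinv_0_lt_compat; lra]|].
  replace (gap t) with ((slope t + l) * (slope t - l) ^ 2 * (slope t + l)) by (unfold gap; ring).
  apply Rmult_le_compat_l; [|lra]. apply Rmult_le_pos; [lra|apply pow2_ge_0].
Qed.

(* [gap] grows like [t^-k] unless it vanishes in the limit, respectively decays like [t^k], up to a forcing of order [t]. *)
Lemma slope_limit a : 0 < a ->
  (forall t, 0 < t < t1 -> a <= S t / t - (c - l)) \/ (forall t, 0 < t < t1 -> S t / t - (c - l) <= - a) ->
  forall e, 0 < e -> exists d, 0 < d < 1 /\ forall t, 0 < t < d -> Rabs (S t / t - l) < e.
Proof.
  intros Ha Hside e Hee. destruct gap_bounds as [C [HC HCb]].
  set (k := 4 * a / (M + l)). assert (Hk : 0 < k) by (apply Rdiv_lt_0_compat; lra).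
  set (e' := e ^ 2 * l ^ 2 / 4). assert (He' : 0 < e').
  { unfold e'. pose proof (pow_lt e 2 Hee). pose proof (pow_lt l 2 Hl0). nra. }
  set (t2 := Rmin t1 (k * e' / (C + 1))).
  assert (Hke : 0 < k * e') by now apply Rmult_lt_0_compat.
  assert (Ht2 : 0 < t2) by (apply Rmin_glb_lt; [lra|apply Rdiv_lt_0_compat; lra]).
  pose proof (Rmin_l t1 (k * e' / (C + 1))) as Ht2a. pose proof (Rmin_r t1 (k * e' / (C + 1))) as Ht2b.
  fold t2 in Ht2a, Ht2b.
  assert (Hsmall : forall t, 0 < t < t2 -> C * t <= k * e').
  { intros t Ht. assert ((C + 1) * t <= (C + 1) * (k * e' / (C + 1))) by (apply Rmult_le_compat_l; lra).
    replace ((C + 1) * (k * e' / (C + 1))) with (k * e') in H by (field; lra). lra. }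
  assert (Hd : forall t, 0 < t < t2 -> is_derive (fun t => gap t - e') t (dgap t)).
  { intros t Ht. deriv_as (dgap t - 0); [|ring]. apply (deriv_minus gap (fun _ => e')); [apply gap_derive; lra|].
    auto_derive; easy. }
  assert (HB : forall t, 0 < t < t2 -> gap t - e' <= (M ^ 2 + l ^ 2) ^ 2).
  { intros t Ht. pose proof (gap_le t ltac:(lra)). lra. }
  assert (Hpos : forall t, 0 < t < t2 -> 0 <= 4 * (slope t + l) * (slope t - l) ^ 2).
  { intros t Ht. pose proof (slope_range t ltac:(lra)). apply Rmult_le_pos; [lra|apply pow2_ge_0]. }
  assert (Hconv : exists d, 0 < d <= t2 /\ forall t, 0 < t < d -> gap t - e' <= e').
  { destruct Hside as [Hside|Hside].
    - exists t2. split; [lra|]. intros t Ht. enough (gap t - e' <= 0) by lra.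
      apply (bounded_repelled (fun t => gap t - e') dgap k ((M ^ 2 + l ^ 2) ^ 2) t2); try assumption.
      intros u Hu. specialize (HCb u ltac:(lra)). apply Rabs_le_between in HCb. specialize (Hside u ltac:(lra)).
      fold (slope u) in Hside. pose proof (gap_split a u ltac:(lra) ltac:(lra)) as Hg. fold k in Hg.
      specialize (Hsmall u Hu). specialize (Hpos u Hu).
      pose proof (Rmult_le_compat_l _ _ _ Hpos Hside). lra.
    - apply (bounded_attracted (fun t => gap t - e') dgap k ((M ^ 2 + l ^ 2) ^ 2) t2); try assumption.
      intros u Hu. specialize (HCb u ltac:(lra)). apply Rabs_le_between in HCb. specialize (Hside u ltac:(lra)).
      fold (slope u) in Hside. pose proof (gap_split a u ltac:(lra) ltac:(lra)) as Hg. fold k in Hg.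
      specialize (Hsmall u Hu). specialize (Hpos u Hu).
      pose proof (Rmult_le_compat_l _ _ _ Hpos Hside). lra. }
  destruct Hconv as [d [Hd1 Hd2]]. exists d. split; [lra|]. intros t Ht.
  apply slope_near; [assumption|lra|]. specialize (Hd2 t Ht). unfold e' in Hd2. lra.
Qed.
End Slope.

Lemma reac_rate_small eps : 0 < eps <= e0 -> reac_rate eps <= 14 * eps.
Proof.
  intros He. unfold reac_rate. pose proof (exp_neg_cube (/ eps) ltac:(apply Rinv_0_lt_compat; lra)) as H.
  pose proof (pow_lt eps 2 ltac:(lra)).
  apply Rmult_le_reg_r with (2 * eps ^ 2); [lra|]. unfold Rdiv. rewrite Rmult_assoc, Rinv_l by lra.
  replace (27 / (/ eps) ^ 3) with (27 * eps ^ 3) in H by (field; lra). nra.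
Qed.

(** * Strong and weak connections from the slopes of the fronts *)

Section Connections.
Variable eps : R.
Hypothesis He : 0 < eps <= e0.

Let roots c : 9 / 10 <= c -> 0 < c /\ 4 * reac_rate eps < c ^ 2.
Proof. intros Hc. split; [lra|]. pose proof (reac_rate_small eps He). unfold e0 in He. nra. Qed.

Let root_eq c : 9 / 10 <= c ->
  slow_root eps c ^ 2 - c * slow_root eps c + reac_rate eps = 0 /\
  fast_root eps c ^ 2 - c * fast_root eps c + reac_rate eps = 0.
Proof.
  intros Hc. destruct (roots c Hc) as [R1 R2].
  destruct (roots_spec eps c ltac:(lra) R1 R2) as (_ & _ & E1 & E2). rewrite <- E2.
  replace (c * slow_root eps c) with ((slow_root eps c + fast_root eps c) * slow_root eps c) by now rewrite E1.
  replace (c * fast_root eps c) with ((slow_root eps c + fast_root eps c) * fast_root eps c) by now rewrite E1.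
  split; ring.
Qed.

Lemma strong_slope e : 0 < e ->
  exists d, 0 < d < 1 /\ forall t, 0 < t < d -> Rabs (front eps (cb eps) t / t - fast_root eps (cb eps)) < e.
Proof.
  intros Hee. destruct (cb_spec eps He) as [Hc [H0 _]]. set (c := cb eps) in *.
  destruct (roots c ltac:(lra)) as [R1 R2]. destruct (roots_spec eps c ltac:(lra) R1 R2) as (G1 & G2 & G3 & G4).
  destruct (root_eq c ltac:(lra)) as [_ Hr].
  (* The slope is at least [c / 2], which separates it from the slow root; towards the node every
     other bounded possibility is repelled. *)
  apply (slope_limit eps c (fast_root eps c) c (31 / 32) (front eps c)) with (a := c / 2 - slow_root eps c); try lra.
  - apply front_spec; lra.
  - intros t Ht. left. apply front_below_line; lra.
  - left. intros t Ht. pose proof (strong_front_lower eps t He ltac:(lra)) as Hl. fold c in Hl.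
    assert (c / 2 <= front eps c t / t); [|lra].
    apply Rmult_le_reg_r with t; [lra|]. unfold Rdiv at 2. rewrite Rmult_assoc, Rinv_l by lra. lra.
Qed.

Lemma weak_front_vanishes c : cb eps <= c -> front eps c 0 = 0.
Proof.
  intros Hc. destruct (cb_spec eps He) as [Hcb [H0 _]].
  pose proof (front_mono eps (cb eps) c _ _ ltac:(lra) ltac:(lra) (front_spec eps (cb eps) ltac:(lra) ltac:(lra))
    (front_spec eps c ltac:(lra) ltac:(lra)) 0 ltac:(lra)).
  destruct (front_spec eps c ltac:(lra) ltac:(lra)) as (_ & Hp & _). specialize (Hp 0). lra.
Qed.

Lemma fast_root_increasing c c' : 9 / 10 <= c < c' -> fast_root eps c < fast_root eps c'.
Proof.
  intros Hc. unfold fast_root. destruct (roots c ltac:(lra)) as [_ Hr].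
  assert (sqrt (c ^ 2 - 4 * reac_rate eps) <= sqrt (c' ^ 2 - 4 * reac_rate eps)) by (apply sqrt_mono; nra). lra.
Qed.

Lemma weak_slope c e : cb eps < c -> 0 < e ->
  exists d, 0 < d < 1 /\ forall t, 0 < t < d -> Rabs (front eps c t / t - slow_root eps c) < e.
Proof.
  intros Hc Hee. destruct (cb_spec eps He) as [Hcb [H0 _]].
  destruct (roots c ltac:(lra)) as [R1 R2]. destruct (roots_spec eps c ltac:(lra) R1 R2) as (G1 & G2 & G3 & G4).
  destruct (root_eq c ltac:(lra)) as [Hr _].
  pose proof (fast_root_increasing (cb eps) c ltac:(lra)) as Hf.
  (* The front lies below the threshold front, whose slope tends to [fast_root eps (cb eps)], so
     near the node its slope stays at least [a] below its own fast root. *)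
  set (a := (fast_root eps c - fast_root eps (cb eps)) / 2). assert (Ha : 0 < a) by (unfold a; lra).
  destruct (strong_slope a Ha) as [t1 [Ht1 Hs]].
  apply (slope_limit eps c (slow_root eps c) c t1 (front eps c)) with (a := a); try lra.
  - apply front_spec; lra.
  - intros t Ht. left. apply front_below_line; [lra|lra|apply weak_front_vanishes; lra|assumption].
  - right. intros t Ht. specialize (Hs t Ht). apply Rabs_lt_between in Hs.
    pose proof (front_mono eps (cb eps) c _ _ ltac:(lra) ltac:(lra) (front_spec eps (cb eps) ltac:(lra) ltac:(lra))
      (front_spec eps c ltac:(lra) ltac:(lra)) t ltac:(lra)) as Hm.
    assert (front eps c t / t <= front eps (cb eps) t / t).
    { apply Rmult_le_compat_r; [left; apply Rinv_0_lt_compat; lra|assumption]. }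
    unfold a in *. lra.
Qed.

Lemma front_connection c : cb eps <= c -> heteroclinic (zfk_field eps c) p_minus p_plus (graph_orbit (front eps c)).
Proof.
  intros Hc. destruct (cb_spec eps He) as [Hcb _].
  apply (front_heteroclinic eps c c); try lra.
  - apply front_spec; lra.
  - intros t Ht. left. apply front_below_line; [lra|lra|now apply weak_front_vanishes|assumption].
Qed.

Lemma front_points c p : cb eps <= c ->
  orbit (graph_orbit (front eps c)) p <-> 0 < fst p < 1 /\ snd p = front eps c (fst p).
Proof.
  intros Hc. destruct (cb_spec eps He) as [Hcb _].
  apply (front_orbit_points eps c c); try lra.
  - apply front_spec; lra.
  - intros t Ht. left. apply front_below_line; [lra|lra|now apply weak_front_vanishes|assumption].
Qed.

Lemma strong_connection :
  strong_heteroclinic (zfk_field eps (cb eps)) p_minus p_plus (graph_orbit (front eps (cb eps))).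
Proof.
  destruct (cb_spec eps He) as [Hcb [H0 _]]. split; [apply front_connection; lra|].
  destruct (roots (cb eps) ltac:(lra)) as [R1 R2].
  exists (node_lin eps (cb eps)), (slow_root eps (cb eps)), (fast_root eps (cb eps)). split; [|split].
  - apply zfk_linearization; lra.
  - apply front_node; lra.
  - apply (front_leaves_along eps (cb eps) (cb eps)); try lra.
    + apply front_spec; lra.
    + intros t Ht. left. apply front_below_line; [lra|lra|assumption|assumption].
    + apply root_eq; lra.
    + apply strong_slope.
Qed.

Lemma weak_connection c : cb eps < c ->
  weak_heteroclinic (zfk_field eps c) p_minus p_plus (graph_orbit (front eps c)).
Proof.
  intros Hc. destruct (cb_spec eps He) as [Hcb [H0 _]]. split; [apply front_connection; lra|].
  destruct (roots c ltac:(lra)) as [R1 R2].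
  exists (node_lin eps c), (slow_root eps c), (fast_root eps c). split; [|split].
  - apply zfk_linearization; lra.
  - apply front_node; lra.
  - apply (front_leaves_along eps c c); try lra.
    + apply front_spec; lra.
    + intros t Ht. left. apply front_below_line; [lra|lra|apply weak_front_vanishes; lra|assumption].
    + apply root_eq; lra.
    + intros e Hee. now apply weak_slope.
Qed.
End Connections.

(** * Nonexistence below the threshold speed *)

Section Nonexistence.
Variables (eps c : R) (g : R -> plane).
Hypothesis He : 0 < eps <= e0.
Hypothesis Hc : 0 < c < cb eps.
Hypothesis Hg : heteroclinic (zfk_field eps c) p_minus p_plus g.
Hypothesis Hrange : forall z, 0 <= fst (g z) <= 1.

Let th z := fst (g z).
Let et z := snd (g z).
Let S := front eps (cb eps).

Let S_front : is_front eps (cb eps) S.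
Proof. apply front_spec; [lra|]. destruct (cb_spec eps He). lra. Qed.

Let th_derive z : is_derive th z (et z).
Proof. destruct Hg as [H _]. apply (proj1 (is_derive_pair g z _)) in H. apply H. Qed.

Let et_derive z : is_derive et z (c * et z - reac eps (th z)).
Proof. destruct Hg as [H _]. apply (proj1 (is_derive_pair g z _)) in H. apply H. Qed.

Let th_cont z : continuous th z.
Proof. exact (deriv_cont _ _ _ (th_derive z)). Qed.

Let et_cont z : continuous et z.
Proof. exact (deriv_cont _ _ _ (et_derive z)). Qed.

(** The reaction is nonnegative as long as theta stays in [0,1]. *)
Let et_growth a b : a <= b -> et b * exp (- c * b) <= et a * exp (- c * a).
Proof.
  intros Hab. enough (- (et a * exp (- c * a)) <= - (et b * exp (- c * b))) by lra.
  apply (nondecreasing_of_derive (fun z => - (et z * exp (- c * z))) (fun z => reac eps (th z) * exp (- c * z)) a b Hab).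
  - intros t _. cont. apply et_cont.
  - intros t _. deriv_as (- ((c * et t - reac eps (th t)) * exp (- c * t) + et t * (- c * exp (- c * t)))); [|ring].
    apply (is_derive_opp (V := R_NormedModule)), (deriv_mult et (fun z => exp (- c * z))); [apply et_derive|].
    auto_derive; [easy|ring].
  - intros t _. apply Rmult_le_pos; [|left; apply exp_pos]. apply reac_nonneg; [lra|apply Hrange].
Qed.

Let th_right e : 0 < e -> forall z0, exists z, z0 <= z /\ 1 - e < th z /\ Rabs (et z) < e.
Proof.
  intros Hee z0. destruct Hg as (_ & _ & H).
  apply (filterlim_pair_R _ _ g p_plus) in H. destruct H as [H1 H2].
  destruct (proj1 (filterlim_R R (Rbar_locally p_infty) _ _) H1 e Hee) as [A1 K1].
  destruct (proj1 (filterlim_R R (Rbar_locally p_infty) _ _) H2 e Hee) as [A2 K2].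
  set (z := Rmax z0 (Rmax A1 A2) + 1). exists z.
  pose proof (Rmax_l z0 (Rmax A1 A2)). pose proof (Rmax_r z0 (Rmax A1 A2)).
  pose proof (Rmax_l A1 A2). pose proof (Rmax_r A1 A2).
  specialize (K1 z ltac:(unfold z; lra)). specialize (K2 z ltac:(unfold z; lra)). simpl in K1, K2.
  rewrite Rminus_0_r in K2. apply Rabs_lt_between in K1. unfold th, et. repeat split; [unfold z; lra|lra|assumption].
Qed.

Let th_left e : 0 < e -> forall z0, exists z, z <= z0 /\ th z < e.
Proof.
  intros Hee z0. destruct Hg as (_ & H & _).
  apply (filterlim_pair_R _ _ g p_minus) in H. destruct H as [H1 _].
  destruct (proj1 (filterlim_R R (Rbar_locally m_infty) _ _) H1 e Hee) as [A1 K1].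
  set (z := Rmin z0 A1 - 1). exists z. pose proof (Rmin_l z0 A1). pose proof (Rmin_r z0 A1).
  specialize (K1 z ltac:(unfold z; lra)). simpl in K1. apply Rabs_lt_between in K1. unfold th. split; [unfold z; lra|lra].
Qed.

(** Once negative, eta would stay below that value forever and could not tend to 0. *)
Let et_nonneg z : 0 <= et z.
Proof.
  destruct (Rle_lt_dec 0 (et z)) as [|Hn]; [assumption|exfalso].
  destruct (th_right (- et z) ltac:(lra) z) as [y [Hy [_ Hye]]]. apply Rabs_lt_between in Hye.
  pose proof (et_growth z y Hy) as H.
  assert (0 < exp (- c * y) <= exp (- c * z)) by (split; [apply exp_pos|apply exp_mono; nra]). nra.
Qed.

Let th_mono a b : a <= b -> th a <= th b.
Proof.
  intros Hab. apply (nondecreasing_of_derive th et a b Hab); auto.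
Qed.

Let W z := et z ^ 2 / 2 - S (th z) ^ 2 / 2.

Let S_cont t : continuous S t.
Proof. apply S_front. Qed.

Let S_th_cont z : continuous (fun z => S (th z)) z.
Proof. apply (continuous_comp th S); [apply th_cont|apply S_cont]. Qed.

Let W_cont z : continuous W z.
Proof. unfold W. cont; [apply et_cont|apply S_th_cont]. Qed.

Let S_pos t : 0 < t < 1 -> 0 < S t.
Proof. intros. now apply S_front. Qed.

Let S_th_derive z : 0 < th z < 1 -> is_derive (fun z => S (th z)) z (et z * (cb eps - reac eps (th z) / S (th z))).
Proof. intros Hz. apply (deriv_comp S th); [now apply S_front|apply th_derive]. Qed.

Let W_derive z : 0 < th z < 1 -> is_derive W z (et z * (c * et z - cb eps * S (th z))).
Proof.
  intros Hz. pose proof (S_pos _ Hz).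
  deriv_as ((c * et z - reac eps (th z)) * et z - et z * (cb eps - reac eps (th z) / S (th z)) * S (th z)); [|field; lra].
  apply (deriv_minus (fun z => et z ^ 2 / 2) (fun z => S (th z) ^ 2 / 2)).
  - apply (deriv_comp (fun u => u ^ 2 / 2) et); [auto_derive; [easy|field]|apply et_derive].
  - apply (deriv_comp (fun u => u ^ 2 / 2) (fun z => S (th z))); [auto_derive; [easy|field]|now apply S_th_derive].
Qed.

(** Where eta exceeds S, W' is at most c eta (eta - S) <= 2 c W; otherwise W' is nonpositive. The
    exponential weight turns this into a comparison with the constant [W a < 0]. *)
Let W_barrier a b : a <= b -> 0 < th a -> th b < 1 -> W a < 0 -> W b <= W a.
Proof.
  intros Hab Ha Hb HW.
  assert (Hth : forall z, a <= z <= b -> 0 < th z < 1).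
  { intros z Hz. pose proof (th_mono a z ltac:(lra)). pose proof (th_mono z b ltac:(lra)). lra. }
  enough (H : (W b - W a) * exp (- (2 * c) * b) <= 0) by (pose proof (exp_pos (- (2 * c) * b)); nra).
  apply (comparison (fun z => (W z - W a) * exp (- (2 * c) * z))
    (fun z => (et z * (c * et z - cb eps * S (th z)) - 2 * c * (W z - W a)) * exp (- (2 * c) * z)) a b Hab).
  - intros t _. cont. apply W_cont.
  - intros t Ht. deriv_as ((et t * (c * et t - cb eps * S (th t)) - 0) * exp (- (2 * c) * t)
      + (W t - W a) * (- (2 * c) * exp (- (2 * c) * t))); [|ring].
    apply (deriv_mult (fun z => W z - W a) (fun z => exp (- (2 * c) * z))).
    + apply (deriv_minus W (fun _ => W a)); [apply W_derive, Hth; lra|auto_derive; easy].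
    + auto_derive; [easy|ring].
  - lra.
  - intros t Ht Hp. pose proof (exp_pos (- (2 * c) * t)) as Hx.
    assert (HWt : 0 < W t - W a) by nra.
    enough (et t * (c * et t - cb eps * S (th t)) <= 2 * c * (W t - W a)) by nra.
    pose proof (S_pos _ (Hth t ltac:(lra))) as Hs. pose proof (et_nonneg t) as Hn.
    assert (E : W t = et t ^ 2 / 2 - S (th t) ^ 2 / 2) by reflexivity.
    assert (c * et t - cb eps * S (th t) <= c * (et t - S (th t))) by nra.
    apply Rle_trans with (c * (et t * (et t - S (th t)))); [nra|].
    rewrite (Rmult_comm 2 c), Rmult_assoc. apply Rmult_le_compat_l; [lra|].
    destruct (Rle_lt_dec (S (th t)) (et t)); nra.
Qed.

(** A negative [W] would persist up to theta = 1, where [S] tends to 0 and W is at least - S^2 /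
    2. *)
Let above_front z : 0 < th z < 1 -> S (th z) <= et z.
Proof.
  intros Hz. destruct (Rle_lt_dec (S (th z)) (et z)) as [|Hlt]; [assumption|exfalso].
  pose proof (et_nonneg z) as Hn. pose proof (S_pos _ Hz) as Hs.
  assert (HW : W z < 0) by (unfold W; nra).
  destruct (proj1 (cont_eps _ _) (S_cont 1) (Rmin 1 (- W z))) as [d [Hd K]]; [apply Rmin_glb_lt; lra|].
  set (y := Rmax (th z) (1 - d / 2)).
  assert (Hy : th z <= y < 1) by (split; [apply Rmax_l|apply Rmax_lub_lt; lra]).
  assert (Hyd : 1 - d / 2 <= y) by apply Rmax_r.
  specialize (K y ltac:(rewrite Rabs_left; lra)).
  replace (S 1) with 0 in K by (symmetry; apply S_front). rewrite Rminus_0_r in K.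
  destruct (th_right (1 - y) ltac:(lra) z) as [b [Hb [Hb2 _]]].
  destruct (ivt_on th z b y Hb) as [s [Hs1 Hs2]]; [auto|lra|].
  pose proof (W_barrier z s ltac:(lra) ltac:(lra) ltac:(lra) HW) as HWs.
  assert (Hys : 0 < S y) by (apply S_pos; lra). rewrite Rabs_right in K by lra.
  pose proof (Rmin_l 1 (- W z)). pose proof (Rmin_r 1 (- W z)).
  assert (E : W s = et s ^ 2 / 2 - S y ^ 2 / 2) by (unfold W; now rewrite Hs2).
  pose proof (pow2_ge_0 (et s)). nra.
Qed.

(* Backwards in time the ratio [S / eta], which lies in (0,1], would decrease at a uniform rate. *)
Lemma no_slow_heteroclinic : False.
Proof.
  destruct (cb_spec eps He) as [Hcb _].
  destruct (th_left (1 / 2) ltac:(lra) 0) as [zl [Hzl1 Hzl2]].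
  destruct (th_right (1 / 2) ltac:(lra) 0) as [zr [Hzr1 [Hzr2 _]]].
  destruct (ivt_on th zl zr (1 / 2) ltac:(lra)) as [z1 [_ Hz1]]; [auto|lra|].
  assert (Het1 : 0 < et z1).
  { pose proof (above_front z1 ltac:(lra)). pose proof (S_pos (th z1) ltac:(lra)). lra. }
  assert (Het : forall z, z <= z1 -> 0 < et z).
  { intros z Hz. pose proof (et_growth z z1 Hz). pose proof (exp_pos (- c * z)). pose proof (exp_pos (- c * z1)). nra. }
  assert (Hth : forall z, z <= z1 -> 0 < th z <= 1 / 2).
  { intros z Hz. pose proof (th_mono z z1 Hz). split; [|lra].
    destruct (mvt_open th et (z - 1) z ltac:(lra)) as [xi [Hxi E]]; [auto|auto|].
    pose proof (Het xi ltac:(lra)). pose proof (Hrange (z - 1)) as Hr. fold (th (z - 1)) in Hr. nra. }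
  set (Q := fun z => S (th z) / et z).
  (* Uniform rate of increase of [Q]: the weight [Q] falls on [cb - c] and the weight [1 - Q] on
     [cb / 2], half of [cb] being spent on the reaction term. *)
  set (m := Rmin (cb eps - c) (cb eps / 2)). assert (Hm : 0 < m) by (apply Rmin_glb_lt; lra).
  assert (HQ : forall z, z <= z1 -> 0 < Q z <= 1).
  { intros z Hz. pose proof (Hth z Hz). pose proof (Het z Hz). pose proof (S_pos (th z) ltac:(lra)).
    pose proof (above_front z ltac:(lra)). unfold Q. split; [apply Rdiv_lt_0_compat; lra|].
    apply Rmult_le_reg_r with (et z); [lra|]. unfold Rdiv. rewrite Rmult_assoc, Rinv_l by lra. lra. }
  assert (HQd : forall z, z <= z1 -> is_derive Q z (cb eps - c * Q z - reac eps (th z) / S (th z) * (1 - Q z ^ 2))).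
  { intros z Hz. pose proof (Hth z Hz). pose proof (Het z Hz). pose proof (S_pos (th z) ltac:(lra)).
    deriv_as ((et z * (cb eps - reac eps (th z) / S (th z)) * et z - S (th z) * (c * et z - reac eps (th z))) / et z ^ 2).
    - apply (deriv_div (fun z => S (th z)) et); [apply S_th_derive; lra|apply et_derive|lra].
    - unfold Q. field. lra. }
  (* Over this time span [Q] would change by at least 2, although it lies in (0,1]. *)
  set (z := z1 - 2 / m). assert (Hz : z < z1) by (unfold z; pose proof (Rdiv_lt_0_compat 2 m ltac:(lra) Hm); lra).
  destruct (mvt_open Q (fun z => cb eps - c * Q z - reac eps (th z) / S (th z) * (1 - Q z ^ 2)) z z1 Hz) as [xi [Hxi E]].
  { intros t Ht. exact (deriv_cont _ _ _ (HQd t ltac:(lra))). }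
  { intros t Ht. apply HQd. lra. }
  pose proof (HQ z ltac:(lra)) as Q0. pose proof (HQ z1 ltac:(lra)) as Q1. pose proof (HQ xi ltac:(lra)) as Qx.
  pose proof (Hth xi ltac:(lra)) as Tx. pose proof (S_pos (th xi) ltac:(lra)) as Sx.
  assert (Hr : 0 <= reac eps (th xi) / S (th xi) <= cb eps / 4).
  { split.
    - apply Rmult_le_pos; [apply reac_nonneg; lra|left; now apply Rinv_0_lt_compat].
    - apply Rmult_le_reg_r with (S (th xi)); [assumption|].
      unfold Rdiv at 1. rewrite Rmult_assoc, Rinv_l by lra. rewrite Rmult_1_r.
      pose proof (reac_small eps (th xi) He ltac:(lra)).
      pose proof (strong_front_lower eps (th xi) He ltac:(lra)) as Hl. fold S in Hl.
      assert (cb eps / 4 * (cb eps / 2 * th xi) <= cb eps / 4 * S (th xi)) by (apply Rmult_le_compat_l; lra). nra. }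
  assert (Hrate : m <= cb eps - c * Q xi - reac eps (th xi) / S (th xi) * (1 - Q xi ^ 2)).
  { pose proof (Rmin_l (cb eps - c) (cb eps / 2)). pose proof (Rmin_r (cb eps - c) (cb eps / 2)). fold m in H, H0.
    set (r := reac eps (th xi) / S (th xi)) in *. set (q := Q xi) in *.
    assert (r * (1 - q ^ 2) <= cb eps / 4 * (2 * (1 - q))) by (apply Rmult_le_compat; nra).
    assert (m * q <= (cb eps - c) * q) by (apply Rmult_le_compat_r; lra).
    assert (m * (1 - q) <= cb eps / 2 * (1 - q)) by (apply Rmult_le_compat_r; lra). lra. }
  assert (H2 : m * (z1 - z) = 2) by (unfold z; field; lra).
  assert (m * (z1 - z) <= Q z1 - Q z) by (rewrite E; apply Rmult_le_compat_r; lra). lra.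
Qed.
End Nonexistence.

(** * Convergence to the singular orbits *)

(** For [c >= 1] its graph over [0,1) is the union of [Gamma0] and [Gamma1]. *)
Definition outer (c th : R) : R := Rmax (1 - c * (1 - th)) 0.

Lemma outer_lipschitz c c' th : 0 <= th <= 1 -> Rabs (outer c' th - outer c th) <= Rabs (c' - c).
Proof.
  intros Hth. assert (H : Rabs ((c' - c) * (1 - th)) <= Rabs (c' - c)).
  { rewrite Rabs_mult, (Rabs_right (1 - th)) by lra. pose proof (Rabs_pos (c' - c)). nra. }
  apply Rle_trans with (2 := H). unfold outer, Rmax.
  destruct (Rle_dec (1 - c' * (1 - th)) 0), (Rle_dec (1 - c * (1 - th)) 0); unfold Rabs; repeat destruct Rcase_abs; lra.
Qed.

Section FrontNearOuter.
Variables (eps c d : R).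
Hypothesis Hd : 0 < d <= 1 / 2.
Hypothesis Hc : 1 / 2 < c.
Hypothesis He : 0 < eps <= d ^ 5 / 10.

Let S := front eps c.
Let S_front : is_front eps c S.
Proof. apply front_spec; lra. Qed.

Let S_cont t : continuous S t.
Proof. apply S_front. Qed.

Let pow_small : d ^ 5 <= d ^ 2 /\ d ^ 2 <= d.
Proof. assert (0 <= d ^ 2) by nra. assert (d ^ 3 <= 1) by (replace 1 with (1 ^ 3) by ring; apply pow_incr; lra). split; nra. Qed.

(** The fifth power in the bound on [eps] pays for [d ^ 3] from the cubic exponential estimate and
    leaves [d ^ 2], so that [reac / S <= d] where [S >= d]. *)
Lemma reac_off_layer t : 0 < t < 1 - d -> reac eps t <= d ^ 2.
Proof.
  intros Ht. unfold reac. replace (- / eps * (1 - t)) with (- ((1 - t) / eps)) by (field; lra).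
  assert (Hp : 0 < (1 - t) / eps) by (apply Rdiv_lt_0_compat; lra).
  pose proof (exp_neg_cube _ Hp) as H. pose proof (exp_pos (- ((1 - t) / eps))) as Hx.
  assert (H0 : 0 < d ^ 3) by (apply pow_lt; lra).
  assert (H1 : d ^ 3 <= (1 - t) ^ 3) by (apply pow_incr; lra).
  assert (Hp2 : 0 < eps ^ 2) by (apply pow_lt; lra).
  assert (H2 : exp (- ((1 - t) / eps)) <= 27 * eps ^ 3 / d ^ 3).
  { apply Rle_trans with (1 := H). replace (27 / ((1 - t) / eps) ^ 3) with (27 * eps ^ 3 * / (1 - t) ^ 3) by (field; lra).
    unfold Rdiv. apply Rmult_le_compat_l; [assert (0 < eps ^ 3) by (apply pow_lt; lra); lra|].
    apply Rinv_le_contravar; lra. }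
  assert (H3 : t * (1 - t) * exp (- ((1 - t) / eps)) <= 1 / 4 * (27 * eps ^ 3 / d ^ 3)).
  { apply Rmult_le_compat; [nra|lra| |assumption]. pose proof (pow2_ge_0 (t - 1 / 2)). lra. }
  apply Rle_trans with (1 / (2 * eps ^ 2) * (1 / 4 * (27 * eps ^ 3 / d ^ 3))).
  { apply Rmult_le_compat_l; [left; apply Rdiv_lt_0_compat; lra|assumption]. }
  replace (1 / (2 * eps ^ 2) * (1 / 4 * (27 * eps ^ 3 / d ^ 3))) with (27 / 8 * eps / d ^ 3) by (field; lra).
  apply Rmult_le_reg_r with (d ^ 3); [assumption|]. unfold Rdiv at 1. rewrite Rmult_assoc, Rinv_l by lra.
  replace (d ^ 2 * d ^ 3) with (d ^ 5) by ring. lra.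
Qed.

Lemma front_plateau : 1 - (2 + 2 * c) * d <= S (1 - d).
Proof.
  pose proof (front_energy_lower_far eps c S ltac:(lra) ltac:(lra) S_front (1 - d) ltac:(lra)) as H.
  pose proof (front_le_1 eps c S ltac:(lra) ltac:(lra) S_front (1 - d) ltac:(lra)) as H1.
  assert (H0 : 0 <= S (1 - d)) by apply S_front.
  destruct pow_small as [P1 P2].
  enough (1 - d <= hs2 (lay eps (1 - d))) by nra.
  unfold hs2, lay. set (a := d / eps). replace ((1 - d - 1) / eps) with (- a) by (unfold a; field; lra).
  assert (Ha : 10 / d <= a).
  { unfold a. apply Rmult_le_reg_r with (eps * d); [nra|]. replace (10 / d * (eps * d)) with (10 * eps) by (field; lra).
    replace (d / eps * (eps * d)) with (d ^ 2) by (field; lra). lra. }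
  assert (Hd2 : 20 <= 10 / d).
  { apply Rmult_le_reg_r with d; [lra|]. unfold Rdiv. rewrite Rmult_assoc, Rinv_l by lra. lra. }
  pose proof (exp_neg_cube a ltac:(lra)) as Hx.
  assert (Hda : 10 <= d * a).
  { apply Rle_trans with (d * (10 / d)); [right; field; lra|apply Rmult_le_compat_l; lra]. }
  assert ((a + 1) * exp (- a) <= d).
  { apply Rle_trans with ((a + 1) * (27 / a ^ 3)); [apply Rmult_le_compat_l; lra|].
    assert (0 < a ^ 3) by (apply pow_lt; lra).
    apply Rmult_le_reg_r with (a ^ 3); [assumption|].
    replace ((a + 1) * (27 / a ^ 3) * a ^ 3) with (27 * (a + 1)) by (field; lra).
    replace (d * a ^ 3) with ((d * a) * a ^ 2) by ring.
    assert (10 * a ^ 2 <= d * a * a ^ 2) by (apply Rmult_le_compat_r; nra). nra. }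
  lra.
Qed.

Lemma front_above_outer th : 0 < th <= 1 - d -> outer c th - (2 + 2 * c) * d <= S th.
Proof.
  intros Hth. assert (Hn : 0 <= S th) by apply S_front.
  assert (H : S th >= 1 - c * (1 - th) - (2 + 2 * c) * d).
  { pose proof front_plateau as Hp.
    assert (H : c * th - S th <= c * (1 - d) - S (1 - d)).
    { apply (nondecreasing_of_derive (fun t => c * t - S t) (fun t => c - (c - reac eps t / S t)) th (1 - d) ltac:(lra)).
      - intros t _. cont. apply S_cont.
      - intros t Ht. apply (deriv_minus (fun t => c * t) S); [auto_derive; [easy|ring]|apply S_front; lra].
      - intros t Ht. destruct S_front as (_ & _ & _ & K). destruct (K t ltac:(lra)) as [K1 _].
        pose proof (reac_pos eps t ltac:(lra) ltac:(lra)).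
        assert (0 < reac eps t / S t) by now apply Rdiv_lt_0_compat. lra. }
    nra. }
  unfold outer, Rmax. destruct (Rle_dec (1 - c * (1 - th)) 0); [|lra].
  assert (0 <= (2 + 2 * c) * d) by (apply Rmult_le_pos; lra). lra.
Qed.

(* Where [S >= d] its slope is at least [c - d], so going left from the layer it falls below [d] no later than the line of that slope. *)
Lemma front_below_outer th : 0 < th <= 1 - d -> S th <= outer c th + (1 + c) * d.
Proof.
  intros Hth. destruct (S_front) as (_ & _ & _ & HS).
  assert (Hslope : forall t, 0 < t < 1 - d -> d <= S t -> reac eps t / S t <= d).
  { intros t Ht Hs. apply Rmult_le_reg_r with (S t); [lra|]. unfold Rdiv. rewrite Rmult_assoc, Rinv_l by lra.
    pose proof (reac_off_layer t Ht). nra. }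
  set (line := fun t => 1 - (c - d) * (1 - d - t)).
  assert (Hline : forall t, 0 < t <= 1 - d -> d <= line t -> S t <= line t).
  { intros t Ht Hlt. enough (S t - line t <= 0) by lra.
    apply (comparison_left (fun t => S t - line t) (fun t => c - reac eps t / S t - (c - d)) t (1 - d) ltac:(lra)).
    - intros u _. unfold line. cont; apply S_cont.
    - intros u Hu. apply (deriv_minus S line); [apply HS; lra|]. unfold line. auto_derive; [easy|ring].
    - unfold line. pose proof (front_le_1 eps c S ltac:(lra) ltac:(lra) S_front (1 - d) ltac:(lra)). lra.
    - intros u Hu Hp.
      assert (line t <= line u) by (unfold line; nra).
      pose proof (Hslope u ltac:(lra) ltac:(lra)). lra. }
  assert (Hmain : S th <= Rmax (line th) d).
  { destruct (Rle_lt_dec d (line th)) as [Hle|Hlt].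
    - apply Rle_trans with (1 := Hline th Hth Hle). apply Rmax_l.
    - set (t0 := 1 - d - (1 - d) / (c - d)).
      assert (Hcd : 0 < c - d) by lra.
      assert (E0 : line t0 = d) by (unfold line, t0; field; lra).
      assert (Ht0 : th < t0).
      { destruct (Rle_lt_dec t0 th) as [Hx|]; [exfalso|assumption].
        assert (line t0 <= line th) by (unfold line; nra). lra. }
      assert (Ht01 : t0 < 1 - d) by (unfold t0; pose proof (Rdiv_lt_0_compat (1 - d) (c - d) ltac:(lra) Hcd); lra).
      apply Rle_trans with d; [|apply Rmax_r]. enough (S th - d <= 0) by lra.
      apply (comparison_left (fun t => S t - d) (fun t => c - reac eps t / S t) th t0 ltac:(lra)).
      + intros u _. cont. apply S_cont.
      + intros u Hu. deriv_as (c - reac eps u / S u - 0); [|ring].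
        apply (deriv_minus S (fun _ => d)); [apply HS; lra|auto_derive; easy].
      + pose proof (Hline t0 ltac:(lra) ltac:(lra)). lra.
      + intros u Hu Hp. pose proof (Hslope u ltac:(lra) ltac:(lra)). lra. }
  apply Rle_trans with (1 := Hmain). pose proof (Rmax_l (1 - c * (1 - th)) 0). pose proof (Rmax_r (1 - c * (1 - th)) 0).
  apply Rmax_lub; unfold outer, line; nra.
Qed.

Lemma front_near_outer th : 0 < th <= 1 - d -> Rabs (S th - outer c th) <= (2 + 2 * c) * d.
Proof.
  intros Hth. pose proof (front_above_outer th Hth). pose proof (front_below_outer th Hth).
  apply Rabs_le. nra.
Qed.
End FrontNearOuter.

Section HausdorffGraph.
Variables (S : R -> R) (A : plane -> Prop) (c d n : R).
Hypothesis A_graph : forall p, A p <-> 0 < fst p < 1 /\ snd p = S (fst p).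
Hypothesis S_cont : forall t, continuous S t.
Hypothesis S_range : forall t, 0 < t < 1 -> 0 < S t <= 1.
Hypothesis S_1 : S 1 = 0.
Hypothesis Hc : 1 <= c.
Hypothesis Hd : 0 < d <= 1 / 2.
Hypothesis S_outer : forall t, 0 < t <= 1 - d -> Rabs (S t - outer c t) <= n.

Let Hn : 0 <= n.
Proof. specialize (S_outer (1 - d) ltac:(lra)). pose proof (Rabs_pos (S (1 - d) - outer c (1 - d))). lra. Qed.

Let invc : 0 < / c <= 1.
Proof. split; [apply Rinv_0_lt_compat; lra|]. rewrite <- Rinv_1. apply Rinv_le_contravar; lra. Qed.

Let outer_left t : t <= 1 - / c -> outer c t = 0.
Proof.
  intros Ht. unfold outer. apply Rmax_right. assert (c * / c = 1) by (field; lra). nra.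
Qed.

Let outer_right t : 1 - / c <= t -> outer c t = c * t + 1 - c.
Proof.
  intros Ht. unfold outer. rewrite Rmax_left; [ring|]. assert (c * / c = 1) by (field; lra). nra.
Qed.

Let outer_Gamma t : 0 <= t < 1 -> Gamma c (t, outer c t).
Proof.
  intros Ht. destruct (Rle_lt_dec t (1 - / c)) as [Hle|Hlt].
  - left. split; simpl; [lra|now apply outer_left].
  - right. left. split; simpl; [lra|apply outer_right; lra].
Qed.

Let outer_step t t' : Rabs (outer c t' - outer c t) <= c * Rabs (t' - t).
Proof.
  assert (E : c * Rabs (t' - t) = Rabs (c * (t' - t))) by (rewrite Rabs_mult, (Rabs_right c) by lra; reflexivity).
  rewrite E. unfold outer, Rmax.
  destruct (Rle_dec (1 - c * (1 - t')) 0), (Rle_dec (1 - c * (1 - t)) 0); unfold Rabs; repeat destruct Rcase_abs; lra.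
Qed.

Let dist := n + (c + 2) * d.

Let graph_to_Gamma : within_distance dist A (Gamma c).
Proof.
  assert (Hcd : 0 <= c * d) by (apply Rmult_le_pos; lra).
  intros [t s] Hp. apply A_graph in Hp. simpl in Hp. destruct Hp as [Ht ->].
  destruct (Rle_lt_dec t (1 - d)) as [Hle|Hlt].
  - exists (t, outer c t). split; [apply outer_Gamma; lra|]. simpl.
    apply Rle_trans with (1 := norm_pair_le _ _). rewrite Rminus_diag, Rabs_R0.
    specialize (S_outer t ltac:(lra)). unfold dist. lra.
  - exists (1, S t). split.
    + right. right. split; simpl; [easy|]. specialize (S_range t Ht). lra.
    + simpl. apply Rle_trans with (1 := norm_pair_le _ _). rewrite Rminus_diag, Rabs_R0, Rabs_left by lra.
      pose proof Hn. unfold dist. lra.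
Qed.

Let outer_near_graph t : 0 <= t < 1 ->
  exists p, A p /\ norm ((t - fst p, outer c t - snd p) : R * R) <= dist.
Proof.
  intros Ht. set (u := Rmax d (Rmin t (1 - d))).
  assert (Hu : d <= u <= 1 - d /\ Rabs (t - u) <= d).
  { unfold u, Rmax, Rmin. destruct (Rle_dec t (1 - d)); destruct Rle_dec; split; try lra; apply Rabs_le; lra. }
  destruct Hu as [Hu1 Hu2]. exists (u, S u). split; [apply A_graph; simpl; split; [lra|easy]|]. simpl.
  apply Rle_trans with (1 := norm_pair_le _ _).
  assert (H1 : Rabs (outer c t - S u) <= c * Rabs (t - u) + n).
  { replace (outer c t - S u) with ((outer c t - outer c u) + (outer c u - S u)) by ring.
    apply Rle_trans with (1 := Rabs_triang _ _). apply Rplus_le_compat; [apply outer_step|].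
    rewrite Rabs_minus_sym. apply S_outer. lra. }
  assert (c * Rabs (t - u) <= c * d) by (apply Rmult_le_compat_l; lra). unfold dist. lra.
Qed.

Let Gamma_to_graph : within_distance dist (Gamma c) A.
Proof.
  assert (Hcd : 0 <= c * d) by (apply Rmult_le_pos; lra). pose proof Hn as Hn'.
  intros [t s] [[Hp1 Hp2]|[[Hp1 Hp2]|[Hp1 Hp2]]]; simpl in *.
  - rewrite Hp2, <- (outer_left t) by lra. apply outer_near_graph. lra.
  - rewrite Hp2, <- (outer_right t) by lra. apply outer_near_graph. lra.
  - subst t. set (s0 := S (1 - d)). pose proof (S_range (1 - d) ltac:(lra)) as Hs0. fold s0 in Hs0.
    assert (Hs1 : 1 - c * d - n <= s0).
    { specialize (S_outer (1 - d) ltac:(lra)). fold s0 in S_outer. apply Rabs_le_between in S_outer.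
      pose proof (Rmax_l (1 - c * (1 - (1 - d))) 0). unfold outer in S_outer. lra. }
    (* A point of the vertical segment is matched at a height attained by the steep part of the
       graph over [[1 - d, 1)]: [s] is moved into [(0, s0]]. *)
    set (y := Rmin s0 (Rmax s d)).
    assert (Hy : 0 < y <= s0) by (unfold y; split; [apply Rmin_glb_lt; [lra|pose proof (Rmax_r s d); lra]|apply Rmin_l]).
    assert (Hys : Rabs (s - y) <= d + c * d + n).
    { unfold y, Rmin, Rmax. destruct (Rle_dec s d); destruct Rle_dec; apply Rabs_le; lra. }
    destruct (ivt_on (fun t => - S t) (1 - d) 1 (- y)) as [x [Hx1 Hx2]]; [lra| |rewrite S_1; fold s0; lra|].
    { intros t _. cont. apply S_cont. }
    assert (Hx3 : x <> 1) by (intros ->; rewrite S_1 in Hx2; lra).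
    exists (x, S x). split; [apply A_graph; simpl; split; [lra|easy]|]. simpl.
    apply Rle_trans with (1 := norm_pair_le _ _). replace (S x) with y by lra.
    rewrite (Rabs_right (1 - x)) by lra. unfold dist. lra.
Qed.

Lemma hausdorff_graph : Rbar_le (hausdorff_dist A (Gamma c)) (n + (c + 2) * d).
Proof.
  unfold hausdorff_dist. apply Glb_Rbar_correct. split; [|split; [exact graph_to_Gamma|exact Gamma_to_graph]].
  pose proof Hn. assert (0 <= (c + 2) * d) by (apply Rmult_le_pos; lra). lra.
Qed.
End HausdorffGraph.

Lemma at_right_0 (P : R -> Prop) e : 0 < e -> (forall x, 0 < x < e -> P x) -> at_right 0 P.
Proof.
  intros He H. exists (mkposreal e He). intros x Hx H0. apply H.
  unfold ball in Hx; simpl in Hx; unfold AbsRing_ball, abs, minus, plus, opp in Hx; simpl in Hx.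
  rewrite Ropp_0, Rplus_0_r in Hx. apply Rabs_lt_between in Hx. lra.
Qed.

(** Two speeds are allowed because the strong orbit moves at [cb eps], while its limit set belongs
    to speed 1. *)
Lemma front_hausdorff eps c c' d : 0 < eps <= e0 -> eps <= d ^ 5 / 10 -> 0 < d <= 1 / 2 ->
  cb eps <= c' -> 1 <= c -> Rabs (c' - c) <= d ->
  Rbar_le (hausdorff_dist (orbit (graph_orbit (front eps c'))) (Gamma c)) ((3 * c + 8) * d).
Proof.
  intros He He' Hd Hc' Hc Hcc. destruct (cb_spec eps He) as [Hcb _].
  assert (HF : is_front eps c' (front eps c')) by (apply front_spec; lra).
  apply Rbar_le_trans with (((2 + 2 * c') * d + d) + (c + 2) * d).
  - apply (hausdorff_graph (front eps c')); try assumption.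
    + intros p. now apply front_points.
    + apply HF.
    + intros t Ht. split; [now apply HF|]. apply (front_le_1 eps c'); lra || assumption.
    + apply HF.
    + intros t Ht. pose proof (front_near_outer eps c' d Hd ltac:(lra) ltac:(lra) t Ht).
      pose proof (outer_lipschitz c c' t ltac:(lra)).
      replace (front eps c' t - outer c t) with ((front eps c' t - outer c' t) + (outer c' t - outer c t)) by ring.
      apply Rle_trans with (1 := Rabs_triang _ _). lra.
  - simpl. apply Rabs_le_between in Hcc. nra.
Qed.

Lemma hausdorff_scale c delta : 1 <= c -> 0 < delta -> exists d, 0 < d <= 1 / 2 /\ (3 * c + 8) * d < delta.
Proof.
  intros Hc Hdelta. exists (Rmin (1 / 2) (delta / (2 * (3 * c + 8)))).
  assert (Hp : 0 < delta / (2 * (3 * c + 8))) by (apply Rdiv_lt_0_compat; lra).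
  split; [split; [apply Rmin_glb_lt; lra|apply Rmin_l]|].
  apply Rle_lt_trans with ((3 * c + 8) * (delta / (2 * (3 * c + 8)))).
  - apply Rmult_le_compat_l; [lra|apply Rmin_r].
  - replace ((3 * c + 8) * (delta / (2 * (3 * c + 8)))) with (delta / 2) by (field; lra). lra.
Qed.

Lemma strong_orbit_limit : hausdorff_cvg (fun eps => orbit (graph_orbit (front eps (cb eps)))) (Gamma 1).
Proof.
  intros delta Hdelta. destruct (hausdorff_scale 1 delta ltac:(lra) Hdelta) as [d [Hd Hdd]].
  assert (Hd5 : 0 < d ^ 5) by (apply pow_lt; lra). pose proof e0_pos.
  (* By [speed_rate], [d / 60] keeps the threshold speed within [d] of 1. *)
  set (e := Rmin e0 (Rmin (d ^ 5 / 10) (d / 60))).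
  apply (at_right_0 _ e); [repeat apply Rmin_glb_lt; lra|]. intros eps He.
  pose proof (Rmin_l e0 (Rmin (d ^ 5 / 10) (d / 60))). pose proof (Rmin_r e0 (Rmin (d ^ 5 / 10) (d / 60))).
  pose proof (Rmin_l (d ^ 5 / 10) (d / 60)). pose proof (Rmin_r (d ^ 5 / 10) (d / 60)). fold e in H0, H1.
  eapply Rbar_le_lt_trans; [apply (front_hausdorff eps 1 (cb eps) d); try lra|exact Hdd].
  pose proof (speed_rate eps ltac:(lra)). lra.
Qed.

Lemma weak_orbit_limit c : 1 < c -> hausdorff_cvg (fun eps => orbit (graph_orbit (front eps c))) (Gamma c).
Proof.
  intros Hc delta Hdelta. destruct (hausdorff_scale c delta ltac:(lra) Hdelta) as [d [Hd Hdd]].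
  assert (Hd5 : 0 < d ^ 5) by (apply pow_lt; lra). pose proof e0_pos.
  (* By [speed_rate], [(c - 1) / 60] puts the threshold speed below [c]. *)
  set (e := Rmin e0 (Rmin (d ^ 5 / 10) ((c - 1) / 60))).
  apply (at_right_0 _ e); [repeat apply Rmin_glb_lt; lra|]. intros eps He.
  pose proof (Rmin_l e0 (Rmin (d ^ 5 / 10) ((c - 1) / 60))). pose proof (Rmin_r e0 (Rmin (d ^ 5 / 10) ((c - 1) / 60))).
  pose proof (Rmin_l (d ^ 5 / 10) ((c - 1) / 60)). pose proof (Rmin_r (d ^ 5 / 10) ((c - 1) / 60)). fold e in H0, H1.
  eapply Rbar_le_lt_trans; [apply (front_hausdorff eps c c d); try lra|exact Hdd].
  - pose proof (speed_rate eps ltac:(lra)) as Hr. apply Rabs_le_between in Hr. lra.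
  - rewrite Rminus_diag, Rabs_R0. lra.
Qed.

Theorem theorem4p1 :
  exists kappa0 sigma0 : R, 0 < kappa0 /\ 0 < sigma0 /\
  forall sigma : R, sigma0 < sigma ->
  exists eps0 : R, 0 < eps0 /\
  forall kappa : R, 0 < kappa < kappa0 ->
  exists cbar : R -> R,
    smooth_on (fun eps : R => 0 <= eps < eps0) cbar /\
    cbar 0 = 1 /\
    (exists I : R,
       is_RInt_gen (fun x : R => 1 - h_s x)
         (Rbar_locally m_infty) (at_point 0) I /\
       is_derive_on (fun eps : R => 0 <= eps < eps0) cbar 0 (I - 1) /\
       Rabs ((I - 1) - 34405 / 100000) < 5 / 1000000 /\
       0 < I - 1) /\
    (forall eps c : R, 0 < eps < eps0 -> 0 < c < cbar eps ->
       ~ exists g : R -> plane,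
           heteroclinic (zfk_field eps c) p_minus p_plus g /\
           (forall z : R, 0 <= fst (g z) <= 1)) /\
    (exists g : R -> R -> plane,
       (forall eps : R, 0 < eps < eps0 ->
          strong_heteroclinic (zfk_field eps (cbar eps)) p_minus p_plus
            (g eps)) /\
       hausdorff_cvg (fun eps : R => orbit (g eps)) (Gamma 1)) /\
    (exists g : R -> R -> R -> plane,
       (forall eps c : R, 0 < eps < eps0 -> cbar eps < c <= sigma ->
          weak_heteroclinic (zfk_field eps c) p_minus p_plus (g c eps)) /\
       (forall c : R, 1 + kappa < c <= sigma ->
          hausdorff_cvg (fun eps : R => orbit (g c eps)) (Gamma c))).
Proof.
  exists 1, 1. split; [lra|]. split; [lra|]. intros sigma _.
  exists e0. split; [exact e0_pos|]. intros kappa Hkappa.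
  assert (Hcbar : forall eps, 0 < eps -> cbar eps = cb eps).
  { intros eps He. unfold cbar. destruct (Rle_dec eps 0); [lra|easy]. }
  exists cbar. split; [exact (cbar_smooth cb0_0)|]. split.
  { unfold cbar. destruct (Rle_dec 0 0); lra. }
  split; [|split; [|split]].
  - destruct defect_integral as [I HI]. exists I. split; [exact (defect_RInt_gen I HI)|]. split.
    + rewrite <- (cb0_1 I HI).
      (* The two functions agree also for [eps <= 0] because [cb0 0 = 1], so the derivative of the
         smooth family is that of [cbar]. *)
      assert (E : cbar = cbar_deriv 0).
      { apply FunctionalExtensionality.functional_extensionality. intros x. unfold cbar, cbar_deriv.
        destruct (Rle_dec x 0); [now rewrite cb0_0|easy]. }
      rewrite E. replace (cb0 1) with (cbar_deriv 1 0) by (unfold cbar_deriv; destruct (Rle_dec 0 0); lra).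
      apply cbar_deriv_derive. pose proof e0_pos. lra.
    + exact (defect_integral_value I HI).
  - intros eps c He Hc [g [Hg Hrange]]. rewrite Hcbar in Hc by lra.
    apply (no_slow_heteroclinic eps c g); try assumption. lra.
  - exists (fun eps => graph_orbit (front eps (cb eps))). split; [|exact strong_orbit_limit].
    intros eps He. rewrite Hcbar by lra. apply strong_connection. lra.
  - exists (fun c eps => graph_orbit (front eps c)). split.
    + intros eps c He Hc. rewrite Hcbar in Hc by lra. apply weak_connection; lra.
    + intros c Hc. apply weak_orbit_limit. lra.
Qed.
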